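(* The point spectrum of $\mathbf L$ satisfies $$\sigma_p(\mathbf L)\cap\{\lambda\in\mathbb C:\operatorname{Re}\lambda\ge0\}=\{1,4\}.$$ Furthermore, $\ker(\mathbf I-\mathbf L)=\langle\mathbf f_1^*\rangle$ and $\ker(4\mathbf I-\mathbf L)=\langle\mathbf f_4^*\rangle$, where $$\mathbf f_1^*(y)=\frac{(7h(y)^2-15y^2)h(y)}{(5y^2+3h(y)^2)^3}\begin{pmatrix}1\\3\end{pmatrix},\qquad \mathbf f_4^*(y)=\frac{1}{(5y^2+3h(y)^2)^3}\begin{pmatrix}1\\6\end{pmatrix}.$$
   Context: Let $R\ge\frac12$ be fixed and $h(y)=\sqrt{2+y^2}-2$. Let $\mathbb B^7_R$ be the open ball of radius $R$ in $\mathbb R^7$ and $H^k_{\rm rad}(\mathbb B^7_R)=\{f:(0,R)\to\mathbb C: f(|\cdot|)\in H^k(\mathbb B^7_R)\}$ with norm $\|f(|\cdot|)\|_{H^k(\mathbb B_R^7)}$. Set $\mathcal H_R=H^6_{\rm rad}(\mathbb B^7_R)\times H^5_{\rm rad}(\mathbb B^7_R)$ (a Hilbert space) and $C_e^\infty[0,R]=\{f\in C^\infty[0,R]:f^{(2j+1)}(0)=0\ \forall j\in\mathbb N_0\}$. Define $$c_{11}=-\frac6y\frac{(yh'-h)h}{1-h'^2}+\frac{y^2-h^2}{1-h'^2}\frac{yh''}{yh'-h}+2\frac{hh'-y}{1-h'^2},\qquad c_{12}=\frac{h^2-y^2}{1-h'^2},$$ $$c_{20}=-1-\frac6y\frac{(yh'-h)h'}{1-h'^2}+\frac{y^2-h^2}{1-h'^2}\frac{h''}{yh'-h},\qquad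 c_{21}=2\frac{hh'-y}{1-h'^2},$$ $$V=\frac{48(21h^2-5y^2)}{(5y^2+3h^2)^2}\frac{(yh'-h)^2}{1-h'^2}$$ (all functions of $y$, with $h=h(y)$). Let $\tilde{\mathbf L}$ be the operator on $\mathcal H_R$ with domain $C_e^\infty[0,R]^2$, $$\tilde{\mathbf L}\mathbf f=\begin{pmatrix}f_2-2f_1\\ c_{11}f_1'+c_{12}f_1''+c_{20}f_2+c_{21}f_2'-2f_2+Vf_1\end{pmatrix},\quad \mathbf f=(f_1,f_2).$$ $\tilde{\mathbf L}$ is closable and $\mathbf L$ denotes its closure. $\sigma_p(\mathbf L)$ is the set of eigenvalues of $\mathbf L$, and $\langle\cdot\rangle$ denotes the linear span. *)

(* Defs.v *)
From HB Require Import structures.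
From mathcomp Require Import all_boot all_order all_algebra.
From mathcomp Require Import all_classical all_reals all_analysis.
From mathcomp Require Import complex.

Set Implicit Arguments.
Unset Strict Implicit.
Unset Printing Implicit Defensive.

Import Order.TTheory GRing.Theory Num.Theory.
Import numFieldNormedType.Exports.

Local Open Scope classical_set_scope.
Local Open Scope ring_scope.

Section Sobolev.
Context {R : realType}.

(* R7 carries the product topology; M7 is the same product, with the product
   of the Borel sigma-algebras on which lebesgue_measure is defined. *)
Local Notation R7 := (R * R * R * R * R * R * R)%type.
Local Notation MR := (measurableTypeR R).
Local Notation M7 := (MR * MR * MR * MR * MR * MR * MR)%type.

Definition mu7 : {measure set M7 -> \bar R} :=
  (@lebesgue_measure R \x @lebesgue_measure R \x @lebesgue_measure R
   \x @lebesgue_measure R \x @lebesgue_measure R \x @lebesgue_measure R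
   \x @lebesgue_measure R)%E.

Definition e7 (i : 'I_7) : R7 :=
  let d (k : nat) : R := (i == k :> nat)%:R in
  (d 0%N, d 1%N, d 2%N, d 3%N, d 4%N, d 5%N, d 6%N).

Definition norm7 (x : R7) : R :=
  let: (x0, x1, x2, x3, x4, x5, x6) := x in
  Num.sqrt (x0 ^+ 2 + x1 ^+ 2 + x2 ^+ 2 + x3 ^+ 2 + x4 ^+ 2 + x5 ^+ 2
            + x6 ^+ 2).

Definition ball7 (r : R) : set R7 := [set x | norm7 x < r].

Definition partial (i : 'I_7) (phi : R7 -> R) : R7 -> R :=
  fun x => 'D_(e7 i) phi x.

Definition partials (s : seq 'I_7) (phi : R7 -> R) : R7 -> R :=
  foldr partial phi s.

Definition smooth7 (phi : R7 -> R) : Prop :=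
  forall s : seq 'I_7, continuous (partials s phi) /\
    forall (i : 'I_7) (x : R7), derivable (partials s phi) x (e7 i).

(* Real-valued test functions suffice, by linearity. *)
Definition test_function (r : R) (phi : R7 -> R) : Prop :=
  smooth7 phi /\
  exists K : set R7, [/\ compact K, K `<=` ball7 r &
    forall x, ~ K x -> phi x = 0].

Definition Dmulti (a : 'I_7 -> nat) (phi : R7 -> R) : R7 -> R :=
  foldr (fun i psi => iter (a i) (partial i) psi) phi (enum 'I_7).

Definition sqmod (z : R[i]) : R := complex.Re z ^+ 2 + complex.Im z ^+ 2.

Definition cintegral (A : set R7) (u : R7 -> R[i]) : R[i] :=
  Complex (\int[mu7]_(x in A) complex.Re (u x))
          (\int[mu7]_(x in A) complex.Im (u x)).

Definition L2 (r : R) (u : R7 -> R[i]) : Prop :=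
  [/\ measurable_fun (ball7 r : set M7) (fun x => complex.Re (u x)),
      measurable_fun (ball7 r : set M7) (fun x => complex.Im (u x)) &
      (\int[mu7]_(x in ball7 r) (sqmod (u x))%:E < +oo)%E].

Definition weak_derivative (r : R) (a : 'I_7 -> nat) (u g : R7 -> R[i]) : Prop :=
  L2 r g /\
  forall phi : R7 -> R, test_function r phi ->
    cintegral (ball7 r) (fun x => u x * (Dmulti a phi x)%:C%C)
    = (-1) ^+ (\sum_(i < 7) a i)%N
      * cintegral (ball7 r) (fun x => g x * (phi x)%:C%C).

(* A representative of the weak derivative, when one exists in L2. *)
Definition wderiv (r : R) (a : 'I_7 -> nat) (u : R7 -> R[i]) : R7 -> R[i] :=
  xget (fun=> 0) [set g | weak_derivative r a u g].

Definition Hk (k : nat) (r : R) (u : R7 -> R[i]) : Prop :=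
  L2 r u /\
  forall a : 'I_7 -> nat, (\sum_(i < 7) a i <= k)%N ->
    exists g, weak_derivative r a u g.

(* The index ranges over the multi-indices of length at most k. *)
Definition Hk_norm (k : nat) (r : R) (u : R7 -> R[i]) : R :=
  Num.sqrt (\sum_(a : {ffun 'I_7 -> 'I_k.+1} | (\sum_(i < 7) a i <= k)%N)
    \int[mu7]_(x in ball7 r) sqmod (wderiv r (fun i => a i) u x)).

(* Functions on (0, r) are represented by total functions on R, of which only
   the values on (0, r) matter: the origin of R^7 is a null set. *)
Definition lift7 (f : R -> R[i]) : R7 -> R[i] := fun x => f (norm7 x).

Definition Hrad (k : nat) (r : R) (f : R -> R[i]) : Prop := Hk k r (lift7 f).

Definition Hrad_norm (k : nat) (r : R) (f : R -> R[i]) : R :=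
  Hk_norm k r (lift7 f).

Definition aeq (r : R) (f g : R -> R[i]) : Prop :=
  {ae mu7, forall x, ball7 r x -> lift7 f x = lift7 g x}.

End Sobolev.

Notation pairfun R := ((R -> R[i]) * (R -> R[i]))%type.

Section EnergySpace.
Context {R : realType}.

Definition HR (r : R) (f : pairfun R) : Prop := Hrad 6 r f.1 /\ Hrad 5 r f.2.

Definition HR_norm (r : R) (f : pairfun R) : R :=
  Num.sqrt (Hrad_norm 6 r f.1 ^+ 2 + Hrad_norm 5 r f.2 ^+ 2).

Definition HR_eq (r : R) (f g : pairfun R) : Prop :=
  aeq r f.1 g.1 /\ aeq r f.2 g.2.

Definition HR_cvg (r : R) (u : nat -> pairfun R) (f : pairfun R) : Prop :=
  [/\ forall n, HR r (u n), HR r f &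
      HR_norm r (u n - f) @[n --> \oo] --> (0 : R)].

Definition cscale (c : R[i]) (f : pairfun R) : pairfun R :=
  (fun y => c * f.1 y, fun y => c * f.2 y).

(* Subspaces of the space of classes are given as sets of representatives. *)
Definition cspan (r : R) (f : pairfun R) : set (pairfun R) :=
  [set g | HR r g /\ exists c : R[i], HR_eq r g (cscale c f)].

End EnergySpace.

Section Operator.
Context {R : realType}.

(* Derivative relative to [0, r], hence one-sided at the endpoints. *)
Definition quot (g : R -> R) (x : R) : R -> R :=
  fun y => (g y - g x) / (y - x).

Definition derivable_in (r : R) (g : R -> R) (x : R) : Prop :=
  cvg (quot g x y @[y --> within [set` `[0, r]] x^']).

Definition deriv_in (r : R) (g : R -> R) : R -> R :=
  fun x => lim (quot g x y @[y --> within [set` `[0, r]] x^']).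

Definition cderivable_in (r : R) (f : R -> R[i]) (x : R) : Prop :=
  derivable_in r (fun y => complex.Re (f y)) x /\
  derivable_in r (fun y => complex.Im (f y)) x.

Definition cderiv_in (r : R) (f : R -> R[i]) : R -> R[i] :=
  fun x => Complex (deriv_in r (fun y => complex.Re (f y)) x)
                   (deriv_in r (fun y => complex.Im (f y)) x).

Definition cderivn_in (r : R) (n : nat) (f : R -> R[i]) : R -> R[i] :=
  iter n (cderiv_in r) f.

Definition smooth_in (r : R) (f : R -> R[i]) : Prop :=
  forall (n : nat) (x : R), 0 <= x <= r -> cderivable_in r (cderivn_in r n f) x.

Definition Ceven (r : R) (f : R -> R[i]) : Prop :=
  smooth_in r f /\ forall j : nat, cderivn_in r (2 * j + 1) f 0 = 0.

Definition h (y : R) : R := Num.sqrt (2 + y ^+ 2) - 2.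
Definition h1 : R -> R := derive1 h.
Definition h2 : R -> R := derive1 h1.

Definition c11 (y : R) : R :=
  - (6 / y) * (((y * h1 y - h y) * h y) / (1 - h1 y ^+ 2))
  + (y ^+ 2 - h y ^+ 2) / (1 - h1 y ^+ 2) * ((y * h2 y) / (y * h1 y - h y))
  + 2 * ((h y * h1 y - y) / (1 - h1 y ^+ 2)).

Definition c12 (y : R) : R := (h y ^+ 2 - y ^+ 2) / (1 - h1 y ^+ 2).

Definition c20 (y : R) : R :=
  - 1 - 6 / y * (((y * h1 y - h y) * h1 y) / (1 - h1 y ^+ 2))
  + (y ^+ 2 - h y ^+ 2) / (1 - h1 y ^+ 2) * (h2 y / (y * h1 y - h y)).

Definition c21 (y : R) : R := 2 * ((h y * h1 y - y) / (1 - h1 y ^+ 2)).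

Definition V (y : R) : R :=
  48 * (21 * h y ^+ 2 - 5 * y ^+ 2) / (5 * y ^+ 2 + 3 * h y ^+ 2) ^+ 2
  * ((y * h1 y - h y) ^+ 2 / (1 - h1 y ^+ 2)).

Definition dom_Ltilde (r : R) (f : pairfun R) : Prop :=
  Ceven r f.1 /\ Ceven r f.2.

Definition Ltilde (r : R) (f : pairfun R) : pairfun R :=
  (fun y => f.2 y - 2 * f.1 y,
   fun y => (c11 y)%:C%C * cderiv_in r f.1 y
          + (c12 y)%:C%C * cderivn_in r 2 f.1 y
          + (c20 y)%:C%C * f.2 y
          + (c21 y)%:C%C * cderiv_in r f.2 y
          - 2 * f.2 y
          + (V y)%:C%C * f.1 y).

(* [graph_L r f g] means that f is in the domain of the closure L of Ltilde
   and L f = g: the graph of L is the closure of the graph of Ltilde. *)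
Definition graph_L (r : R) (f g : pairfun R) : Prop :=
  exists u : nat -> pairfun R,
    [/\ forall n, dom_Ltilde r (u n),
        HR_cvg r u f &
        HR_cvg r (fun n => Ltilde r (u n)) g].

(* ker (lambda I - L) *)
Definition ker_L (r : R) (lambda : R[i]) : set (pairfun R) :=
  [set f | graph_L r f (cscale lambda f)].

Definition point_spectrum (r : R) : set R[i] :=
  [set lambda | exists f, ker_L r lambda f /\ ~ HR_eq r f 0].

Definition f1star : pairfun R :=
  let p (y : R) : R := (7 * h y ^+ 2 - 15 * y ^+ 2) * h y
                       / (5 * y ^+ 2 + 3 * h y ^+ 2) ^+ 3 in
  (fun y => (p y)%:C%C, fun y => 3 * (p y)%:C%C).

Definition f4star : pairfun R :=
  let p (y : R) : R := 1 / (5 * y ^+ 2 + 3 * h y ^+ 2) ^+ 3 in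
  (fun y => (p y)%:C%C, fun y => 6 * (p y)%:C%C).

End Operator.

(* Main.v *)
Require Import Defs.
From HB Require Import structures.
From mathcomp Require Import all_boot all_order all_algebra.
From mathcomp Require Import all_classical all_reals all_analysis.
From mathcomp Require Import measurable_realfun.
From mathcomp Require Import complex lra ring.
(* The charge theory of mathcomp-analysis shadows [cscale]. *)
Import Defs.

(** An element of the domain of the closure is C^1 away from the origin, up to
    the boundary, by a one-dimensional Sobolev bound along rays, so that an
    eigenfunction (f1, (lambda + 2) f1) solves the eigenvalue equation
    classically; square integrability in R^7 excludes the branch y^-5 at the
    origin.  Put k = 1 - lambda, W = y^3 f1 and let ' be the derivative in
    artanh rho, rho = y / (2 - sqrt (2 + y^2)).  Up to a power weight the
    equation inside the light cone y < 1/2 is W'' = (U0 + k^2) W, and the two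
    known solutions, at k = 0 and k = -3, are removed by a second-order
    Darboux-Crum transformation om = (k^2 + LP) W - LL W'.  The new potential
    UU is positive with UU' + 2 UU < 0.  Hence a quadratic expression in om and
    qq = om' - k om (the energy if lambda is real, a Morawetz-type expression
    otherwise) is monotone; for Re lambda >= 0 it tends to 0 at the origin and
    to a nonpositive limit at the light cone, so om = 0.  The transformation is
    invertible unless lambda is 1 or 4, and in these two cases om = 0 leaves
    only the multiples of the known eigenfunction.  Outside the light cone
    uniqueness follows from the energy |f1'|^2 + |f1|^2 / (y - 1/2), whose
    growth is controlled because Re lambda >= 0. *)

(** With s = sqrt (2 + y^2), the eigenfunction at lambda = 1 changes sign inside the light cone,
    where 7 (2 - s)^2 = 15 y^2, so a single Darboux step with it would create a pole. Both solutions
    are removed at once because their Wronskian, a multiple of rho^7 (1 - rho^2)^(3/2) / (3 + 5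
    rho^2)^5, has no zero; [LL] is its logarithmic derivative and [UU = U0 - 2 LL']. The two
    solutions never enter the transformation explicitly: it rests on identities between rational
    functions of rho. At the light cone UU decays at rate exactly 2, so the constant in UU' + 2 UU <
    0 cannot be larger; it matches Re k <= 1, that is Re lambda >= 0. In the borderline case Re
    lambda = 0 the sign at the cone comes from a relation between the limits of om and of qq / (1 -
    rho^2), forced by the absence of a logarithm. The equation degenerates at y = 1/2, which may be
    the outer boundary R: hence the one-sided limits of f1 and f1' there, and a passage across the
    cone that relies on C^1 regularity alone. *)

Set Implicit Arguments.
Unset Strict Implicit.
Unset Printing Implicit Defensive.

Import Order.TTheory GRing.Theory Num.Theory.
Import numFieldNormedType.Exports.

Local Open Scope classical_set_scope.
Local Open Scope ring_scope.

(* [lra] and [nra] are slow in a context with hypotheses other than comparisons. *)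
Ltac clear_but_order := repeat match goal with H : ?T |- _ =>
  lazymatch T with
  | is_true (@Order.le _ _ _ _) => fail
  | is_true (@Order.lt _ _ _ _) => fail
  | @eq (Real.sort _) _ _ => fail
  | _ => lazymatch type of T with Prop => clear H end
  end end.
Ltac lra_ctx := first [clear_but_order; lra | lra].
Ltac nra_ctx := first [clear_but_order; nra | nra].

(** * Measures on products of intervals *)

Section ProductMeasures.
Context {R : realType}.
Local Notation mu := (@lebesgue_measure R).

Definition preserves d (T : measurableType d) (m : set T -> \bar R)
    (f : T -> T) : Prop :=
  measurable_fun setT f /\ forall A, measurable A -> m (f @^-1` A) = m A.

(** Uniqueness of Lebesgue measure: the pushforward under the translation has the right value on
    every half-open interval. *)
Lemma preserves_addr (c : R) : preserves mu (fun x : measurableTypeR R => (x + c : R)).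
Proof.
have mf : @measurable_fun _ _ (measurableTypeR R) (measurableTypeR R) setT
    (fun x : R => x + c) by exact: measurable_funD.
split=> // A mA.
pose m' : {measure set _ -> \bar R} :=
  pushforward mu (fun x : measurableTypeR R => (x + c : R) : measurableTypeR R).
rewrite [RHS](@lebesgue_measure_unique R (m' mf))// => _ [[a b]] _ <-.
have E : (fun x : R => x + c) @^-1` `]a, b] = `]a - c, b - c]%classic.
  by apply/seteqP; split => x /=; rewrite !in_itv /= ltrBlDr lerBrDr.
rewrite /m' /= /pushforward /= E.
rewrite !lebesgue_measure_itv/= !lte_fin ltrD2r.
by case: ifP => // _; rewrite -!EFinB; congr (_%:E); ring.
Qed.

(** Fubini: a section of the preimage is the preimage under [g] of a section, and the outer integral
    is transported by [f]. *)
Lemma preserves_prod d1 d2 (T1 : measurableType d1) (T2 : measurableType d2)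
    (m1 : {measure set T1 -> \bar R})
    (m2 : {sigma_finite_measure set T2 -> \bar R}) f g :
  preserves m1 f -> preserves m2 g ->
  preserves (m1 \x m2)%E (fun x => (f x.1, g x.2)).
Proof.
move=> [mf Hf] [mg Hg].
have mfg : measurable_fun setT (fun x : T1 * T2 => (f x.1, g x.2)).
  apply/measurable_fun_pairP; split => /=.
    exact: (measurableT_comp mf).
  exact: (measurableT_comp mg).
split=> // A mA.
have mh : measurable_fun setT (m2 \o xsection A) by exact: measurable_fun_xsection.
rewrite /= /product_measure1 /=.
transitivity (\int[m1]_x (((m2 \o xsection A) \o f) x))%E.
  apply: eq_integral => x _ /=.
  rewrite -[RHS]Hg; last exact: measurable_xsection.
  by congr (m2 _); apply/seteqP; split => y /=; rewrite /xsection /= !inE.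
transitivity (\int[pushforward m1 f]_x ((m2 \o xsection A) x))%E.
  by rewrite ge0_integral_pushforward.
by apply: eq_measure_integral => B mB _; exact: Hf.
Qed.

(** Measurability travels with the value, so that a product of seven factors is computed by chaining
    [measure_is_prod]. *)
Definition measure_is d (T : measurableType d) (m : set T -> \bar R) (A : set T) (x : R) :=
  measurable A /\ m A = x%:E.

Lemma measure_is_prod d1 d2 (T1 : measurableType d1) (T2 : measurableType d2)
    (m1 : {measure set T1 -> \bar R}) (m2 : {sigma_finite_measure set T2 -> \bar R})
    A B x y : measure_is m1 A x -> measure_is m2 B y ->
  measure_is (m1 \x m2)%E (A `*` B) (x * y).
Proof.
move=> [mA Ax] [mB By]; split; first exact: measurableX.
by rewrite product_measure1E// Ax By EFinM.
Qed.

(** The data consumed by Dynkin's theorem and by the uniqueness of measures: a generating pi-system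
    that exhausts the space. *)
Definition generates d (T : measurableType d) (G : set (set T)) : Prop :=
  [/\ @measurable _ T = <<s G >>, setI_closed G &
      exists2 g : nat -> set T, forall n, G (g n) & \bigcup_n g n = setT].

Definition prod_family T1 T2 (G1 : set (set T1)) (G2 : set (set T2)) :
    set (set (T1 * T2)) :=
  [set C | exists A B, [/\ G1 A, G2 B & C = A `*` B]].

Lemma generates_itv : generates
  ([set A | exists a b : R, A = `]a, b[%classic] : set (set (measurableTypeR R))).
Proof.
split.
- exact: (@RGenOpens.measurableE R).
- move=> _ _ [a [b ->]] [c [d ->]].
  exists (Num.max a c), (Num.min b d).
  apply/seteqP; split => x /=; rewrite !in_itv /= lt_min gt_max.
    by move=> [/andP[-> ->] /andP[-> ->]].
  by move=> /andP[/andP[-> ->] /andP[-> ->]].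
- exists (fun n => `]- n%:R, n%:R[%classic); first by move=> n; do 2 eexists.
  apply/seteqP; split => // x _; exists (Num.bound `|x|) => //=.
  rewrite in_itv /= -ltr_norml.
  exact: archi_boundP.
Qed.

(** Cylinders generate the product sigma-algebra but are not rectangles of the family; the
    exhausting sequences write each of them as a countable union of such rectangles. *)
Lemma generates_prod d1 d2 (T1 : measurableType d1) (T2 : measurableType d2)
    (G1 : set (set T1)) (G2 : set (set T2)) :
  generates G1 -> generates G2 -> generates (prod_family G1 G2).
Proof.
move=> [E1 I1 [g1 Gg1 U1]] [E2 I2 [g2 Gg2 U2]]; split.
- apply/seteqP; split; last first.
    apply: smallest_sub; first exact: sigma_algebra_measurable.
    move=> _ [A [B [GA GB ->]]]; apply: measurableX.
      by rewrite E1; exact: sub_sigma_algebra.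
    by rewrite E2; exact: sub_sigma_algebra.
  rewrite measurable_prod_measurableType.
  have S : sigma_algebra setT <<s prod_family G1 G2 >> by exact: smallest_sigma_algebra.
  case: (S) => S0 SC SU.
  have SI A B : <<s prod_family G1 G2 >> A -> <<s prod_family G1 G2 >> B ->
      <<s prod_family G1 G2 >> (A `&` B).
    exact: (@measurableI _ (g_sigma_algebraType (prod_family G1 G2))).
  have H1 A : measurable A -> <<s prod_family G1 G2 >> (A `*` setT).
    move=> mA.
    have : <<s G1 >> A by rewrite -E1.
    move: A {mA}; apply: smallest_sub => [|A GA /=].
      split => /=.
      + by rewrite set0X.
      + move=> A HA; rewrite (_ : _ `*` _ = setT `\` (A `*` setT)); first exact: SC.
        apply/seteqP; split => -[x y] /=; first by move=> [[_ ?] _]; split => // -[].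
        by move=> [_ h]; split => //; split => // ?; exact: h.
      + move=> A HA; rewrite (_ : _ `*` _ = \bigcup_i (A i `*` setT)); first exact: SU.
        apply/seteqP; split => -[x y] /=.
          by move=> [[n _ An] _]; exists n.
        by move=> [n _ [/= An _]]; split => //; exists n.
    rewrite (_ : _ `*` _ = \bigcup_i (A `*` g2 i)); last first.
      apply/seteqP; split => -[x y] /=.
        by move=> [Ax _]; have : setT y by []; rewrite -U2 => -[n _ ?]; exists n.
      by move=> [n _ [/= ? ?]].
    apply: SU => n; apply: sub_sigma_algebra.
    by exists A, (g2 n).
  have H2 A : measurable A -> <<s prod_family G1 G2 >> (setT `*` A).
    move=> mA.
    have : <<s G2 >> A by rewrite -E2.
    move: A {mA}; apply: smallest_sub => [|A GA /=].
      split => /=.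
      + by rewrite setX0.
      + move=> A HA; rewrite (_ : _ `*` _ = setT `\` (setT `*` A)); first exact: SC.
        apply/seteqP; split => -[x y] /=; first by move=> [_ [_ ?]]; split => // -[].
        by move=> [_ h]; split => //; split => // ?; exact: h.
      + move=> A HA; rewrite (_ : _ `*` _ = \bigcup_i (setT `*` A i)); first exact: SU.
        apply/seteqP; split => -[x y] /=.
          by move=> [_ [n _ An]]; exists n.
        by move=> [n _ [/= _ An]]; split => //; exists n.
    rewrite (_ : _ `*` _ = \bigcup_i (g1 i `*` A)); last first.
      apply/seteqP; split => -[x y] /=.
        by move=> [_ Ax]; have : setT x by []; rewrite -U1 => -[n _ ?]; exists n.
      by move=> [n _ [/= ? ?]].
    apply: SU => n; apply: sub_sigma_algebra.
    by exists (g1 n), A.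
  apply: smallest_sub => // _ [A mA [B mB <-]].
  rewrite (_ : A `*` B = (A `*` setT) `&` (setT `*` B)).
    by apply: SI; [exact: H1|exact: H2].
  by rewrite -setXI setIT setTI.
- move=> _ _ [A [B [GA GB ->]]] [A' [B' [GA' GB' ->]]].
  by exists (A `&` A'), (B `&` B'); rewrite setXI; split; [exact: I1|exact: I2|].
(* An enumeration of the pairs of indices; the default value only repeats a member of the family. *)
- pose e : nat -> nat * nat := fun n => odflt (0, 0)%N (unpickle n).
  exists (fun n => g1 (e n).1 `*` g2 (e n).2).
    by move=> n; exists (g1 (e n).1), (g2 (e n).2).
  apply/seteqP; split => // -[x y] _.
  have : setT x by []; rewrite -{1}U1 => -[n _ ?].
  have : setT y by []; rewrite -{1}U2 => -[m _ ?].
  by exists (pickle (n, m)) => //=; rewrite /e pickleK.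
Qed.

(** The sets on which [g] integrates to 0 form a Dynkin system: complements are covered by the
    hypothesis on the whole space. So they include all measurable sets, which forces [g = 0] almost
    everywhere. *)
Lemma integral_family_ae0 d (T : measurableType d) (m : {measure set T -> \bar R})
    (G : set (set T)) (g : T -> R) :
  generates G -> m.-integrable setT (EFin \o g) ->
  (\int[m]_x (g x)%:E = 0)%E ->
  (forall A, G A -> (\int[m]_(x in A) (g x)%:E = 0)%E) ->
  {ae m, forall x, g x = 0}.
Proof.
move=> [E I _] ig gT gG.
have mg := measurable_int m ig.
have H A : measurable A -> (\int[m]_(x in A) (g x)%:E = 0)%E.
  rewrite E; move: A; apply: (dynkin_induction E I) => //.
  - move=> S mS HS.
    have := gT; rewrite -(setUv S) (@integral_setU_EFin _ _ _ m)//=.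
    + by rewrite HS add0e.
    + exact: measurableC.
    + by rewrite setUv; exact/measurable_EFinP.
    + by apply/disj_setPS; rewrite setICr.
  - move=> F mF tF HF.
    rewrite (@integral_bigcup _ _ _ m F (EFin \o g))//=.
      by rewrite eseries0// => n _ _; exact: HF.
    apply: integrableS ig => //; exact: bigcupT_measurable.
have mgR : measurable_fun setT g by exact/measurable_EFinP.
have : ae_eq m setT (EFin \o g) (cst 0%E).
  apply: integral_ae_eq => //.
  by move=> F FT mF; rewrite H// integral0.
apply: filterS => x /(_ Logic.I) /= h.
by case: h.
Qed.

End ProductMeasures.

(** * Coordinates and Lebesgue measure on R^7 *)

Notation R7 R := (R * R * R * R * R * R * R)%type.
Notation M7 R := (measurableTypeR R * measurableTypeR R * measurableTypeR R
  * measurableTypeR R * measurableTypeR R * measurableTypeR R * measurableTypeR R)%type.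

Section Space7.
Context {R : realType}.
Local Notation R7 := (R7 R).
Local Notation M7 := (M7 R).
Local Notation mu7 := (@mu7 R).

Definition co (i : 'I_7) (x : R7) : R :=
  match val i with
  | 0%N => x.1.1.1.1.1.1 | 1%N => x.1.1.1.1.1.2 | 2%N => x.1.1.1.1.2
  | 3%N => x.1.1.1.2 | 4%N => x.1.1.2 | 5%N => x.1.2 | _ => x.2
  end.

Lemma forall7 (P : 'I_7 -> Prop) :
  (forall i, P i) <->
  [/\ P (inord 0), P (inord 1), P (inord 2) & [/\ P (inord 3), P (inord 4), P (inord 5) & P (inord 6)]].
Proof.
split=> [H|[H0 H1 H2 [H3 H4 H5 H6]] i]; first by do 2 (split=> //).
have -> : i = inord i by rewrite inord_val.
by case: i => [[|[|[|[|[|[|[|//]]]]]]] Hi] /=.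
Qed.

Lemma coE (x : R7) :
  (co (inord 0) x = x.1.1.1.1.1.1) * (co (inord 1) x = x.1.1.1.1.1.2) *
  (co (inord 2) x = x.1.1.1.1.2) * (co (inord 3) x = x.1.1.1.2) *
  (co (inord 4) x = x.1.1.2) * (co (inord 5) x = x.1.2) * (co (inord 6) x = x.2).
Proof. by rewrite /co /= !inordK. Qed.

Lemma co_ext (x y : R7) : (forall i, co i x = co i y) -> x = y.
Proof.
move=> /forall7; rewrite !coE.
by case: x => [[[[[[? ?] ?] ?] ?] ?] ?]; case: y => [[[[[[? ?] ?] ?] ?] ?] ?] /=
  => -[-> -> -> [-> -> -> ->]].
Qed.

Lemma coD i (x y : R7) : co i (x + y) = co i x + co i y.
Proof. by move: i; apply/forall7; rewrite !coE. Qed.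

Lemma coZ i (t : R) (x : R7) : co i (t *: x) = t * co i x.
Proof. by move: i; apply/forall7; rewrite !coE. Qed.

Lemma co_e7 i j : co i (e7 j : R7) = (i == j)%:R.
Proof.
have E : forall k : 'I_7, (k == j :> nat) = (k == j) by [].
move: i; apply/forall7; rewrite !coE /= -!E !inordK//.
by rewrite !(eq_sym _ (nat_of_ord j)).
Qed.

Lemma big7 (F : 'I_7 -> R) : \sum_i F i =
  F (inord 0) + F (inord 1) + F (inord 2) + F (inord 3) + F (inord 4) + F (inord 5) + F (inord 6).
Proof.
have E i (H : (i < 7)%N) : Ordinal H = inord i by apply/val_inj; rewrite /= inordK.
do 7 rewrite big_ord_recr /=.
rewrite big_ord0 add0r.
by do !congr (_ + _); congr F; apply/val_inj; rewrite /= inordK.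
Qed.

Lemma norm7E x : norm7 x = Num.sqrt (\sum_i co i x ^+ 2) :> R.
Proof.
rewrite big7 !coE.
by case: x => [[[[[[? ?] ?] ?] ?] ?] ?].
Qed.

Lemma norm7_ge0 x : 0 <= norm7 x :> R.
Proof. by rewrite norm7E sqrtr_ge0. Qed.

Lemma norm7_sq x : norm7 x ^+ 2 = \sum_i co i x ^+ 2 :> R.
Proof. by rewrite norm7E sqr_sqrtr// sumr_ge0// => i _; rewrite sqr_ge0. Qed.

Lemma co_le_norm7 i x : `|co i x| <= norm7 x :> R.
Proof.
rewrite -sqrtr_sqr norm7E ler_sqrt ?sqr_ge0//.
  by rewrite (bigD1 i)//= lerDl sumr_ge0// => j _; rewrite sqr_ge0.
by rewrite sumr_ge0// => j _; rewrite sqr_ge0.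
Qed.

Lemma norm7_eq0 x : (norm7 x == 0 :> R) = (x == 0).
Proof.
apply/eqP/eqP => [H|->].
  apply: co_ext => i; have -> : co i (0 : R7) = 0.
    by move: (i); apply/forall7; rewrite !coE.
  by apply/eqP; rewrite -normr_le0 -H co_le_norm7.
have E : forall i, co i (0 : R7) = 0 by apply/forall7; rewrite !coE.
by rewrite norm7E big1 ?sqrtr0// => i _; rewrite E expr0n.
Qed.

Lemma measurable_co i : measurable_fun setT (co i : M7 -> R).
Proof.
have m1 d1 d2 (T1 : measurableType d1) (T2 : measurableType d2) :
  measurable_fun setT (fst : T1 * T2 -> T1) by exact: measurable_fst.
have m2 d1 d2 (T1 : measurableType d1) (T2 : measurableType d2) :
  measurable_fun setT (snd : T1 * T2 -> T2) by exact: measurable_snd.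
move: i; apply/forall7; split; last split.
- apply: (eq_measurable_fun (fun x : M7 => x.1.1.1.1.1.1)); first by move=> x _; rewrite coE.
  by do 5 (apply: measurableT_comp; first exact: m1); exact: m1.
- apply: (eq_measurable_fun (fun x : M7 => x.1.1.1.1.1.2)); first by move=> x _; rewrite coE.
  by apply: measurableT_comp; [exact: m2|do 4 (apply: measurableT_comp; first exact: m1); exact: m1].
- apply: (eq_measurable_fun (fun x : M7 => x.1.1.1.1.2)); first by move=> x _; rewrite coE.
  by apply: measurableT_comp; [exact: m2|do 3 (apply: measurableT_comp; first exact: m1); exact: m1].
- apply: (eq_measurable_fun (fun x : M7 => x.1.1.1.2)); first by move=> x _; rewrite coE.
  by apply: measurableT_comp; [exact: m2|do 2 (apply: measurableT_comp; first exact: m1); exact: m1].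
- apply: (eq_measurable_fun (fun x : M7 => x.1.1.2)); first by move=> x _; rewrite coE.
  by apply: measurableT_comp; [exact: m2|do 1 (apply: measurableT_comp; first exact: m1); exact: m1].
- apply: (eq_measurable_fun (fun x : M7 => x.1.2)); first by move=> x _; rewrite coE.
  by apply: measurableT_comp; [exact: m2|exact: m1].
- apply: (eq_measurable_fun (fun x : M7 => x.2)); first by move=> x _; rewrite coE.
  exact: m2.
Qed.

Lemma measurable_norm7 : measurable_fun setT (@norm7 R : M7 -> R).
Proof.
apply: (eq_measurable_fun (fun x : M7 => Num.sqrt (\sum_i co i x ^+ 2))).
  by move=> x _; rewrite norm7E.
apply: measurableT_comp; first by apply: continuous_measurable_fun; exact: sqrt_continuous.
apply: measurable_sum => i.
exact: measurable_funX (measurable_co i).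
Qed.

Lemma measurable_ball7 r : measurable (ball7 r : set M7).
Proof.
rewrite (_ : ball7 r = setT `&` (@norm7 R : M7 -> R) @^-1` `]-oo, r[%classic).
  by apply: measurable_norm7 => //; exact: measurable_itv.
by rewrite setTI; apply/seteqP; split => x /=; rewrite /ball7 /= in_itv.
Qed.

Definition box (a b : 'I_7 -> R) : set M7 := [set x | forall i, a i < co i x < b i].
Definition cbox (a b : 'I_7 -> R) : set M7 := [set x | forall i, a i <= co i x <= b i].

Lemma box_prod (a b : 'I_7 -> R) : box a b =
  (((((( `]a (inord 0), b (inord 0)[%classic `*` `]a (inord 1), b (inord 1)[%classic)
  `*` `]a (inord 2), b (inord 2)[%classic) `*` `]a (inord 3), b (inord 3)[%classic)
  `*` `]a (inord 4), b (inord 4)[%classic) `*` `]a (inord 5), b (inord 5)[%classic)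
  `*` `]a (inord 6), b (inord 6)[%classic).
Proof.
apply/seteqP; split => x /=; rewrite /box /=.
  by move=> /forall7; rewrite !coE !in_itv /= => -[-> -> -> [-> -> -> ->]].
rewrite !in_itv /= => -[[[[[[? ?] ?] ?] ?] ?] ?]; apply/forall7; rewrite !coE.
by split; last split.
Qed.

Lemma measurable_box a b : measurable (box a b).
Proof. by rewrite box_prod; do ! apply: measurableX; exact: measurable_itv. Qed.

Lemma mu7_box (a b : 'I_7 -> R) : (forall i, a i <= b i) ->
  mu7 (box a b) = (\prod_i (b i - a i))%:E.
Proof.
move=> ab; rewrite box_prod /mu7.
have E i : measure_is (@lebesgue_measure R) `]a i, b i[%classic (b i - a i).
  split; first exact: measurable_itv.
  rewrite lebesgue_measure_itv /= lte_fin -EFinB; case: ltgtP (ab i) => //= -> _.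
  by rewrite subrr.
rewrite (_ : \prod_i (b i - a i) = (b (inord 0) - a (inord 0)) * (b (inord 1) - a (inord 1))
 * (b (inord 2) - a (inord 2)) * (b (inord 3) - a (inord 3)) * (b (inord 4) - a (inord 4))
 * (b (inord 5) - a (inord 5)) * (b (inord 6) - a (inord 6))); last first.
  do 7 rewrite big_ord_recr /=.
  rewrite big_ord0 mul1r.
  by do ![congr (_ * _)]; congr (b _ - a _); apply/val_inj; rewrite /= inordK.
have [_ H] := measure_is_prod (measure_is_prod (measure_is_prod (measure_is_prod
  (measure_is_prod (measure_is_prod (E (inord 0)) (E (inord 1))) (E (inord 2)))
  (E (inord 3))) (E (inord 4))) (E (inord 5))) (E (inord 6)).
exact H.
Qed.

Lemma generates_box : generates ([set A | exists a b, A = box a b] : set (set M7)).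
Proof.
have H := @generates_itv R.
have H7 := generates_prod (generates_prod (generates_prod (generates_prod (generates_prod
  (generates_prod H H) H) H) H) H) H.
set G := prod_family _ _ in H7.
suff -> : [set A | exists a b, A = box a b] = G by [].
apply/seteqP; split => A.
  move=> [a [b ->]]; rewrite box_prod.
  do 6 (eexists; eexists; split; last reflexivity; last by do 2 eexists).
  by do 2 eexists.
move=> [_ [_ [[_ [_ [[_ [_ [[_ [_ [[_ [_ [[_ [_ [[a0 [b0 ->]] [a1 [b1 ->]] ->]]] [a2 [b2 ->]] ->]]] [a3 [b3 ->]] ->]]] [a4 [b4 ->]] ->]]] [a5 [b5 ->]] ->]]] [a6 [b6 ->]] ->]]].
exists (fun i => nth 0 [:: a0; a1; a2; a3; a4; a5; a6] i),
  (fun i => nth 0 [:: b0; b1; b2; b3; b4; b5; b6] i).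
by rewrite box_prod !inordK.
Qed.

Lemma preserves7 (v : R7) : preserves mu7 (fun x : M7 => ((x : R7) + v : R7)).
Proof.
case: v => [[[[[[v0 v1] v2] v3] v4] v5] v6].
have E : (fun x : M7 => ((x : R7) + (v0, v1, v2, v3, v4, v5, v6) : R7)) =
  (fun x : M7 => (x.1.1.1.1.1.1 + v0, x.1.1.1.1.1.2 + v1, x.1.1.1.1.2 + v2, x.1.1.1.2 + v3, x.1.1.2 + v4, x.1.2 + v5, x.2 + v6)).
  by apply/funext => -[[[[[[? ?] ?] ?] ?] ?] ?].
rewrite /mu7 E.
exact (preserves_prod (preserves_prod (preserves_prod (preserves_prod (preserves_prod
  (preserves_prod (preserves_addr v0) (preserves_addr v1)) (preserves_addr v2))
  (preserves_addr v3)) (preserves_addr v4)) (preserves_addr v5)) (preserves_addr v6)).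
Qed.

Lemma ball7_fin r : (mu7 (ball7 r) < +oo)%E.
Proof.
apply: (@le_lt_trans _ _ (mu7 (box (fun=> - (`|r| + 1)) (fun=> `|r| + 1)))).
  apply: le_measure; rewrite ?inE; [exact: measurable_ball7|exact: measurable_box|].
  move=> x /= xr i; rewrite -ltr_norml.
  apply: le_lt_trans (co_le_norm7 i x) _.
  by apply: lt_le_trans xr _; rewrite (le_trans (ler_norm _))// lerDl.
rewrite mu7_box ?ltry// => i.
by have := normr_ge0 r; lra_ctx.
Qed.

Lemma ball_co (x y : R7) (e : R) :
  ball x e y <-> forall i, `|co i x - co i y| < e.
Proof.
split.
  case=> -[[[[[[h0 h1] h2] h3] h4] h5] h6].
  by apply/forall7; rewrite !coE; split; last split.
move=> /forall7; rewrite !coE => -[h0 h1 h2 [h3 h4 h5 h6]].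
by do ! split.
Qed.

Definition qlo (q : {ffun 'I_7 -> rat * rat}) i : R := ratr (q i).1.
Definition qhi (q : {ffun 'I_7 -> rat * rat}) i : R := ratr (q i).2.

(** The closed box inside [O] can carry the support of a test function, and rational corners leave
    only countably many boxes, so that null sets can be united. *)
Lemma open_rat_box (O : set R7) x : open O -> O x ->
  exists q, box (qlo q) (qhi q) x /\ cbox (qlo q) (qhi q) `<=` O.
Proof.
rewrite openE => /(_ x) /[apply] /nbhs_ballP [e /= e0 He].
have H i : exists p : rat * rat, co i x - e < ratr p.1 < co i x /\ co i x < ratr p.2 < co i x + e.
  have [p1 P1] := @rat_in_itvoo R (co i x - e) (co i x) ltac:(by rewrite ltrBlDr ltrDl).
  have [p2 P2] := @rat_in_itvoo R (co i x) (co i x + e) ltac:(by rewrite ltrDl).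
  by exists (p1, p2); move: P1 P2; rewrite !in_itv.
have [f Hf] := choice H.
exists [ffun i => f i]; split.
  move=> i; rewrite /qlo /qhi ffunE.
  by case: (Hf i) => /andP[_ ->] /andP[-> _].
move=> y Hy; apply: He; apply/ball_co => i.
move: (Hy i); rewrite /qlo /qhi ffunE => /andP[h1 h2].
case: (Hf i) => /andP[h3 h4] /andP[h5 h6].
by rewrite ltr_norml; apply/andP; split; lra_ctx.
Qed.

Lemma measurable_countable_bigcup (T : countType) d (X : measurableType d) (F : T -> set X) :
  (forall t, measurable (F t)) -> measurable (\bigcup_t F t).
Proof.
move=> mF; pose G n := if unpickle n is Some t then F t else set0.
rewrite (_ : \bigcup_t F t = \bigcup_n G n).
  by apply: bigcupT_measurable => n; rewrite /G; case: unpickle.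
apply/seteqP; split => x [t _ Ft]; first by exists (pickle t) => //; rewrite /G pickleK.
by move: Ft; rewrite /G; case: unpickle => // s Fs; exists s.
Qed.

Lemma open_measurable7 (O : set R7) : open O -> measurable (O : set M7).
Proof.
move=> oO.
rewrite (_ : O = \bigcup_q (if `[< cbox (qlo q) (qhi q) `<=` O >] then box (qlo q) (qhi q) else set0)).
  apply: measurable_countable_bigcup => q.
  by case: ifP => _ //; exact: measurable_box.
apply/seteqP; split => x.
  move=> /(open_rat_box oO)[q [h1 h2]]; exists q => //.
  by case: asboolP.
move=> [q _]; case: asboolP => // h1 h2; apply: h1 => i.
by have /andP[/ltW -> /ltW ->] := h2 i.
Qed.

Lemma continuous_measurable7 (f : R7 -> R) : continuous f ->
  measurable_fun setT (f : M7 -> R).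
Proof.
move=> cf; apply: (@measurability _ _ _ _ _ _ (@RGenOpens.G R)).
  exact: (@RGenOpens.measurableE R).
move=> _ [_ [a [b ->]] <-]; rewrite setTI; apply: open_measurable7.
by move/continuousP: cf; apply; exact: interval_open.
Qed.

Lemma continuous_co i : continuous (co i : R7 -> R).
Proof.
move=> x; apply/cvgrPdist_lt => e e0.
have := nbhsx_ballx x e e0.
apply: filterS => y /ball_co; exact.
Qed.

End Space7.

(** * Smooth functions and bump functions *)

Section DerivRules.
Context {R : realType}.

(** Reduces directional derivatives to one real variable, where the chain rule and the mean value
    theorem live. *)
Lemma is_derive_lineP (V : normedModType R) (f : V -> R) x v df :
  is_derive x v f df <-> is_derive (0 : R) 1 (fun t : R => f (t *: v + x)) df.
Proof.
have E : (fun h : R => h^-1 *: ((f \o shift x) (h *: v) - f x)) =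
  (fun h : R => h^-1 *: (((fun t : R => f (t *: v + x)) \o shift 0) (h *: (1 : R)) - f (0 *: v + x))).
  apply/funext => h /=; rewrite addr0 scale0r add0r.
  by rewrite [h *: (1 : R)]mulr1.
split=> -[H1 H2]; split.
- by move: H1; rewrite /derivable E.
- by move: H2; rewrite /derive E.
- by move: H1; rewrite /derivable E.
- by move: H2; rewrite /derive E.
Qed.

Lemma der_eq (V : normedModType R) (f : V -> R) x v df df' :
  df = df' -> is_derive x v f df -> is_derive x v f df'.
Proof. by move=> ->. Qed.

Lemma near_oo (a b x : R) : a < x < b -> \forall y \near x, a < y < b.
Proof.
move=> H; have := @near_in_itvoo R a b x; rewrite in_itv /= => /(_ H).
by apply: filterS => y; rewrite in_itv.
Qed.

Section Rules.
Variables (V : normedModType R) (x v : V).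
Implicit Types f g : V -> R.

Lemma der_cst (c : R) : is_derive x v (fun=> c) 0.
Proof. exact: is_derive_cst. Qed.

Lemma derD f g df dg : is_derive x v f df -> is_derive x v g dg ->
  is_derive x v (fun y => f y + g y) (df + dg).
Proof. by move=> ? ?; exact: is_deriveD. Qed.

Lemma derN f df : is_derive x v f df -> is_derive x v (fun y => - f y) (- df).
Proof. by move=> ?; exact: is_deriveN. Qed.

Lemma derB f g df dg : is_derive x v f df -> is_derive x v g dg ->
  is_derive x v (fun y => f y - g y) (df - dg).
Proof. by move=> ? ?; exact: is_deriveB. Qed.

Lemma derM f g df dg : is_derive x v f df -> is_derive x v g dg ->
  is_derive x v (fun y => f y * g y) (df * g x + f x * dg).
Proof.
move=> hf hg; apply: (is_derive_eq (is_deriveM hf hg)).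
by rewrite addrC [_ *: df]mulrC.
Qed.

Lemma der_comp (h : R -> R) f dh df : is_derive (f x) 1 h dh -> is_derive x v f df ->
  is_derive x v (fun y => h (f y)) (dh * df).
Proof.
move=> hh /is_derive_lineP hf; apply/is_derive_lineP.
apply: (@is_derive1_comp _ h (fun t : R => f (t *: v + x)) 0 dh df) => //.
by rewrite scale0r add0r.
Qed.

Lemma derX f df n : is_derive x v f df ->
  is_derive x v (fun y => f y ^+ n) (n%:R * f x ^+ n.-1 * df).
Proof.
elim: n => [|n IH] hf; first by rewrite !mul0r; apply: der_cst.
under [fun y => _]funext do rewrite exprS.
have := derM hf (IH hf); apply: der_eq.
case: n {IH} => [|n] /=; first by rewrite expr0; ring.
by rewrite [f x ^+ n.+1]exprS -[n.+2%:R]natr1; ring.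
Qed.

Lemma derV f df : f x != 0 -> is_derive x v f df ->
  is_derive x v (fun y => (f y)^-1) (- df / f x ^+ 2).
Proof.
move=> f0 hf.
have := @der_comp GRing.inv f (- (f x) ^- 2) df _ hf.
have -> : - (f x) ^- 2 * df = - df / f x ^+ 2 by rewrite mulNr mulrC mulNr.
apply; rewrite -[- _]mulr1.
have := @is_deriveV R id (f x) 1 1 f0 (is_derive_id _ _).
by apply: der_eq; rewrite /= [RHS]mulr1 [LHS]mulr1.
Qed.

End Rules.

Lemma der_id (x : R) : is_derive x 1 (fun y : R => y) 1.
Proof. exact: is_derive_id. Qed.

Lemma der_ext (V : normedModType R) (f g : V -> R) x v df :
  (\forall y \near x, f y = g y) -> is_derive x v f df -> is_derive x v g df.
Proof.
move=> H hf; exact: (near_eq_is_derive _ hf).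
Qed.

Lemma der_cont (f : R -> R) (x df : R) : is_derive x (1 : R) f df -> {for x, continuous f}.
Proof. by move=> [h _]; exact/differentiable_continuous/derivable1_diffP. Qed.

End DerivRules.

(** * Bump functions built from e^(-1/y) *)

Section BumpFunction.
Context {R : realType}.

(* [flat p] is [y |-> p(1/y) e^(-1/y)] on [y > 0], extended by 0: this family is stable under
   derivation. *)
Definition flat (p : {poly R}) (y : R) : R :=
  if 0 < y then p.[y^-1] * expR (- y^-1) else 0.

(** With x = 1/y one has dx/dy = - x^2, so p(x) e^(-x) has derivative x^2 (p - p')(x) e^(-x). *)
Definition flat' (p : {poly R}) : {poly R} := 'X^2 * (p - p^`()).

(** The exponential series bounds e^x below by x^(d+2) / (d+2)!, where d bounds the degree; the two
    spare powers of y make the difference quotient at 0 tend to 0. *)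
Lemma flat_small (p : {poly R}) :
  exists2 C, 0 <= C & forall y, 0 < y <= 1 -> `|flat p y| <= C * y ^+ 2.
Proof.
pose d := size p; pose C := (\sum_(i < d) `|p`_i|) * (d.+2)`!%:R.
exists C; first by rewrite mulr_ge0// sumr_ge0.
move=> y /andP[y0 y1].
rewrite /flat y0 normrM (ger0_norm (expR_ge0 _)) expRN.
have yV : 1 <= y^-1 by rewrite invf_ge1.
have h1 : `|p.[y^-1]| <= (\sum_(i < d) `|p`_i|) * y^-1 ^+ d.
  rewrite horner_coef; apply: le_trans (ler_norm_sum _ _ _) _.
  rewrite mulr_suml; apply: ler_sum => i _.
  rewrite normrM ler_wpM2l// normrX gtr0_norm ?invr_gt0//.
  by apply: ler_weXn2l => //; exact: ltnW.
have h2 : y^-1 ^+ d.+2 / (d.+2)`!%:R <= expR y^-1.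
  have := @expR_ge1Dxn R y^-1 d.+1 (le_trans ler01 yV); apply: le_trans.
  by rewrite lerDr.
have f0 : 0 < (d.+2)`!%:R :> R by rewrite ltr0n fact_gt0.
have h3 : (expR y^-1)^-1 <= (d.+2)`!%:R * y ^+ d.+2.
  have yd : 0 < y ^+ d.+2 by rewrite exprn_gt0.
  rewrite -[leRHS]invrK lef_pV2 ?posrE ?expR_gt0 ?invr_gt0 ?(mulr_gt0 f0 yd)//.
  by apply: le_trans h2; rewrite invfM -exprVn mulrC.
have h4 : 0 <= (expR y^-1)^-1 by rewrite invr_ge0 expR_ge0.
apply: (le_trans (ler_pM (normr_ge0 _) h4 h1 h3)).
rewrite /C le_eqVlt; apply/orP; left; apply/eqP.
rewrite exprVn -[in y ^+ d.+2](addn2 d) exprD.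
have : y ^+ d != 0 by rewrite expf_neq0// gt_eqF.
move=> yd; have -> : (\sum_(i < d) `|p`_i|) / y ^+ d * (d.+2`!%:R * (y ^+ d * y ^+ 2)) =
  (\sum_(i < d) `|p`_i|) * d.+2`!%:R * y ^+ 2 * (y ^+ d / y ^+ d) by ring.
by rewrite divff// mulr1.
Qed.

Lemma der_flat (p : {poly R}) (y : R) : is_derive y 1 (flat p) (flat (flat' p) y).
Proof.
have [y0|y0|<-] := ltgtP 0 y.
- rewrite [flat (flat' p) y]/flat y0.
  apply: (@der_ext _ _ (fun z : R => p.[z^-1] * expR (- z^-1))).
    have /near_oo : 0 < y < y + 1 by rewrite y0 ltrDl ltr01.
    by apply: filterS => z /andP[z0 _]; rewrite /flat z0.
  have hV := derV (lt0r_neq0 y0) (der_id y).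
  have hN := derN hV.
  have := derM (der_comp (@is_derive_poly _ p y^-1) hV)
    (@der_comp _ _ y 1 _ (fun z : R => - z^-1) _ _ (is_derive_expR (- y^-1)) hN).
  apply: der_eq; rewrite /flat' hornerM hornerXn hornerD hornerN -exprVn.
  by rewrite mulNr mul1r; ring.
- rewrite [flat (flat' p) y]/flat ltNge (ltW y0) /=.
  apply: (@der_ext _ _ (cst 0) _ y 1 0).
  have /near_oo : y - 1 < y < 0 by rewrite y0 ltrBlDr ltrDl ltr01.
  by apply: filterS => z /andP[_ z0]; rewrite /flat ltNge (ltW z0).
- rewrite [flat (flat' p) 0]/flat ltxx.
  have [C C0 HC] := flat_small p.
  have f00 : flat p 0 = 0 by rewrite /flat ltxx.
  suff H : (fun h : R => h^-1 *: ((flat p \o shift 0) (h *: (1 : R)) - flat p 0)) @ 0^' --> (0 : R).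
    split; first by apply/cvg_ex; exists 0.
    exact/cvg_lim.
  apply/cvgrPdist_le => e e0; near=> h.
  rewrite sub0r normrN /= addr0 f00 subr0 [h *: (1 : R)]mulr1 normrZ.
  have [h0|h0] := ltP 0 h; last first.
    by rewrite /flat ltNge h0 /= normr0 mulr0 ltW.
  have h1 : h <= 1.
    rewrite (le_trans (ler_norm _))//; near: h; exact: dnbhs0_le.
  apply: (le_trans (ler_wpM2l _ (HC _ _))) => //; first by rewrite h0.
  rewrite gtr0_norm ?invr_gt0// (_ : h^-1 * (C * h ^+ 2) = C * h * (h^-1 * h)); last by ring.
  rewrite mulVf ?gt_eqF// mulr1.
  have : h <= e / (C + 1).
    rewrite (le_trans (ler_norm _))//; near: h; apply: dnbhs0_le.
    by rewrite divr_gt0// ltr_wpDl.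
  rewrite ler_pdivlMr ?ltr_wpDl// => /(le_trans _); apply.
  by rewrite mulrC ler_wpM2l ?(ltW h0)// lerDl.
Unshelve. all: by end_near. Qed.

Lemma flat1E (y : R) : flat 1 y = if 0 < y then expR (- y^-1) else 0.
Proof. by rewrite /flat hornerC mul1r. Qed.

Lemma flat1_ge0 y : 0 <= flat 1 y :> R.
Proof. by rewrite flat1E; case: ifP => // _; exact: expR_ge0. Qed.

Lemma flat1_le1 y : flat 1 y <= 1 :> R.
Proof.
rewrite flat1E; case: ifP => // y0.
by rewrite expR_le1 oppr_le0 invr_ge0 ltW.
Qed.

Lemma flat1_cvg y : 0 < y -> flat 1 (n.+1%:R * y) @[n --> \oo] --> (1 : R).
Proof.
move=> y0.
have H : (fun n => expR (- (n.+1%:R^-1 * y^-1))) @ \oo --> (1 : R).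
  have H0 : (fun n => - (n.+1%:R^-1 * y^-1)) @ \oo --> (0 : R).
    rewrite -[X in _ --> X]oppr0; apply: cvgN.
    rewrite -[X in _ --> X](mul0r y^-1); apply: cvgM; last exact: cvg_cst.
    exact: cvg_harmonic.
  have := @continuous_expR R 0; rewrite /continuous_at expR0 => c.
  exact: (cvg_comp _ _ H0 c).
rewrite (_ : (fun n => flat _ _) = (fun n => expR (- (n.+1%:R^-1 * y^-1))))//.
apply/funext => n; rewrite flat1E mulr_gt0// ?ltr0Sn//.
by rewrite invfM.
Qed.

End BumpFunction.

(** * A syntax of smooth functions on R^7 closed under partial derivatives *)

Section SmoothTerms.
Context {R : realType}.
Local Notation R7 := (R7 R).
Local Notation M7 := (M7 R).
Local Notation mu7 := (@mu7 R).

(* [TBump p i k c] is [x |-> flat p (k x_i + c)]; [TS], [TIS] and [TID] stand for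
   [s = sqrt (2 + |x|^2)], [1/s] and [1/(5 |x|^2 + 3 (s - 2)^2)]. *)
Inductive term :=
  | TC of R | TX of 'I_7 | TBump of {poly R} & 'I_7 & R & R
  | TS | TIS | TID | TD of term & term | TM of term & term.

Definition sx (x : R7) : R := Num.sqrt (2 + \sum_i co i x ^+ 2).
Definition dx (x : R7) : R := 5 * (sx x ^+ 2 - 2) + 3 * (sx x - 2) ^+ 2.

Fixpoint eval (t : term) (x : R7) : R :=
  match t with
  | TC c => c | TX i => co i x | TBump p i k c => flat p (k * co i x + c)
  | TS => sx x | TIS => (sx x)^-1 | TID => (dx x)^-1
  | TD a b => eval a x + eval b x | TM a b => eval a x * eval b x
  end.

(** Syntactic derivatives keep all iterated partials inside the class, so smoothness and weak
    derivatives follow by structural induction. In the case [TID], the derivative of 5 (s^2 - 2) + 3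
    (s - 2)^2 is x_j (10 + 6 (1 - 2/s)), because s has derivative x_j / s. *)
Fixpoint tder (j : 'I_7) (t : term) : term :=
  match t with
  | TC c => TC 0
  | TX i => TC (i == j)%:R
  | TBump p i k c => TM (TBump (flat' p) i k c) (TC (k * (i == j)%:R))
  | TS => TM (TX j) TIS
  | TIS => TM (TC (- 1)) (TM (TX j) (TM TIS (TM TIS TIS)))
  | TID => TM (TM (TC (- 1)) (TM TID TID))
             (TM (TX j) (TD (TC 10) (TM (TC 6) (TD (TC 1) (TM (TC (- 2)) TIS)))))
  | TD a b => TD (tder j a) (tder j b)
  | TM a b => TD (TM (tder j a) b) (TM a (tder j b))
  end.

Lemma sumsq_ge0 (x : R7) : 0 <= \sum_i co i x ^+ 2.
Proof. by apply: sumr_ge0 => i _; rewrite sqr_ge0. Qed.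

Lemma sx_gt1 x : 1 < sx x.
Proof.
rewrite -(@sqrtr1 R) ltr_sqrt; have := sumsq_ge0 x; lra_ctx.
Qed.

Lemma sx_gt0 x : 0 < sx x.
Proof. by have := sx_gt1 x; lra_ctx. Qed.

Lemma sx_sq x : sx x ^+ 2 = 2 + \sum_i co i x ^+ 2.
Proof. by rewrite sqr_sqrtr// addr_ge0// sumsq_ge0. Qed.

Lemma dx_gt0 x : 0 < dx x.
Proof.
have h1 := sx_gt1 x; have h2 := sx_sq x; have h3 := sumsq_ge0 x.
rewrite /dx; have [->|s2] := eqVneq (sx x) 2; first by lra_ctx.
have : 0 < (sx x - 2) ^+ 2 by rewrite exprn_even_gt0//= subr_eq0.
lra_ctx.
Qed.

Lemma der_co i j (x : R7) : is_derive x (e7 j) (co i) (i == j)%:R.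
Proof.
apply/is_derive_lineP.
rewrite (_ : (fun t : R => _) = (fun t : R => t * (i == j)%:R + co i x)); last first.
  by apply/funext => t; rewrite coD coZ co_e7.
have := derD (derM (der_id (0 : R)) (der_cst _ _ (i == j)%:R)) (der_cst _ _ (co i x)).
by apply: der_eq; rewrite mulr0 mul1r !addr0.
Qed.

Lemma der_sx j (x : R7) : is_derive x (e7 j) sx (co j x / sx x).
Proof.
have h0 : 0 < 2 + \sum_i co i x ^+ 2 by have := sumsq_ge0 x; lra_ctx.
have hs : is_derive x (e7 j) (fun x => 2 + \sum_i co i x ^+ 2) (2 * co j x).
  have H i : is_derive x (e7 j) (fun y => co i y ^+ 2) (2%:R * co i x ^+ 1 * (i == j)%:R).
    exact: (derX 2 (der_co i j x)).
  have := derD (der_cst x (e7 j) (2 : R)) (is_derive_sum H).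
  rewrite (_ : (fun y => _) = (fun x => 2 + \sum_i co i x ^+ 2)); last first.
    by apply/funext => y; rewrite fct_sumE.
  apply: der_eq; rewrite add0r (bigD1 j)//= big1 ?addr0 ?eqxx ?mulr1//.
  by move=> i /negPf ->; rewrite mulr0.
have := @der_comp _ _ _ _ Num.sqrt (fun x => 2 + \sum_i co i x ^+ 2) _ _ (is_derive1_sqrt h0) hs.
apply: der_eq; rewrite -/(sx x).
have := sx_gt0 x => s0; field; exact: lt0r_neq0.
Qed.

Lemma der_eval t j x : is_derive x (e7 j) (eval t) (eval (tder j t) x).
Proof.
have s0 := lt0r_neq0 (sx_gt0 x); have d0 := lt0r_neq0 (dx_gt0 x).
elim: t => [c|i|p i k c||||a IHa b IHb|a IHa b IHb] /=.
- exact: der_cst.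
- exact: der_co.
- apply: (@der_comp _ _ _ _ (flat p) (fun x => k * co i x + c)); first exact: der_flat.
  have := derD (derM (der_cst _ _ k) (der_co i j x)) (der_cst _ _ c).
  by apply: der_eq; rewrite mul0r add0r addr0.
- exact: der_sx.
- have := derV s0 (der_sx j x); apply: der_eq; field; exact: s0.
- have hs := der_sx j x.
  have h2 := derX 2 (derB hs (der_cst x (e7 j) 2)).
  have := derV d0 (derD (derM (der_cst x (e7 j) 5) (derB (derX 2 hs) (der_cst x (e7 j) 2)))
    (derM (der_cst x (e7 j) 3) h2)).
  apply: der_eq; rewrite /=; field; exact/andP.
- exact: derD.
- exact: derM.
Qed.

Lemma continuous_eval t : continuous (eval t).
Proof.
have cs : continuous sx.
  move=> x; apply: (@continuous_comp _ _ _ (fun x : R7 => 2 + \sum_i co i x ^+ 2) Num.sqrt);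
    last exact: sqrt_continuous.
  apply: cvgD; first exact: cvg_cst.
  apply: (cvg_big add_continuous) => i _; apply: cvgM; exact: continuous_co.
have cd : continuous dx.
  move=> x; have := cs x => csx.
  have dd := derD (derM (der_cst (sx x) 1 5) (derB (derX 2 (der_id (sx x))) (der_cst (sx x) 1 2)))
    (derM (der_cst (sx x) 1 3) (derX 2 (derB (der_id (sx x)) (der_cst (sx x) 1 2)))).
  exact: (@continuous_comp _ _ _ sx (fun s => 5 * (s ^+ 2 - 2) + 3 * (s - 2) ^+ 2) _ csx (der_cont dd)).
elim: t => [c|i|p i k c||||a IHa b IHb|a IHa b IHb] x /=.
- exact: cvg_cst.
- exact: continuous_co.
- apply: (@continuous_comp _ _ _ (fun x => k * co i x + c) (flat p)).
    by apply: cvgD; [apply: cvgM; [exact: cvg_cst|exact: continuous_co]|exact: cvg_cst].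
  exact: der_cont (der_flat p _).
- exact: cs.
- by apply: cvgV; [exact: lt0r_neq0 (sx_gt0 x)|exact: cs].
- by apply: cvgV; [exact: lt0r_neq0 (dx_gt0 x)|exact: cd].
- by apply: cvgD; [exact: IHa|exact: IHb].
- by apply: cvgM; [exact: IHa|exact: IHb].
Qed.

Lemma partial_eval t j : partial j (eval t) = eval (tder j t).
Proof. by apply/funext => x; have [_] := der_eval t j x. Qed.

Lemma partials_eval t s : partials s (eval t) = eval (foldr tder t s).
Proof. by elim: s => //= j s ->; rewrite partial_eval. Qed.

Lemma smooth7_eval t : smooth7 (eval t).
Proof.
move=> s; rewrite partials_eval; split; first exact: continuous_eval.
by move=> i x; have [] := der_eval (foldr tder t s) i x.
Qed.

Lemma measurable_eval t : measurable_fun setT (eval t : M7 -> R).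
Proof. by apply: continuous_measurable7; exact: continuous_eval. Qed.

Lemma compact_cbox (a b : 'I_7 -> R) : compact (cbox a b : set R7).
Proof.
rewrite (_ : cbox a b =
  (((((( `[a (inord 0), b (inord 0)]%classic `*` `[a (inord 1), b (inord 1)]%classic)
  `*` `[a (inord 2), b (inord 2)]%classic) `*` `[a (inord 3), b (inord 3)]%classic)
  `*` `[a (inord 4), b (inord 4)]%classic) `*` `[a (inord 5), b (inord 5)]%classic)
  `*` `[a (inord 6), b (inord 6)]%classic)).
  by do ! apply: compact_setX; exact: segment_compact.
apply/seteqP; split => x /=; rewrite /cbox /=.
  by move=> /forall7; rewrite !coE !in_itv /= => -[-> -> -> [-> -> -> ->]].
rewrite !in_itv /= => -[[[[[[? ?] ?] ?] ?] ?] ?]; apply/forall7; rewrite !coE.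
by split; last split.
Qed.

(** Smooth functions with support in [cbox a b] that converge pointwise to the indicator of
    [box a b] as n grows. *)
Definition tbump (a b : 'I_7 -> R) (n : nat) : term :=
  foldr (fun i t => TM (TM (TBump 1 i n.+1%:R (- (n.+1%:R * a i)))
    (TBump 1 i (- n.+1%:R) (n.+1%:R * b i))) t) (TC 1) (enum 'I_7).

Lemma eval_tbump a b n x : eval (tbump a b n) x =
  \prod_i (flat 1 (n.+1%:R * (co i x - a i)) * flat 1 (n.+1%:R * (b i - co i x))).
Proof.
rewrite /tbump -big_enum /=; elim: (enum 'I_7) => [|i s IH] /=; first by rewrite big_nil.
rewrite big_cons -IH; congr (flat _ _ * flat _ _ * _); ring.
Qed.

Lemma tbump_ge0 a b n x : 0 <= eval (tbump a b n) x.
Proof. by rewrite eval_tbump; apply: prodr_ge0 => i _; rewrite mulr_ge0 ?flat1_ge0. Qed.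

Lemma tbump_le1 a b n x : eval (tbump a b n) x <= 1.
Proof.
rewrite eval_tbump; apply: prodr_ile1 => i _.
by rewrite mulr_ge0 ?flat1_ge0//= mulr_ile1 ?flat1_ge0 ?flat1_le1.
Qed.

Lemma tbump_out a b n x : ~ box a b x -> eval (tbump a b n) x = 0.
Proof.
move=> H; have [i Hi] : exists i, ~~ (a i < co i x < b i).
  by apply: contrapT => /forallNP K; apply: H => i; have /negP/negPn := K i.
rewrite eval_tbump (bigD1 i)//= !flat1E !pmulr_rgt0 ?ltr0Sn// !subr_gt0.
by move: Hi; rewrite negb_and => /orP[] /negPf ->; rewrite ?(mul0r, mulr0).
Qed.

Lemma tbump_cvg a b x : box a b x -> eval (tbump a b n) x @[n --> \oo] --> (1 : R).
Proof.
move=> H; pose F i n := flat 1 (n.+1%:R * (co i x - a i)) * flat 1 (n.+1%:R * (b i - co i x)).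
have H1 : (fun n => \prod_i F i n) @ \oo --> \prod_(i : 'I_7) (1 : R).
  apply: (cvg_big (@mul_continuous R)) => i _.
  have /andP[h1 h2] := H i.
  have K : F i @ \oo --> (1 * 1 : R) by apply: cvgM; apply: flat1_cvg; rewrite subr_gt0.
  by rewrite mulr1 in K.
rewrite big1 // in H1.
rewrite (_ : (fun n => eval _ x) = (fun n => \prod_i F i n))//.
by apply/funext => n; rewrite eval_tbump.
Qed.

Lemma test_function_tbump r a b n : cbox a b `<=` ball7 r ->
  test_function r (eval (tbump a b n)).
Proof.
move=> H; split; first exact: smooth7_eval.
exists (cbox a b); split; [exact: compact_cbox|exact: H|].
move=> x Hx; apply: tbump_out => K; apply: Hx => i.
by have /andP[/ltW -> /ltW ->] := K i.
Qed.

End SmoothTerms.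

(** * Translation, integration by parts and vanishing of functions tested against bumps *)

Section Integrals7.
Context {R : realType}.
Local Notation R7 := (R7 R).
Local Notation M7 := (M7 R).
Local Notation mu7 := (@mu7 R).

Lemma box_fin (a b : 'I_7 -> R) : (mu7 (box a b) < +oo)%E.
Proof.
apply: (@le_lt_trans _ _ (mu7 (box a (fun i => Num.max (a i) (b i))))).
  apply: le_measure; rewrite ?inE; [exact: measurable_box|exact: measurable_box|].
  by move=> x /= xr i; have /andP[-> h] := xr i; rewrite lt_max h orbT.
by rewrite mu7_box ?ltry// => i; rewrite le_max lexx.
Qed.

Lemma integrable_bounded_box (F : M7 -> R) (M rho : R) : measurable_fun setT F ->
  (forall x, `|F x| <= M) -> (forall x : R7, F x != 0 -> forall i, `|co i x| < rho) ->
  mu7.-integrable setT (EFin \o F).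
Proof.
move=> mF FM Fs.
have mB := @measurable_box R (fun=> - rho) (fun=> rho).
rewrite (_ : EFin \o F = (EFin \o F) \_ (box (fun=> - rho) (fun=> rho))).
  apply/(integrable_mkcond _ mB).
   apply: measurable_bounded_integrable => //.
  - exact: box_fin.
  - exact: measurable_funTS.
  - exists M; split; first exact: num_real.
    by move=> y My x _; exact: le_trans (FM x) (ltW My).
apply/funext => x; rewrite patchE; case: ifPn => // /negP H.
have [F0|/Fs K] := eqVneq (F x) 0; first by rewrite /= F0.
by exfalso; apply: H; rewrite inE => i; rewrite -ltr_norml.
Qed.

Lemma integral_shift7 (F : M7 -> R) (M rho : R) (v : R7) : measurable_fun setT F ->
  (forall x, `|F x| <= M) -> (forall x : R7, F x != 0 -> forall i, `|co i x| < rho) ->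
  (\int[mu7]_x (F ((x : R7) + v : R7))%:E = \int[mu7]_x (F x)%:E)%E.
Proof.
move=> mF FM Fs.
have [mphi pres] := preserves7 v.
have iF' : mu7.-integrable setT (EFin \o (fun x : M7 => F ((x : R7) + v : R7))).
  apply: (@integrable_bounded_box _ M (rho + \big[Num.max/0]_i `|co i v|)).
  - exact: (measurableT_comp mF mphi).
  - by move=> x; exact: FM.
  - move=> x /Fs H i; have := H i; rewrite coD => h.
    have -> : co i x = co i x + co i v - co i v by ring.
    apply: le_lt_trans (ler_normB _ _) _; rewrite ltr_leD//.
    exact: (le_bigmax_cond _ (fun i => `|co i v|)).
have mEF : measurable_fun setT (EFin \o F) by exact/measurable_EFinP.
rewrite -[LHS](integral_pushforward mphi mEF iF' measurableT).
by apply: eq_measure_integral => A mA _; exact: pres.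
Qed.

Lemma cvg_quot_seq (V : normedModType R) (f : V -> R) x v df : is_derive x v f df ->
  (fun n => n.+1%:R * (f (n.+1%:R^-1 *: v + x) - f x)) @ \oo --> df.
Proof.
move=> [d1 d2].
have H : (fun n => n.+1%:R^-1 : R) @ \oo --> (0 : R)^'.
  move=> A /= hA; have := @cvg_harmonic R _ hA.
  case=> N _ HN; exists N => // n /HN /=; apply.
  by rewrite /harmonic /= invr_eq0 pnatr_eq0.
have := cvg_comp _ _ H (cvg_toP d1 d2 : _ --> df).
by apply: cvg_trans; apply: near_eq_cvg; apply: nearW => n /=; rewrite invrK.
Qed.

Lemma der_bound (f df : R -> R) (M : R) : (forall x : R, is_derive x (1 : R) f (df x)) ->
  (forall x, `|df x| <= M) -> forall x y, `|f x - f y| <= M * `|x - y|.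
Proof.
move=> hf hM x y; wlog xy : x y / y <= x.
  move=> W; have [/W//|/ltW /W] := leP y x.
  by rewrite distrC [`|y - x|]distrC.
have [] := @MVT_segment R f df y x xy.
- apply: continuous_subspaceT => z; exact: der_cont (hf z).
- by move=> c _ ->; rewrite normrM ler_wpM2r.
Qed.

(** Translation invariance makes the integral of every difference quotient vanish; the mean value
    theorem bounds these quotients by M, and dominated convergence passes to the derivative. *)
Lemma integral_partial0 i (F F' : R7 -> R) (M rho : R) :
  (forall x, is_derive x (e7 i) F (F' x)) -> measurable_fun setT (F : M7 -> R) ->
  (forall x, `|F x| <= M) -> (forall x, `|F' x| <= M) ->
  (forall x, F x != 0 -> forall j, `|co j x| < rho) ->
  (\int[mu7]_x (F' x)%:E = 0)%E.
Proof.
move=> hF mF FM F'M Fs.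
have M0 : 0 <= M by exact: le_trans (normr_ge0 _) (FM 0).
pose D n (x : M7) : R := n.+1%:R * (F (n.+1%:R^-1 *: e7 i + (x : R7)) - F x).
pose Sh n (x : M7) : R := F ((x : R7) + n.+1%:R^-1 *: e7 i).
have ShE n x : F (n.+1%:R^-1 *: e7 i + x) = Sh n x by rewrite /Sh addrC.
have mSh n : measurable_fun setT (Sh n).
  by have [mphi _] := preserves7 (n.+1%:R^-1 *: e7 i : R7); exact: (measurableT_comp mF mphi).
have mD n : measurable_fun setT (D n).
  rewrite (_ : D n = fun x => n.+1%:R * (Sh n x - F x)).
    by apply: measurable_funM => //; exact: measurable_funB.
  by apply/funext => x; rewrite /D ShE.
have Dcvg x : D ^~ x @ \oo --> F' x by exact: cvg_quot_seq.
have mF' : measurable_fun setT (F' : M7 -> R).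
  by apply: (measurable_fun_cvg (h := D)) => // x _; exact: Dcvg.
have inv1 n : `|n.+1%:R^-1 : R| <= 1.
  by rewrite ger0_norm ?invr_ge0// invf_le1 ?ltr0Sn// ler1n.
have DM n x : `|D n x| <= M.
  have := @der_bound (fun t => F (t *: e7 i + x)) (fun t => F' (t *: e7 i + x)) M.
  move=> /(_ _ _ n.+1%:R^-1 0); rewrite scale0r add0r subr0 => H.
  rewrite /D normrM (ger0_norm (ler0n _ _)).
  have -> : M = n.+1%:R * (M * `|n.+1%:R^-1|).
    by rewrite ger0_norm ?invr_ge0// mulrCA mulfV ?mulr1// pnatr_eq0.
  apply: ler_wpM2l => //; apply: H => // t.
  apply/is_derive_lineP; have /is_derive_lineP := hF (t *: e7 i + x).
  rewrite (_ : (fun t0 : R => F (t0 *: e7 i + (t *: e7 i + x))) =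
    (fun t0 : R => F ((t0 *: (1 : R) + t) *: e7 i + x)))//.
  by apply/funext => t0; rewrite [t0 *: (1 : R)]mulr1 scalerDl addrA.
(* The steps 1/(n+1) are at most 1, so one box of half-width [rho + 1] contains all translated
   supports and carries the dominating function. *)
have Shs n (x : R7) : Sh n x != 0 -> forall j, `|co j x| < rho + 1.
  move=> /Fs H j; have := H j; rewrite coD coZ co_e7 => h.
  have -> : co j x = co j x + n.+1%:R^-1 * (j == i)%:R - n.+1%:R^-1 * (j == i)%:R by ring.
  apply: le_lt_trans (ler_normB _ _) _; rewrite ltr_leD//.
  by rewrite normrM; case: eqP => _; rewrite ?normr1 ?mulr1 ?normr0 ?mulr0 ?ler01.
have Ds n (x : R7) : D n x != 0 -> forall j, `|co j x| < rho + 1.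
  move=> H j; have [F0|] := eqVneq (F x) 0; last first.
    by move/Fs => /(_ j) h; apply: lt_trans h _; rewrite ltrDl.
  apply: (Shs n); apply: contra_neq H => S0.
  by rewrite /D ShE S0 F0 subr0 mulr0.
have iF : mu7.-integrable setT (EFin \o (F : M7 -> R)) by exact: integrable_bounded_box Fs.
have iSh n : mu7.-integrable setT (EFin \o Sh n).
  apply: (@integrable_bounded_box _ M (rho + 1)) => //; last exact: (Shs n).
  by move=> x; exact: FM.
have D0 n : (\int[mu7]_x (D n x)%:E = 0)%E.
  transitivity (\int[mu7]_x (n.+1%:R%:E * (Sh n x - F x)%:E))%E.
    by apply: eq_integral => x _; rewrite /D ShE EFinM.
  rewrite integralZl//; last exact: (integrableB _ (iSh n) iF).
  under eq_integral do rewrite EFinB.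
  rewrite integralB_EFin//.
  rewrite [X in (X - _)%E](@integral_shift7 F M rho)//.
  rewrite subee ?mule0//.
  exact: (@integrable_fin_num _ _ _ mu7 setT measurableT (EFin \o F)).
have [] := @dominated_convergence _ _ _ mu7 setT measurableT (fun n => EFin \o D n)
  (EFin \o F') (EFin \o (fun x : M7 => M * \1_(box (fun=> - (rho + 1)) (fun=> rho + 1)) x)).
- by move=> n; exact/measurable_EFinP.
- exact/measurable_EFinP.
- apply: aeW => x _ /=; apply: cvg_EFin; last exact: Dcvg.
  by apply: nearW.
- apply: (@integrable_bounded_box _ M (rho + 1)).
  + apply: measurable_funM => //; apply: measurable_indic; exact: measurable_box.
  + move=> x; rewrite indicE normrM (ger0_norm M0); case: (_ \in _).
      by rewrite normr1 mulr1.
    by rewrite normr0 mulr0.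
  + move=> x; rewrite indicE; case: (boolP (x \in _)) => [+ _ j|_].
      by rewrite inE => /(_ j); rewrite -ltr_norml.
    by rewrite mulr0 eqxx.
- apply: aeW => x n _ /=; rewrite lee_fin indicE.
  have [->|/Ds H] := eqVneq (D n x) 0; first by rewrite normr0 mulr_ge0.
  rewrite mem_set ?mulr1//= => j.
  by rewrite -ltr_norml.
- move=> _ _; rewrite (_ : [sequence _]_n = cst 0%E); last first.
    by apply/funext => n /=; exact: D0.
  by move=> /cvg_lim <-//; rewrite lim_cst.
Qed.

(** The bumps are bounded by 1 and converge to the indicator of the box, so dominated convergence
    applies with bound |g|. *)
Lemma integral_box0 r (a b : 'I_7 -> R) (g : M7 -> R) :
  mu7.-integrable (ball7 r) (EFin \o g) -> cbox a b `<=` ball7 r ->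
  (forall n, \int[mu7]_(x in ball7 r) (g x * eval (tbump a b n) x)%:E = 0)%E ->
  (\int[mu7]_(x in box a b) (g x)%:E = 0)%E.
Proof.
move=> ig ab H.
have mg : measurable_fun (ball7 r : set M7) g.
  by have /measurable_EFinP := measurable_int mu7 ig.
have mB := @measurable_ball7 R r; have mb := @measurable_box R a b.
have sub : box a b `<=` ball7 r.
  by move=> x Hx; apply: ab => i; have /andP[/ltW -> /ltW ->] := Hx i.
have [] := @dominated_convergence _ _ _ mu7 (ball7 r) mB
  (fun n x => (g x * eval (tbump a b n) x)%:E) (fun x => (g x * \1_(box a b) x)%:E)
  (fun x => `|g x|%:E).
- move=> n; apply/measurable_EFinP; apply: measurable_funM => //.
  apply: measurable_funTS; exact: measurable_eval.
- by apply/measurable_EFinP; exact: measurable_funM.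
- apply: aeW => x _; apply: cvg_EFin; first exact: nearW.
  apply: cvgM; first exact: cvg_cst.
  rewrite indicE; case: (boolP (x \in _)); first by rewrite inE; exact: tbump_cvg.
  move=> /negP Hx; rewrite (_ : (fun n => _) = cst 0); first exact: cvg_cst.
  apply/funext => n; apply: tbump_out => K; apply: Hx; exact: mem_set.
- exact: (integrable_norm ig).
- apply: aeW => x n _ /=; rewrite lee_fin normrM ler_piMr//.
  by rewrite ger0_norm ?tbump_ge0 ?tbump_le1.
- move=> _ _; rewrite (_ : [sequence _]_n = cst 0%E); last first.
    by apply/funext => n /=; exact: H.
  move=> /cvg_lim; rewrite lim_cst// => E; rewrite [RHS]E//.
  rewrite -[in LHS](setIidr sub) integral_mkcondr; apply: eq_integral => x _.
  by rewrite patchE indicE; case: ifP; rewrite ?mulr1 ?mulr0.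
Qed.

Lemma ae_countable (T : countType) (P : T -> M7 -> Prop) :
  (forall t, {ae mu7, forall x, P t x}) -> {ae mu7, forall x t, P t x}.
Proof.
move=> H.
have : {ae mu7, forall x n, if unpickle n is Some t then P t x else True}.
  by apply/ae_foralln => n; case: (unpickle n) => // *; exact: aeW.
by apply: filterS => x K t; have := K (pickle t); rewrite pickleK.
Qed.

(** A local form of the fundamental lemma of the calculus of variations: on each of the countably
    many rational boxes inside [O], a subbox is again a box admissible for [tbump], so
    [integral_family_ae0] applies. Locality matters because radial formulas for derivatives hold
    only away from the origin. *)
Lemma test_functions_ae0 r (O : set R7) (g : M7 -> R) : open O -> O `<=` ball7 r ->
  mu7.-integrable (ball7 r) (EFin \o g) ->
  (forall a b n, cbox a b `<=` O ->
    \int[mu7]_(x in ball7 r) (g x * eval (tbump a b n) x)%:E = 0)%E ->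
  {ae mu7, forall x, O x -> g x = 0}.
Proof.
move=> oO Or ig H.
have mg : measurable_fun (ball7 r : set M7) g.
  by have /measurable_EFinP := measurable_int mu7 ig.
have Hbox a b : cbox a b `<=` O -> (\int[mu7]_(x in box a b) (g x)%:E = 0)%E.
  move=> abO; apply: (@integral_box0 r) => //; first exact: subset_trans Or.
  by move=> n; exact: H.
have Hq (q : {ffun 'I_7 -> rat * rat}) : {ae mu7, forall x,
    cbox (qlo q : _ -> R) (qhi q) `<=` O -> box (qlo q) (qhi q) x -> g x = 0}.
  have [qO|nqO] := pselect (cbox (qlo q : _ -> R) (qhi q) `<=` O); last exact: aeW.
  pose B := box (qlo q : _ -> R) (qhi q).
  have mB : measurable B by exact: measurable_box.
  have BO : B `<=` O by move=> x Hx; apply: qO => i; have /andP[/ltW -> /ltW ->] := Hx i.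
  have iB : mu7.-integrable setT (EFin \o (g \_ B)).
    rewrite -restrict_EFin; apply/(integrable_mkcond _ mB).
    by apply: integrableS ig => //; [exact: measurable_ball7|exact: subset_trans Or].
  have intB A : (\int[mu7]_(x in A) ((g \_ B) x)%:E = \int[mu7]_(x in A `&` B) (g x)%:E)%E.
    by rewrite integral_mkcondr; apply: eq_integral => x _; rewrite !patchE; case: ifP.
  have BT : (\int[mu7]_x ((g \_ B) x)%:E = 0)%E by rewrite intB setTI Hbox.
  have BG A : [set A | exists a b, A = box a b] A -> (\int[mu7]_(x in A) ((g \_ B) x)%:E = 0)%E.
    move=> [a [b ->]]; rewrite intB.
    pose lo i := Num.max (a i) (qlo q i : R); pose hi i := Num.min (b i) (qhi q i : R).
    have E : box a b `&` B = box lo hi.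
      apply/seteqP; split => x /=.
        move=> [H1 H2] i; rewrite lt_min gt_max.
        by have /andP[-> ->] := H1 i; have /andP[-> ->] := H2 i.
      by move=> K; split => i; have := K i; rewrite lt_min gt_max => /andP[/andP[? ?] /andP[? ?]];
        apply/andP.
    rewrite E; have [lohi|nlohi] := pselect (forall i, lo i < hi i).
      apply: Hbox => x Hx; apply: qO => i.
      have := Hx i; rewrite le_min ge_max => /andP[/andP[_ ->] /andP[_ ->]] //.
    rewrite (_ : box lo hi = set0) ?integral_set0//.
    apply/seteqP; split => // x Hx; apply: nlohi => i.
    by have /andP[] := Hx i; exact: lt_trans.
  apply: filterS (integral_family_ae0 (@generates_box R) iB BT BG) => x h _ Bx.
  by move: h; rewrite patchE mem_set.
have := ae_countable Hq; apply: filterS => x K Ox.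
by have [q [h1 h2]] := open_rat_box oO Ox; exact: (K q).
Qed.

End Integrals7.

(** * Weak derivatives *)

Section TestFunctions.
Context {R : realType}.
Local Notation R7 := (R7 R).
Local Notation M7 := (M7 R).
Local Notation mu7 := (@mu7 R).

(** A test function with a named set outside which it vanishes; for a compact [K] this same [K]
    serves all partial derivatives. *)
Definition tfun (K : set R7) (psi : R7 -> R) : Prop :=
  smooth7 psi /\ forall x, ~ K x -> psi x = 0.

Lemma smooth7_partial psi j : smooth7 psi -> smooth7 (partial j psi : R7 -> R).
Proof.
move=> H s; have := H (s ++ [:: j]).
by rewrite /partials foldr_cat.
Qed.

Lemma smooth7_der psi j x : smooth7 psi -> is_derive x (e7 j) psi (partial j psi x : R).
Proof. by move=> /(_ [::])[_ /(_ j x)] h; split. Qed.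

Lemma smooth7_cont psi : smooth7 psi -> continuous (psi : R7 -> R).
Proof. by move=> /(_ [::])[]. Qed.

Lemma near_notin (K : set R7) x : compact K -> ~ K x -> \forall y \near x, ~ K y.
Proof.
move=> cK Kx; have cl : closed K by apply: compact_closed => //; exact: norm_hausdorff.
have oK : open (~` K) by exact: closed_openC.
by move: oK; rewrite openE => /(_ x Kx).
Qed.

Lemma tfun_partial K psi j : compact K -> tfun K psi -> tfun K (partial j psi).
Proof.
move=> cK [sm out]; split; first exact: smooth7_partial.
move=> x Kx; have [_] : is_derive x (e7 j) psi 0; last by [].
apply: (@der_ext _ _ (cst 0)).
by apply: filterS (near_notin cK Kx) => y Ky; rewrite out.
Qed.

Lemma tfun_partials K psi s : compact K -> tfun K psi -> tfun K (partials s psi).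
Proof. by move=> cK H; elim: s => //= j s IH; exact: tfun_partial. Qed.

Lemma compact_coord_bound (K : set R7) : compact K ->
  exists rho, forall x, K x -> forall i, `|co i x| < rho.
Proof.
move=> /compact_bounded [M [_ HM]]; exists (M + 2) => x Kx i.
have h := HM (M + 1) ltac:(by rewrite ltrDl) x Kx.
have : ball (0 : R7) (M + 2) x.
  rewrite -ball_normE /= sub0r normrN; apply: le_lt_trans h _; lra_ctx.
move/ball_co => /(_ i).
have -> : co i (0 : R7) = 0 by move: (i); apply/forall7; rewrite !coE.
by rewrite sub0r normrN.
Qed.

Lemma continuous_compact_bound (K : set R7) (f : R7 -> R) : compact K -> continuous f ->
  exists M, forall x, K x -> `|f x| <= M.
Proof.
move=> cK cf.
have : compact (f @` K) by apply: continuous_compact => //; exact: continuous_subspaceT.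
move=> /compact_bounded [M [_ HM]]; exists (M + 1) => x Kx.
by apply: HM; [rewrite ltrDl|exists x].
Qed.

Lemma tfun_bound K psi : compact K -> tfun K psi -> exists M, forall x, `|psi x| <= M.
Proof.
move=> cK [sm out]; have [M HM] := continuous_compact_bound cK (smooth7_cont sm).
exists `|M| => x; have [/HM h|/out ->] := pselect (K x); last by rewrite normr0.
exact: le_trans h (ler_norm _).
Qed.

Lemma Dmulti_partials (a : 'I_7 -> nat) : exists s, size s = (\sum_i a i)%N /\
  forall phi : R7 -> R, Dmulti a phi = partials s phi.
Proof.
exists (flatten [seq nseq (a i) i | i <- enum 'I_7]); split.
  rewrite size_flatten /shape -map_comp sumnE big_map big_enum /=.
  by apply: eq_bigr => i _; rewrite size_nseq.
move=> phi; rewrite /Dmulti /partials; elim: (enum 'I_7) => //= i s ->.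
by rewrite foldr_cat; elim: (a i) => //= n ->.
Qed.

Lemma integral_ball_supp r (K : set R7) (f : M7 -> R) : K `<=` ball7 r ->
  (forall x, ~ K x -> f x = 0) ->
  (\int[mu7]_(x in ball7 r) (f x)%:E = \int[mu7]_x (f x)%:E)%E.
Proof.
move=> Kr f0; rewrite integral_mkcond; apply: eq_integral => x _.
rewrite patchE; case: ifPn => // /negP H; rewrite f0// => /Kr Kx.
by apply: H; exact: mem_set.
Qed.

(** Differentiability of [u] is asked only on an open neighbourhood of the support, since [psi]
    annihilates the rest; the claim is [integral_partial0] for the product [u * psi]. *)
Lemma ibp_local r j (O K : set R7) (u u' psi : R7 -> R) (M : R) :
  open O -> O `<=` ball7 r -> compact K -> K `<=` O -> tfun K psi ->
  (forall x, O x -> is_derive x (e7 j) u (u' x)) ->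
  measurable_fun (O : set M7) (u : M7 -> R) -> measurable_fun (O : set M7) (u' : M7 -> R) ->
  (forall x, K x -> `|u x| <= M) -> (forall x, K x -> `|u' x| <= M) ->
  (\int[mu7]_(x in ball7 r) (u x * partial j psi x)%:E
   = - \int[mu7]_(x in ball7 r) (u' x * psi x)%:E)%E.
Proof.
move=> oO Or cK KO tK hu mu mu' uM u'M.
have tK' := tfun_partial j cK tK.
have [P1 HP1] := tfun_bound cK tK; have [P2 HP2] := tfun_bound cK tK'.
have [rho Hrho] := compact_coord_bound cK.
have Kr : K `<=` ball7 r by exact: subset_trans Or.
case: (tK) => sm out; case: (tK') => sm' out'.
have mO : measurable (O : set M7) by exact: open_measurable7.
have mm (f g : R7 -> R) : measurable_fun (O : set M7) (f : M7 -> R) ->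
    continuous g -> (forall x, ~ K x -> g x = 0) ->
    measurable_fun setT (fun x : M7 => f x * g x).
  move=> mf cg g0; rewrite (_ : (fun x => _) = (fun x => (f \_ O) x * g x)).
    apply: measurable_funM; last by exact: continuous_measurable7.
    exact/(measurable_restrictT _ mO).
  apply/funext => x; rewrite patchE; case: ifPn => // /negP H.
  by rewrite g0 ?mulr0// => /KO Ox; apply: H; exact: mem_set.
have bd (f g : R7 -> R) P : (forall x, K x -> `|f x| <= M) -> (forall x, `|g x| <= P) ->
    (forall x, ~ K x -> g x = 0) -> forall x, `|f x * g x| <= `|M| * `|P|.
  move=> fM gP g0 x; have [Kx|/g0 ->] := pselect (K x); last by rewrite mulr0 normr0 mulr_ge0.
  rewrite normrM ler_pM//; first exact: le_trans (fM _ Kx) (ler_norm _).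
  exact: le_trans (gP _) (ler_norm _).
have sp (f g : R7 -> R) : (forall x, ~ K x -> g x = 0) -> forall x, f x * g x != 0 ->
    forall i, `|co i x| < rho.
  move=> g0 x fg i; apply: Hrho; apply: contrapT => /g0 gx.
  by move: fg; rewrite gx mulr0 eqxx.
have i1 : mu7.-integrable setT (EFin \o (fun x : M7 => u' x * psi x)).
  apply: (integrable_bounded_box (mm _ _ mu' (smooth7_cont sm) out)
    (bd _ _ _ u'M HP1 out) (sp _ _ out)).
have i2 : mu7.-integrable setT (EFin \o (fun x : M7 => u x * partial j psi x)).
  apply: (integrable_bounded_box (mm _ _ mu (smooth7_cont sm') out')
    (bd _ _ _ uM HP2 out') (sp _ _ out')).
rewrite !(integral_ball_supp Kr); last 2 first.
  by move=> x Kx; rewrite out ?mulr0.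
  by move=> x Kx; rewrite out' ?mulr0.
have : (\int[mu7]_x (u' x * psi x + u x * partial j psi x)%:E = 0)%E.
  apply: (@integral_partial0 _ j (fun x => u x * psi x)
    (fun x => u' x * psi x + u x * partial j psi x)
    (`|M| * `|P1| + (`|M| * `|P2|)) rho).
  - move=> x; have [/KO Ox|Kx] := pselect (K x).
      by apply: derM; [exact: hu|exact: smooth7_der].
    rewrite out ?mulr0 ?add0r// out' ?mulr0//.
    apply: (@der_ext _ _ (cst 0)).
    by apply: filterS (near_notin cK Kx) => y Ky; rewrite out ?mulr0.
  - exact: mm (smooth7_cont sm) out.
  - by move=> x; apply: le_trans (bd _ _ _ uM HP1 out x) _; rewrite lerDl mulr_ge0.
  - move=> x; apply: le_trans (ler_normD _ _) _; apply: lerD.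
      exact: (bd _ _ _ u'M HP1 out x).
    exact: (bd _ _ _ uM HP2 out' x).
  - exact: sp out.
under eq_integral do rewrite EFinD.
rewrite integralD_EFin// => E.
have F1 := @integrable_fin_num _ _ _ mu7 setT measurableT _ i1.
have F2 := @integrable_fin_num _ _ _ mu7 setT measurableT _ i2.
move: E F1 F2.
rewrite /=; set A := (\int[mu7]_x (u' x * psi x)%:E)%E; set B := integral _ _ _.
case: A => [a| |] //; case: B => [b| |] // [ab] _ _.
by congr (_%:E); lra_ctx.
Qed.

(** A left fold, because integration by parts moves the outermost partial of the test function
    first. *)
Definition dt (s : seq 'I_7) (t : @term R) : term := foldl (fun t j => tder j t) t s.

Lemma open_ball7 r : open (ball7 r : set R7).
Proof.
have cn : continuous (@norm7 R).
  have E : @norm7 R = fun x => Num.sqrt (\sum_i co i x ^+ 2) by apply/funext => x; rewrite norm7E.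
  rewrite E => x; apply: (@continuous_comp _ _ _ (fun x : R7 => \sum_i co i x ^+ 2) Num.sqrt);
    last exact: sqrt_continuous.
  by apply: (cvg_big add_continuous) => i _; apply: cvgM; exact: continuous_co.
rewrite (_ : ball7 r = @norm7 R @^-1` `]-oo, r[%classic).
  by move/continuousP: cn; apply; exact: interval_open.
by apply/seteqP; split => x /=; rewrite /ball7 /= in_itv.
Qed.

Lemma weak_eval r (K : set R7) psi s t : compact K -> K `<=` ball7 r -> tfun K psi ->
  (\int[mu7]_(x in ball7 r) (eval t x * partials s psi x)%:E
   = ((-1) ^+ size s)%:E * \int[mu7]_(x in ball7 r) (eval (dt s t) x * psi x)%:E)%E.
Proof.
move=> cK Kr tK; elim: s t => [|j s IH] t; first by rewrite expr0 mul1e.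
have [M1 HM1] := continuous_compact_bound cK (@continuous_eval _ t).
have [M2 HM2] := continuous_compact_bound cK (@continuous_eval _ (tder j t)).
transitivity (- \int[mu7]_(x in ball7 r) (eval (tder j t) x * partials s psi x)%:E)%E; last first.
  by rewrite IH /= exprS mulN1r EFinN mulNe.
apply: (@ibp_local r j (ball7 r) K _ _ _ (Num.max M1 M2)).
- exact: open_ball7.
- by [].
- by [].
- by [].
- exact: tfun_partials.
- by move=> x _; exact: der_eval.
- by apply: measurable_funTS; exact: measurable_eval.
- by apply: measurable_funTS; exact: measurable_eval.
- by move=> x /HM1 h; rewrite le_max h.
- by move=> x /HM2 h; rewrite le_max h orbT.
Qed.

End TestFunctions.

(** * Weak derivatives of real-valued functions *)

Section RealWeak.
Context {R : realType}.
Local Notation R7 := (R7 R).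
Local Notation M7 := (M7 R).
Local Notation mu7 := (@mu7 R).
Implicit Types (r : R) (u v g : M7 -> R).

Definition rL2 r u : Prop := measurable_fun (ball7 r : set M7) u /\
  (\int[mu7]_(x in ball7 r) (u x ^+ 2)%:E < +oo)%E.

Definition rweak r (a : 'I_7 -> nat) u g : Prop := forall phi : R7 -> R, test_function r phi ->
  \int[mu7]_(x in ball7 r) (u x * Dmulti a phi x)
  = (-1) ^+ (\sum_i a i)%N * \int[mu7]_(x in ball7 r) (g x * phi x).

Lemma rL2_lin r u v (a b : R) : rL2 r u -> rL2 r v -> rL2 r (fun x => a * u x + b * v x).
Proof.
have mB := @measurable_ball7 R r.
move=> [mu iu] [mv iv]; split.
  by apply: measurable_funD; apply: measurable_funM.
have m2 (w : M7 -> R) : measurable_fun (ball7 r : set M7) w ->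
  measurable_fun (ball7 r : set M7) (fun x => (w x ^+ 2)%:E).
  by move=> mw; apply/measurable_EFinP; exact: measurable_funX.
apply: (@le_lt_trans _ _ (\int[mu7]_(x in ball7 r)
  ((2 * a ^+ 2)%:E * (u x ^+ 2)%:E + (2 * b ^+ 2)%:E * (v x ^+ 2)%:E))%E).
  apply: ge0_le_integral => //.
  - by move=> x _; rewrite lee_fin sqr_ge0.
  - by apply: m2; apply: measurable_funD; apply: measurable_funM.
  - by apply: emeasurable_funD; apply: emeasurable_funM => //; exact: m2.
  - move=> x _; rewrite -!EFinM -EFinD lee_fin -subr_ge0.
    have -> : 2 * a ^+ 2 * u x ^+ 2 + 2 * b ^+ 2 * v x ^+ 2 - (a * u x + b * v x) ^+ 2 =
      (a * u x - b * v x) ^+ 2 by ring.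
    exact: sqr_ge0.
have h (c : R) : 0 <= (2 * c ^+ 2) :> R by rewrite mulr_ge0// sqr_ge0.
rewrite ge0_integralD//; first last.
- by apply: emeasurable_funM => //; exact: m2.
- by move=> x _; rewrite -EFinM lee_fin mulr_ge0// ?sqr_ge0// h.
- by apply: emeasurable_funM => //; exact: m2.
- by move=> x _; rewrite -EFinM lee_fin mulr_ge0// ?sqr_ge0// h.
rewrite !ge0_integralZl//; do ?[exact: m2]; do ?[by rewrite lee_fin h];
  do ?[by move=> x _; rewrite lee_fin sqr_ge0].
by apply: lte_add_pinfty; apply: lte_mul_pinfty; rewrite ?lee_fin ?h.
Qed.

Lemma rL2_integrableM r u (phi : M7 -> R) M : rL2 r u -> measurable_fun (ball7 r : set M7) phi ->
  (forall x, `|phi x| <= M) -> mu7.-integrable (ball7 r) (EFin \o (fun x => u x * phi x)).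
Proof.
have mB := @measurable_ball7 R r.
move=> [mu iu] mphi phiM; apply/integrableP; split.
  by apply/measurable_EFinP; exact: measurable_funM.
apply: (@le_lt_trans _ _ (\int[mu7]_(x in ball7 r) ((M ^+ 2)%:E + (u x ^+ 2)%:E))%E).
  apply: ge0_le_integral => //.
  - apply/measurable_EFinP; apply: measurableT_comp => //; exact: measurable_funM.
  - by apply: emeasurable_funD => //; apply/measurable_EFinP; exact: measurable_funX.
  - move=> x _; rewrite -EFinD lee_fin /= normrM.
    have h := phiM x; have h0 := normr_ge0 (phi x); have h1 := normr_ge0 (u x).
    rewrite -[u x ^+ 2]real_normK ?num_real//.
    have : `|u x| * `|phi x| <= `|u x| * M by apply: ler_wpM2l.
    have : 0 <= (`|u x| - M) ^+ 2 by exact: sqr_ge0.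
    nra_ctx.
rewrite ge0_integralD//; first last.
- by apply/measurable_EFinP; exact: measurable_funX.
- by move=> x _; rewrite lee_fin sqr_ge0.
- by move=> x _; rewrite lee_fin sqr_ge0.
apply: lte_add_pinfty => //.
by rewrite integral_cst// lte_mul_pinfty// ?lee_fin ?sqr_ge0// ball7_fin.
Qed.

Lemma rL2_integrable r u : rL2 r u -> mu7.-integrable (ball7 r) (EFin \o u).
Proof.
move=> h; have := @rL2_integrableM r u (cst 1) 1 h.
rewrite (_ : EFin \o (fun x => u x * cst 1 x) = EFin \o u).
  by apply => //; rewrite ?normr1 // => x; rewrite normr1.
by apply/funext => x /=; rewrite mulr1.
Qed.

Lemma test_function_tfun r phi : test_function r phi ->
  exists K, [/\ compact K, K `<=` ball7 r & tfun K phi].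
Proof. by move=> [sm [K [cK Kr out]]]; exists K. Qed.

Lemma test_integrable r u phi s : rL2 r u -> test_function r phi ->
  mu7.-integrable (ball7 r) (EFin \o (fun x => u x * partials s phi x)).
Proof.
move=> hu /test_function_tfun [K [cK Kr tK]].
have tK' := tfun_partials s cK tK; have [M HM] := tfun_bound cK tK'.
apply: (rL2_integrableM hu _ HM); apply: measurable_funTS.
by apply: continuous_measurable7; apply: smooth7_cont; case: tK'.
Qed.

Lemma test_lin r u v (a b : R) phi s : rL2 r u -> rL2 r v -> test_function r phi ->
  \int[mu7]_(x in ball7 r) ((a * u x + b * v x) * partials s phi x) =
  a * \int[mu7]_(x in ball7 r) (u x * partials s phi x) +
  b * \int[mu7]_(x in ball7 r) (v x * partials s phi x).
Proof.
have mB := @measurable_ball7 R r.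
move=> hu hv tp.
have iu := test_integrable s hu tp; have iv := test_integrable s hv tp.
rewrite -!RintegralZl// -RintegralD//.
- by apply: eq_Rintegral => x _; ring.
- rewrite (_ : EFin \o _ = (fun x => a%:E * (u x * partials s phi x)%:E)%E); first exact: integrableZl.
  by apply/funext => x.
- rewrite (_ : EFin \o _ = (fun x => b%:E * (v x * partials s phi x)%:E)%E); first exact: integrableZl.
  by apply/funext => x.
Qed.

Lemma rweak_lin r a u v g g' (c d : R) : rL2 r u -> rL2 r v -> rL2 r g -> rL2 r g' ->
  rweak r a u g -> rweak r a v g' ->
  rweak r a (fun x => c * u x + d * v x) (fun x => c * g x + d * g' x).
Proof.
move=> hu hv hg hg' w1 w2 phi tp.
have [s [Es Ds]] := @Dmulti_partials R a.
have := w1 _ tp; have := w2 _ tp; rewrite !Ds => e2 e1.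
rewrite test_lin// e1 e2.
rewrite -[phi in RHS]/(partials [::] phi) test_lin//=; ring.
Qed.

(** The fundamental lemma of the calculus of variations on the whole ball. *)
Lemma test_zero_ae r g : rL2 r g ->
  (forall phi, test_function r phi -> \int[mu7]_(x in ball7 r) (g x * phi x) = 0) ->
  {ae mu7, forall x, ball7 r x -> g x = 0}.
Proof.
have mB := @measurable_ball7 R r.
move=> hg H; apply: (@test_functions_ae0 _ r) => //.
- exact: open_ball7.
- exact: rL2_integrable.
- move=> a b n ab; have tp := test_function_tbump n ab.
  have := test_integrable [::] hg tp => /= i; have := H _ tp.
  have := integrable_fin_num mB i.
  by rewrite /Rintegral /=; case: integral => // c _ /= ->.
Qed.

Lemma ae_imp (P Q : M7 -> Prop) : (forall x, P x -> Q x) ->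
  {ae mu7, forall x, P x} -> {ae mu7, forall x, Q x}.
Proof.
move=> h [N [mN N0 sub]]; exists N; split=> // x nQ; apply: sub => Px; apply: nQ; exact: h.
Qed.

Lemma integral_ball_ae r u v : measurable_fun (ball7 r : set M7) u ->
  measurable_fun (ball7 r : set M7) v ->
  {ae mu7, forall x, ball7 r x -> u x = v x} ->
  (\int[mu7]_(x in ball7 r) (u x)%:E = \int[mu7]_(x in ball7 r) (v x)%:E)%E.
Proof.
move=> mu mv H; apply: ae_eq_integral; [exact: measurable_ball7|exact/measurable_EFinP
  |exact/measurable_EFinP|].
exact (ae_imp (fun x h xr => f_equal EFin (h xr)) H).
Qed.

Lemma rL2_eval r t : rL2 r (eval t).
Proof.
have mB := @measurable_ball7 R r.
have mt : measurable_fun (ball7 r : set M7) (eval t : M7 -> R).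
  by apply: measurable_funTS; exact: measurable_eval.
split=> //.
have cB := @compact_cbox R (fun=> - `|r|) (fun=> `|r|).
have [M HM] := continuous_compact_bound cB (@continuous_eval _ t).
apply: (@le_lt_trans _ _ (\int[mu7]_(x in ball7 r) (M ^+ 2)%:E)%E).
  apply: ge0_le_integral => //.
  - by move=> x _; rewrite lee_fin sqr_ge0.
  - by apply/measurable_EFinP; exact: measurable_funX.
  - move=> x Bx; rewrite lee_fin -[eval t x ^+ 2]real_normK ?num_real// lerXn2r//.
    + rewrite nnegrE; apply: le_trans (normr_ge0 _) (HM x _) => i.
      rewrite -ler_norml; apply: le_trans (co_le_norm7 i x) _.
      exact: le_trans (ltW Bx) (ler_norm _).
    + apply: HM => i; rewrite -ler_norml; apply: le_trans (co_le_norm7 i x) _.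
      exact: le_trans (ltW Bx) (ler_norm _).
by rewrite integral_cst// lte_mul_pinfty// ?lee_fin ?sqr_ge0// ball7_fin.
Qed.

Lemma rweak_eval r a t : exists t', rweak r a (eval t) (eval t').
Proof.
have [s [Es Ds]] := @Dmulti_partials R a; exists (dt s t) => phi.
move=> /test_function_tfun [K [cK Kr tK]].
rewrite Ds /Rintegral (weak_eval s t cK Kr tK) -Es.
rewrite fineM//.
apply: (integrable_fin_num (@measurable_ball7 R r)).
apply: (@rL2_integrableM r (eval (dt s t)) phi _ (rL2_eval _ _)).
  by apply: measurable_funTS; apply: continuous_measurable7; apply: smooth7_cont; case: tK.
exact: (projT2 (cid (tfun_bound cK tK))).
Qed.

End RealWeak.

(** * Complex-valued Sobolev functions through real and imaginary parts *)

Section ComplexWeak.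
Context {R : realType}.
Local Notation R7 := (R7 R).
Local Notation M7 := (M7 R).
Local Notation mu7 := (@mu7 R).
Local Notation Re := (@complex.Re R).
Local Notation Im := (@complex.Im R).
Implicit Types (r : R) (u v g : M7 -> R[i]).

Definition reu u : M7 -> R := fun x => Re (u x).
Definition imu u : M7 -> R := fun x => Im (u x).

Lemma complexP (z w : R[i]) : z = w <-> Re z = Re w /\ Im z = Im w.
Proof. by split=> [->//|]; case: z; case: w => a b c d /= [-> ->]. Qed.

Lemma ReD (z w : R[i]) : Re (z + w) = Re z + Re w. Proof. by case: z; case: w. Qed.
Lemma ImD (z w : R[i]) : Im (z + w) = Im z + Im w. Proof. by case: z; case: w. Qed.
Lemma ReN (z : R[i]) : Re (- z) = - Re z. Proof. by case: z. Qed.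
Lemma ImN (z : R[i]) : Im (- z) = - Im z. Proof. by case: z. Qed.
Lemma Re_mul (z w : R[i]) : Re (z * w) = Re z * Re w - Im z * Im w.
Proof. by case: z; case: w. Qed.
Lemma Im_mul (z w : R[i]) : Im (z * w) = Re z * Im w + Im z * Re w.
Proof. by case: z; case: w. Qed.

Lemma L2P r u : L2 r u <-> rL2 r (reu u) /\ rL2 r (imu u).
Proof.
have mB := @measurable_ball7 R r.
have E : measurable_fun (ball7 r : set M7) (reu u) ->
  measurable_fun (ball7 r : set M7) (imu u) ->
  (\int[mu7]_(x in ball7 r) (sqmod (u x))%:E =
   \int[mu7]_(x in ball7 r) (reu u x ^+ 2)%:E + \int[mu7]_(x in ball7 r) (imu u x ^+ 2)%:E)%E.
  move=> mr mi; rewrite -ge0_integralD//.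
  - by move=> x _; rewrite lee_fin sqr_ge0.
  - by apply/measurable_EFinP; exact: measurable_funX.
  - by move=> x _; rewrite lee_fin sqr_ge0.
  - by apply/measurable_EFinP; exact: measurable_funX.
have p (f : M7 -> R) : (0 <= \int[mu7]_(x in ball7 r) (f x ^+ 2)%:E)%E.
  by apply: integral_ge0 => x _; rewrite lee_fin sqr_ge0.
split=> [[mr mi]|[[mr ir] [mi ii]]].
  rewrite E// => h; split; split=> //; apply: le_lt_trans h.
    by rewrite leeDl// p.
  by rewrite leeDr// p.
by split=> //; rewrite E//; exact: lte_add_pinfty.
Qed.

Lemma sign_complex n (a b : R) :
  (-1) ^+ n * Complex a b = Complex ((-1) ^+ n * a) ((-1) ^+ n * b) :> R[i].
Proof.
rewrite -[(-1) ^+ n]signr_odd -[((-1) ^+ n : R)]signr_odd; case: (odd n).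
  by rewrite !expr1 !mulN1r.
by rewrite !expr0 !mul1r.
Qed.

(** Real test functions see the real and the imaginary part separately. *)
Lemma weakP r a u g : weak_derivative r a u g <->
  [/\ L2 r g, rweak r a (reu u) (reu g) & rweak r a (imu u) (imu g)].
Proof.
have E (w : M7 -> R[i]) (phi : R7 -> R) : cintegral (ball7 r) (fun x => w x * (phi x)%:C%C) =
   Complex (\int[mu7]_(x in ball7 r) (reu w x * phi x)) (\int[mu7]_(x in ball7 r) (imu w x * phi x)).
  congr Complex; apply: eq_Rintegral => x _.
    by rewrite Re_mul /= mulr0 subr0.
  by rewrite Im_mul /= mulr0 add0r.
split=> [[Lg H]|[Lg Hr Hi]].
  by split=> // phi tp; have := H phi tp; rewrite !E sign_complex => -[].
by split=> // phi tp; rewrite !E sign_complex Hr// Hi.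
Qed.

Lemma L2_lin r u v (c d : R[i]) : L2 r u -> L2 r v -> L2 r (fun x => c * u x + d * v x).
Proof.
move=> /L2P[u1 u2] /L2P[v1 v2]; apply/L2P; split.
  have := rL2_lin 1 1 (rL2_lin (Re c) (- Im c) u1 u2) (rL2_lin (Re d) (- Im d) v1 v2).
  by congr (rL2 r _); apply/funext => x; rewrite /reu /imu ReD !Re_mul; ring.
have := rL2_lin 1 1 (rL2_lin (Re c) (Im c) u2 u1) (rL2_lin (Re d) (Im d) v2 v1).
by congr (rL2 r _); apply/funext => x; rewrite /reu /imu ImD !Im_mul; ring.
Qed.

Lemma weak_lin r a u v g g' (c d : R[i]) : L2 r u -> L2 r v ->
  weak_derivative r a u g -> weak_derivative r a v g' ->
  weak_derivative r a (fun x => c * u x + d * v x) (fun x => c * g x + d * g' x).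
Proof.
move=> Lu Lv /weakP[Lg wr wi] /weakP[Lg' wr' wi'].
have Lcg := L2_lin c d Lg Lg'.
move: Lu Lv Lg Lg' => /L2P[u1 u2] /L2P[v1 v2] /L2P[g1 g2] /L2P[h1 h2].
apply/weakP; split=> //.
  have := rweak_lin 1 1 (rL2_lin (Re c) (- Im c) u1 u2) (rL2_lin (Re d) (- Im d) v1 v2)
    (rL2_lin (Re c) (- Im c) g1 g2) (rL2_lin (Re d) (- Im d) h1 h2)
    (rweak_lin (Re c) (- Im c) u1 u2 g1 g2 wr wi) (rweak_lin (Re d) (- Im d) v1 v2 h1 h2 wr' wi').
  by congr (rweak r a _ _); apply/funext => x; rewrite /reu /imu ReD !Re_mul; ring.
have := rweak_lin 1 1 (rL2_lin (Re c) (Im c) u2 u1) (rL2_lin (Re d) (Im d) v2 v1)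
    (rL2_lin (Re c) (Im c) g2 g1) (rL2_lin (Re d) (Im d) h2 h1)
    (rweak_lin (Re c) (Im c) u2 u1 g2 g1 wi wr) (rweak_lin (Re d) (Im d) v2 v1 h2 h1 wi' wr').
by congr (rweak r a _ _); apply/funext => x; rewrite /reu /imu ImD !Im_mul; ring.
Qed.

Lemma Hk_lin k r u v (c d : R[i]) : Hk k r u -> Hk k r v -> Hk k r (fun x => c * u x + d * v x).
Proof.
move=> [Lu Hu] [Lv Hv]; split; first exact: L2_lin.
move=> a ak; have [g wg] := Hu a ak; have [g' wg'] := Hv a ak.
by exists (fun x => c * g x + d * g' x); exact: weak_lin.
Qed.

Lemma rweak_ae r a (u v g : M7 -> R) : rL2 r u -> rL2 r v ->
  {ae mu7, forall x, ball7 r x -> u x = v x} -> rweak r a u g -> rweak r a v g.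
Proof.
move=> Lu Lv uv w phi tp; rewrite -w//; congr fine.
have [s [_ Ds]] := @Dmulti_partials R a.
have := test_integrable s Lu tp; have := test_integrable s Lv tp.
move=> /(measurable_int mu7) /measurable_EFinP m1 /(measurable_int mu7) /measurable_EFinP m2.
rewrite Ds; apply: integral_ball_ae => //.
by apply: ae_imp uv => x h /h ->.
Qed.

Lemma Hk_ae k r u v : Hk k r u -> L2 r v -> {ae mu7, forall x, ball7 r x -> u x = v x} ->
  Hk k r v.
Proof.
move=> [Lu Hu] Lv uv; split=> // a /Hu [g /weakP[Lg wr wi]]; exists g.
move: Lu Lv => /L2P[u1 u2] /L2P[v1 v2].
apply/weakP; split=> //.
  by apply: rweak_ae wr => //; apply: ae_imp uv => x h /h; rewrite /reu => ->.
by apply: rweak_ae wi => //; apply: ae_imp uv => x h /h; rewrite /imu => ->.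
Qed.

(** This makes the choice of representative in [wderiv] harmless, and lets weak derivatives be
    identified with classical formulas. *)
Lemma rweak_unique r a (u v g h : M7 -> R) : rL2 r u -> rL2 r v -> rL2 r g -> rL2 r h ->
  {ae mu7, forall x, ball7 r x -> u x = v x} -> rweak r a u g -> rweak r a v h ->
  {ae mu7, forall x, ball7 r x -> g x = h x}.
Proof.
move=> Lu Lv Lg Lh uv wg wh.
have W := rweak_ae Lu Lv uv wg.
have := @test_zero_ae R r (fun x => 1 * g x + (- 1) * h x) (rL2_lin 1 (- 1) Lg Lh).
have K : forall phi, test_function r phi ->
    \int[mu7]_(x in ball7 r) ((1 * g x + (- 1) * h x) * phi x) = 0.
  move=> phi tp; have := test_lin 1 (- 1) [::] Lg Lh tp => /= ->.
  have := W _ tp; rewrite wh// => E.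
  have : ((-1) ^+ (\sum_i a i)%N : R) != 0 by rewrite signr_eq0.
  by move=> /mulfI /(_ _ _ E) ->; ring.
move=> /(_ K); apply: ae_imp => x H /H; lra_ctx.
Qed.

Lemma ae_and (P Q : M7 -> Prop) : {ae mu7, forall x, P x} -> {ae mu7, forall x, Q x} ->
  {ae mu7, forall x, P x /\ Q x}.
Proof.
move=> [N [mN N0 sN]] [M [mM M0 sM]]; exists (N `|` M); split.
- exact: measurableU.
- by rewrite null_set_setU.
- move=> x /= H; have [Px|nP] := pselect (P x); last by left; exact: sN.
  by right; apply: sM => Qx; apply: H.
Qed.

Lemma Hk_norm0 k r u : L2 r u -> {ae mu7, forall x, ball7 r x -> u x = 0} ->
  Hk_norm k r u = 0.
Proof.
move=> Lu u0; rewrite /Hk_norm big1 ?sqrtr0// => a _.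
set g := wderiv r _ u.
have g0 : L2 r g /\ {ae mu7, forall x, ball7 r x -> g x = 0}.
  (* Either [g] is a weak derivative of a null function, hence null, or no weak derivative exists
     and [g] is the default value 0. *)
  rewrite /g /wderiv; case: xgetP => [h -> wh|_]; last first.
    split; last by apply: aeW.
    by apply/L2P; split; split;
      [exact: measurable_cst|under eq_integral do rewrite expr0n; rewrite integral0|
       exact: measurable_cst|under eq_integral do rewrite expr0n; rewrite integral0].
  have /weakP[Lh wr wi] := wh; split=> //.
  move: (Lu) (Lh) => /L2P[u1 u2] /L2P[h1 h2].
  have z1 : rL2 r (cst 0 : M7 -> R).
    by split; [exact: measurable_cst|under eq_integral do rewrite expr0n; rewrite integral0].
  have zw b : rweak r b (cst 0 : M7 -> R) (cst 0).
    move=> phi _; rewrite /Rintegral.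
    by do 2 (under eq_integral do rewrite mul0r; rewrite integral0); rewrite /= mulr0.
  have a1 := rweak_unique u1 z1 h1 z1 (ae_imp (fun x H Bx => congr1 Re (H Bx)) u0) wr (zw _).
  have a2 := rweak_unique u2 z1 h2 z1 (ae_imp (fun x H Bx => congr1 Im (H Bx)) u0) wi (zw _).
  apply: ae_imp (ae_and a1 a2) => x [H1 H2] Bx.
  by apply/complexP; split; [exact: H1|exact: H2].
case: g0 => /L2P[[g1 _] [g2 _]] g0.
rewrite /Rintegral (@integral_ball_ae _ r _ (cst 0)) ?integral0//.
- by apply: measurable_funD; apply: measurable_funX.
- by apply: ae_imp g0 => x H /H ->; rewrite /sqmod /= expr0n addr0.
Qed.

Lemma measure_is_set0 : measure_is mu7 ([set 0] : set M7) 0.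
Proof.
have E : measure_is (@lebesgue_measure R) [set 0] 0.
  by split; [exact: measurable_set1|exact: lebesgue_measure_set1].
have H := measure_is_prod (measure_is_prod (measure_is_prod (measure_is_prod
  (measure_is_prod (measure_is_prod E E) E) E) E) E) E.
rewrite !mulr0 in H.
have S : [set 0] = (((((([set (0 : R)] `*` [set (0 : R)]) `*` [set (0 : R)]) `*` [set (0 : R)])
    `*` [set (0 : R)]) `*` [set (0 : R)]) `*` [set (0 : R)]) :> set M7.
  by apply/seteqP; split=> [x ->//|[[[[[[? ?] ?] ?] ?] ?] ?] /= [[[[[[-> ->] ->] ->] ->] ->] ->]].
rewrite /Defs.mu7 S.
exact H.
Qed.

Lemma mu7_set0 : mu7 [set 0] = 0%E.
Proof. by case: measure_is_set0. Qed.

Lemma measurable_set07 : measurable ([set 0] : set M7).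
Proof. by case: measure_is_set0. Qed.

Lemma ae_off0 (P : M7 -> Prop) : (forall x : R7, x != 0 -> P x) -> {ae mu7, forall x, P x}.
Proof.
move=> H; exists [set 0]; split; [exact: measurable_set07|exact: mu7_set0|].
by move=> x nP /=; apply/eqP/negPn/negP => x0; apply: nP; exact: H.
Qed.

Lemma L2_off0 r u v : L2 r u -> (forall x : R7, ball7 r x -> x != 0 -> u x = v x) -> L2 r v.
Proof.
have mB := @measurable_ball7 R r.
have key (f g : M7 -> R) : (forall x : R7, ball7 r x -> x != 0 -> f x = g x) ->
    rL2 r f -> rL2 r g.
  move=> fg [mf i2].
  have mg : measurable_fun (ball7 r : set M7) g.
    have m0 := measurable_set07.
    rewrite (_ : ball7 r = (ball7 r `&` [set 0]) `|` (ball7 r `\` [set 0])); last by rewrite setUIDK.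
    apply/measurable_funU; [exact: measurableI|exact: measurableD|split].
      apply: (@eq_measurable_fun _ _ _ _ _ (cst (g 0))) => [x|]; last exact: measurable_cst.
      by rewrite inE => -[_ ->].
    apply: (@eq_measurable_fun _ _ _ _ _ f) => [x|].
      by rewrite inE => -[Bx /eqP x0]; exact: fg.
    by apply: measurable_funS mf => // x [].
  split=> //; move: i2; congr (_ < _)%E; apply: integral_ball_ae.
  - exact: measurable_funX.
  - exact: measurable_funX.
  - by apply: ae_off0 => x x0 Bx; rewrite fg.
move=> /L2P[h1 h2] uv; apply/L2P; split; [apply: key h1|apply: key h2] => x Bx x0.
  by rewrite /reu uv.
by rewrite /imu uv.
Qed.

(** The origin is a null set. There the formulas for the coefficients divide by 0, so equalities
    between [Ltilde] and explicit functions hold only away from it. *)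
Lemma Hk_off0 k r u v : Hk k r u -> (forall x : R7, ball7 r x -> x != 0 -> u x = v x) ->
  Hk k r v.
Proof.
move=> Hu uv; apply: (Hk_ae Hu); first by apply: L2_off0 uv; case: Hu.
by apply: ae_off0 => x x0 Bx; exact: uv.
Qed.

Lemma Hk_eval k r t (c : R[i]) : Hk k r (fun x => c * (eval t x)%:C%C).
Proof.
have Z : rL2 r (cst 0 : M7 -> R).
  by split; [exact: measurable_cst|under eq_integral do rewrite expr0n; rewrite integral0].
have L (t0 : term) : L2 r (fun x => (eval t0 x)%:C%C).
  by apply/L2P; split; [exact: rL2_eval|exact: Z].
have H : Hk k r (fun x => (eval t x)%:C%C).
  split=> // a _; have [t' wt] := rweak_eval r a t; exists (fun x => (eval t' x)%:C%C).
  apply/weakP; split=> // phi _; rewrite /Rintegral.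
  by do 2 (under eq_integral do rewrite mul0r; rewrite integral0); rewrite /= mulr0.
have := Hk_lin c 0 H H; congr (Hk k r _).
by apply/funext => x; rewrite mul0r addr0.
Qed.

Lemma ae_box_witness (a b : 'I_7 -> R) (P : M7 -> Prop) : (forall i, a i < b i) ->
  {ae mu7, forall x, P x} -> exists2 x, box a b x & P x.
Proof.
move=> ab [N [mN N0 sN]]; apply: contrapT => H.
have : (mu7 (box a b) <= mu7 N)%E.
  apply: le_measure; rewrite ?inE//; first exact: measurable_box.
  by move=> x Bx; apply: sN => Px; apply: H; exists x.
rewrite N0 mu7_box; last by move=> i; exact: ltW.
by rewrite lee_fin leNgt prodr_gt0// => i _; rewrite subr_gt0.
Qed.

(** Each squared L2 norm of a derivative is one summand under the square root of [Hk_norm]. The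
    real-valued integral can be read back as an extended one because membership in [Hk] makes it
    finite. *)
Lemma Hk_norm_cvg k r (w : nat -> M7 -> R[i]) (a : 'I_7 -> nat) :
  (forall n, Hk k r (w n)) -> Hk_norm k r (w n) @[n --> \oo] --> (0 : R) ->
  (\sum_i a i <= k)%N ->
  exists g : nat -> M7 -> R[i], (forall n, weak_derivative r a (w n) (g n)) /\
    forall e, 0 < e -> \forall n \near \oo,
      (\int[mu7]_(x in ball7 r) (sqmod (g n x))%:E <= e%:E)%E.
Proof.
move=> Hw cvg0 ak; exists (fun n => wderiv r a (w n)).
have wd n b : (\sum_i b i <= k)%N -> weak_derivative r b (w n) (wderiv r b (w n)).
  by move=> bk; have [_ /(_ b bk)[g wg]] := Hw n; exact: (@xgetPex _ _ [set g | weak_derivative r b (w n) g] (ex_intro _ g wg)).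
split; first by move=> n; exact: wd.
move=> e e0.
have ak' i : (a i < k.+1)%N.
  by rewrite ltnS; apply: leq_trans ak; rewrite (bigD1 i)//= leq_addr.
(* The multi-index [a] as a member of the finite index set over which [Hk_norm] sums. *)
pose A : {ffun 'I_7 -> 'I_k.+1} := [ffun i => Ordinal (ak' i)].
have AE : (fun i => A i : nat) = a by apply/funext => i; rewrite ffunE.
have se : 0 < Num.sqrt e by rewrite sqrtr_gt0.
move/cvgrPdist_lt : cvg0 => /(_ _ se); apply: filterS => n.
rewrite sub0r normrN ger0_norm ?sqrtr_ge0// /Hk_norm ltr_sqrt// => /ltW H.
have Lg : L2 r (wderiv r a (w n)) by have [] := wd n a ak.
have fin : ((\int[mu7]_(x in ball7 r) (sqmod (wderiv r a (w n) x))%:E)%E \is a fin_num).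
  case: Lg => _ _ h; rewrite ge0_fin_numE//.
  by apply: integral_ge0 => x _; rewrite lee_fin addr_ge0 ?sqr_ge0.
rewrite -(fineK fin) lee_fin; apply: le_trans H.
have P : (\sum_(i < 7) A i <= k)%N.
  by rewrite (eq_bigr a)// => i _; rewrite ffunE.
rewrite (bigD1 A)//= AE lerDl; apply: sumr_ge0 => B _; apply: Rintegral_ge0 => x _.
by rewrite addr_ge0 ?sqr_ge0.
Qed.

End ComplexWeak.

(** * The coefficients in terms of sqrt (2 + y^2) *)

Section OneSided.
Context {R : realType}.

Lemma near_withinP (r x : R) (P : R -> Prop) :
  (\forall y \near within [set` `[0, r]] x^', P y) <->
  exists2 e, 0 < e & forall y, 0 <= y <= r -> y != x -> `|y - x| < e -> P y.
Proof.
split.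
  move=> /nbhs_ballP [e /= e0 He]; exists e => // y yr yx yxe.
  have := He y; rewrite /= /ball /= distrC => /(_ yxe yx); apply.
  by rewrite in_itv.
move=> [e e0 He]; apply/nbhs_ballP; exists e => //= y.
rewrite /ball /= => yx ynx /=; rewrite in_itv /= => yr.
by apply: He => //; rewrite distrC.
Qed.

(** Properness, at the endpoints too, is what makes the limit in [deriv_in] unique. *)
Lemma within_proper (r x : R) : 0 < r -> 0 <= x <= r ->
  ProperFilter (within [set` `[0, r]] x^').
Proof.
move=> r0 /andP[x0 xr].
have FF : Filter (within [set` `[0, r]] x^') by exact: within_filter.
split=> //.
move=> /(near_withinP r x (fun=> False)) [e e0 He].
have [xlr|rlx] := ltP x r.
  pose d := Num.min (e / 2) (r - x).
  have d0 : 0 < d by rewrite lt_min divr_gt0//= subr_gt0.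
  have d1 : d <= e / 2 by rewrite ge_min lexx.
  have d2 : d <= r - x by rewrite ge_min lexx orbT.
  apply: (He (x + d)); first by apply/andP; split; lra_ctx.
    by rewrite -subr_eq0 addrAC subrr add0r gt_eqF.
  by rewrite addrAC subrr add0r gtr0_norm//; lra_ctx.
pose d := Num.min (e / 2) r.
have d0 : 0 < d by rewrite lt_min divr_gt0.
have d1 : d <= e / 2 by rewrite ge_min lexx.
have d2 : d <= r by rewrite ge_min lexx orbT.
apply: (He (x - d)); first by apply/andP; split; lra_ctx.
  by rewrite -subr_eq0 addrAC subrr add0r oppr_eq0 gt_eqF.
by rewrite addrAC subrr add0r normrN gtr0_norm//; lra_ctx.
Qed.

Lemma deriv_in_cvg (r x d : R) (g G : R -> R) : 0 <= x <= r ->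
  (forall y, 0 <= y <= r -> g y = G y) -> is_derive x 1 G d ->
  quot g x y @[y --> within [set` `[0, r]] x^'] --> d.
Proof.
move=> xr gG [h1 h2].
have FF : Filter (within [set` `[0, r]] x^') by exact: within_filter.
have := cvg_toP h1 h2 => /cvgrPdist_lt H.
apply/cvgrPdist_lt => e /H /nbhs_ballP [a /= a0 Ha].
apply/near_withinP; exists a => // y yr yx yxa.
have := Ha (y - x); rewrite /ball /= sub0r normrN => /(_ yxa).
rewrite subr_eq0 => /(_ yx) /=; rewrite [(y - x) *: (1 : R)]mulr1 subrK.
by rewrite /quot !gG// [_ *: _]mulrC.
Qed.

Lemma deriv_inP (r x d : R) (g G : R -> R) : 0 < r -> 0 <= x <= r ->
  (forall y, 0 <= y <= r -> g y = G y) -> is_derive x 1 G d ->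
  derivable_in r g x /\ deriv_in r g x = d.
Proof.
move=> r0 xr gG hG; have H := deriv_in_cvg xr gG hG.
have PF := within_proper r0 xr.
split; first by apply/cvg_ex; exists d.
exact/cvg_lim.
Qed.

Lemma cderivn_inP (r : R) (f : R -> R[i]) (G1 G2 : nat -> R -> R) : 0 < r ->
  (forall y, 0 <= y <= r -> f y = Complex (G1 0%N y) (G2 0%N y)) ->
  (forall n (y : R), is_derive y (1 : R) (G1 n) (G1 n.+1 y)) ->
  (forall n (y : R), is_derive y (1 : R) (G2 n) (G2 n.+1 y)) ->
  forall n y, 0 <= y <= r -> cderivn_in r n f y = Complex (G1 n y) (G2 n y).
Proof.
move=> r0 f0 h1 h2; elim=> [|n IH] y yr; first exact: f0.
rewrite /cderivn_in iterS -/(cderivn_in r n f) /cderiv_in.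
have E1 z : 0 <= z <= r -> complex.Re (cderivn_in r n f z) = G1 n z by move=> /IH ->.
have E2 z : 0 <= z <= r -> complex.Im (cderivn_in r n f z) = G2 n z by move=> /IH ->.
have [_ ->] := deriv_inP r0 yr E1 (h1 n y).
by have [_ ->] := deriv_inP r0 yr E2 (h2 n y).
Qed.

Lemma smooth_inP (r : R) (f : R -> R[i]) (G1 G2 : nat -> R -> R) : 0 < r ->
  (forall y, 0 <= y <= r -> f y = Complex (G1 0%N y) (G2 0%N y)) ->
  (forall n (y : R), is_derive y (1 : R) (G1 n) (G1 n.+1 y)) ->
  (forall n (y : R), is_derive y (1 : R) (G2 n) (G2 n.+1 y)) -> smooth_in r f.
Proof.
move=> r0 f0 h1 h2 n y yr; have IH := cderivn_inP r0 f0 h1 h2 n; split.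
  have E1 z : 0 <= z <= r -> complex.Re (cderivn_in r n f z) = G1 n z by move=> /IH ->.
  by have [] := deriv_inP r0 yr E1 (h1 n y).
have E2 z : 0 <= z <= r -> complex.Im (cderivn_in r n f z) = G2 n z by move=> /IH ->.
by have [] := deriv_inP r0 yr E2 (h2 n y).
Qed.

End OneSided.

(** * The coefficients as rational functions of y and s = sqrt (2 + y^2), with y^2 = s^2 - 2 *)

Section Coefficients.
Context {R : realType}.

Definition sq (y : R) : R := Num.sqrt (2 + y ^+ 2).

Lemma sq_gt1 y : 1 < sq y.
Proof. rewrite -(@sqrtr1 R) ltr_sqrt; have := sqr_ge0 y; lra_ctx. Qed.

Lemma sq_sq y : sq y ^+ 2 = 2 + y ^+ 2.
Proof. by rewrite sqr_sqrtr//; have := sqr_ge0 y; lra_ctx. Qed.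

Lemma sq_gt0 y : 0 < sq y.
Proof. by have := sq_gt1 y; lra_ctx. Qed.

Lemma der_sq (y : R) : is_derive y (1 : R) sq (y / sq y).
Proof.
have h0 : 0 < 2 + y ^+ 2 by have := sqr_ge0 y; lra_ctx.
have := @der_comp _ _ y 1 Num.sqrt (fun y => 2 + y ^+ 2) _ _ (is_derive1_sqrt h0)
  (derD (der_cst y 1 2) (derX 2 (der_id y))).
apply: der_eq; rewrite -/(sq y) /=.
by have := lt0r_neq0 (sq_gt0 y) => s0; field.
Qed.

Lemma hE y : h y = sq y - 2. Proof. by []. Qed.

Lemma h1E y : h1 y = y / sq y.
Proof.
rewrite /h1 derive1E; have [_ ->] // : is_derive y 1 h (y / sq y).
by have := derB (der_sq y) (der_cst y 1 2); apply: der_eq; rewrite subr0.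
Qed.

Lemma h2E y : h2 y = 2 / sq y ^+ 3.
Proof.
have s0 := lt0r_neq0 (sq_gt0 y).
rewrite /h2 derive1E; have [_ ->] // : is_derive y 1 h1 (2 / sq y ^+ 3).
rewrite (_ : h1 = fun y => y * (sq y)^-1); last by apply/funext => z; rewrite h1E.
have := derM (der_id y) (derV s0 (der_sq y)); apply: der_eq.
have E := sq_sq y; rewrite (_ : 2 = sq y ^+ 2 - y ^+ 2); last by rewrite E; ring.
by field.
Qed.

Lemma one_sub_h1 y : 1 - h1 y ^+ 2 = 2 / sq y ^+ 2.
Proof.
have s0 := lt0r_neq0 (sq_gt0 y); have E := sq_sq y.
by rewrite h1E (_ : 2 = sq y ^+ 2 - y ^+ 2); [field|rewrite E; ring].
Qed.

Lemma yh1_sub_h y : y * h1 y - h y = 2 * (sq y - 1) / sq y.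
Proof.
have s0 := lt0r_neq0 (sq_gt0 y); have E := sq_sq y.
rewrite h1E hE (_ : y * (y / sq y) = y ^+ 2 / sq y); last by ring.
by rewrite (_ : y ^+ 2 = sq y ^+ 2 - 2); [field|rewrite E; ring].
Qed.

Lemma y2h2 y : y ^+ 2 - h y ^+ 2 = 4 * sq y - 6.
Proof.
by rewrite hE (_ : y ^+ 2 = sq y ^+ 2 - 2); [ring|rewrite sq_sq; ring].
Qed.

Lemma c12E y : c12 y = (3 - 2 * sq y) * sq y ^+ 2.
Proof.
have s0 := lt0r_neq0 (sq_gt0 y).
rewrite /c12 one_sub_h1 (_ : h y ^+ 2 - y ^+ 2 = - (4 * sq y - 6)); last by rewrite -y2h2; ring.
by field.
Qed.

Lemma c21E y : c21 y = - 2 * y * sq y.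
Proof.
have s0 := lt0r_neq0 (sq_gt0 y).
by rewrite /c21 one_sub_h1 hE h1E; field.
Qed.

Lemma sqm1_neq0 y : sq y - 1 != 0.
Proof. by apply: lt0r_neq0; have := sq_gt1 y; lra_ctx. Qed.

Lemma c11E y : y != 0 -> c11 y =
  (3 - 2 * sq y) * (6 * sq y ^+ 2 / y - y / (sq y - 1)) + 4 * y * sq y.
Proof.
move=> y0; have s0 := lt0r_neq0 (sq_gt0 y); have s1 := sqm1_neq0 y; have E := sq_sq y.
have -> : c11 y = (- 6 * sq y * (sq y - 1) * (sq y - 2) - 2 * sq y * y ^+ 2
    - y ^+ 2 * (3 - 2 * sq y) / (sq y - 1)) / y.
  by rewrite /c11 y2h2 yh1_sub_h one_sub_h1 hE h1E h2E; field; rewrite s0 s1 y0.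
have -> : (3 - 2 * sq y) * (6 * sq y ^+ 2 / y - y / (sq y - 1)) + 4 * y * sq y =
  ((3 - 2 * sq y) * (6 * sq y ^+ 2 - y ^+ 2 / (sq y - 1)) + 4 * y ^+ 2 * sq y) / y.
  by field; rewrite y0 s1.
rewrite (_ : y ^+ 2 = sq y ^+ 2 - 2); last by rewrite E; ring.
by field; rewrite y0 s1.
Qed.

Lemma c20E y : y != 0 -> c20 y = 7 - 6 * sq y - 1 / (sq y - 1).
Proof.
move=> y0; have s0 := lt0r_neq0 (sq_gt0 y); have s1 := sqm1_neq0 y.
by rewrite /c20 y2h2 yh1_sub_h one_sub_h1 h1E h2E; field; rewrite s0 s1 y0.
Qed.

Definition dn (y : R) : R := 5 * (sq y ^+ 2 - 2) + 3 * (sq y - 2) ^+ 2.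

Lemma dn_gt0 y : 0 < dn y.
Proof.
have h1 := sq_gt1 y; have h2 := sq_sq y; have h3 := sqr_ge0 y.
rewrite /dn; have [->|s2] := eqVneq (sq y) 2; first by lra_ctx.
have : 0 < (sq y - 2) ^+ 2 by rewrite exprn_even_gt0//= subr_eq0.
lra_ctx.
Qed.

Lemma VE y : V y = 96 * (sq y - 1) ^+ 2 * (21 * (sq y - 2) ^+ 2 - 5 * (sq y ^+ 2 - 2)) / dn y ^+ 2.
Proof.
have s0 := lt0r_neq0 (sq_gt0 y); have d0 := lt0r_neq0 (dn_gt0 y).
rewrite /V one_sub_h1 yh1_sub_h hE (_ : y ^+ 2 = sq y ^+ 2 - 2); last by rewrite sq_sq; ring.
by rewrite -/(dn y); field; rewrite s0 d0.
Qed.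

End Coefficients.

(** * The two eigenfunctions *)

Section Kernel.
Context {R : realType}.
Local Notation R7 := (R7 R).
Local Notation M7 := (M7 R).
Local Notation mu7 := (@mu7 R).
Local Notation Re := (@complex.Re R).
Local Notation Im := (@complex.Im R).

Definition i6 : 'I_7 := inord 6.
Definition ray (y : R) : R7 := y *: e7 i6.

Lemma co_ray i y : co i (ray y) = y * (i == i6)%:R.
Proof. by rewrite coZ co_e7. Qed.

Lemma sumsq_ray y : \sum_i co i (ray y) ^+ 2 = y ^+ 2.
Proof.
rewrite (bigD1 i6)//= co_ray eqxx mulr1 big1 ?addr0// => i /negPf h.
by rewrite co_ray h mulr0 expr0n.
Qed.

Lemma sx_ray y : sx (ray y) = sq y.
Proof. by rewrite /sx sumsq_ray. Qed.

Lemma sx_norm7 x : sx x = sq (norm7 x) :> R.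
Proof. by rewrite /sx /sq norm7_sq. Qed.

Lemma dx_sq x y : sx x = sq y -> dx x = dn y :> R.
Proof. by rewrite /dx /dn => ->. Qed.

Lemma der_ray t (y : R) : is_derive y (1 : R) (fun y => eval t (ray y)) (eval (tder i6 t) (ray y)).
Proof.
apply/is_derive_lineP; have /is_derive_lineP := der_eval t i6 (ray y).
rewrite (_ : (fun t0 : R => eval t (t0 *: e7 i6 + ray y)) =
  (fun t0 : R => eval t (ray (t0 *: (1 : R) + y))))//.
by apply/funext => t0; rewrite /ray [t0 *: (1 : R)]mulr1 scalerDl.
Qed.

Definition tray (t : @term R) (n : nat) (y : R) : R := eval (iter n (tder i6) t) (ray y).

Lemma der_tray t n (y : R) : is_derive y (1 : R) (tray t n) (tray t n.+1 y).
Proof. exact: der_ray. Qed.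

(** Each differentiation of f(-y) = f(y) flips the parity; hence the odd derivatives vanish at 0, as
    [Ceven] demands. *)
Lemma tray_parity t n y : (forall y, tray t 0 (- y) = tray t 0 y) ->
  tray t n (- y) = (-1) ^+ n * tray t n y.
Proof.
move=> even; elim: n y => [|n IH] y; first by rewrite mul1r.
have h1 : is_derive y (1 : R) (fun z => tray t n (- z)) (- tray t n.+1 (- y)).
  have := @der_comp _ _ y 1 (tray t n) (fun z => - z) _ _ (der_tray t n (- y)) (derN (der_id y)).
  by apply: der_eq; rewrite mulrN1.
have h2 : is_derive y (1 : R) (fun z => tray t n (- z)) ((-1) ^+ n * tray t n.+1 y).
  rewrite (_ : (fun z => _) = (fun z => (-1) ^+ n * tray t n z)); last by apply/funext => z; exact: IH.
  have := derM (der_cst y 1 ((-1) ^+ n)) (der_tray t n y).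
  by apply: der_eq; rewrite mul0r add0r.
case: h1 => _ e1; case: h2 => _; rewrite e1 exprS mulN1r => e2.
by rewrite mulNr -e2 opprK.
Qed.

Definition star (p : R -> R) (m : R) : pairfun R :=
  (fun y => (p y)%:C%C, fun y => m%:C%C * (p y)%:C%C).

Section Star.
Variables (t : @term R) (p : R -> R) (r lam : R).
Hypothesis r0 : 0 < r.
Hypothesis tp : forall x, eval t x = p (norm7 x).
Hypothesis trp : forall y, tray t 0 y = p y.
Hypothesis even : forall y, p (- y) = p y.
Hypothesis ode : forall y, 0 < y < r ->
  c11 y * tray t 1 y + c12 y * tray t 2 y + c20 y * ((lam + 2) * p y)
  + c21 y * ((lam + 2) * tray t 1 y) - 2 * ((lam + 2) * p y) + V y * p y
  = lam * ((lam + 2) * p y).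

Let F (c : R[i]) := cscale c (star p (lam + 2)).

Let F1E c y : (F c).1 y = Complex (Re c * p y) (Im c * p y).
Proof. by case: c => a b; rewrite /F /cscale /star /=; apply/complexP; rewrite -/Re -/Im; split=> /=; ring. Qed.

Let F2E c y : (F c).2 y = Complex (Re c * (lam + 2) * p y) (Im c * (lam + 2) * p y).
Proof. by case: c => a b; rewrite /F /cscale /star /=; apply/complexP; split=> /=; ring. Qed.

Let der_scale (c : R) n (y : R) :
  is_derive y (1 : R) (fun z => c * tray t n z) (c * tray t n.+1 y).
Proof.
have := derM (der_cst y 1 c) (der_tray t n y).
by apply: der_eq; rewrite mul0r add0r.
Qed.

Let Ceven_scale (f : R -> R[i]) (a b : R) : (forall y, f y = Complex (a * p y) (b * p y)) ->
  Ceven r f /\ forall n y, 0 <= y <= r -> cderivn_in r n f y = Complex (a * tray t n y) (b * tray t n y).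
Proof.
move=> fE.
have f0 y : 0 <= y <= r -> f y = Complex (a * tray t 0 y) (b * tray t 0 y) by rewrite fE trp.
have H := cderivn_inP r0 f0 (der_scale a) (der_scale b).
have S := smooth_inP r0 f0 (der_scale a) (der_scale b).
split=> //; split=> // j; rewrite H ?lexx ?ltW//.
have : tray t (2 * j + 1) 0 = - tray t (2 * j + 1) 0.
  rewrite -[in LHS]oppr0 tray_parity; last by move=> y; rewrite !trp.
  by rewrite exprD exprM sqrrN expr1n expr1n mul1r expr1 mulN1r.
move=> /eqP; rewrite -addr_eq0 -mulr2n mulrn_eq0 /= => /eqP ->.
by rewrite !mulr0.
Qed.

Lemma star_dom c : dom_Ltilde r (F c).
Proof. by split; [case: (Ceven_scale (F1E c))|case: (Ceven_scale (F2E c))]. Qed.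

Lemma star_HR c : HR r (F c).
Proof.
split.
  have := Hk_eval 6 r t c; congr (Hk 6 r _).
  by apply/funext => x; rewrite /lift7 /= tp.
have := Hk_eval 5 r t (c * (lam + 2)%:C%C); congr (Hk 5 r _).
by apply/funext => x; rewrite /lift7 /= tp mulrA.
Qed.

Lemma star_Ltilde c y : 0 < y < r ->
  (Ltilde r (F c)).1 y = lam%:C%C * (F c).1 y /\ (Ltilde r (F c)).2 y = lam%:C%C * (F c).2 y.
Proof.
move=> yr; have yr' : 0 <= y <= r by case/andP: yr => /ltW -> /ltW ->.
have [_ D1] := Ceven_scale (F1E c); have [_ D2] := Ceven_scale (F2E c).
have two : (2 : R[i]) = (2 : R)%:C%C by rewrite rmorph_nat.
split.
  rewrite [LHS]/= -/(F c) two; apply/complexP.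
  rewrite -[c * (p y)%:C%C]/((F c).1 y) -[c * (_ * (p y)%:C%C)]/((F c).2 y) F1E F2E.
  by split=> /=; ring.
rewrite /Ltilde /= -[cderiv_in r _]/(cderivn_in r 1 (F c).1).
rewrite -[cderiv_in r (fun y => c * (_ * _))]/(cderivn_in r 1 (F c).2).
rewrite -[cderiv_in r (cderivn_in _ _ _)]/(cderivn_in r 2 (F c).1) !D1// !D2//.
rewrite -[c * (p y)%:C%C]/((F c).1 y) -[c * (_ * (p y)%:C%C)]/((F c).2 y) F1E F2E two.
have O := ode yr.
apply/complexP; split=> /=.
  transitivity (Re c * (lam * ((lam + 2) * p y))); last by ring.
  by rewrite -O; ring.
transitivity (Im c * (lam * ((lam + 2) * p y))); last by ring.
by rewrite -O; ring.
Qed.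

Lemma norm7_itv (x : R7) : ball7 r x -> x != 0 -> 0 < norm7 x < r.
Proof. by move=> xr x0; rewrite xr andbT lt_neqAle eq_sym norm7_eq0 x0 norm7_ge0. Qed.

Lemma HR_scale c f : HR r f -> HR r (cscale c f).
Proof.
have H k (u : R -> R[i]) : Hrad k r u -> Hrad k r (fun y => c * u y).
  move=> Hu; have := Hk_lin c 0 Hu Hu; congr (Hk k r _).
  by apply/funext => x; rewrite mul0r addr0.
by move=> [h1 h2]; split; exact: H.
Qed.

Lemma HR_sub f g : HR r f -> HR r g -> HR r (f - g).
Proof.
have H k (u v : R -> R[i]) : Hrad k r u -> Hrad k r v -> Hrad k r (u - v).
  move=> Hu Hv; have := Hk_lin 1 (-1) Hu Hv; congr (Hk k r _).
  by apply/funext => x; rewrite mul1r mulN1r.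
by move=> [h1 h2] [g1 g2]; split; exact: H.
Qed.

Lemma HR_norm_eq0 f g : HR r f -> HR r g -> HR_eq r f g -> HR_norm r (f - g) = 0.
Proof.
move=> Hf Hg [e1 e2]; have [h1 h2] := HR_sub Hf Hg.
rewrite /HR_norm /Hrad_norm.
rewrite (Hk_norm0 _ (proj1 h1)); last first.
  by apply: ae_imp e1 => x H /H; rewrite /lift7 /= => E; apply/eqP; rewrite subr_eq0 E.
rewrite (Hk_norm0 _ (proj1 h2)); last first.
  by apply: ae_imp e2 => x H /H; rewrite /lift7 /= => E; apply/eqP; rewrite subr_eq0 E.
by rewrite expr0n addr0 sqrtr0.
Qed.

(** The explicit function lies in the domain of [Ltilde] itself, so the constant sequence witnesses
    the closure for every representative [g] of its class. *)
Lemma star_ker c g : HR r g -> HR_eq r g (F c) -> ker_L r lam%:C%C g.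
Proof.
move=> Hg [e1 e2]; exists (fun=> F c); split.
- by move=> n; exact: star_dom.
- split=> //; first by move=> n; exact: star_HR.
  rewrite (_ : (fun n => _) = cst 0); first exact: cvg_cst.
  apply/funext => n; apply: HR_norm_eq0 => //; first exact: star_HR.
  by split; [apply: ae_imp e1|apply: ae_imp e2] => x H /H ->.
- have HL : HR r (Ltilde r (F c)).
    have [h1 h2] := HR_scale lam%:C%C (star_HR c); split.
      by apply: (Hk_off0 h1) => x Bx x0; have [E _] := star_Ltilde c (norm7_itv Bx x0).
    by apply: (Hk_off0 h2) => x Bx x0; have [_ E] := star_Ltilde c (norm7_itv Bx x0).
  have Hg' := HR_scale lam%:C%C Hg.
  split=> //.
  rewrite (_ : (fun n => _) = cst 0); first exact: cvg_cst.
  apply/funext => n; apply: HR_norm_eq0 => //.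
  have off (P : M7 -> Prop) := @ae_off0 R P.
  have o1 : {ae mu7, forall x, ball7 r x -> lift7 (Ltilde r (F c)).1 x = lam%:C%C * (F c).1 (norm7 x)}.
    by apply: off => x x0 Bx; case: (star_Ltilde c (norm7_itv Bx x0)).
  have o2 : {ae mu7, forall x, ball7 r x -> lift7 (Ltilde r (F c)).2 x = lam%:C%C * (F c).2 (norm7 x)}.
    by apply: off => x x0 Bx; case: (star_Ltilde c (norm7_itv Bx x0)).
  split.
    by apply: ae_imp (ae_and o1 e1) => x [H1 H2] Bx; rewrite H1//; have := H2 Bx; rewrite /lift7 /= => ->.
  by apply: ae_imp (ae_and o2 e2) => x [H1 H2] Bx; rewrite H1//; have := H2 Bx; rewrite /lift7 /= => ->.
Qed.

Lemma star_nonzero : (forall d, 0 < d -> exists2 e, 0 < e <= d & forall y, 0 < y < e -> p y != 0) ->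
  ~ HR_eq r (F 1) 0.
Proof.
move=> pn [e1 _].
have [e /andP[e0 er] He] := pn r r0.
(* The cube (0, e/7)^7 has positive measure and lies in the ball of radius e, since 7 (e/7)^2 <
   e^2. *)
have e70 : 0 < e / 7 by rewrite divr_gt0.
have [x Bx Hx] := @ae_box_witness R (fun=> 0) (fun=> e / 7) _ (fun=> e70) e1.
have x1 : 0 < norm7 x.
  rewrite lt_neqAle norm7_ge0 andbT eq_sym norm7_eq0; apply/eqP => x0.
  have := Bx i6; rewrite x0 (_ : co i6 (0 : R7) = 0) ?ltxx//.
  by rewrite /co /= inordK.
have x2 : norm7 x < e.
  rewrite -[e]gtr0_norm// -sqrtr_sqr norm7E ltr_sqrt ?exprn_gt0//.
  apply: (@le_lt_trans _ _ (\sum_(i < 7) (e / 7) ^+ 2)).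
    apply: ler_sum => i _; have /andP[h1 h2] := Bx i.
    by rewrite lerXn2r ?nnegrE ?ltW.
  rewrite sumr_const card_ord -mulr_natl exprMn.
  have : 0 < e ^+ 2 by rewrite exprn_gt0.
  lra.
have := Hx (lt_le_trans x2 er); rewrite /lift7 /= mul1r => -[/eqP].
by apply/negP; apply: He; rewrite x1.
Qed.

End Star.

Definition t4 : @term R := TM TID (TM TID TID).
Definition p4 (y : R) : R := 1 / (5 * y ^+ 2 + 3 * h y ^+ 2) ^+ 3.

Definition th : @term R := TD (TS) (TC (- 2)).
Definition t1 : @term R :=
  TM (TM (TD (TM (TC 7) (TM th th)) (TM (TC (- 15)) (TD (TM (TS) (TS)) (TC (- 2))))) th) t4.
Definition p1 (y : R) : R :=
  (7 * h y ^+ 2 - 15 * y ^+ 2) * h y / (5 * y ^+ 2 + 3 * h y ^+ 2) ^+ 3.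

Lemma ysq y : y ^+ 2 = sq y ^+ 2 - 2 :> R.
Proof. by rewrite sq_sq; ring. Qed.

Lemma p4E y : p4 y = (dn y)^-1 ^+ 3.
Proof. by rewrite /p4 (ysq y) hE -/(dn y) exprVn mul1r. Qed.

Lemma p1E y : p1 y =
  (7 * (sq y - 2) ^+ 2 - 15 * (sq y ^+ 2 - 2)) * (sq y - 2) * (dn y)^-1 ^+ 3.
Proof. by rewrite /p1 (ysq y) hE -/(dn y) exprVn. Qed.

Lemma eval_t4 x y : sx x = sq y -> eval t4 x = p4 y.
Proof. by move=> E; rewrite /= (dx_sq E) p4E; ring. Qed.

Lemma eval_t1 x y : sx x = sq y -> eval t1 x = p1 y.
Proof. by move=> E; rewrite /= (dx_sq E) E p1E; ring. Qed.

Lemma sq_even y : sq (- y) = sq y :> R.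
Proof. by rewrite /sq sqrrN. Qed.

Lemma t4_1 y (i := (dn y)^-1) (v := (sq y)^-1) : tray t4 1 y = y * (- 3 * i ^+ 4 * (16 - 12 * v)).
Proof.
rewrite /tray /= !(dx_sq (sx_ray y)) !sx_ray !co_ray eqxx (_ : true%:R = 1 :> R)// -/i -/v.
by ring.
Qed.

Lemma t4_2 y (i := (dn y)^-1) (v := (sq y)^-1) : tray t4 2 y =
  - 3 * i ^+ 4 * (16 - 12 * v) + y ^+ 2 * (12 * i ^+ 5 * (16 - 12 * v) ^+ 2 - 36 * i ^+ 4 * v ^+ 3).
Proof.
rewrite /tray /= !(dx_sq (sx_ray y)) !sx_ray !co_ray eqxx (_ : true%:R = 1 :> R)// -/i -/v.
by ring.
Qed.

Lemma ode_t4 y : 0 < y ->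
  c11 y * tray t4 1 y + c12 y * tray t4 2 y + c20 y * ((4 + 2) * p4 y)
  + c21 y * ((4 + 2) * tray t4 1 y) - 2 * ((4 + 2) * p4 y) + V y * p4 y
  = 4 * ((4 + 2) * p4 y).
Proof.
move=> y0; have yn0 := lt0r_neq0 y0.
rewrite t4_1 t4_2 c11E// c12E c20E// c21E VE p4E.
have s0 := lt0r_neq0 (sq_gt0 y); have s1 := sqm1_neq0 y.
have d0 := lt0r_neq0 (dn_gt0 y).
move: (ysq y) d0 s0 s1; rewrite /dn.
set s := sq y => E d0 s0 s1.
(* After clearing 1/y only even powers of y remain, so that y^2 = s^2 - 2 leaves an identity in s
   alone. *)
transitivity (((3 - 2 * s) * (6 * s ^+ 2 - y ^+ 2 / (s - 1)) + 4 * y ^+ 2 * s) *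
   (- 3 * (5 * (s ^+ 2 - 2) + 3 * (s - 2) ^+ 2)^-1 ^+ 4 * (16 - 12 / s)) +
  (3 - 2 * s) * s ^+ 2 * (- 3 * (5 * (s ^+ 2 - 2) + 3 * (s - 2) ^+ 2)^-1 ^+ 4 * (16 - 12 / s) +
    y ^+ 2 * (12 * (5 * (s ^+ 2 - 2) + 3 * (s - 2) ^+ 2)^-1 ^+ 5 * (16 - 12 / s) ^+ 2
      - 36 * (5 * (s ^+ 2 - 2) + 3 * (s - 2) ^+ 2)^-1 ^+ 4 * s^-1 ^+ 3)) +
  (7 - 6 * s - 1 / (s - 1)) * (6 * (5 * (s ^+ 2 - 2) + 3 * (s - 2) ^+ 2)^-1 ^+ 3)
  - 12 * y ^+ 2 * s * (- 3 * (5 * (s ^+ 2 - 2) + 3 * (s - 2) ^+ 2)^-1 ^+ 4 * (16 - 12 / s))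
  - 12 * (5 * (s ^+ 2 - 2) + 3 * (s - 2) ^+ 2)^-1 ^+ 3
  + 96 * (s - 1) ^+ 2 * (21 * (s - 2) ^+ 2 - 5 * (s ^+ 2 - 2)) / (5 * (s ^+ 2 - 2) + 3 * (s - 2) ^+ 2) ^+ 2
   * (5 * (s ^+ 2 - 2) + 3 * (s - 2) ^+ 2)^-1 ^+ 3).
  field.
  by rewrite d0 s1 s0 yn0.
rewrite !E; field.
by rewrite d0 s1 s0.
Qed.

(** [P] is the numerator of [p1] as a polynomial in s and [Ps] its derivative in s; [e] is the
    factor with (1/d)' = - y e / d^2 for the denominator d. *)
Lemma t1_1 y (i := (dn y)^-1) (v := (sq y)^-1) (s := sq y) (e := 16 - 12 * v)
   (P := (- 8 * s ^+ 2 - 28 * s + 58) * (s - 2)) (Ps := - 24 * s ^+ 2 - 24 * s + 114) :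
  s * v = 1 ->
  tray t1 1 y = y * (v * Ps * i ^+ 3 - 3 * P * i ^+ 4 * e).
Proof.
rewrite /tray /= !(dx_sq (sx_ray y)) !sx_ray !co_ray eqxx (_ : true%:R = 1 :> R)// /P /Ps /e -/i -/v -/s => E.
by ring.
Qed.

Lemma t1_2 y (i := (dn y)^-1) (v := (sq y)^-1) (s := sq y) (e := 16 - 12 * v)
   (P := (- 8 * s ^+ 2 - 28 * s + 58) * (s - 2)) (Ps := - 24 * s ^+ 2 - 24 * s + 114)
   (Pss := - 48 * s - 24) :
  s * v = 1 -> tray t1 2 y = (v * Ps * i ^+ 3 - 3 * P * i ^+ 4 * e) +
   y ^+ 2 * (- v ^+ 3 * Ps * i ^+ 3 + v ^+ 2 * Pss * i ^+ 3 - 6 * v * Ps * i ^+ 4 * e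
             + 12 * P * i ^+ 5 * e ^+ 2 - 36 * P * i ^+ 4 * v ^+ 3).
Proof.
rewrite /tray /= !(dx_sq (sx_ray y)) !sx_ray !co_ray eqxx (_ : true%:R = 1 :> R)// /P /Ps /Pss /e -/i -/v -/s => E.
by ring.
Qed.

Lemma ode_t1 y : 0 < y ->
  c11 y * tray t1 1 y + c12 y * tray t1 2 y + c20 y * ((1 + 2) * p1 y)
  + c21 y * ((1 + 2) * tray t1 1 y) - 2 * ((1 + 2) * p1 y) + V y * p1 y
  = 1 * ((1 + 2) * p1 y).
Proof.
move=> y0; have yn0 := lt0r_neq0 y0.
have s0 := lt0r_neq0 (sq_gt0 y); have s1 := sqm1_neq0 y.
rewrite t1_1 ?t1_2 ?mulfV// c11E// c12E c20E// c21E VE p1E.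
have d0 := lt0r_neq0 (dn_gt0 y).
move: (ysq y) d0 s0 s1; rewrite /dn.
set s := sq y => E d0 s0 s1.
set i := (5 * (s ^+ 2 - 2) + 3 * (s - 2) ^+ 2)^-1.
have vs : s^-1 * s = 1 by rewrite mulVf.
have idn : i * (5 * (s ^+ 2 - 2) + 3 * (s - 2) ^+ 2) = 1 by rewrite mulVf.
set A := s^-1 * (-24 * s ^+ 2 - 24 * s + 114) * i ^+ 3 -
  3 * ((-8 * s ^+ 2 - 28 * s + 58) * (s - 2)) * i ^+ 4 * (16 - 12 / s).
set B := _ - 36 * _ * _ ^+ 4 * _ ^+ 3.
transitivity (((3 - 2 * s) * (6 * s ^+ 2 - y ^+ 2 / (s - 1)) + 4 * y ^+ 2 * s) * A +
  (3 - 2 * s) * s ^+ 2 * (A + y ^+ 2 * B) +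
  ((7 - 6 * s - 1 / (s - 1)) * 3 - 6 + 96 * (s - 1) ^+ 2 * (21 * (s - 2) ^+ 2 - 5 * (s ^+ 2 - 2)) * i ^+ 2) *
  ((7 * (s - 2) ^+ 2 - 15 * (s ^+ 2 - 2)) * (s - 2) * i ^+ 3) - 6 * y ^+ 2 * s * A).
  move: A B => A B; rewrite /i; field.
  by rewrite d0 s1 yn0.
rewrite !E /A /B /i; field.
by rewrite d0 s1 s0.
Qed.

Lemma f4starE : f4star = star p4 (4 + 2).
Proof. by rewrite /f4star /star (_ : (4 + 2 : R)%:C%C = 6)// -natrD rmorph_nat. Qed.

Lemma f1starE : f1star = star p1 (1 + 2).
Proof. by rewrite /f1star /star (_ : (1 + 2 : R)%:C%C = 3)// -[1 : R]/(1%:R) -natrD rmorph_nat. Qed.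

Lemma tray_eval t p : (forall x y, sx x = sq y -> eval t x = p y) ->
  (forall x, eval t x = p (norm7 x)) /\ forall y, tray t 0 y = p y.
Proof. by move=> H; split=> [x|y]; apply: H; [exact: sx_norm7|exact: sx_ray]. Qed.

Lemma p4_even y : p4 (- y) = p4 y. Proof. by rewrite !p4E /dn sq_even. Qed.
Lemma p1_even y : p1 (- y) = p1 y. Proof. by rewrite !p1E /dn sq_even. Qed.

Lemma ker_f4star (r : R) c g : 0 < r -> HR r g -> HR_eq r g (cscale c f4star) -> ker_L r 4 g.
Proof.
move=> r0 Hg; rewrite f4starE => E; have [h1 h2] := tray_eval eval_t4.
rewrite (_ : 4 = (4 : R)%:C%C); last by rewrite rmorph_nat.
by apply: (star_ker r0 h1 h2 p4_even _ Hg E) => y /andP[/ode_t4].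
Qed.

Lemma ker_f1star (r : R) c g : 0 < r -> HR r g -> HR_eq r g (cscale c f1star) -> ker_L r 1 g.
Proof.
move=> r0 Hg; rewrite f1starE => E; have [h1 h2] := tray_eval eval_t1.
rewrite (_ : 1 = (1 : R)%:C%C)//.
by apply: (star_ker r0 h1 h2 p1_even _ Hg E) => y /andP[/ode_t1].
Qed.

Lemma HR_f4star (r : R) c : 0 < r -> HR r (cscale c f4star).
Proof.
by move=> r0; rewrite f4starE; have [h1 h2] := tray_eval eval_t4; exact: star_HR.
Qed.

Lemma HR_f1star (r : R) c : 0 < r -> HR r (cscale c f1star).
Proof.
by move=> r0; rewrite f1starE; have [h1 h2] := tray_eval eval_t1; exact: star_HR.
Qed.

Lemma p4_gt0 y : 0 < p4 y.
Proof. by rewrite p4E exprn_gt0// invr_gt0 dn_gt0. Qed.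

(** The factor 7 h^2 - 15 y^2 has a zero inside the light cone, so nonvanishing can only be claimed
    near the origin. The bound on s comes from 1.42^2 > 2.01. *)
Lemma p1_neq0 y : 0 < y < 1 / 10 -> p1 y != 0.
Proof.
move=> /andP[y0 y1]; have g1 := sq_gt1 y.
have s2 : sq y < 142 / 100.
  rewrite -(@ltr_pXn2r _ 2)// ?nnegrE; [|lra_ctx|lra_ctx].
  rewrite sq_sq; nra_ctx.
rewrite p1E mulf_neq0//; last by rewrite expf_neq0// invr_neq0// gt_eqF// dn_gt0.
rewrite mulf_neq0//; last by rewrite lt_eqF//; lra_ctx.
by rewrite gt_eqF//; nra_ctx.
Qed.

Lemma f4star_nonzero (r : R) : 0 < r -> ~ HR_eq r (cscale 1 f4star) 0.
Proof.
move=> r0; rewrite f4starE; apply: star_nonzero => // d d0.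
by exists d; rewrite ?d0 ?lexx// => y _; rewrite gt_eqF// p4_gt0.
Qed.

Lemma f1star_nonzero (r : R) : 0 < r -> ~ HR_eq r (cscale 1 f1star) 0.
Proof.
move=> r0; rewrite f1starE; apply: star_nonzero => // d d0.
exists (Num.min d (1 / 10)) => [|y /andP[y0]].
  by rewrite lt_min d0 ge_min lexx/=; lra_ctx.
by rewrite lt_min => /andP[_ y1]; apply: p1_neq0; rewrite y0.
Qed.

End Kernel.

(** * Sobolev estimates along rays *)

Section RadialMeasure.
Context {R : realType}.
Local Notation R7 := (R7 R).
Local Notation M7 := (M7 R).
Local Notation mu7 := (@mu7 R).
Local Notation mu := (@lebesgue_measure R).

Lemma norm7Z (t : R) (x : R7) : norm7 (t *: x) = `|t| * norm7 x.
Proof.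
rewrite !norm7E -sqrtr_sqr -sqrtrM ?sqr_ge0// mulr_sumr.
by congr Num.sqrt; apply: eq_bigr => i _; rewrite coZ exprMn.
Qed.

Lemma measurable_scale7 (t : R) : measurable_fun setT (fun x : M7 => (t *: (x : R7)) : M7).
Proof.
have mc i : measurable_fun setT (fun x : M7 => t * co i x : measurableTypeR R).
  by apply: measurable_funM => //; exact: measurable_co.
have mp d1 d2 (T1 : measurableType d1) (T2 : measurableType d2) (f : M7 -> T1) (g : M7 -> T2) :
    measurable_fun setT f -> measurable_fun setT g -> measurable_fun setT (fun x => (f x, g x)).
  by move=> mf mg; apply/measurable_fun_pairP; split.
have m1 := mc (inord 0).
have m2 := mp _ _ _ _ _ _ m1 (mc (inord 1)); have m3 := mp _ _ _ _ _ _ m2 (mc (inord 2)).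
have m4 := mp _ _ _ _ _ _ m3 (mc (inord 3)); have m5 := mp _ _ _ _ _ _ m4 (mc (inord 4)).
have m6 := mp _ _ _ _ _ _ m5 (mc (inord 5)); have m7 := mp _ _ _ _ _ _ m6 (mc (inord 6)).
rewrite (_ : (fun x : M7 => _) = (fun x : M7 => (t * co (inord 0) x, t * co (inord 1) x,
  t * co (inord 2) x, t * co (inord 3) x, t * co (inord 4) x, t * co (inord 5) x, t * co (inord 6) x))); last first.
  by apply/funext => x; rewrite !coE.
exact m7.
Qed.

(** Both sides are measures of the set, and they agree on open boxes, which generate. *)
Lemma mu7_scale (t : R) (A : set M7) : 0 < t -> measurable A ->
  mu7 ((fun x : M7 => (t^-1 *: (x : R7)) : M7) @^-1` A) = ((t ^+ 7)%:E * mu7 A)%E.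
Proof.
move=> t0 mA; have t7 : 0 <= t ^+ 7 by rewrite exprn_ge0// ltW.
have [E I [g Gg gT]] := @generates_box R.
have fE a b : (fun x : M7 => (t^-1 *: (x : R7)) : M7) @^-1` (box a b) =
    box (fun i => t * a i) (fun i => t * b i).
  apply/seteqP; split => x H i; have := H i; rewrite coZ => /andP[h1 h2]; apply/andP; split.
  - by rewrite mulrC -ltr_pdivlMr// mulrC.
  - by rewrite mulrC -ltr_pdivrMr// mulrC.
  - by rewrite mulrC ltr_pdivlMr// mulrC.
  - by rewrite mulrC ltr_pdivrMr// mulrC.
pose m1 := pushforward mu7 (fun x : M7 => (t^-1 *: (x : R7)) : M7).
have mf := @measurable_scale7 t^-1.
have boxe (a b : 'I_7 -> R) : ~ (forall i, a i <= b i) -> box a b = set0.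
  move=> h; apply/seteqP; split => // x H; apply: h => i.
  by have /andP[h1 h2] := H i; exact: ltW (lt_trans h1 h2).
have := @measure_unique _ R _ _ g E I Gg gT m1 (mscale (NngNum t7) mu7) _ _ A mA.
rewrite /m1 /pushforward/= /mscale/=; apply.
- exact: mf.
- move=> _ [a [b ->]]; rewrite /pushforward/= fE.
  have [ab|ab] := pselect (forall i, a i <= b i); last first.
    rewrite (boxe _ _ ab) boxe ?measure0 ?mule0//.
    by move=> H; apply: ab => i; rewrite -(ler_pM2l t0).
  rewrite !mu7_box// => [|i]; last by rewrite ler_pM2l.
  rewrite -EFinM; congr _%:E.
  under eq_bigr do rewrite -mulrBr.
  by rewrite big_split/= prodr_const card_ord.
- move=> k; have [a [b ->]] := Gg k; rewrite /pushforward/= fE; exact: box_fin.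
Qed.

Definition vol1 : R := fine (mu7 (ball7 1)).

Lemma vol1E : mu7 (ball7 1) = vol1%:E.
Proof.
have fb : mu7 (ball7 1) \is a fin_num by rewrite ge0_fin_numE// ball7_fin.
by rewrite /vol1 fineK.
Qed.

Lemma mu7_ball (t : R) : 0 < t -> mu7 (ball7 t) = (t ^+ 7 * vol1)%:E.
Proof.
move=> t0; rewrite EFinM -vol1E -(mu7_scale t0 (measurable_ball7 1)).
have E x : (norm7 (t^-1 *: x : R7) < 1) = (norm7 x < t).
  by rewrite norm7Z ger0_norm ?invr_ge0 ?ltW// mulrC ltr_pdivrMr// mul1r.
by congr (mu7 _); apply/seteqP; split => x; rewrite /ball7/= E.
Qed.

Lemma vol1_gt0 : 0 < vol1.
Proof.
rewrite -lte_fin -vol1E.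
have sub : box (fun=> 0) (fun=> 1 / 7) `<=` ball7 (1 : R).
  move=> x H; rewrite /ball7/= -[X in _ < X]sqrtr1 norm7E ltr_sqrt//.
  apply: (@le_lt_trans _ _ (\sum_(i < 7) (1 / 7) ^+ 2)).
    apply: ler_sum => i _; have /andP[h1 h2] := H i.
    by rewrite lerXn2r ?nnegrE ?ltW.
  by rewrite sumr_const card_ord -mulr_natl exprMn; lra_ctx.
have mb : mu7 (box (fun=> 0) (fun=> 1 / 7)) = (\prod_(i < 7) (1 / 7 - 0))%:E.
  by rewrite mu7_box// => i; lra_ctx.
apply: (@lt_le_trans _ _ (mu7 (box (fun=> 0) (fun=> 1 / 7)))).
  by rewrite mb lte_fin; apply: prodr_gt0 => i _; lra_ctx.
by apply: le_measure; rewrite ?inE//; [exact: measurable_box|exact: measurable_ball7].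
Qed.

Definition root7 (u : R) : R := u `^ 7^-1.

Lemma root7_gt0 u : 0 < u -> 0 < root7 u.
Proof. exact: powR_gt0. Qed.

Lemma root7K u : 0 <= u -> root7 u ^+ 7 = u.
Proof.
by move=> u0; rewrite /root7 -powR_mulrn ?powR_ge0// -powRrM mulVf ?powRr1// pnatr_eq0.
Qed.

Lemma expr7K t : 0 <= t -> root7 (t ^+ 7) = t.
Proof.
by move=> t0; rewrite /root7 -powR_mulrn// -powRrM mulfV ?powRr1// pnatr_eq0.
Qed.

Lemma ltr_exp7 (x y : R) : 0 <= x -> 0 <= y -> (x ^+ 7 < y ^+ 7) = (x < y).
Proof. by move=> x0 y0; rewrite ltr_pXn2r. Qed.

Lemma ler_exp7 (x y : R) : 0 <= x -> 0 <= y -> (x ^+ 7 <= y ^+ 7) = (x <= y).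
Proof. by move=> x0 y0; rewrite ler_pXn2r. Qed.

Lemma der_root7 (u : R) : 0 < u -> is_derive u (1 : R) root7 (root7 u / (7 * u)).
Proof.
move=> u0; have := is_derive1_powR 7^-1 u0; apply: der_eq.
rewrite powRB ?lt0r_neq0 ?implybT// powRr1 ?ltW// -/(root7 u) mulrCA invfM.
by ring.
Qed.

(** The seventh power is, up to the constant [vol1], the volume of the ball through x: in this
    variable the radial part of Lebesgue measure has constant density. *)
Definition n7 (x : M7) : measurableTypeR R := norm7 x ^+ 7.

Lemma measurable_n7 : measurable_fun setT n7.
Proof. exact: measurable_funX measurable_norm7. Qed.

(** A replacement for polar coordinates: on a half-line below b > 0 both measures give b * [vol1],
    by the scaling of balls, and uniqueness of measures does the rest. *)
Lemma law_n7 (A : set (measurableTypeR R)) : measurable A -> A `<=` `[0, +oo[%classic ->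
  mu7 (n7 @^-1` A) = (vol1%:E * mu A)%E.
Proof.
move=> mA A0; have mn := measurable_n7.
have mI : measurable (`[0, +oo[%classic : set (measurableTypeR R)) by exact: measurable_itv.
have v0 := ltW vol1_gt0.
pose m1 := pushforward mu7 n7.
pose m2 := mscale (NngNum v0) (mrestr mu mI).
have H : m1 A = m2 A.
  have := @measure_unique _ R (measurableTypeR R) (@RGenInftyO.G R) (fun n => `]-oo, n%:R[%classic)
    (@RGenInftyO.measurableE R) _ _ _ (pushforward mu7 n7) (mscale (NngNum v0) (mrestr mu mI)) _ _ A mA.
  rewrite /m1 /m2; apply.
  - move=> _ _ [a ->] [b ->]; exists (Num.min a b); apply/seteqP; split => x /=.
      by rewrite !in_itv/= lt_min => -[-> ->].
    by rewrite !in_itv/= lt_min => /andP[].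
  - by move=> i; exists i%:R.
  - apply/seteqP; split => // x _.
    exists (Num.truncn `|x|).+1 => //=; rewrite in_itv/=.
    by apply: le_lt_trans (ler_norm _) _; rewrite truncnS_gt.
  - move=> _ [b ->].
    pose I0 : set (measurableTypeR R) := `]-oo, b[%classic `&` `[0, +oo[%classic.
    suff : mu7 (n7 @^-1` `]-oo, b[%classic) = (vol1%:E * mu I0)%E by [].
    rewrite /I0.
    have [b0|b0] := leP b 0.
      rewrite (_ : _ @^-1` _ = set0); last first.
        apply/seteqP; split => // x /=; rewrite in_itv/= => h.
        have := lt_le_trans h b0; rewrite ltNge exprn_ge0// norm7_ge0//.
      rewrite (_ : _ `&` _ = set0) ?measure0 ?mule0//.
      apply/seteqP; split => // x /=; rewrite !in_itv/= andbT => -[h1 h2].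
      by have := le_lt_trans h2 (lt_le_trans h1 b0); rewrite ltxx.
    rewrite (_ : _ @^-1` _ = ball7 (root7 b)); last first.
      apply/seteqP; split => x /=; rewrite in_itv/= /ball7/= -[in n7 x < b](root7K (ltW b0)) ltr_exp7 ?norm7_ge0// ltW// root7_gt0//.
    rewrite mu7_ball ?root7_gt0// root7K ?ltW// mulrC EFinM; congr (_ * _)%E.
    rewrite (_ : _ `&` _ = `[0, b[%classic); last first.
      apply/seteqP; split => x /=; rewrite !in_itv/= ?andbT; first by move=> [-> ->].
      by move=> /andP[-> ->].
    by rewrite lebesgue_measure_itv/= lte_fin b0 oppr0 adde0.
  - move=> k.
    apply: (@le_lt_trans _ _ (mu7 (ball7 (root7 k.+1%:R)))); last exact: ball7_fin.
    suff : (mu7 (n7 @^-1` `]-oo, k%:R[%classic) <= mu7 (ball7 (root7 k.+1%:R)))%E by [].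
    apply: le_measure; rewrite ?inE.
    + rewrite -[X in measurable X]setTI; apply: mn => //; exact: measurable_itv.
    + exact: measurable_ball7.
    + move=> x /=; rewrite in_itv/= /ball7/= => h.
      rewrite -ltr_exp7 ?norm7_ge0 ?root7K//; last by rewrite ltW// root7_gt0.
      by apply: lt_trans h _; rewrite ltr_nat.
pose I0 : set (measurableTypeR R) := A `&` `[0, +oo[%classic.
have H' : mu7 (n7 @^-1` A) = (vol1%:E * mu I0)%E := H.
by rewrite H' /I0 (setIidl A0).
Qed.

Lemma radial_integral (a b : R) (f : measurableTypeR R -> R) : 0 <= a ->
  measurable_fun `[a, b]%classic f -> (forall u, a <= u <= b -> 0 <= f u) ->
  (\int[mu7]_(x in n7 @^-1` `[a, b]%classic) (f (n7 x))%:E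
   = vol1%:E * \int[mu]_(u in `[a, b]%classic) (f u)%:E)%E.
Proof.
move=> a0 mf f0; have mn := measurable_n7.
have mI : measurable (`[a, b]%classic : set (measurableTypeR R)) by exact: measurable_itv.
have v0 := ltW vol1_gt0.
rewrite -(@ge0_integral_pushforward _ _ _ _ R _ mn mu7 _ (EFin \o f))//; last first.
- by move=> u; rewrite inE/= in_itv/= => h; rewrite lee_fin f0.
- exact/measurable_EFinP.
rewrite -[vol1]/((NngNum v0)%:num) -ge0_integral_mscale//; last first.
- exact/measurable_EFinP.
apply: eq_measure_integral => A mA AI; apply: law_n7 => // u /AI.
by rewrite /= !in_itv/= andbT => /andP[h _]; exact: le_trans a0 h.
Qed.

End RadialMeasure.

(** * A one-dimensional Sobolev inequality *)

Section Sobolev1.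
Context {R : realType}.
Local Notation mu := (@lebesgue_measure R).

Lemma der_within (a b : R) (f f' : R -> R) : (forall u, a <= u <= b -> is_derive u (1 : R) f (f' u)) ->
  {within `[a, b], continuous f}.
Proof.
move=> df; apply: continuous_in_subspaceT => u; rewrite inE/= in_itv/= => h.
exact: der_cont (df u h).
Qed.

Lemma der_FTC (a b : R) (f f' : R -> R) : a < b ->
  (forall u, a <= u <= b -> is_derive u (1 : R) f (f' u)) ->
  {within `[a, b], continuous f'} ->
  (\int[mu]_(u in `[a, b]) (f' u)%:E = (f b - f a)%:E)%E.
Proof.
move=> ab df cf'; rewrite EFinB; apply: continuous_FTC2 => //.
  split.
  - by move=> u; rewrite in_itv/= => /andP[h1 h2]; have [] := df u; rewrite ?ltW.
  - apply: cvg_at_right_filter; apply: (@der_cont _ _ _ (f' a)); apply: df.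
    by rewrite lexx ltW.
  - apply: cvg_at_left_filter; apply: (@der_cont _ _ _ (f' b)); apply: df.
    by rewrite lexx ltW.
move=> u; rewrite in_itv/= => /andP[h1 h2]; rewrite derive1E.
have h : a <= u <= b by rewrite (ltW h1) ltW.
by have [_ ->] := df u h.
Qed.

Lemma within_mul (a b : R) (f g : R -> R) : {within `[a, b], continuous f} ->
  {within `[a, b], continuous g} -> {within `[a, b], continuous (fun u => f u * g u)}.
Proof. by move=> cf cg u; apply: continuousM; [exact: cf|exact: cg]. Qed.

Lemma within_add (a b : R) (f g : R -> R) : {within `[a, b], continuous f} ->
  {within `[a, b], continuous g} -> {within `[a, b], continuous (fun u => f u + g u)}.
Proof. by move=> cf cg u; apply: continuousD; [exact: cf|exact: cg]. Qed.

(** Integrate the derivative of (u - a) W^2 over [a, b]: the weight kills the boundary term at a,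
    and 2 W W' <= W^2 + W'^2. *)
Lemma sobolev1 (a b : R) (W W' : R -> R) : a < b ->
  (forall u, a <= u <= b -> is_derive u (1 : R) W (W' u)) ->
  {within `[a, b], continuous W'} ->
  (((b - a) * W b ^+ 2)%:E <=
   (1 + (b - a))%:E * \int[mu]_(u in `[a, b]%classic) (W u ^+ 2 + W' u ^+ 2)%:E)%E.
Proof.
move=> ab dW cW'.
have cW := der_within dW.
pose P u := (u - a) * W u ^+ 2.
pose P' u := W u ^+ 2 + (u - a) * (2 * W u * W' u).
have dP u : a <= u <= b -> is_derive u (1 : R) P (P' u).
  move=> h; have h1 := dW u h.
  have := derM (derB (der_id u) (der_cst u 1 a)) (derX 2 h1).
  by apply: der_eq; rewrite /P' subr0 mul1r expr1.
have mk := @within_mul a b; have ad := @within_add a b.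
have cc (c : R) : {within `[a, b], continuous (fun=> c)} by move=> u; exact: cvg_cst.
have cid : {within `[a, b], continuous (fun u => u - a)}.
  apply: (@der_within _ _ _ (fun=> 1)) => u _.
  by have := derB (der_id u) (der_cst u 1 a); apply: der_eq; rewrite subr0.
have cP' : {within `[a, b], continuous P'}.
  apply: (ad); first exact: (mk).
  by apply: (mk) => //; apply: (mk) => //; exact: (mk).
have cG : {within `[a, b], continuous (fun u => (1 + (b - a)) * (W u ^+ 2 + W' u ^+ 2))}.
  by apply: (mk) => //; apply: (ad); exact: (mk).
have cS : {within `[a, b], continuous (fun u => W u ^+ 2 + W' u ^+ 2)}.
  by apply: (ad); exact: (mk).
have := der_FTC ab dP cP'.
rewrite {1}/P {1}/P subrr mul0r subr0 => <-.
have mI : measurable (`[a, b]%classic : set (measurableTypeR R)) by exact: measurable_itv.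
rewrite -ge0_integralZl_EFin//; last 3 first.
- by move=> u _; rewrite lee_fin addr_ge0// sqr_ge0.
- by apply/measurable_EFinP; apply: subspace_continuous_measurable_fun.
- by rewrite addr_ge0// subr_ge0 ltW.
apply: le_integral.
- exact: mI.
- by apply: continuous_compact_integrable cP'; exact: segment_compact.
- by apply: continuous_compact_integrable cG; exact: segment_compact.
move=> u; rewrite inE/= in_itv/= => /andP[h1 h2]; rewrite lee_fin /P'.
have q1 := sqr_ge0 (W u); have q2 := sqr_ge0 (W' u).
have q3 : 2 * W u * W' u <= W u ^+ 2 + W' u ^+ 2.
  by rewrite -subr_ge0; have := sqr_ge0 (W u - W' u); congr (_ <= _); ring.
have q4 : (u - a) * (2 * W u * W' u) <= (b - a) * (W u ^+ 2 + W' u ^+ 2).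
  apply: (@le_trans _ _ ((u - a) * (W u ^+ 2 + W' u ^+ 2))).
    by apply: ler_wpM2l => //; rewrite subr_ge0.
  by apply: ler_wpM2r; [exact: addr_ge0|lra_ctx].
by lra_ctx.
Qed.

End Sobolev1.

(** * Pointwise bounds of radial functions by integrals over shells *)

Section Radial.
Context {R : realType}.
Local Notation R7 := (R7 R).
Local Notation M7 := (M7 R).
Local Notation mu7 := (@mu7 R).
Local Notation mu := (@lebesgue_measure R).
Implicit Types (v : R -> R) (r eps : R).

Definition shell (a b : R) : set M7 := [set x | a < norm7 x < b].

Lemma measurable_shell a b : measurable (shell a b).
Proof.
have mn := @measurable_norm7 R.
rewrite (_ : shell a b = @norm7 R @^-1` `]a, b[%classic).
  by rewrite -[X in measurable X]setTI; apply: mn => //; exact: measurable_itv.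
by apply/seteqP; split => x /=; rewrite in_itv.
Qed.

Lemma measurable_radial a b (g : R -> R) :
  (forall y, a < y < b -> {for y, continuous g}) ->
  measurable_fun (shell a b) (fun x => g (norm7 x)).
Proof.
move=> cg; have mn := @measurable_norm7 R.
apply: (@measurable_comp _ _ _ _ (measurableTypeR R) _ (`]a, b[%classic : set (measurableTypeR R))).
- exact: measurable_itv.
- by move=> _ [x /= h <-]; rewrite in_itv.
- apply: subspace_continuous_measurable_fun; first exact: measurable_itv.
  apply: continuous_in_subspaceT => u; rewrite inE/= in_itv/= => h; exact: cg.
- by apply: measurable_funS mn => //.
Qed.

(** [sobolev1] in the variable u = y^7 on an interval ending at the point considered. Its left end
    is fixed and its length is at least [d], so the constant does not degenerate as y approaches
    r. *)
Lemma shell_bound r eps : 0 < eps < r -> exists2 C : R, 0 < C &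
  forall v v' v'', (forall y : R, 0 < y < r -> is_derive y (1 : R) v (v' y)) ->
    (forall y : R, 0 < y < r -> is_derive y (1 : R) v' (v'' y)) ->
  forall y : R, eps <= y < r ->
  ((v y ^+ 2)%:E <= C%:E *
     \int[mu7]_(x in shell (eps / 4) r) (v (norm7 x) ^+ 2 + v' (norm7 x) ^+ 2)%:E)%E.
Proof.
move=> /andP[e0 er].
(* The interval starts at radius eps/2, strictly inside the open shell that starts at eps/4 and
   strictly below every admissible y. *)
have [a aE] : exists a, a = (eps / 2) ^+ 7 by exists ((eps / 2) ^+ 7).
have a0 : 0 < a by rewrite aE exprn_gt0//; lra_ctx.
have ae : a < eps ^+ 7 by rewrite aE ltr_exp7; lra_ctx.
have [d dE] : exists d, d = eps ^+ 7 - a by exists (eps ^+ 7 - a).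
have d0 : 0 < d by rewrite dE; lra_ctx.
have r7 : 0 < r ^+ 7 by rewrite exprn_gt0//; lra_ctx.
have [K KE] : exists K, K = (r / (7 * a)) ^+ 2 by exists ((r / (7 * a)) ^+ 2).
have K0 : 0 <= K by rewrite KE sqr_ge0.
have v0 := @vol1_gt0 R.
have C0 : 0 < (1 + r ^+ 7) * (1 + K) / (d * vol1).
  by rewrite divr_gt0 ?mulr_gt0//; lra_ctx.
exists ((1 + r ^+ 7) * (1 + K) / (d * vol1)) => //.
move=> v v' v'' dv dv' y /andP[ey yr].
have y0 : 0 < y by lra_ctx.
have [b bE] : exists b, b = y ^+ 7 by exists (y ^+ 7).
have b0 : 0 < b by rewrite bE exprn_gt0.
have eb : eps ^+ 7 <= b by rewrite bE ler_exp7//; lra_ctx.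
have br : b < r ^+ 7 by rewrite bE ltr_exp7//; lra_ctx.
have ab : a < b by lra_ctx.
have rt u : a <= u <= b -> 0 < u /\ eps / 4 < root7 u < r.
  move=> /andP[au ub]; have u0 : 0 < u by lra_ctx.
  have rg := root7_gt0 u0.
  split=> //; rewrite -ltr_exp7 -1?[root7 u < r]ltr_exp7 ?root7K ?ltW//; [|lra_ctx|lra_ctx].
  apply/andP; split; last by lra_ctx.
  by apply: lt_le_trans au; rewrite aE ltr_exp7; lra_ctx.
pose W u := v (root7 u); pose W' u := v' (root7 u) * (root7 u / (7 * u)).
have dW u : a <= u <= b -> is_derive u (1 : R) W (W' u).
  move=> /rt[u0 /andP[h1 h2]]; apply: der_comp (der_root7 u0).
  by apply: dv; rewrite h2 root7_gt0.
have dr u : a <= u <= b -> is_derive u (1 : R) (fun u => root7 u / (7 * u))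
    (root7 u / (7 * u) * (7 * u)^-1 + root7 u * (- (0 * u + 7 * 1) / (7 * u) ^+ 2)).
  move=> /rt[u0 _]; apply: derM; first exact: der_root7.
  apply: derV; first by rewrite lt0r_neq0// mulr_gt0.
  exact: (derM (der_cst u 1 7) (der_id u)).
have cW' : {within `[a, b], continuous W'}.
  apply: (@der_within _ _ _ _ (fun u => v'' (root7 u) * (root7 u / (7 * u)) * (root7 u / (7 * u)) +
    v' (root7 u) * (root7 u / (7 * u) * (7 * u)^-1 + root7 u * (- (0 * u + 7 * 1) / (7 * u) ^+ 2)))).
  move=> u h; have [u0 /andP[h1 h2]] := rt u h.
  apply: derM (dr u h); apply: (@der_comp _ _ u 1 v' root7) (der_root7 u0).
  by apply: dv'; rewrite h2 root7_gt0.
have cvr : {within `[a, b], continuous (fun u => v (root7 u))} by exact: der_within dW.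
have cvr' : {within `[a, b], continuous (fun u => v' (root7 u))}.
  apply: (@der_within _ _ _ _ (fun u => v'' (root7 u) * (root7 u / (7 * u)))) => u h.
  have [u0 /andP[h1 h2]] := rt u h; apply: (@der_comp _ _ u 1 v' root7) (der_root7 u0).
  by apply: dv'; rewrite h2 root7_gt0.
have ad (f g : R -> R) : {within `[a, b], continuous f} -> {within `[a, b], continuous g} ->
    {within `[a, b], continuous (fun u => f u ^+ 2 + g u ^+ 2)}.
  by move=> cf cg; apply: within_add; exact: within_mul.
have mI : measurable (`[a, b]%classic : set (measurableTypeR R)) by exact: measurable_itv.
have mG : measurable_fun `[a, b]%classic (fun u => v (root7 u) ^+ 2 + v' (root7 u) ^+ 2).
  by apply: subspace_continuous_measurable_fun => //; exact: ad.
pose J := (\int[mu]_(u in `[a, b]%classic) (v (root7 u) ^+ 2 + v' (root7 u) ^+ 2)%:E)%E.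
have S := sobolev1 ab dW cW'.
have W'b u : a <= u <= b -> W' u ^+ 2 <= K * v' (root7 u) ^+ 2.
  move=> h; have [u0 /andP[h1 h2]] := rt u h; have rg := root7_gt0 u0.
  rewrite /W' exprMn mulrC; apply: ler_wpM2r; first exact: sqr_ge0.
  rewrite KE lerXn2r ?nnegrE//.
  - by rewrite divr_ge0 ?ltW// mulr_gt0.
  - by apply: divr_ge0; [rewrite ltW// (lt_trans e0)|rewrite mulr_ge0// ltW].
  - apply: ler_pM; [exact: ltW|by rewrite invr_ge0 mulr_ge0// ltW|exact: ltW|].
    rewrite lef_pV2 ?posrE ?mulr_gt0// ler_pM2l//.
    by case/andP: h.
have J1 : (\int[mu]_(u in `[a, b]%classic) (W u ^+ 2 + W' u ^+ 2)%:E <= (1 + K)%:E * J)%E.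
  rewrite /J -ge0_integralZl_EFin//; last 3 first.
  - by move=> u _; rewrite lee_fin addr_ge0// sqr_ge0.
  - exact/measurable_EFinP.
  - by lra_ctx.
  apply: ge0_le_integral => //.
  - by move=> u _; rewrite lee_fin addr_ge0// sqr_ge0.
  - by apply/measurable_EFinP; apply: subspace_continuous_measurable_fun => //; exact: ad.
  - by apply/measurable_EFinP; apply: measurable_funM.
  move=> u; rewrite /= in_itv/= => h; rewrite -EFinM lee_fin.
  have := W'b u h; rewrite /W; have := sqr_ge0 (v (root7 u)); have := sqr_ge0 (v' (root7 u)).
  have := mulr_ge0 K0 (sqr_ge0 (v (root7 u))).
  rewrite mulrDl mul1r mulrDr; lra_ctx.
have J2 : ((vol1)%:E * J <= \int[mu7]_(x in shell (eps / 4) r) (v (norm7 x) ^+ 2 + v' (norm7 x) ^+ 2)%:E)%E.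
  rewrite /J -radial_integral//; last 2 first.
  - by rewrite ltW.
  - by move=> u _; rewrite addr_ge0// sqr_ge0.
  have -> : (fun x : M7 => (v (root7 (n7 x)) ^+ 2 + v' (root7 (n7 x)) ^+ 2)%:E) =
      (fun x : M7 => (v (norm7 x) ^+ 2 + v' (norm7 x) ^+ 2)%:E).
    by apply/funext => x; rewrite /n7 expr7K// norm7_ge0.
  apply: ge0_subset_integral.
  - by rewrite -[X in measurable X]setTI; apply: measurable_n7 => //.
  - exact: measurable_shell.
  - apply/measurable_EFinP; apply: (@measurable_radial _ _ (fun y => v y ^+ 2 + v' y ^+ 2)) => z /andP[z1 z2].
    have zr : 0 < z < r by rewrite z2 andbT (lt_trans _ z1)// divr_gt0.
    exact: (der_cont (derD (derX 2 (dv z zr)) (derX 2 (dv' z zr)))).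
  - by move=> x _; rewrite lee_fin addr_ge0// sqr_ge0.
  - move=> x; rewrite /shell/= in_itv/= => /rt[_]; rewrite /n7 expr7K// norm7_ge0//.
have Jge : (0 <= J)%E by apply: integral_ge0 => u _; rewrite lee_fin addr_ge0// sqr_ge0.
have Wb : W b = v y by rewrite /W bE expr7K// ltW.
set Q := integral _ _ _ in J2 *.
have S2 : ((d * v y ^+ 2)%:E <= ((1 + r ^+ 7) * (1 + K))%:E * J)%E.
  apply: (@le_trans _ _ ((b - a) * W b ^+ 2)%:E).
    by rewrite lee_fin Wb; apply: ler_wpM2r; [exact: sqr_ge0|rewrite dE lerD2r].
  apply: le_trans S _; apply: (@le_trans _ _ ((1 + (b - a))%:E * ((1 + K)%:E * J))%E).
    by apply: lee_wpmul2l => //; rewrite lee_fin addr_ge0// subr_ge0 ltW.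
  rewrite muleA -EFinM; apply: lee_wpmul2r => //; rewrite lee_fin.
  apply: ler_wpM2r; first by rewrite addr_ge0.
  by rewrite lerD2l lerBlDr (le_trans (ltW br))// lerDl ltW.
have -> : (v y ^+ 2)%:E = (d^-1%:E * (d * v y ^+ 2)%:E)%E.
  by rewrite -EFinM mulrA mulVf ?mul1r// lt0r_neq0.
apply: (@le_trans _ _ (d^-1%:E * (((1 + r ^+ 7) * (1 + K))%:E * J))%E).
  by apply: lee_wpmul2l => //; rewrite lee_fin invr_ge0 ltW.
apply: (@le_trans _ _ (((1 + r ^+ 7) * (1 + K) / (d * vol1))%:E * ((vol1)%:E * J))%E).
  rewrite !muleA -!EFinM; apply: lee_wpmul2r => //; rewrite lee_fin.
  by rewrite le_eqVlt; apply/orP; left; apply/eqP; field; rewrite !lt0r_neq0.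
by apply: lee_wpmul2l => //; rewrite lee_fin ltW.
Qed.

Lemma der_norm7 j (x : R7) : x != 0 -> is_derive x (e7 j) (@norm7 R) (co j x / norm7 x).
Proof.
move=> x0; have n0 : 0 < norm7 x by rewrite lt_neqAle eq_sym norm7_eq0 x0 norm7_ge0.
have s0 : 0 < \sum_i co i x ^+ 2 by rewrite -norm7_sq exprn_gt0.
have hs : is_derive x (e7 j) (fun x => \sum_i co i x ^+ 2) (2 * co j x).
  have H i : is_derive x (e7 j) (fun y => co i y ^+ 2) (2%:R * co i x ^+ 1 * (i == j)%:R).
    exact: (derX 2 (der_co i j x)).
  have := is_derive_sum H; rewrite (_ : \sum_(i < 7) (fun y => co i y ^+ 2) = (fun y => \sum_i co i y ^+ 2)); last first.
    by apply/funext => z; rewrite fct_sumE.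
  apply: der_eq.
  rewrite (bigD1 j)//= eqxx mulr1 expr1 big1 ?addr0// => i /negPf ->; by rewrite mulr0.
rewrite (_ : @norm7 R = fun x => Num.sqrt (\sum_i co i x ^+ 2)); last by apply/funext => z; exact: norm7E.
have := @der_comp _ _ x (e7 j) Num.sqrt (fun x => \sum_i co i x ^+ 2) _ _ (is_derive1_sqrt s0) hs.
apply: der_eq; rewrite -norm7E -?norm7E.
by field; exact: lt0r_neq0.
Qed.

Lemma der_radial j (x : R7) (v : R -> R) d : x != 0 -> is_derive (norm7 x) (1 : R) v d ->
  is_derive x (e7 j) (fun x => v (norm7 x)) (d * (co j x / norm7 x)).
Proof. by move=> x0 dv; apply: der_comp dv (der_norm7 j x0). Qed.

Lemma der_radial2 j (x : R7) (v' : R -> R) d : x != 0 -> is_derive (norm7 x) (1 : R) v' d ->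
  is_derive x (e7 j) (fun x => v' (norm7 x) * (co j x / norm7 x))
    (d * (co j x / norm7 x) ^+ 2 + v' (norm7 x) * ((norm7 x)^-1 - co j x ^+ 2 / norm7 x ^+ 3)).
Proof.
move=> x0 dv; have n0 : norm7 x != 0 by rewrite norm7_eq0.
have := derM (der_radial j x0 dv) (derM (der_co j j x) (derV n0 (der_norm7 j x0))).
by apply: der_eq; rewrite eqxx (_ : true%:R = 1)//; field.
Qed.

End Radial.

(** * Weak derivatives of a radial function are the classical ones on shells *)

Section WeakRadial.
Context {R : realType}.
Local Notation R7 := (R7 R).
Local Notation M7 := (M7 R).
Local Notation mu7 := (@mu7 R).
Local Notation mu := (@lebesgue_measure R).
Implicit Types (v : R -> R) (r a b : R).

(** The pure derivative of order n in direction j. The squares of the first ones add up to v'^2, and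
    the second ones add up to the Laplacian. *)
Definition multi (n : nat) (j : 'I_7) : 'I_7 -> nat := fun i => (n * (i == j))%N.

Lemma Dmulti_multi n j (phi : R7 -> R) : Dmulti (multi n j) phi = iter n (partial j) phi.
Proof.
rewrite /Dmulti; have : uniq (enum 'I_7) by exact: enum_uniq.
have : j \in enum 'I_7 by rewrite mem_enum.
have H s : j \notin s -> foldr (fun i psi => iter (multi n j i) (partial i) psi) phi s = phi.
  elim: s => // i s IH; rewrite inE negb_or => /andP[ij js] /=; rewrite IH//.
  by rewrite /multi eq_sym (negPf ij) muln0.
elim: (enum 'I_7) => // i s IH; rewrite inE => /predU1P[<-|js] /= /andP[h1 h2].
  by rewrite H// /multi eqxx muln1.
rewrite IH// /multi (_ : (i == j) = false) ?muln0//.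
by apply/negP => /eqP ij; move: h1; rewrite ij js.
Qed.

Lemma sum_multi n j : (\sum_(i < 7) multi n j i = n)%N.
Proof.
rewrite (bigD1 j)//= /multi eqxx muln1 big1 ?addn0// => i /negPf ->; by rewrite muln0.
Qed.

Lemma continuous_norm7 : continuous (@norm7 R : R7 -> R).
Proof.
move=> x; rewrite (_ : @norm7 R = (fun x : R7 => Num.sqrt (\sum_i co i x ^+ 2))); last first.
  by apply/funext => z; exact: norm7E.
apply: (@continuous_comp _ _ _ (fun x : R7 => \sum_i co i x ^+ 2) Num.sqrt); last exact: sqrt_continuous.
apply: cvg_big => [|i _]; first exact: add_continuous.
exact: (continuousM (@continuous_co R i x) (@continuous_co R i x)).
Qed.

Lemma open_shell a b : open (shell a b : set R7).
Proof.
rewrite (_ : shell a b = @norm7 R @^-1` `]a, b[%classic).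
  by apply: open_comp; [move=> x _; exact: continuous_norm7|exact: itv_open].
by apply/seteqP; split => x /=; rewrite in_itv.
Qed.

Lemma shell_ball a b : shell a b `<=` ball7 b.
Proof. by move=> x /andP[]. Qed.

Lemma ball7S a b : a <= b -> ball7 a `<=` ball7 (b : R).
Proof. by move=> ab x /lt_le_trans; apply. Qed.

Lemma shell_neq0 a b (x : R7) : 0 < a -> shell a b x -> x != 0.
Proof. by move=> a0 /andP[h _]; rewrite -norm7_eq0 gt_eqF// (lt_trans a0). Qed.

Lemma cbox_compact_shell (qa qb : 'I_7 -> R) a b : cbox qa qb `<=` shell a b ->
  compact (cbox qa qb : set R7) /\ cbox qa qb `<=` ball7 b.
Proof. by move=> h; split; [exact: compact_cbox|apply: subset_trans h _; exact: shell_ball]. Qed.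

Lemma tfun_tbump (qa qb : 'I_7 -> R) n : tfun (cbox qa qb) (eval (tbump qa qb n)).
Proof.
split; first exact: smooth7_eval.
move=> x Hx; apply: tbump_out => K; apply: Hx => i.
by have /andP[/ltW -> /ltW ->] := K i.
Qed.

Lemma bounded_rL2 r (f : M7 -> R) M : measurable_fun (ball7 r : set M7) f ->
  (forall x, `|f x| <= M) -> rL2 r f.
Proof.
move=> mf fM; split=> //; have mB := @measurable_ball7 R r.
apply: (@le_lt_trans _ _ (\int[mu7]_(x in ball7 r) (M ^+ 2)%:E)%E).
  apply: ge0_le_integral => //.
  - by move=> x _; rewrite lee_fin sqr_ge0.
  - by apply/measurable_EFinP; exact: measurable_funX.
  - move=> x _; rewrite lee_fin -[f x ^+ 2]real_normK ?num_real//.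
    by rewrite lerXn2r ?nnegrE// (le_trans _ (fM x)).
by rewrite integral_cst// lte_mul_pinfty// ?lee_fin ?sqr_ge0// ball7_fin.
Qed.

Lemma ae_shell r a b (h U : M7 -> R) M : 0 < a -> b <= r -> rL2 r h ->
  measurable_fun (shell a b) U -> (forall x, shell a b x -> `|U x| <= M) ->
  (forall qa qb n, cbox qa qb `<=` shell a b ->
    \int[mu7]_(x in ball7 r) (h x * eval (tbump qa qb n) x)%:E
    = \int[mu7]_(x in ball7 r) (U x * eval (tbump qa qb n) x)%:E)%E ->
  {ae mu7, forall x, shell a b x -> h x = U x}.
Proof.
move=> a0 br Lh mU UM H.
have sr : shell a b `<=` ball7 r by apply: subset_trans (@shell_ball a b) (ball7S br).
have mS := @measurable_shell R a b.
have mB := @measurable_ball7 R r.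
pose U0 := U \_ (shell a b).
have U0E x : shell a b x -> U0 x = U x by move=> /mem_set h1; rewrite /U0 patchE h1.
have mU0 : measurable_fun (ball7 r : set M7) U0.
  by apply: (@measurable_funS _ _ _ _ setT) => //; exact/(measurable_restrictT _ mS).
have U0M x : `|U0 x| <= `|M|.
  rewrite /U0 patchE; case: ifPn => [/set_mem /UM h1|_].
    exact: le_trans h1 (ler_norm _).
  by rewrite normr0.
have LU := bounded_rL2 mU0 U0M.
have iU := rL2_integrable LU.
have ih := rL2_integrable Lh.
suff : {ae mu7, forall x, shell a b x -> h x - U0 x = 0}.
  apply: ae_imp => x E Sx; apply/eqP; rewrite -subr_eq0 -(U0E _ Sx); exact/eqP/E.
apply: (@test_functions_ae0 R r) => //; first exact: open_shell.
  rewrite (_ : EFin \o _ = (EFin \o h) \- (EFin \o U0))%E//.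
  exact: integrableB.
move=> qa qb n sub.
have [Mt Ht] : exists Mt, forall x, `|eval (tbump qa qb n) x| <= Mt :> R.
  have [h1 h2] := cbox_compact_shell sub.
  exact: tfun_bound h1 (tfun_tbump qa qb n).
have mt : measurable_fun (ball7 r : set M7) (eval (tbump qa qb n)).
  by apply: (@measurable_funS _ _ _ _ setT) => //; exact: measurable_eval.
have i1 := rL2_integrableM Lh mt Ht.
have i2 := rL2_integrableM LU mt Ht.
under eq_integral do rewrite mulrBl EFinB.
rewrite integralB//= H//.
have -> : (\int[mu7]_(x in ball7 r) (U x * eval (tbump qa qb n) x)%:E =
    \int[mu7]_(x in ball7 r) (U0 x * eval (tbump qa qb n) x)%:E)%E.
  apply: eq_integral => x _; have [Sx|Sx] := pselect (shell a b x); first by rewrite U0E.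
  have [_ out] := tfun_tbump qa qb n.
  by rewrite (out x) ?mulr0// => /sub.
by rewrite subee//; apply: (integrable_fin_num _ i2).
Qed.

Lemma bounded_itv a b (g : R -> R) : (forall y, a <= y <= b -> {for y, continuous g}) ->
  exists2 M, 0 <= M & forall y, a <= y <= b -> `|g y| <= M.
Proof.
move=> cg; have [ab|ba] := leP a b; last first.
  by exists 0 => // y /andP[h1 h2]; have := lt_le_trans ba (le_trans h1 h2); rewrite ltxx.
have cn : {within `[a, b], continuous (fun y => `|g y|)}.
  apply: continuous_in_subspaceT => u; rewrite inE/= in_itv/= => h.
  by apply: (@continuous_comp _ _ _ g Num.norm); [exact: cg|exact: norm_continuous].
have [c _ Hc] := EVT_max ab cn; exists `|g c| => // y h; apply: Hc; by rewrite in_itv.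
Qed.

(** Both integrals are finite, so the identity between real integrals lifts to extended reals. *)
Lemma weak_fin r (a : 'I_7 -> nat) u g phi : rL2 r u -> rL2 r g -> rweak r a u g -> test_function r phi ->
  (\int[mu7]_(x in ball7 r) (u x * Dmulti a phi x)%:E =
   ((-1) ^+ (\sum_i a i)%N)%:E * \int[mu7]_(x in ball7 r) (g x * phi x)%:E)%E.
Proof.
move=> Lu Lg W tp; have := W phi tp; rewrite /Rintegral.
have [s [_ Ds]] := @Dmulti_partials R a.
have i1 : mu7.-integrable (ball7 r) (EFin \o (fun x => u x * Dmulti a phi x)).
  by rewrite Ds; exact: test_integrable.
have i2 : mu7.-integrable (ball7 r) (EFin \o (fun x => g x * phi x)).
  exact: (@test_integrable _ r g phi [::]).
have mB := @measurable_ball7 R r.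
have f1 := integrable_fin_num mB i1; have f2 := integrable_fin_num mB i2.
move: f1 f2; rewrite /=.
set A := integral _ _ _; set B := integral _ _ _.
by case: A => [x| |] //; case: B => [y| |] // _ _ /= ->; rewrite EFinM.
Qed.

(** The derivatives are bounded only on shells with outer radius b < r; countably many of them
    exhaust the shell up to r. *)
Lemma ae_shell_union a r (P : M7 -> Prop) :
  (forall b, b < r -> {ae mu7, forall x, shell a b x -> P x}) ->
  {ae mu7, forall x, shell a r x -> P x}.
Proof.
move=> H; have hb (k : nat) : r - k.+1%:R^-1 < r by rewrite ltrBlDr ltrDl invr_gt0 ltr0n.
apply: ae_imp (@ae_countable R nat (fun k x => shell a (r - k.+1%:R^-1) x -> P x) (fun k => H _ (hb k))) => x.
move=> K /andP[h1 h2]; have rn : 0 < r - norm7 x by rewrite subr_gt0.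
pose k := Num.truncn (r - norm7 x)^-1.
have hk : k.+1%:R^-1 < r - norm7 x.
  by rewrite invf_plt ?posrE ?ltr0n// truncnS_gt.
by apply: (K k); rewrite /shell/= h1/= ltrBrDr addrC -ltrBrDr.
Qed.

Section OneRadial.
Variables (r a b : R) (v v' v'' : R -> R) (j : 'I_7).
Hypotheses (a0 : 0 < a) (br : b < r).
Hypothesis dv : forall y : R, 0 < y < r -> is_derive y (1 : R) v (v' y).
Hypothesis dv' : forall y : R, 0 < y < r -> is_derive y (1 : R) v' (v'' y).
Hypothesis cv'' : forall y : R, 0 < y < r -> {for y, continuous v''}.
Hypothesis LV : rL2 r (fun x => v (norm7 x)).

Let U1 (x : R7) : R := v' (norm7 x) * (co j x / norm7 x).
Let U2 (x : R7) : R := v'' (norm7 x) * (co j x / norm7 x) ^+ 2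
  + v' (norm7 x) * ((norm7 x)^-1 - co j x ^+ 2 / norm7 x ^+ 3).

Let in_shell x : shell a b x -> x != 0 /\ 0 < norm7 x < r.
Proof.
move=> S; split; first exact: shell_neq0 S.
by case/andP: S => h1 h2; rewrite (lt_trans a0 h1) (lt_trans h2 br).
Qed.

Let cont (g g' : R -> R) : (forall y : R, 0 < y < r -> is_derive y (1 : R) g (g' y)) ->
  forall y : R, 0 < y < r -> {for y, continuous g}.
Proof. by move=> dg y h; exact: der_cont (dg y h). Qed.

Let mco : measurable_fun (shell a b) (fun x : M7 => co j x / norm7 x).
Proof.
apply: measurable_funM; first by apply: measurable_funS (measurable_co j).
apply: (@measurable_radial R a b (fun y => y^-1)) => y /andP[y1 _].
by apply: continuousV; [rewrite gt_eqF// (lt_trans a0)|exact: cvg_id].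
Qed.

Let mrad (g : R -> R) : (forall y : R, 0 < y < r -> {for y, continuous g}) ->
  measurable_fun (shell a b) (fun x : M7 => g (norm7 x)).
Proof.
move=> cg; apply: measurable_radial => y /andP[y1 y2]; apply: cg.
by rewrite (lt_trans a0 y1) (lt_trans y2 br).
Qed.

Let mU1 : measurable_fun (shell a b) (U1 : M7 -> R).
Proof. by apply: measurable_funM => //; apply: mrad; exact: cont dv'. Qed.

Let mU2 : measurable_fun (shell a b) (U2 : M7 -> R).
Proof.
apply: measurable_funD.
  by apply: measurable_funM; [exact: mrad|exact: measurable_funX].
apply: measurable_funM; first by apply: mrad; exact: cont dv'.
have mi : measurable_fun (shell a b) (fun x : M7 => (norm7 x)^-1).
  apply: (@measurable_radial R a b (fun y => y^-1)) => y /andP[y1 _].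
  by apply: continuousV; [rewrite gt_eqF// (lt_trans a0)|exact: cvg_id].
rewrite (_ : (fun x => _) = (fun x : M7 => (norm7 x)^-1 - (co j x / norm7 x) ^+ 2 * (norm7 x)^-1)); last first.
  by apply/funext => x; rewrite -exprVn; ring.
by apply: measurable_funB => //; apply: measurable_funM => //; exact: measurable_funX.
Qed.

Let brad (g : R -> R) : (forall y : R, 0 < y < r -> {for y, continuous g}) ->
  exists2 M, 0 <= M & forall x, shell a b x -> `|g (norm7 x)| <= M.
Proof.
move=> cg; have [y|M M0 HM] := @bounded_itv a b g.
  by move=> /andP[h1 h2]; apply: cg; rewrite (lt_le_trans a0 h1) (le_lt_trans h2 br).
by exists M => // x /andP[h1 h2]; apply: HM; rewrite !ltW.
Qed.

Let bco x : shell a b x -> `|co j x / norm7 x| <= 1.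
Proof.
move=> S; have [_ /andP[n0 _]] := in_shell S.
by rewrite normrM normfV (gtr0_norm n0) ler_pdivrMr// mul1r co_le_norm7.
Qed.

Let bU1 : exists2 M, 0 <= M & forall x, shell a b x -> `|U1 x| <= M.
Proof.
have [M M0 HM] := brad (cont dv'); exists M => // x S.
rewrite /U1 normrM -[M]mulr1; apply: ler_pM => //; [exact: HM|exact: bco].
Qed.

Let bU2 : exists2 M, 0 <= M & forall x, shell a b x -> `|U2 x| <= M.
Proof.
have [M M0 HM] := brad (cont dv'); have [M' M'0 HM'] := brad cv''.
exists (M' + M * (a^-1 + a^-1)).
  by rewrite addr_ge0// mulr_ge0// addr_ge0// invr_ge0 ltW.
move=> x S; have [_ /andP[n0 _]] := in_shell S; have /andP[h1 h2] := S.
have ai : (norm7 x)^-1 <= a^-1 by rewrite lef_pV2 ?posrE// ltW.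
have c2 : `|(co j x / norm7 x) ^+ 2| <= 1.
  by rewrite normrX -[X in _ <= X](expr1n _ 2) lerXn2r ?nnegrE//; exact: bco.
apply: le_trans (ler_normD _ _) _; apply: lerD.
  by rewrite normrM -[M']mulr1; apply: ler_pM => //; exact: HM'.
rewrite normrM; apply: ler_pM => //; first exact: HM.
apply: le_trans (ler_normB _ _) _; apply: lerD.
  by rewrite gtr0_norm ?invr_gt0.
rewrite (_ : _ / _ = (co j x / norm7 x) ^+ 2 * (norm7 x)^-1); last first.
  by rewrite -exprVn; ring.
rewrite normrM -[a^-1]mul1r; apply: ler_pM => //.
by rewrite gtr0_norm ?invr_gt0.
Qed.

Let ibp1 qa qb (psi : R7 -> R) : cbox qa qb `<=` shell a b -> tfun (cbox qa qb : set R7) psi ->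
  (\int[mu7]_(x in ball7 r) (v (norm7 x) * partial j psi x)%:E
   = - \int[mu7]_(x in ball7 r) (U1 x * psi x)%:E)%E.
Proof.
move=> sub tp; have [M M0 HM] := brad (cont dv); have [M' M'0 HM'] := bU1.
have sr : shell a b `<=` ball7 r by apply: subset_trans (@shell_ball a b) (ball7S (ltW br)).
apply: (@ibp_local R r j (shell a b) (cbox qa qb) _ U1 psi (M + M')) => //.
- exact: open_shell.
- exact: compact_cbox.
- by move=> x /in_shell[x0 /dv]; exact: der_radial.
- exact: mrad (cont dv).
- by move=> x /sub /HM h; rewrite (le_trans h)// lerDl.
- by move=> x /sub /HM' h; rewrite (le_trans h)// lerDr.
Qed.

Let ibp2 qa qb (psi : R7 -> R) : cbox qa qb `<=` shell a b -> tfun (cbox qa qb : set R7) psi ->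
  (\int[mu7]_(x in ball7 r) (U1 x * partial j psi x)%:E
   = - \int[mu7]_(x in ball7 r) (U2 x * psi x)%:E)%E.
Proof.
move=> sub tp; have [M M0 HM] := bU1; have [M' M'0 HM'] := bU2.
have sr : shell a b `<=` ball7 r by apply: subset_trans (@shell_ball a b) (ball7S (ltW br)).
apply: (@ibp_local R r j (shell a b) (cbox qa qb) U1 U2 psi (M + M')) => //.
- exact: open_shell.
- exact: compact_cbox.
- by move=> x /in_shell[x0 /dv']; exact: der_radial2.
- by move=> x /sub /HM h; rewrite (le_trans h)// lerDl.
- by move=> x /sub /HM' h; rewrite (le_trans h)// lerDr.
Qed.

Lemma weak_shell1 (h : M7 -> R) : rL2 r h -> rweak r (multi 1 j) (fun x => v (norm7 x)) h ->
  {ae mu7, forall x, shell a b x -> h x = U1 x}.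
Proof.
move=> Lh W; have [M M0 HM] := bU1.
apply: (@ae_shell r a b h U1 M) => //; first exact: ltW.
move=> qa qb n sub; have tp := tfun_tbump qa qb n.
have [cK Kb] := cbox_compact_shell sub.
have tt := test_function_tbump n (subset_trans Kb (ball7S (ltW br))).
have := weak_fin LV Lh W tt; rewrite Dmulti_multi sum_multi /= (ibp1 sub tp) expr1 mulN1e.
by move=> /oppe_inj ->.
Qed.

Lemma weak_shell2 (h : M7 -> R) : rL2 r h -> rweak r (multi 2 j) (fun x => v (norm7 x)) h ->
  {ae mu7, forall x, shell a b x -> h x = U2 x}.
Proof.
move=> Lh W; have [M M0 HM] := bU2.
apply: (@ae_shell r a b h U2 M) => //; first exact: ltW.
move=> qa qb n sub; have tp := tfun_tbump qa qb n.
have [cK Kb] := cbox_compact_shell sub.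
have tt := test_function_tbump n (subset_trans Kb (ball7S (ltW br))).
have := weak_fin LV Lh W tt; rewrite Dmulti_multi sum_multi /=.
rewrite (ibp1 sub (tfun_partial j cK tp)) (ibp2 sub tp) oppeK sqrrN expr1n mul1e.
by move=> ->.
Qed.

End OneRadial.

End WeakRadial.

(** * Uniform bounds for v and v' from weak derivatives of order at most 2 *)

Section RadialSup.
Context {R : realType}.
Local Notation R7 := (R7 R).
Local Notation M7 := (M7 R).
Local Notation mu7 := (@mu7 R).
Implicit Types (v : R -> R) (r a b eta : R).

Lemma int_dom (I : finType) r (S : set M7) (f : M7 -> R) (g : I -> M7 -> R) c eta :
  measurable S -> S `<=` ball7 r -> 0 <= c ->
  measurable_fun S f -> (forall x, 0 <= f x) ->
  (forall i, measurable_fun (ball7 r : set M7) (g i)) ->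
  {ae mu7, forall x, S x -> f x <= c * \sum_i g i x ^+ 2} ->
  (forall i, \int[mu7]_(x in ball7 r) (g i x ^+ 2)%:E <= eta%:E)%E ->
  (\int[mu7]_(x in S) (f x)%:E <= (c * #|I|%:R * eta)%:E)%E.
Proof.
move=> mS SB c0 mf f0 mg fg gI; have mB := @measurable_ball7 R r.
have mg2 i : measurable_fun S (fun x => g i x ^+ 2).
  by apply: measurable_funX; apply: measurable_funS (mg i).
apply: (@le_trans _ _ (\int[mu7]_(x in S) (c%:E * \sum_(i <- enum I) (g i x ^+ 2)%:E))%E).
  apply: ae_ge0_le_integral => //.
  - by move=> x _; rewrite lee_fin.
  - exact/measurable_EFinP.
  - by move=> x _; apply: mule_ge0; rewrite ?lee_fin// sume_ge0// => i _; rewrite lee_fin sqr_ge0.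
  - apply: emeasurable_funM => //; apply: emeasurable_sum => i.
    exact/measurable_EFinP.
  - apply: ae_imp fg => x H Sx; have := H Sx.
    by rewrite sumEFin -EFinM lee_fin big_enum.
rewrite ge0_integralZl_EFin//; last 2 first.
- by move=> x _; apply: sume_ge0 => i _; rewrite lee_fin sqr_ge0.
- by apply: emeasurable_sum => i; exact/measurable_EFinP.
rewrite ge0_integral_sum//; last 2 first.
- by move=> i; exact/measurable_EFinP.
- by move=> i x _; rewrite lee_fin sqr_ge0.
rewrite -mulrA EFinM; apply: lee_wpmul2l; first by rewrite lee_fin.
apply: (@le_trans _ _ (\sum_(i <- enum I) eta%:E)%E).
  apply: lee_sum => i _; apply: le_trans (gI i).
  apply: ge0_subset_integral => //.
    by apply/measurable_EFinP; exact: measurable_funX.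
  by move=> x _; rewrite lee_fin sqr_ge0.
by rewrite sumEFin big_enum sumr_const mulr_natl.
Qed.

(** Cauchy-Schwarz with 7 + 1 terms: the seven pure second derivatives and the first-order term of
    the radial Laplacian. *)
Lemma sqr_sum8 (x : R) (k : 'I_7 -> R) : (\sum_i k i + x) ^+ 2 <= 8 * (\sum_i k i ^+ 2 + x ^+ 2).
Proof.
have H (n : nat) (f : 'I_n -> R) : (\sum_i f i) ^+ 2 <= n%:R * \sum_i f i ^+ 2.
  elim: n f => [|n IH] f; first by rewrite !big_ord0 expr0n mul0r.
  rewrite !big_ord_recl; have := IH (fun i => f (lift ord0 i)).
  set S := \sum_i _; set Q := \sum_i _ => SQ.
  have Q0 : 0 <= Q by apply: sumr_ge0 => i _; exact: sqr_ge0.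
  have := sqr_ge0 (n%:R * f ord0 - S).
  case: n {IH} f @S @Q SQ Q0 => [|n] f S Q SQ Q0 H.
    by rewrite /S /Q !big_ord0 !addr0 mul1r.
  have n0 : (0 : R) < n.+1%:R by rewrite ltr0n.
  rewrite -(ler_pM2l n0).
  have -> : n.+2%:R = n.+1%:R + 1 :> R by rewrite -natr1.
  move: (n.+1%:R : R) n0 H SQ => N n0 H SQ.
  have : N * S ^+ 2 <= N * (N * Q) by rewrite ler_pM2l.
  move: H; rewrite expr2 => H.
  nra_ctx.
have := H 8 (fun i => if unlift ord0 i is Some j then k j else x).
have E (F : 'I_8 -> R) : \sum_i F i = F ord0 + \sum_(i < 7) F (lift ord0 i) by rewrite big_ord_recl.
rewrite !E unlift_none.
under eq_bigr do rewrite liftK.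
under [in X in _ <= _ * (_ + X)]eq_bigr do rewrite liftK.
by rewrite ![x + _]addrC ![x ^+ 2 + _]addrC.
Qed.

(** The L2 norm of v' is read off the gradient, that of v'' off v'' = Laplacian - (6 / y) v'; then
    [shell_bound] is applied to v and to v'. *)
Lemma radial_sup r eps : 0 < eps < r -> exists2 C : R, 0 < C &
  forall v v' v'' v''', (forall y : R, 0 < y < r -> is_derive y (1 : R) v (v' y)) ->
    (forall y : R, 0 < y < r -> is_derive y (1 : R) v' (v'' y)) ->
    (forall y : R, 0 < y < r -> is_derive y (1 : R) v'' (v''' y)) ->
    rL2 r (fun x => v (norm7 x)) ->
  forall h k : 'I_7 -> M7 -> R,
    (forall j, rL2 r (h j) /\ rweak r (multi 1 j) (fun x => v (norm7 x)) (h j)) ->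
    (forall j, rL2 r (k j) /\ rweak r (multi 2 j) (fun x => v (norm7 x)) (k j)) ->
  forall eta, (\int[mu7]_(x in ball7 r) (v (norm7 x) ^+ 2)%:E <= eta%:E)%E ->
    (forall j, (\int[mu7]_(x in ball7 r) (h j x ^+ 2)%:E <= eta%:E)%E) ->
    (forall j, (\int[mu7]_(x in ball7 r) (k j x ^+ 2)%:E <= eta%:E)%E) ->
  forall y : R, eps <= y < r -> v y ^+ 2 <= C * eta /\ v' y ^+ 2 <= C * eta.
Proof.
move=> er; have [C0 C00 HC0] := shell_bound er; have /andP[e0 ltr_er] := er.
pose a := eps / 4; have a0 : 0 < a by rewrite /a; lra_ctx.
(* The 8 comes from [sqr_sum8], 36 / a^2 bounds the square of the coefficient 6 / |x|, and the last
   1 pays for v'^2 itself. *)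
pose c2 := 8 * (1 + 36 / a ^+ 2) + 1.
have c20 : 8 <= c2.
  have : 0 <= 36 / a ^+ 2 by rewrite divr_ge0// sqr_ge0.
  rewrite /c2; lra_ctx.
exists (C0 * (8 + c2 * 14)); first by rewrite mulr_gt0//; lra_ctx.
move=> v v' v'' v''' dv dv' dv'' LV h k Hh Hk eta HV Hh2 Hk2 y yr.
have eta0 : 0 <= eta.
  by rewrite -lee_fin; apply: le_trans HV; apply: integral_ge0 => x _; rewrite lee_fin sqr_ge0.
have cv'' : forall y : R, 0 < y < r -> {for y, continuous v''} by move=> z zr; exact: der_cont (dv'' z zr).
have mS := @measurable_shell R a r.
have SB : shell a r `<=` ball7 r by exact: shell_ball.
have A1 : {ae mu7, forall x, shell a r x -> forall j, h j x = v' (norm7 x) * (co j x / norm7 x)}.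
  apply: ae_shell_union => b br.
  apply: ae_imp (ae_countable (fun j => weak_shell1 a0 br dv dv' LV (proj1 (Hh j)) (proj2 (Hh j)))) => x H Sx j.
  exact: H.
have A2 : {ae mu7, forall x, shell a r x -> forall j, k j x = v'' (norm7 x) * (co j x / norm7 x) ^+ 2
  + v' (norm7 x) * ((norm7 x)^-1 - co j x ^+ 2 / norm7 x ^+ 3)}.
  apply: ae_shell_union => b br.
  apply: ae_imp (ae_countable (fun j => weak_shell2 a0 br dv dv' cv'' LV (proj1 (Hk j)) (proj2 (Hk j)))) => x H Sx j.
  exact: H.
have sum1 (x : M7) : shell a r x -> \sum_j (co j x / norm7 x) ^+ 2 = 1.
  move=> Sx; have x0 := shell_neq0 a0 Sx.
  under eq_bigr do rewrite expr_div_n.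
  by rewrite -mulr_suml -norm7_sq divff// expf_neq0// norm7_eq0.
have inr z : a < z < r -> 0 < z < r by move=> /andP[z1 ->]; rewrite (lt_trans a0 z1).
have B1 : (\int[mu7]_(x in shell a r) (v (norm7 x) ^+ 2 + v' (norm7 x) ^+ 2)%:E <= (8 * eta)%:E)%E.
  have c8 : #|{: option 'I_7}|%:R = 8 :> R by rewrite card_option card_ord.
  rewrite -[8]mul1r -c8.
  apply: (@int_dom _ r _ _ (fun o x => if o is Some j then h j x else v (norm7 x))) => //.
  - apply: (@measurable_radial _ a r (fun y => v y ^+ 2 + v' y ^+ 2)) => z /inr zr.
    exact: (der_cont (derD (derX 2 (dv z zr)) (derX 2 (dv' z zr)))).
  - by move=> x; rewrite addr_ge0// sqr_ge0.
  - by move=> [j|]; [case: (Hh j) => -[]|case: LV].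
  - apply: ae_imp A1 => x H Sx; rewrite mul1r (bigD1 None)//= lerD2l.
    rewrite (reindex_onto Some (fun o => odflt ord0 o)) /=; last by case.
    rewrite (eq_bigl xpredT) => [|j]; last by rewrite eqxx.
    under eq_bigr do rewrite H// exprMn.
    by rewrite -mulr_sumr sum1// mulr1.
  - by case.
have B2 : (\int[mu7]_(x in shell a r) (v' (norm7 x) ^+ 2 + v'' (norm7 x) ^+ 2)%:E <= (c2 * 14 * eta)%:E)%E.
  have c14 : #|{: 'I_7 + 'I_7}|%:R = 14 :> R by rewrite card_sum !card_ord.
  rewrite -c14.
  apply: (@int_dom _ r _ _ (fun o x => match o with inl j => h j x | inr j => k j x end)) => //.
  - by rewrite (le_trans _ c20).
  - apply: (@measurable_radial _ a r (fun y => v' y ^+ 2 + v'' y ^+ 2)) => z /inr zr.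
    exact: (der_cont (derD (derX 2 (dv' z zr)) (derX 2 (dv'' z zr)))).
  - by move=> x; rewrite addr_ge0// sqr_ge0.
  - by move=> [j|j]; [case: (Hh j) => -[]|case: (Hk j) => -[]].
  - apply: ae_imp (ae_and A1 A2) => x [H1 H2] Sx; rewrite big_sumType/=.
    have E1 : \sum_j h j x ^+ 2 = v' (norm7 x) ^+ 2.
      under eq_bigr do rewrite H1// exprMn.
      by rewrite -mulr_sumr sum1// mulr1.
    have n0 : 0 < norm7 x by case/andP: Sx => h1 _; rewrite (lt_trans a0).
    have E2 : \sum_j k j x = v'' (norm7 x) + v' (norm7 x) * (6 / norm7 x).
      under eq_bigr do rewrite H2//.
      rewrite big_split/= -!mulr_sumr sum1// mulr1; congr (_ + _ * _).
      rewrite sumrB sumr_const card_ord -mulr_suml -norm7_sq -mulr_natl.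
      by field; exact: lt0r_neq0.
    have -> : v'' (norm7 x) = \sum_j k j x + - (v' (norm7 x) * (6 / norm7 x)) by rewrite E2 addrK.
    have := sqr_sum8 (- (v' (norm7 x) * (6 / norm7 x))) (k^~ x).
    rewrite E1; set K := \sum_j k j x ^+ 2.
    have K0 : 0 <= K by apply: sumr_ge0 => j _; exact: sqr_ge0.
    have i0 : (6 / norm7 x) ^+ 2 <= 36 / a ^+ 2.
      rewrite expr_div_n; have -> : 6 ^+ 2 = 36 :> R by ring.
      rewrite ler_pM2l// lef_pV2 ?posrE ?exprn_gt0//.
      rewrite lerXn2r// ?nnegrE; [exact: ltW|exact: ltW|].
      by case/andP: Sx => /ltW.
    rewrite sqrrN exprMn; have q := sqr_ge0 (v' (norm7 x)).
    have : v' (norm7 x) ^+ 2 * (6 / norm7 x) ^+ 2 <= v' (norm7 x) ^+ 2 * (36 / a ^+ 2).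
      exact: ler_wpM2l.
    have : 8 * K <= c2 * K by exact: ler_wpM2r.
    have : c2 * v' (norm7 x) ^+ 2 = 8 * (v' (norm7 x) ^+ 2 + v' (norm7 x) ^+ 2 * (36 / a ^+ 2)) + v' (norm7 x) ^+ 2.
      by rewrite /c2; ring.
    rewrite [c2 * (_ + K)]mulrDr; lra_ctx.
  - by case.
have C8 : 0 <= C0 * (8 * eta) by apply: mulr_ge0; [exact: ltW|exact: mulr_ge0].
have C9 : 0 <= C0 * (c2 * 14 * eta).
  by apply: mulr_ge0; [exact: ltW|rewrite !mulr_ge0// (le_trans _ c20)].
have CE : C0 * (8 + c2 * 14) * eta = C0 * (8 * eta) + C0 * (c2 * 14 * eta) by ring.
split.
  rewrite -lee_fin; apply: le_trans (HC0 v v' v'' dv dv' y yr) _.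
  apply: (@le_trans _ _ (C0%:E * (8 * eta)%:E)%E).
    by apply: lee_wpmul2l => //; rewrite lee_fin ltW.
  by rewrite -EFinM lee_fin CE lerDl.
rewrite -lee_fin; apply: le_trans (HC0 v' v'' v''' dv' dv'' y yr) _.
apply: (@le_trans _ _ (C0%:E * (c2 * 14 * eta)%:E)%E).
  by apply: lee_wpmul2l => //; rewrite lee_fin ltW.
by rewrite -EFinM lee_fin CE lerDr.
Qed.

End RadialSup.

(** * Limits in H^6 x H^5 and the classical eigenvalue equation *)

Section ComplexDerivative.
Context {R : realType}.
Local Notation Re := (@complex.Re R).
Local Notation Im := (@complex.Im R).
Implicit Types (f g : R -> R[i]) (d : R[i]) (y r : R).

Definition cder f y d : Prop :=
  is_derive y (1 : R) (fun z => Re (f z)) (Re d) /\ is_derive y (1 : R) (fun z => Im (f z)) (Im d).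

Lemma cder_eq f y d d' : d = d' -> cder f y d -> cder f y d'.
Proof. by move=> ->. Qed.

Lemma cder_cst (c : R[i]) y : cder (fun=> c) y 0.
Proof. by split; exact: der_cst. Qed.

Lemma cder_real (g : R -> R) y (d : R) : is_derive y (1 : R) g d -> cder (fun z => (g z)%:C%C) y d%:C%C.
Proof. by move=> dg; split=> //; exact: der_cst. Qed.

Lemma cderD f g y d d' : cder f y d -> cder g y d' -> cder (fun z => f z + g z) y (d + d').
Proof.
move=> [f1 f2] [g1 g2]; split.
  rewrite ReD (_ : (fun z => _) = (fun z => Re (f z) + Re (g z))); last by apply/funext => z; rewrite ReD.
  exact: derD.
rewrite ImD (_ : (fun z => _) = (fun z => Im (f z) + Im (g z))); last by apply/funext => z; rewrite ImD.
exact: derD.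
Qed.

Lemma cderM f g y d d' : cder f y d -> cder g y d' ->
  cder (fun z => f z * g z) y (d * g y + f y * d').
Proof.
move=> [f1 f2] [g1 g2]; split.
  rewrite (_ : (fun z => _) = (fun z => Re (f z) * Re (g z) - Im (f z) * Im (g z))); last by apply/funext => z; rewrite Re_mul.
  by apply: der_eq (derB (derM f1 g1) (derM f2 g2)); rewrite ReD !Re_mul; ring.
rewrite (_ : (fun z => _) = (fun z => Re (f z) * Im (g z) + Im (f z) * Re (g z))); last by apply/funext => z; rewrite Im_mul.
by apply: der_eq (derD (derM f1 g2) (derM f2 g1)); rewrite ImD !Im_mul; ring.
Qed.

Lemma cderN f y d : cder f y d -> cder (fun z => - f z) y (- d).
Proof.
move=> [f1 f2]; split.
  rewrite ReN (_ : (fun z => _) = (fun z => - Re (f z))); last by apply/funext => z; rewrite ReN.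
  exact: derN.
rewrite ImN (_ : (fun z => _) = (fun z => - Im (f z))); last by apply/funext => z; rewrite ImN.
exact: derN.
Qed.

Lemma cderB f g y d d' : cder f y d -> cder g y d' -> cder (fun z => f z - g z) y (d - d').
Proof. by move=> hf hg; exact: cderD hf (cderN hg). Qed.

Lemma cderZ (c : R[i]) f y d : cder f y d -> cder (fun z => c * f z) y (c * d).
Proof. by move=> hf; apply: cder_eq (cderM (cder_cst c y) hf); rewrite mul0r add0r. Qed.

Lemma cder_uniq f y d d' : cder f y d -> cder f y d' -> d = d'.
Proof.
by move=> [[_ e1] [_ e2]] [[_ e3] [_ e4]]; apply/complexP; rewrite -e1 -e2 e3 e4.
Qed.

Lemma cder_ext f g y d : (\forall z \near y, f z = g z) -> cder f y d -> cder g y d.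
Proof.
move=> H [h1 h2]; split.
  by apply: der_ext h1; apply: filterS H => z ->.
by apply: der_ext h2; apply: filterS H => z ->.
Qed.

Lemma derivable_in_der r y (g : R -> R) : 0 < y < r -> derivable_in r g y ->
  is_derive y (1 : R) g (deriv_in r g y).
Proof.
move=> /andP[y0 yr] /cvg_ex[d /= cd].
have r0 : 0 < r by exact: lt_trans y0 yr.
have PF : ProperFilter (within [set` `[0, r]] y^') by apply: within_proper => //; rewrite !ltW.
have Ed : deriv_in r g y = d by exact/cvg_lim.
have FF : Filter (within [set` `[0, r]] y^') by exact: within_filter.
have C : (fun h => h^-1 *: ((g \o shift y) (h *: (1 : R)) - g y)) @ 0^' --> d.
  apply/cvgrPdist_lt => e e0.
  move/cvgrPdist_lt : cd => /(_ _ e0) /near_withinP[e1 e10 H].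
  pose e2 := Num.min e1 (Num.min y (r - y)).
  have e20 : 0 < e2 by rewrite !lt_min e10 y0 subr_gt0.
  apply/nbhs_ballP; exists e2 => //= h; rewrite /ball/= sub0r normrN => he h0.
  move: he; rewrite /e2 !lt_min => /and3P[h1 h2 h3].
  have /ltr_normlP[h4 h5] := h2; have /ltr_normlP[h6 h7] := h3.
  have := H (h + y); rewrite /quot addrK [h *: (1 : R)]mulr1 -[h^-1 *: _]mulrC; apply => //.
    by apply/andP; split; lra_ctx.
  by rewrite -subr_eq0 addrK.
split; first by apply/cvg_ex; exists d.
by rewrite Ed; apply/cvg_lim.
Qed.

Lemma smooth_in_cder r f n y : smooth_in r f -> 0 < y < r ->
  cder (cderivn_in r n f) y (cderivn_in r n.+1 f y).
Proof.
move=> sf yr; have yr' : 0 <= y <= r by case/andP: yr => h1 h2; rewrite !ltW.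
by have [d1 d2] := sf n y yr'; split; exact: derivable_in_der.
Qed.

Definition left_lim (f : R -> R) y (l : R) : Prop :=
  forall e, 0 < e -> exists2 d, 0 < d & forall z, y - d < z < y -> `|f z - l| < e.

Lemma derivable_in_left r y (g : R -> R) : 0 < y <= r -> derivable_in r g y -> left_lim g y (g y).
Proof.
move=> /andP[y0 yr] /cvg_ex[d /= cd] e e0.
have FF : Filter (within [set` `[0, r]] y^') by exact: within_filter.
move/cvgrPdist_lt : cd => /(_ _ ltr01) /near_withinP[e1 e10 H].
pose M := `|d| + 1; have M0 : 0 < M by rewrite /M ltr_wpDl.
pose e2 := Num.min e1 (Num.min y (e / M)).
have e20 : 0 < e2 by rewrite !lt_min e10 y0 divr_gt0.
exists e2 => // z /andP[z1 z2].
have := lexx e2; rewrite {2}/e2 !le_min => /and3P[m1 m2 m3].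
have zy : z != y by rewrite lt_eqF.
have zd : `|z - y| < e2 by rewrite distrC gtr0_norm ?subr_gt0//; lra_ctx.
have := H z; rewrite (lt_le_trans zd m1) => /(_ _ zy isT) K.
have {}K : `|d - quot g y z| < 1 by apply: K; apply/andP; split; lra_ctx.
have q : `|quot g y z| < M.
  rewrite -[quot g y z](subrKC d) addrC; apply: le_lt_trans (ler_normD _ _) _.
  by rewrite /M addrC ltrD2l distrC.
have -> : g z - g y = quot g y z * (z - y) by rewrite /quot divfK// subr_eq0.
rewrite normrM; apply: (@le_lt_trans _ _ (M * `|z - y|)).
  by apply: ler_wpM2r => //; exact: ltW.
by rewrite mulrC -ltr_pdivlMr//; apply: lt_le_trans zd m3.
Qed.

End ComplexDerivative.

(** * Families tending to 0 in the Sobolev sense *)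

Section Small.
Context {R : realType}.
Local Notation R7 := (R7 R).
Local Notation M7 := (M7 R).
Local Notation mu7 := (@mu7 R).
Local Notation Re := (@complex.Re R).
Local Notation Im := (@complex.Im R).
Implicit Types (r : R).

(** The part of convergence to 0 in [Hk] that the uniform bounds consume. The filter is general
    because Cauchy estimates run over pairs of indices. *)
Definition small (T : Type) (F : set_system T) r (w : T -> M7 -> R[i]) : Prop :=
  (forall t, L2 r (w t)) /\ forall (n : nat) j, (n <= 2)%N ->
    exists g : T -> M7 -> R[i], (forall t, weak_derivative r (multi n j) (w t) (g t)) /\
      forall e, 0 < e -> \forall t \near F, (\int[mu7]_(x in ball7 r) (sqmod (g t x))%:E <= e%:E)%E.

Lemma Hk_small k r (w : nat -> M7 -> R[i]) : (2 <= k)%N -> (forall n, Hk k r (w n)) ->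
  Hk_norm k r (w n) @[n --> \oo] --> (0 : R) -> small \oo r w.
Proof.
move=> k2 Hw cw; split=> [n|n j n2]; first by case: (Hw n).
by apply: Hk_norm_cvg Hw cw _; rewrite sum_multi (leq_trans n2).
Qed.

Lemma sqmod_lin (c d z w : R[i]) :
  sqmod (c * z + d * w) <= 2 * (sqmod c * sqmod z) + 2 * (sqmod d * sqmod w).
Proof.
case: c => c1 c2; case: d => d1 d2; case: z => z1 z2; case: w => w1 w2.
rewrite /sqmod /=.
rewrite -subr_ge0 (_ : _ - _ = (c1 * z1 - c2 * z2 - (d1 * w1 - d2 * w2)) ^+ 2 +
  (c1 * z2 + c2 * z1 - (d1 * w2 + d2 * w1)) ^+ 2).
  by rewrite addr_ge0// sqr_ge0.
ring.
Qed.

Lemma sqmod_ge0 (z : R[i]) : 0 <= sqmod z.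
Proof. by rewrite addr_ge0// sqr_ge0. Qed.

Lemma measurable_sqmod r (u : M7 -> R[i]) : L2 r u ->
  measurable_fun (ball7 r : set M7) (fun x => sqmod (u x)).
Proof. by move=> [m1 m2 _]; apply: measurable_funD; exact: measurable_funX. Qed.

Lemma small_lin (T : Type) (F : set_system T) (FF : Filter F) r w w' (c d : R[i]) :
  small F r w -> small F r w' -> small F r (fun t x => c * w t x + d * w' t x).
Proof.
have mB := @measurable_ball7 R r.
move=> [Lw Hw] [Lw' Hw']; split=> [t|n j n2]; first exact: L2_lin.
have [g [Wg Sg]] := Hw n j n2; have [g' [Wg' Sg']] := Hw' n j n2.
exists (fun t x => c * g t x + d * g' t x); split; first by move=> t; exact: weak_lin.
move=> e e0.
pose C := 2 * sqmod c + 2 * sqmod d + 1.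
have C0 : 0 < C by rewrite /C; have := sqmod_ge0 c; have := sqmod_ge0 d; lra_ctx.
have eC : 0 < e / C by rewrite divr_gt0.
apply: filterS2 (Sg _ eC) (Sg' _ eC) => t I1 I2.
have Lg : L2 r (g t) by case: (Wg t).
have Lg' : L2 r (g' t) by case: (Wg' t).
have m1 := measurable_sqmod Lg; have m2 := measurable_sqmod Lg'.
have p (a b : R) : 0 <= a -> 0 <= b -> 0 <= a * b by exact: mulr_ge0.
apply: (@le_trans _ _ (\int[mu7]_(x in ball7 r) ((2 * sqmod c)%:E * (sqmod (g t x))%:E +
   (2 * sqmod d)%:E * (sqmod (g' t x))%:E))%E).
  apply: ge0_le_integral => //.
  - by move=> x _; rewrite lee_fin sqmod_ge0.
  - by apply/measurable_EFinP; apply: measurable_sqmod; exact: L2_lin.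
  - apply: emeasurable_funD; apply: emeasurable_funM => //; exact/measurable_EFinP.
  - by move=> x _; rewrite -!EFinM -EFinD lee_fin -!mulrA sqmod_lin.
have q (z : R[i]) : 0 <= 2 * sqmod z by rewrite mulr_ge0 ?sqmod_ge0.
rewrite ge0_integralD//; last 4 first.
- by move=> x _; rewrite -EFinM lee_fin mulr_ge0 ?sqmod_ge0.
- by apply: emeasurable_funM => //; exact/measurable_EFinP.
- by move=> x _; rewrite -EFinM lee_fin mulr_ge0 ?sqmod_ge0.
- by apply: emeasurable_funM => //; exact/measurable_EFinP.
rewrite !ge0_integralZl_EFin//; last 4 first.
- by move=> x _; rewrite lee_fin sqmod_ge0.
- exact/measurable_EFinP.
- by move=> x _; rewrite lee_fin sqmod_ge0.
- exact/measurable_EFinP.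
apply: (@le_trans _ _ ((2 * sqmod c)%:E * (e / C)%:E + (2 * sqmod d)%:E * (e / C)%:E)%E).
  by apply: leeD; apply: lee_wpmul2l => //; rewrite lee_fin.
rewrite -!EFinM -EFinD lee_fin -mulrDl mulrCA -[X in _ <= X]mulr1 ler_pM2l//.
by rewrite ler_pdivrMr// mul1r /C lerDl.
Qed.

Lemma small_comp (T T' : Type) (F : set_system T) (F' : set_system T') r w (p : T' -> T) :
  (forall P : T -> Prop, (\forall t \near F, P t) -> \forall t \near F', P (p t)) ->
  small F r w -> small F' r (fun t => w (p t)).
Proof.
move=> H [Lw Hw]; split=> // n j n2; have [g [Wg Sg]] := Hw n j n2.
exists (fun t => g (p t)); split=> // e e0; exact: (H _ (Sg e e0)).
Qed.

Lemma small_L2 (T : Type) (F : set_system T) (FF : Filter F) r w : small F r w ->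
  forall e, 0 < e -> \forall t \near F, (\int[mu7]_(x in ball7 r) (sqmod (w t x))%:E <= e%:E)%E.
Proof.
move=> [Lw Hw] e e0; have [g [Wg Sg]] := Hw 0%N ord0 isT.
apply: filterS (Sg e e0) => t; congr (_ <= _)%E.
have Lg : L2 r (g t) by case: (Wg t).
apply: integral_ball_ae; [exact: measurable_sqmod|exact: measurable_sqmod|].
have triv (u : M7 -> R) : rweak r (multi 0 ord0) u u.
  by move=> phi _; rewrite Dmulti_multi sum_multi expr0 mul1r.
have /weakP[_ w1 w2] := Wg t.
have /L2P[l1 l2] := Lw t; have /L2P[l3 l4] := Lg.
have same (u : M7 -> R) : {ae mu7, forall x, ball7 r x -> u x = u x} by apply: aeW.
have A1 := rweak_unique l1 l1 l3 l1 (same _) w1 (triv _).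
have A2 := rweak_unique l2 l2 l4 l2 (same _) w2 (triv _).
apply: ae_imp (ae_and A1 A2) => x [H1 H2] Bx.
by rewrite /sqmod -/(reu (g t) x) -/(imu (g t) x) H1// H2.
Qed.

Lemma re_le_sqmod r (u : M7 -> R[i]) e : L2 r u ->
  (\int[mu7]_(x in ball7 r) (sqmod (u x))%:E <= e%:E)%E ->
  (\int[mu7]_(x in ball7 r) (reu u x ^+ 2)%:E <= e%:E)%E /\
  (\int[mu7]_(x in ball7 r) (imu u x ^+ 2)%:E <= e%:E)%E.
Proof.
have mB := @measurable_ball7 R r.
move=> Lu H; have ms := measurable_sqmod Lu; case: Lu => m1 m2 _.
split; apply: le_trans H; apply: ge0_le_integral => //.
- by move=> x _; rewrite lee_fin sqr_ge0.
- by apply/measurable_EFinP; exact: measurable_funX.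
- exact/measurable_EFinP.
- by move=> x _; rewrite lee_fin /sqmod lerDl sqr_ge0.
- by move=> x _; rewrite lee_fin sqr_ge0.
- by apply/measurable_EFinP; exact: measurable_funX.
- exact/measurable_EFinP.
- by move=> x _; rewrite lee_fin /sqmod lerDr sqr_ge0.
Qed.

Lemma small_sup (T : Type) (F : set_system T) (FF : Filter F) r eps (z z' z'' z''' : T -> R -> R[i]) :
  0 < eps < r -> small F r (fun t => lift7 (z t)) ->
  (forall t y, 0 < y < r -> cder (z t) y (z' t y)) ->
  (forall t y, 0 < y < r -> cder (z' t) y (z'' t y)) ->
  (forall t y, 0 < y < r -> cder (z'' t) y (z''' t y)) ->
  forall e, 0 < e -> \forall t \near F, forall y, eps <= y < r -> sqmod (z t y) <= e /\ sqmod (z' t y) <= e.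
Proof.
move=> er sm d0 d1 d2 e e0; have [C C0 HC] := radial_sup er.
have L0 := small_L2 FF sm; case: sm => Lz Hw.
have [g1 Hg1] := choice (fun j => Hw 1%N j isT).
have [g2 Hg2] := choice (fun j => Hw 2%N j isT).
pose eta := e / (2 * C); have eta0 : 0 < eta by rewrite divr_gt0// mulr_gt0.
have N1 : \forall t \near F, forall j, (\int[mu7]_(x in ball7 r) (sqmod (g1 j t x))%:E <= eta%:E)%E.
  by apply: filter_forall => j; have [_ H] := Hg1 j; exact: H.
have N2 : \forall t \near F, forall j, (\int[mu7]_(x in ball7 r) (sqmod (g2 j t x))%:E <= eta%:E)%E.
  by apply: filter_forall => j; have [_ H] := Hg2 j; exact: H.
apply: filterS3 (L0 _ eta0) N1 N2 => t I0 I1 I2 y yr.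
have /L2P[l1 l2] := Lz t.
have Lg1 j : L2 r (g1 j t) by have [H _] := Hg1 j; case: (H t).
have Lg2 j : L2 r (g2 j t) by have [H _] := Hg2 j; case: (H t).
have [i1 i2] := re_le_sqmod (Lz t) I0.
have eE : C * eta = e / 2 by rewrite /eta; field; exact: lt0r_neq0.
have A := HC (fun y => Re (z t y)) (fun y => Re (z' t y)) (fun y => Re (z'' t y)) (fun y => Re (z''' t y))
  (fun y h => proj1 (d0 t y h)) (fun y h => proj1 (d1 t y h)) (fun y h => proj1 (d2 t y h)) l1
  (fun j => reu (g1 j t)) (fun j => reu (g2 j t)) _ _ eta i1 _ _ y yr.
have B := HC (fun y => Im (z t y)) (fun y => Im (z' t y)) (fun y => Im (z'' t y)) (fun y => Im (z''' t y))
  (fun y h => proj2 (d0 t y h)) (fun y h => proj2 (d1 t y h)) (fun y h => proj2 (d2 t y h)) l2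
  (fun j => imu (g1 j t)) (fun j => imu (g2 j t)) _ _ eta i2 _ _ y yr.
have [a1 a2] : Re (z t y) ^+ 2 <= C * eta /\ Re (z' t y) ^+ 2 <= C * eta.
  apply: A => j.
  - by have /L2P[] := Lg1 j; have [/(_ t)/weakP[]] := Hg1 j.
  - by have /L2P[] := Lg2 j; have [/(_ t)/weakP[]] := Hg2 j.
  - by have [] := re_le_sqmod (Lg1 j) (I1 j).
  - by have [] := re_le_sqmod (Lg2 j) (I2 j).
have [b1 b2] : Im (z t y) ^+ 2 <= C * eta /\ Im (z' t y) ^+ 2 <= C * eta.
  apply: B => j.
  - by have /L2P[] := Lg1 j; have [/(_ t)/weakP[]] := Hg1 j.
  - by have /L2P[] := Lg2 j; have [/(_ t)/weakP[]] := Hg2 j.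
  - by have [] := re_le_sqmod (Lg1 j) (I1 j).
  - by have [] := re_le_sqmod (Lg2 j) (I2 j).
by rewrite [e]splitr -eE /sqmod; split; apply: lerD.
Qed.

Lemma HR_cvg_small r (u : nat -> pairfun R) f : HR_cvg r u f ->
  small \oo r (fun n => lift7 ((u n).1 - f.1)) /\ small \oo r (fun n => lift7 ((u n).2 - f.2)).
Proof.
move=> [Hu Hf c]; have Hd n := HR_sub (Hu n) Hf.
have n0 k (w : M7 -> R[i]) : 0 <= Hk_norm k r w by exact: sqrtr_ge0.
have sq_le (a b : R) : 0 <= a -> 0 <= b -> a <= Num.sqrt (a ^+ 2 + b ^+ 2).
  by move=> a0 b0; rewrite -[X in X <= _](ger0_norm a0) -sqrtr_sqr ler_wsqrtr// lerDl sqr_ge0.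
have sq_le' (a b : R) : 0 <= a -> 0 <= b -> b <= Num.sqrt (a ^+ 2 + b ^+ 2).
  by move=> a0 b0; rewrite addrC; exact: sq_le.
split.
  apply: (@Hk_small 6) => // [n|]; first by have [] := Hd n.
  apply: (squeeze_cvgr _ (cvg_cst 0) c); near=> n; rewrite n0/=; exact: (sq_le _ _ (n0 _ _) (n0 _ _)).
apply: (@Hk_small 5) => // [n|]; first by have [] := Hd n.
apply: (squeeze_cvgr _ (cvg_cst 0) c); near=> n; rewrite n0/=; exact: (sq_le' _ _ (n0 _ _) (n0 _ _)).
Unshelve. all: by end_near. Qed.

End Small.

(** * Uniform limits, their derivatives and their one-sided limits *)

Section UniformLimits.
Context {R : realType}.
Local Notation Re := (@complex.Re R).
Local Notation Im := (@complex.Im R).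
Implicit Types (y r a b : R).

(** An l1 norm instead of the modulus: it takes values in R, is submultiplicative and splits into
    components. *)
Definition nz (z : R[i]) : R := `|Re z| + `|Im z|.

Lemma nz_ge0 (z : R[i]) : 0 <= nz z.
Proof. exact: addr_ge0. Qed.

Lemma nz_D (z w : R[i]) : nz (z + w) <= nz z + nz w.
Proof.
rewrite /nz ReD ImD; have := ler_normD (Re z) (Re w); have := ler_normD (Im z) (Im w).
by move=> h1 h2; rewrite addrACA; exact: lerD.
Qed.

Lemma nz_N (z : R[i]) : nz (- z) = nz z.
Proof. by rewrite /nz ReN ImN !normrN. Qed.

Lemma nz_M (z w : R[i]) : nz (z * w) <= nz z * nz w.
Proof.
rewrite /nz Re_mul Im_mul mulrDl !mulrDr.
have h1 := ler_normB (Re z * Re w) (Im z * Im w).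
have h2 := ler_normD (Re z * Im w) (Im z * Re w).
by rewrite !normrM in h1 h2; lra_ctx.
Qed.

Lemma nz_real (a : R) z : nz (a%:C%C * z) = `|a| * nz z.
Proof. by rewrite /nz Re_mul Im_mul /= !mul0r subr0 addr0 !normrM mulrDr. Qed.

Lemma nz_eq0 (z : R[i]) : nz z = 0 -> z = 0.
Proof.
rewrite /nz => H; have h1 := normr_ge0 (Re z); have h2 := normr_ge0 (Im z).
apply/complexP; split; apply/eqP; rewrite -normr_eq0; apply/eqP => /=; lra_ctx.
Qed.

Lemma sqmod_nz (z : R[i]) e : 0 <= e -> sqmod z <= (e / 2) ^+ 2 -> nz z <= e.
Proof.
move=> e0; rewrite /sqmod /nz => H.
have h1 := sqr_ge0 (Re z); have h2 := sqr_ge0 (Im z).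
have e20 : 0 <= e / 2 by lra_ctx.
have k (x : R) : x ^+ 2 <= (e / 2) ^+ 2 -> `|x| <= e / 2.
  by move=> h; rewrite -(@ler_pXn2r _ 2)// ?nnegrE// real_normK ?num_real.
by rewrite [e]splitr; apply: lerD; apply: k; lra_ctx.
Qed.

Lemma real_cauchy (a : nat -> R) :
  (forall e, 0 < e -> exists N, forall n m, (N <= n)%N -> (N <= m)%N -> `|a n - a m| <= e) ->
  exists l, forall e, 0 < e -> exists N, forall n, (N <= n)%N -> `|a n - l| <= e.
Proof.
move=> H.
have C : cvg (a @ \oo).
  apply: cauchy_cvg; apply: cauchy_exP => e e0.
  have e20 : 0 < e / 2 by rewrite divr_gt0.
  have [N HN] := H _ e20; exists (a N); exists N => // n /= nn.
  by rewrite /ball/=; apply: le_lt_trans (HN N n (leqnn N) nn) _; lra_ctx.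
exists (lim (a @ \oo)) => e e0.
move/cvgrPdist_le : C => /(_ _ e0) [N _ HN]; exists N => n nn.
by rewrite distrC; exact: HN.
Qed.

Lemma cauchy_complex (a : nat -> R[i]) :
  (forall e, 0 < e -> exists N, forall n m, (N <= n)%N -> (N <= m)%N -> nz (a n - a m) <= e) ->
  exists l, forall e, 0 < e -> exists N, forall n, (N <= n)%N -> nz (a n - l) <= e.
Proof.
move=> H.
have [|l1 H1] := @real_cauchy (fun n => Re (a n)).
  move=> e /H[N HN]; exists N => n m nn mm; apply: le_trans (HN n m nn mm).
  by rewrite /nz ReD ReN lerDl.
have [|l2 H2] := @real_cauchy (fun n => Im (a n)).
  move=> e /H[N HN]; exists N => n m nn mm; apply: le_trans (HN n m nn mm).
  by rewrite /nz ImD ImN lerDr.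
exists (Complex l1 l2) => e e0; have e20 : 0 < e / 2 by rewrite divr_gt0.
have [N1 K1] := H1 _ e20; have [N2 K2] := H2 _ e20.
exists (maxn N1 N2) => n; rewrite geq_max => /andP[n1 n2].
by rewrite /nz ReD ReN ImD ImN /= [e]splitr lerD ?K1 ?K2.
Qed.

(** Uniformity holds up to the outer end r but only away from 0; this is what gives limits at the
    boundary. *)
Definition unif_cauchy r (v : nat -> R -> R[i]) : Prop := forall eps e, 0 < eps < r -> 0 < e ->
  exists N, forall n m, (N <= n)%N -> (N <= m)%N -> forall y, eps <= y < r -> nz (v n y - v m y) <= e.

Definition uconv r (v : nat -> R -> R[i]) (F : R -> R[i]) : Prop := forall eps e, 0 < eps < r -> 0 < e ->
  exists N, forall n, (N <= n)%N -> forall y, eps <= y < r -> nz (v n y - F y) <= e.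

Lemma unif_cauchy_conv r v : unif_cauchy r v -> exists F, uconv r v F.
Proof.
move=> H.
have L y : exists l, 0 < y < r -> forall e, 0 < e -> exists N, forall n, (N <= n)%N -> nz (v n y - l) <= e.
  have [yr|yr] := pselect (0 < y < r); last by exists 0.
  have [e /(H y e yr)[N HN]|l Hl] := @cauchy_complex (fun n => v n y).
    by exists N => n m nn mm; apply: HN => //; case/andP: yr => _ ->; rewrite lexx.
  by exists l.
have [F HF] := choice L; exists F => eps e er e0.
have e20 : 0 < e / 2 by rewrite divr_gt0.
have [N HN] := H eps _ er e20; exists N => n nn y yr.
have y0r : 0 < y < r by case/andP: er => h1 h2; case/andP: yr => h3 ->; rewrite (lt_le_trans h1).
have [M HM] := HF y y0r _ e20.
have -> : v n y - F y = (v n y - v (maxn N M) y) + (v (maxn N M) y - F y) by rewrite subrKA.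
apply: le_trans (nz_D _ _) _; rewrite [e]splitr; apply: lerD.
  by apply: HN => //; rewrite leq_maxl.
by apply: HM; rewrite leq_maxr.
Qed.

Lemma uconvD r v w F G : uconv r v F -> uconv r w G ->
  uconv r (fun n y => v n y + w n y) (fun y => F y + G y).
Proof.
move=> hv hw eps e er e0; have e20 : 0 < e / 2 by rewrite divr_gt0.
have [N1 H1] := hv _ _ er e20; have [N2 H2] := hw _ _ er e20.
exists (maxn N1 N2) => n; rewrite geq_max => /andP[n1 n2] y yr.
have -> : v n y + w n y - (F y + G y) = (v n y - F y) + (w n y - G y) by ring.
by apply: le_trans (nz_D _ _) _; rewrite [e]splitr lerD ?H1 ?H2.
Qed.

Lemma uconvZ r (c : R[i]) v F : uconv r v F -> uconv r (fun n y => c * v n y) (fun y => c * F y).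
Proof.
move=> hv eps e er e0; have c1 : 0 < nz c + 1 by rewrite ltr_wpDl// nz_ge0.
have ec : 0 < e / (nz c + 1) by rewrite divr_gt0.
have [N H] := hv _ _ er ec; exists N => n nn y yr.
rewrite -mulrBr; apply: le_trans (nz_M _ _) _.
apply: (@le_trans _ _ ((nz c + 1) * (e / (nz c + 1)))).
  by apply: ler_pM; rewrite ?nz_ge0//; [rewrite lerDl|exact: H].
by rewrite mulrCA mulfV ?mulr1// gt_eqF.
Qed.

Lemma uconv_ext r v w F G : (forall n y, 0 < y < r -> v n y = w n y) -> (forall y, 0 < y < r -> F y = G y) ->
  uconv r v F -> uconv r w G.
Proof.
move=> vw FG hv eps e er e0; have [N H] := hv eps e er e0; exists N => n nn y yr.
have y0r : 0 < y < r by case/andP: er => h1 h2; case/andP: yr => h3 ->; rewrite (lt_le_trans h1).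
by rewrite -vw// -FG//; exact: H.
Qed.

Lemma uconv_pt r v F y : 0 < y < r -> uconv r v F ->
  forall e, 0 < e -> exists N, forall n, (N <= n)%N -> nz (v n y - F y) <= e.
Proof.
move=> yr H e /(H y e yr)[N HN]; exists N => n nn; apply: HN => //.
by case/andP: yr => _ ->; rewrite lexx.
Qed.

Lemma lip_itv a b (f f' : R -> R) M :
  (forall x : R, a < x < b -> is_derive x (1 : R) f (f' x)) ->
  (forall x, a < x < b -> `|f' x| <= M) ->
  forall x y, a < x < b -> a < y < b -> `|f y - f x| <= M * `|y - x|.
Proof.
move=> df fM.
have W x y : a < x < b -> a < y < b -> x <= y -> `|f y - f x| <= M * `|y - x|.
  move=> /andP[x1 x2] /andP[y1 y2] xy.
  have [z|z|c] := @MVT_segment R f f' x y xy.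
  - rewrite in_itv/= => /andP[z1 z2]; apply: df; apply/andP; split; lra_ctx.
  - by apply: (@der_within _ _ _ _ f') => u /andP[u1 u2]; apply: df; apply/andP; split; lra_ctx.
  rewrite in_itv/= => /andP[c1 c2] ->; rewrite normrM; apply: ler_wpM2r => //.
  by apply: fM; apply/andP; split; lra_ctx.
move=> x y hx hy; have [xy|/ltW yx] := leP x y; first exact: W.
by rewrite distrC [`|y - x|]distrC; exact: W.
Qed.

(** The mean value inequality for [f n - f m], followed by m to infinity, compares the difference
    quotients of [f n] and [G] uniformly. *)
Lemma der_limit a b (f f' : nat -> R -> R) (G H : R -> R) :
  (forall n (x : R), a < x < b -> is_derive x (1 : R) (f n) (f' n x)) ->
  (forall x, a < x < b -> forall e, 0 < e -> exists N, forall n, (N <= n)%N -> `|f n x - G x| <= e) ->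
  (forall e, 0 < e -> exists N, forall n, (N <= n)%N -> forall x, a < x < b -> `|f' n x - H x| <= e) ->
  forall x : R, a < x < b -> is_derive x (1 : R) G (H x).
Proof.
move=> df cG cH x xab.
have key e : 0 < e -> exists N, forall n, (N <= n)%N -> forall y, a < y < b ->
    `|(f n y - f n x) - (G y - G x)| <= e * `|y - x|.
  move=> e0; have e20 : 0 < e / 2 by rewrite divr_gt0.
  have [N HN] := cH _ e20; exists N => n nn y yab.
  have L m : (N <= m)%N -> `|(f n y - f n x) - (f m y - f m x)| <= e * `|y - x|.
    move=> mm; have := @lip_itv a b (fun z => f n z - f m z) (fun z => f' n z - f' m z) e _ _ x y xab yab.
    rewrite (_ : f n y - f m y - (f n x - f m x) = f n y - f n x - (f m y - f m x)); last by ring.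
    apply.
      by move=> z zab; apply: derB; exact: df.
    move=> z zab; rewrite (_ : f' n z - f' m z = (f' n z - H z) - (f' m z - H z)); last by ring.
    by apply: le_trans (ler_normB _ _) _; rewrite [e]splitr lerD ?HN.
  apply/ler_addgt0Pr => d d0; have d20 : 0 < d / 2 by rewrite divr_gt0.
  have [N1 H1] := cG y yab _ d20; have [N2 H2] := cG x xab _ d20.
  pose m := maxn N (maxn N1 N2).
  have m1 : (N1 <= m)%N by rewrite /m !leq_max leqnn !orbT.
  have m2 : (N2 <= m)%N by rewrite /m !leq_max leqnn !orbT.
  have m3 : (N <= m)%N by rewrite /m leq_max leqnn.
  rewrite (_ : _ - (G y - G x) = (f n y - f n x - (f m y - f m x)) + ((f m y - G y) - (f m x - G x))); last by ring.
  apply: le_trans (ler_normD _ _) _; apply: lerD; first exact: L.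
  by apply: le_trans (ler_normB _ _) _; rewrite [d]splitr lerD ?H1 ?H2.
have C : (fun h => h^-1 *: ((G \o shift x) (h *: (1 : R)) - G x)) @ 0^' --> H x.
  apply/cvgrPdist_le => e e0.
  have e30 : 0 < e / 3 by rewrite divr_gt0.
  have [N1 K1] := key _ e30; have [N2 K2] := cH _ e30.
  pose n := maxn N1 N2.
  have [h1 h2] := df n x xab.
  have := cvg_toP h1 h2 => /cvgrPdist_le /(_ _ e30) D.
  have sh : \forall h \near 0^', a < h + x < b.
    have /andP[x1 x2] := xab.
    apply/nbhs_ballP; exists (Num.min (x - a) (b - x)); first by rewrite /= lt_min !subr_gt0 x1.
    move=> h; rewrite /ball/= sub0r normrN lt_min => /andP[/ltr_normlP[h3 h4] /ltr_normlP[h5 h6]] _.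
    by apply/andP; split; lra_ctx.
  near=> h.
  have h0 : h != 0 by near: h; exact: nbhs_dnbhs_neq.
  have D1 : `|f' n x - h^-1 *: ((f n \o shift x) (h *: (1 : R)) - f n x)| <= e / 3 by near: h.
  have hx : a < h + x < b by near: h.
  move: D1; rewrite /= [h *: (1 : R)]mulr1.
  have K := K1 n (leq_maxl _ _) (h + x) hx; rewrite addrK in K.
  have K' : `|h^-1 * (f n (h + x) - f n x) - h^-1 * (G (h + x) - G x)| <= e / 3.
    by rewrite -mulrBr normrM normfV mulrC ler_pdivrMr ?normr_gt0.
  have K3 := K2 n (leq_maxr _ _) x xab.
  rewrite /GRing.scale/= => D1.
  rewrite (_ : H x - _ = (f' n x - h^-1 * (f n (h + x) - f n x)) +
    (h^-1 * (f n (h + x) - f n x) - h^-1 * (G (h + x) - G x)) - (f' n x - H x)); last by ring.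
  apply: le_trans (ler_normB _ _) _.
  have -> : e = e / 3 + e / 3 + e / 3 by field.
  by apply: lerD => //; apply: le_trans (ler_normD _ _) _; exact: lerD.
split; first by apply/cvg_ex; exists (H x).
by apply/cvg_lim.
Unshelve. all: by end_near. Qed.

Lemma cder_limit a b (f f' : nat -> R -> R[i]) (G H : R -> R[i]) :
  (forall n x, a < x < b -> cder (f n) x (f' n x)) ->
  (forall x, a < x < b -> forall e, 0 < e -> exists N, forall n, (N <= n)%N -> nz (f n x - G x) <= e) ->
  (forall e, 0 < e -> exists N, forall n, (N <= n)%N -> forall x, a < x < b -> nz (f' n x - H x) <= e) ->
  forall x, a < x < b -> cder G x (H x).
Proof.
move=> df cG cH x xab; split.
  apply: (@der_limit a b (fun n y => Re (f n y)) (fun n y => Re (f' n y)) (fun y => Re (G y)) (fun y => Re (H y))) => //.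
  - by move=> n z /(df n)[].
  - move=> z zab e /(cG z zab)[N HN]; exists N => n /HN; apply: le_trans.
    by rewrite /nz ReD ReN lerDl.
  - move=> e /cH[N HN]; exists N => n nn z /(HN n nn); apply: le_trans.
    by rewrite /nz ReD ReN lerDl.
apply: (@der_limit a b (fun n y => Im (f n y)) (fun n y => Im (f' n y)) (fun y => Im (G y)) (fun y => Im (H y))) => //.
- by move=> n z /(df n)[].
- move=> z zab e /(cG z zab)[N HN]; exists N => n /HN; apply: le_trans.
  by rewrite /nz ImD ImN lerDr.
- move=> e /cH[N HN]; exists N => n nn z /(HN n nn); apply: le_trans.
  by rewrite /nz ImD ImN lerDr.
Qed.

Definition cleft (f : R -> R[i]) y (l : R[i]) : Prop :=
  forall e, 0 < e -> exists2 d, 0 < d & forall z, y - d < z < y -> nz (f z - l) < e.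

(** Interchange of limits: the left limits of the approximants form a Cauchy sequence. The case y =
    r is included, which serves the light cone when r = 1/2. *)
Lemma cleft_uconv r v F y (l : nat -> R[i]) : 0 < y <= r -> uconv r v F -> (forall n, cleft (v n) y (l n)) ->
  exists l', cleft F y l'.
Proof.
move=> /andP[y0 yr] H hl.
have er : 0 < y / 2 < r by apply/andP; split; lra_ctx.
have near2 n e : 0 < e -> exists2 d, 0 < d <= y / 2 & forall z, y - d < z < y -> nz (v n z - l n) < e.
  move=> e0; have [d d0 Hd] := hl n e e0; exists (Num.min d (y / 2)).
    by rewrite lt_min d0 ge_min lexx orbT andbT divr_gt0.
  move=> z /andP[z1 z2]; apply: Hd; rewrite z2 andbT; apply: le_lt_trans z1.
  by rewrite lerD2l lerN2 ge_min lexx.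
have C e : 0 < e -> exists N, forall n m, (N <= n)%N -> (N <= m)%N -> nz (l n - l m) <= e.
  move=> e0; have e40 : 0 < e / 4 by rewrite divr_gt0.
  have [N HN] := H _ _ er e40; exists N => n m nn mm.
  have [d1 /andP[d10 d1y] D1] := near2 n _ e40; have [d2 /andP[d20 d2y] D2] := near2 m _ e40.
  pose d := Num.min d1 d2; have d0 : 0 < d by rewrite lt_min d10 d20.
  have dd1 : d <= d1 by rewrite ge_min lexx.
  have dd2 : d <= d2 by rewrite ge_min lexx orbT.
  pose z := y - d / 2.
  have zr : y / 2 <= z < r by rewrite /z; apply/andP; split; lra_ctx.
  have A1 : nz (v n z - l n) < e / 4 by apply: D1; rewrite /z; apply/andP; split; lra_ctx.
  have A2 : nz (v m z - l m) < e / 4 by apply: D2; rewrite /z; apply/andP; split; lra_ctx.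
  have A3 := HN n nn z zr; have A4 := HN m mm z zr.
  have -> : l n - l m = - (v n z - l n) + ((v n z - F z) + (- (v m z - F z) + (v m z - l m))) by ring.
  apply: le_trans (nz_D _ _) _; rewrite nz_N.
  have := nz_D (v n z - F z) (- (v m z - F z) + (v m z - l m)).
  have := nz_D (- (v m z - F z)) (v m z - l m); rewrite nz_N; lra_ctx.
have [l' Hl'] := cauchy_complex C; exists l' => e e0.
have e30 : 0 < e / 3 by rewrite divr_gt0.
have [N1 K1] := H _ _ er e30; have [N2 K2] := Hl' _ e30.
pose n := maxn N1 N2; have [d /andP[d0 dy] D] := near2 n _ e30.
exists d => // z zy; have zr : y / 2 <= z < r by case/andP: zy => z1 z2; apply/andP; split; lra_ctx.
have A1 := K1 n (leq_maxl _ _) z zr; have A2 := K2 n (leq_maxr _ _); have A3 := D z zy.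
have -> : F z - l' = - (v n z - F z) + ((v n z - l n) + (l n - l')) by ring.
apply: le_lt_trans (nz_D _ _) _; rewrite nz_N.
have := nz_D (v n z - l n) (l n - l'); lra_ctx.
Qed.

End UniformLimits.

(** * Repeated differentiability on (0, r) of the coefficients and of their products *)

Section Differentiability.
Context {R : realType}.
Variable r : R.

(** The sup bounds ask for three classical derivatives of functions such as the second row of
    [Ltilde]; this predicate yields them from closure properties. *)
Fixpoint rdif (n : nat) (f : R -> R) : Prop := if n is m.+1 then
  exists f', (forall y : R, 0 < y < r -> is_derive y (1 : R) f (f' y)) /\ rdif m f' else True.

Fixpoint cdif (n : nat) (f : R -> R[i]) : Prop := if n is m.+1 then
  exists f', (forall y : R, 0 < y < r -> cder f y (f' y)) /\ cdif m f' else True.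

Lemma rdifW n f : rdif n.+1 f -> rdif n f.
Proof.
elim: n f => // n IH f [f' [df Hf']]; exists f'; split=> //; exact: IH.
Qed.

Lemma cdifW n f : cdif n.+1 f -> cdif n f.
Proof.
elim: n f => // n IH f [f' [df Hf']]; exists f'; split=> //; exact: IH.
Qed.

Lemma rdif_cst n c : rdif n (fun=> c).
Proof.
elim: n c => // n IH c; exists (fun=> 0); split=> // y _; exact: der_cst.
Qed.

Lemma rdif_id n : rdif n (fun y => y).
Proof.
case: n => // n; exists (fun=> 1); split; last exact: rdif_cst.
by move=> y _; exact: der_id.
Qed.

Lemma rdifD n f g : rdif n f -> rdif n g -> rdif n (fun y => f y + g y).
Proof.
elim: n f g => // n IH f g [f' [df Hf]] [g' [dg Hg]].
exists (fun y => f' y + g' y); split; last exact: IH.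
by move=> y yr; apply: derD; [exact: df|exact: dg].
Qed.

Lemma rdifM n f g : rdif n f -> rdif n g -> rdif n (fun y => f y * g y).
Proof.
elim: n f g => // n IH f g Df Dg; have Wf := rdifW Df; have Wg := rdifW Dg.
case: Df => f' [df Hf]; case: Dg => g' [dg Hg].
exists (fun y => f' y * g y + f y * g' y); split; last by apply: rdifD; exact: IH.
by move=> y yr; apply: derM; [exact: df|exact: dg].
Qed.

Lemma rdifN n f : rdif n f -> rdif n (fun y => - f y).
Proof.
move=> Df; rewrite (_ : (fun y => _) = (fun y => -1 * f y)); last by apply/funext => y; rewrite mulN1r.
by apply: rdifM Df; exact: rdif_cst.
Qed.

Lemma rdifX n f k : rdif n f -> rdif n (fun y => f y ^+ k).
Proof.
move=> Df; elim: k => [|k IH]; first exact: rdif_cst.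
rewrite (_ : (fun y => _) = (fun y => f y * f y ^+ k)); last by apply/funext => y; rewrite exprS.
exact: rdifM.
Qed.

Lemma rdifV n f : (forall y, 0 < y < r -> f y != 0) -> rdif n f -> rdif n (fun y => (f y)^-1).
Proof.
move=> f0; elim: n => // n IH Df; have Wf := rdifW Df; case: Df => f' [df Hf].
exists (fun y => - (f' y * ((f y)^-1 * (f y)^-1))); split.
  move=> y yr; have := derV (f0 y yr) (df y yr); apply: der_eq.
  by rewrite expr2 invfM mulNr.
by apply: rdifN; apply: rdifM => //; apply: rdifM; exact: IH.
Qed.

Lemma rdif_sq n : rdif n (@sq R).
Proof.
elim: n => // n IH; exists (fun y => y * (sq y)^-1); split; first by move=> y _; exact: der_sq.
apply: rdifM; [exact: rdif_id|apply: rdifV => // y _; exact: lt0r_neq0 (sq_gt0 y)].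
Qed.

Lemma rdif_ext n f g : (forall y, 0 < y < r -> f y = g y) -> rdif n f -> rdif n g.
Proof.
case: n => // n fg [f' [df Hf]]; exists f'; split=> // y yr.
apply: der_ext (df y yr); apply: filterS (near_oo yr); exact: fg.
Qed.

Lemma rdif_cont f y : 0 < y < r -> rdif 1 f -> {for y, continuous f}.
Proof. by move=> yr [f' [/(_ y yr) df _]]; exact: der_cont df. Qed.

Ltac rdif_tac := repeat first
  [ exact: rdif_cst | exact: rdif_sq | exact: rdif_id | apply: rdifX
  | apply: rdifD | apply: rdifN | apply: rdifM ].

Lemma rdif_dn n : rdif n (@dn R).
Proof. rewrite /dn; rdif_tac. Qed.

Lemma rdif_c12 n : rdif n c12.
Proof.
apply: (@rdif_ext n (fun y => (3 - 2 * sq y) * sq y ^+ 2)); first by move=> y _; rewrite c12E.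
by rdif_tac.
Qed.

Lemma rdif_c21 n : rdif n c21.
Proof.
apply: (@rdif_ext n (fun y => - 2 * y * sq y)); first by move=> y _; rewrite c21E.
by rdif_tac.
Qed.

Lemma rdif_sqm1V n : rdif n (fun y => (sq y - 1)^-1).
Proof. by apply: rdifV => [y _|]; [exact: sqm1_neq0|rdif_tac]. Qed.

Lemma rdif_c20 n : rdif n c20.
Proof.
have H := rdif_sqm1V n.
apply: (@rdif_ext n (fun y => 7 - 6 * sq y - 1 * (sq y - 1)^-1)); last by rdif_tac.
move=> y /andP[y0 _]; rewrite c20E//; exact: lt0r_neq0.
Qed.

Lemma rdif_c11 n : rdif n c11.
Proof.
have H := rdif_sqm1V n.
have Hi : rdif n (fun y => y^-1).
  by apply: rdifV; [move=> y /andP[/lt0r_neq0]|exact: rdif_id].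
apply: (@rdif_ext n (fun y => (3 - 2 * sq y) * (6 * sq y ^+ 2 * y^-1 - y * (sq y - 1)^-1) + 4 * y * sq y)).
  by move=> y /andP[y0 _]; rewrite c11E//; exact: lt0r_neq0.
by rdif_tac.
Qed.

Lemma rdif_V n : rdif n V.
Proof.
have H : rdif n (fun y => (dn y ^+ 2)^-1).
  apply: rdifV => [y _|]; first by rewrite expf_neq0// lt0r_neq0// dn_gt0.
  by apply: rdifX; exact: rdif_dn.
apply: (@rdif_ext n (fun y => 96 * (sq y - 1) ^+ 2 * (21 * (sq y - 2) ^+ 2 - 5 * (sq y ^+ 2 - 2)) * (dn y ^+ 2)^-1)).
  by move=> y _; rewrite VE.
by rdif_tac.
Qed.

Lemma cdif_cst n c : cdif n (fun=> c).
Proof.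
elim: n c => // n IH c; exists (fun=> 0); split=> // y _; exact: cder_cst.
Qed.

Lemma cdifD n f g : cdif n f -> cdif n g -> cdif n (fun y => f y + g y).
Proof.
elim: n f g => // n IH f g [f' [df Hf]] [g' [dg Hg]].
exists (fun y => f' y + g' y); split; last exact: IH.
by move=> y yr; apply: cderD; [exact: df|exact: dg].
Qed.

Lemma cdifM n f g : cdif n f -> cdif n g -> cdif n (fun y => f y * g y).
Proof.
elim: n f g => // n IH f g Df Dg; have Wf := cdifW Df; have Wg := cdifW Dg.
case: Df => f' [df Hf]; case: Dg => g' [dg Hg].
exists (fun y => f' y * g y + f y * g' y); split; last by apply: cdifD; exact: IH.
by move=> y yr; apply: cderM; [exact: df|exact: dg].
Qed.

Lemma cdifN n f : cdif n f -> cdif n (fun y => - f y).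
Proof.
move=> Df; rewrite (_ : (fun y => _) = (fun y => -1 * f y)); last by apply/funext => y; rewrite mulN1r.
by apply: cdifM Df; exact: cdif_cst.
Qed.

Lemma cdif_real n f : rdif n f -> cdif n (fun y => (f y)%:C%C).
Proof.
elim: n f => // n IH f [f' [df Hf]]; exists (fun y => (f' y)%:C%C); split; last exact: IH.
by move=> y yr; apply: cder_real; exact: df.
Qed.

Lemma cdif_smooth n k f : smooth_in r f -> cdif n (cderivn_in r k f).
Proof.
move=> sf; elim: n k => // n IH k; exists (cderivn_in r k.+1 f); split=> // y yr.
exact: smooth_in_cder.
Qed.

End Differentiability.

(** * From Sobolev convergence to locally uniform convergence with one derivative *)

Section SmallSup.
Context {R : realType}.
Local Notation R7 := (R7 R).
Local Notation M7 := (M7 R).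
Local Notation mu7 := (@mu7 R).
Local Notation Re := (@complex.Re R).
Local Notation Im := (@complex.Im R).
Implicit Types (r : R).

Lemma small_nz (T : Type) (F : set_system T) (FF : Filter F) r eps (z z' : T -> R -> R[i]) :
  0 < eps < r -> small F r (fun t => lift7 (z t)) ->
  (forall t y, 0 < y < r -> cder (z t) y (z' t y)) -> (forall t, cdif r 2 (z' t)) ->
  forall e, 0 < e -> \forall t \near F, forall y, eps <= y < r -> nz (z t y) <= e /\ nz (z' t y) <= e.
Proof.
move=> er sm d0 d1 e e0.
have [z'' H''] := choice d1.
have [z''' H'''] := choice (fun t => proj2 (H'' t)).
have e20 : 0 < (e / 2) ^+ 2 by rewrite exprn_gt0// divr_gt0.
have := small_sup FF er sm d0 (fun t y h => proj1 (H'' t) y h) (fun t y h => proj1 (H''' t) y h) e20.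
by apply: filterS => t H y /H[h1 h2]; split; apply: sqmod_nz => //; exact: ltW.
Qed.

Lemma small_uconv0 r (z z' : nat -> R -> R[i]) : small \oo r (fun t => lift7 (z t)) ->
  (forall n y, 0 < y < r -> cder (z n) y (z' n y)) -> (forall n, cdif r 2 (z' n)) ->
  uconv r z (fun=> 0) /\ uconv r z' (fun=> 0).
Proof.
move=> sm d0 d1; split=> eps e er e0.
  have [N _ HN] := small_nz _ er sm d0 d1 e0; exists N => n nn y yr.
  by rewrite subr0; have [] := HN n nn y yr.
have [N _ HN] := small_nz _ er sm d0 d1 e0; exists N => n nn y yr.
by rewrite subr0; have [] := HN n nn y yr.
Qed.

(** The limit [f] has no classical derivatives, so it is eliminated: the differences of two
    approximants are small along the product filter. *)
Lemma small_unif_cauchy r (v v' : nat -> R -> R[i]) (f : R -> R[i]) :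
  small \oo r (fun n => lift7 (v n - f)) ->
  (forall n y, 0 < y < r -> cder (v n) y (v' n y)) -> (forall n, cdif r 2 (v' n)) ->
  unif_cauchy r v /\ unif_cauchy r v'.
Proof.
move=> sm d0 d1.
pose F2 := filter_prod (\oo : set_system nat) (\oo : set_system nat).
have FF2 : Filter F2 by exact: filter_prod_filter.
have s1 : small F2 r (fun t => lift7 (v t.1 - f)).
  apply: (@small_comp _ _ _ \oo F2 r (fun n => lift7 (v n - f)) fst) sm => P HP; exact: (cvg_fst HP).
have s2 : small F2 r (fun t => lift7 (v t.2 - f)).
  apply: (@small_comp _ _ _ \oo F2 r (fun n => lift7 (v n - f)) snd) sm => P HP; exact: (cvg_snd HP).
have s3 := small_lin FF2 1 (-1) s1 s2.
have {s1 s2}s3 : small F2 r (fun t => lift7 (fun y => v t.1 y - v t.2 y)).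
  move: s3; congr (small F2 r _); apply/funext => t; apply/funext => x.
  rewrite /lift7 mul1r mulN1r.
  rewrite (_ : (v t.1 - f) (norm7 x) = v t.1 (norm7 x) - f (norm7 x))//.
  by rewrite (_ : (v t.2 - f) (norm7 x) = v t.2 (norm7 x) - f (norm7 x))// opprB subrKA.
have d2 (t : nat * nat) y : 0 < y < r ->
    cder (fun y => v t.1 y - v t.2 y) y (v' t.1 y - v' t.2 y).
  by move=> yr; apply: cderB; exact: d0.
have d3 (t : nat * nat) : cdif r 2 (fun y => v' t.1 y - v' t.2 y).
  by apply: cdifD; [|apply: cdifN]; exact: d1.
have key eps e : 0 < eps < r -> 0 < e -> exists N, forall n m, (N <= n)%N -> (N <= m)%N ->
    forall y, eps <= y < r -> nz (v n y - v m y) <= e /\ nz (v' n y - v' m y) <= e.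
  move=> er e0; have [[A B] /= [[N1 _ h1] [N2 _ h2]] AB] := small_nz FF2 er s3 d2 d3 e0.
  exists (maxn N1 N2) => n m; rewrite !geq_max => /andP[n1 n2] /andP[m1 m2] y yr.
  by apply: (AB (n, m)) => //; split; [exact: h1|exact: h2].
split=> eps e er e0; have [N HN] := key eps e er e0; exists N => n m nn mm y yr;
  by have [] := HN n m nn mm y yr.
Qed.

(** On every shell the L2 limit and the uniform limit coincide; the shells exhaust the punctured
    ball. *)
Lemma small_ae r (v : nat -> R -> R[i]) (f G : R -> R[i]) :
  small \oo r (fun n => lift7 (v n - f)) -> L2 r (lift7 f) -> uconv r v G ->
  (forall y, 0 < y < r -> {for y, continuous (fun z => Re (G z))} /\ {for y, continuous (fun z => Im (G z))}) ->
  aeq r f G.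
Proof.
move=> sm Lf uc cG; have mB := @measurable_ball7 R r.
suff H a : 0 < a < r -> {ae mu7, forall x, shell a r x -> lift7 f x = lift7 G x}.
  have [r0|r0] := ltP 0 r; last first.
    apply: aeW => x Bx; have := lt_le_trans Bx r0; by rewrite ltNge norm7_ge0.
  have hk (k : nat) : 0 < r / k.+2%:R < r.
    by rewrite divr_gt0//= ltr_pdivrMr// ltr_pMr// ltr1n.
  have Q := @ae_off0 R (fun x => x != 0) (fun x h => h).
  apply: ae_imp (ae_and Q (@ae_countable R nat (fun k x => shell (r / k.+2%:R) r x -> lift7 f x = lift7 G x) (fun k => H _ (hk k)))) => x.
  move=> [x0 K] Bx.
  have n0 : 0 < norm7 x by rewrite lt_neqAle eq_sym norm7_eq0 x0 norm7_ge0.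
  pose k := Num.truncn (r / norm7 x); apply: (K k); rewrite /shell/= (Bx : _ < _) andbT.
  rewrite ltr_pdivrMr// mulrC -ltr_pdivrMr//.
  apply: lt_trans (truncnS_gt _) _; by rewrite ltr_nat.
move=> ar; have /andP[a0 ra] := ar.
have mS := @measurable_shell R a r.
have SB : shell a r `<=` ball7 r by exact: shell_ball.
pose q x := sqmod (lift7 G x - lift7 f x).
have mG : measurable_fun (shell a r) (fun x => Re (lift7 G x)) /\ measurable_fun (shell a r) (fun x => Im (lift7 G x)).
  split.
    apply: (@measurable_radial _ a r (fun y => Re (G y))) => y /andP[y1 y2].
    by have [] := cG y _; rewrite ?(lt_trans a0 y1).
  apply: (@measurable_radial _ a r (fun y => Im (G y))) => y /andP[y1 y2].
  by have [] := cG y _; rewrite ?(lt_trans a0 y1).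
have mf : measurable_fun (shell a r) (fun x => Re (lift7 f x)) /\ measurable_fun (shell a r) (fun x => Im (lift7 f x)).
  by case: Lf => m1 m2 _; split; apply: measurable_funS (SB) _.
have mq : measurable_fun (shell a r) q.
  rewrite /q /sqmod; apply: measurable_funD; apply: measurable_funX.
    rewrite (_ : (fun x => _) = (fun x => Re (lift7 G x) - Re (lift7 f x))); last by apply/funext => x; rewrite ReD ReN.
    by apply: measurable_funB; [case: mG|case: mf].
  rewrite (_ : (fun x => _) = (fun x => Im (lift7 G x) - Im (lift7 f x))); last by apply/funext => x; rewrite ImD ImN.
  by apply: measurable_funB; [case: mG|case: mf].
have V0 : 0 <= vol1 * r ^+ 7 by rewrite mulr_ge0 ?ltW ?vol1_gt0// exprn_gt0// (lt_trans a0).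
have I0 : (\int[mu7]_(x in shell a r) (q x)%:E = 0)%E.
  apply/eqP; rewrite eq_le integral_ge0 ?andbT; last by move=> x _; rewrite lee_fin sqmod_ge0.
  apply/lee_addgt0Pr => e e0; rewrite add0e.
  have e40 : 0 < e / 4 by rewrite divr_gt0.
  (* The bound 1 gives d^2 <= d, and the second bound keeps the contribution 2 d times the volume
     below e/2. *)
  pose d := Num.min 1 (e / (8 * (vol1 * r ^+ 7 + 1))).
  have W0 : 0 < 8 * (vol1 * r ^+ 7 + 1) by rewrite mulr_gt0// ltr_wpDl.
  have d0 : 0 < d by rewrite lt_min ltr01 divr_gt0.
  have [N1 _ H1] := small_L2 _ sm e40.
  have [N2 H2] := uc a d ar d0.
  pose n := maxn N1 N2.
  have {H1}H1 := H1 n (leq_maxl _ _); have {H2}H2 := H2 n (leq_maxr _ _).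
  have Lv : L2 r (lift7 (v n - f)) by case: sm.
  have ms := measurable_sqmod Lv.
  have dd : d ^+ 2 <= d.
    by rewrite expr2 ger_pMl// ge_min lexx.
  apply: (@le_trans _ _ (\int[mu7]_(x in shell a r) ((2 * d)%:E + 2%:E * (sqmod (lift7 (v n - f) x))%:E))%E).
    apply: ge0_le_integral => //.
    - by move=> x _; rewrite lee_fin sqmod_ge0.
    - exact/measurable_EFinP.
    - apply: emeasurable_funD => //; apply: emeasurable_funM => //; apply/measurable_EFinP.
      exact: measurable_funS ms.
    move=> x Sx; rewrite -EFinM -EFinD lee_fin /q.
    have -> : lift7 G x - lift7 f x = -1 * (lift7 (v n) x - lift7 G x) + 1 * lift7 (v n - f) x.
      rewrite mulN1r mul1r /lift7 (_ : (v n - f) (norm7 x) = v n (norm7 x) - f (norm7 x))//; ring.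
    have s1 : sqmod (1 : R[i]) = 1 by rewrite /sqmod /= expr1n expr0n addr0.
    have s2 : sqmod (-1 : R[i]) = 1 by rewrite /sqmod /= sqrrN expr1n oppr0 expr0n addr0.
    apply: le_trans (sqmod_lin _ _ _ _) _; rewrite s1 s2 !mul1r lerD2r ler_pM2l//.
    have yr : a <= norm7 x < r by case/andP: Sx => h1 h2; rewrite ltW.
    have := H2 _ yr; rewrite /sqmod /nz -/(lift7 (v n) x) -/(lift7 G x).
    set A := Re _; set B := Im _ => h.
    rewrite -[A ^+ 2]real_normK ?num_real// -[B ^+ 2]real_normK ?num_real//.
    apply: le_trans dd; have := normr_ge0 A; have := normr_ge0 B.
    move: h; move: (`|A|) (`|B|) => p p' h h1 h2; nra_ctx.
  rewrite ge0_integralD//; last 3 first.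
  - by move=> x _; rewrite lee_fin mulr_ge0// ltW.
  - by move=> x _; rewrite -EFinM lee_fin mulr_ge0// sqmod_ge0.
  - by apply: emeasurable_funM => //; apply/measurable_EFinP; exact: measurable_funS ms.
  rewrite integral_cst// ge0_integralZl_EFin//; last 2 first.
  - by move=> x _; rewrite lee_fin sqmod_ge0.
  - by apply/measurable_EFinP; exact: measurable_funS ms.
  have -> : e%:E = ((e / 2)%:E + (e / 2)%:E)%E by rewrite -EFinD -splitr.
  apply: leeD.
    apply: (@le_trans _ _ ((2 * d)%:E * (vol1 * r ^+ 7)%:E)%E).
      apply: lee_wpmul2l; first by rewrite lee_fin mulr_ge0// ltW.
      rewrite mulrC -mu7_ball ?(lt_trans a0)//; apply: le_measure; rewrite ?inE//.
    rewrite -EFinM lee_fin.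
    have : d <= e / (8 * (vol1 * r ^+ 7 + 1)) by rewrite ge_min lexx orbT.
    rewrite ler_pdivlMr// => h.
    have : d * (vol1 * r ^+ 7) <= d * (vol1 * r ^+ 7 + 1) by rewrite ler_pM2l// lerDl.
    lra_ctx.
  apply: (@le_trans _ _ (2%:E * (e / 4)%:E)%E).
    apply: lee_wpmul2l; first by rewrite lee_fin.
    apply: le_trans H1; apply: ge0_subset_integral => //; first exact/measurable_EFinP.
    by move=> x _; rewrite lee_fin sqmod_ge0.
  by rewrite -EFinM lee_fin; lra_ctx.
have I1 : (\int[mu7]_(x in shell a r) `|(EFin \o q) x| = 0)%E.
  by rewrite -[RHS]I0; apply: eq_integral => x _; rewrite gee0_abs// lee_fin sqmod_ge0.
have mE : measurable_fun (shell a r) (EFin \o q) by exact/measurable_EFinP.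
have := (ae_eq_integral_abs mu7 mS mE).1 I1.
apply: ae_imp => x H Sx; have := H Sx => -[] E.
have := sqr_ge0 (Re (lift7 G x - lift7 f x)); have := sqr_ge0 (Im (lift7 G x - lift7 f x)).
move: E; rewrite /q /sqmod => E p1 p2.
have e1 : Re (lift7 G x - lift7 f x) ^+ 2 = 0 by lra_ctx.
have e2 : Im (lift7 G x - lift7 f x) ^+ 2 = 0 by lra_ctx.
apply/eqP; rewrite eq_sym -subr_eq0; apply/eqP/complexP.
by split; apply/eqP; rewrite -sqrf_eq0; apply/eqP.
Qed.

End SmallSup.

(** * Eigenfunctions of the closure solve the differential equation classically *)

Section Classical.
Context {R : realType}.
Local Notation Re := (@complex.Re R).
Local Notation Im := (@complex.Im R).
Implicit Types (r y a b : R).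

Definition uco a b (v : nat -> R -> R[i]) (F : R -> R[i]) : Prop := forall e, 0 < e ->
  exists N, forall n, (N <= n)%N -> forall y, a < y < b -> nz (v n y - F y) <= e.

Lemma uconv_uco r a b v F : 0 < a < b -> b <= r -> uconv r v F -> uco a b v F.
Proof.
move=> /andP[a0 ab] br H e e0; have ar : 0 < a < r by rewrite a0 (lt_le_trans ab br).
have [N HN] := H a e ar e0; exists N => n nn y /andP[y1 y2]; apply: HN => //.
by rewrite ltW//= (lt_le_trans y2).
Qed.

Lemma ucoD a b (v w : nat -> R -> R[i]) F G : uco a b v F -> uco a b w G ->
  uco a b (fun n y => v n y + w n y) (fun y => F y + G y).
Proof.
move=> hv hw e e0; have e20 : 0 < e / 2 by rewrite divr_gt0.
have [N1 H1] := hv _ e20; have [N2 H2] := hw _ e20.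
exists (maxn N1 N2) => n; rewrite geq_max => /andP[n1 n2] y yr.
have -> : v n y + w n y - (F y + G y) = (v n y - F y) + (w n y - G y) by ring.
by apply: le_trans (nz_D _ _) _; rewrite [e]splitr lerD ?H1 ?H2.
Qed.

Lemma ucoN a b (v : nat -> R -> R[i]) F : uco a b v F -> uco a b (fun n y => - v n y) (fun y => - F y).
Proof.
move=> hv e e0; have [N H] := hv _ e0; exists N => n nn y yr.
by rewrite -opprD nz_N; exact: H.
Qed.

Lemma ucoM a b (k : R -> R) M (v : nat -> R -> R[i]) F : (forall y, a < y < b -> `|k y| <= M) ->
  uco a b v F -> uco a b (fun n y => (k y)%:C%C * v n y) (fun y => (k y)%:C%C * F y).
Proof.
move=> kM hv e e0; have M0 : 0 < `|M| + 1 by rewrite ltr_wpDl.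
have eM : 0 < e / (`|M| + 1) by rewrite divr_gt0.
have [N H] := hv _ eM; exists N => n nn y yr.
rewrite -mulrBr nz_real; apply: (@le_trans _ _ ((`|M| + 1) * (e / (`|M| + 1)))).
  apply: ler_pM; rewrite ?nz_ge0//; last exact: H.
  by apply: le_trans (kM y yr) _; apply: le_trans (ler_norm M) _; rewrite lerDl.
by rewrite mulrCA mulfV ?mulr1// gt_eqF.
Qed.

Lemma uco_ext a b (v w : nat -> R -> R[i]) F G :
  (forall n y, a < y < b -> v n y = w n y) -> (forall y, a < y < b -> F y = G y) ->
  uco a b v F -> uco a b w G.
Proof.
move=> vw FG hv e e0; have [N H] := hv e e0; exists N => n nn y yr.
by rewrite -vw// -FG//; exact: H.
Qed.

(** The first row of the eigenvalue equation says that the second component is (lam + 2) times the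
    first; this is the second row after that substitution, with F, P, Q for the value and two
    derivatives. *)
Definition eigen_ode (lam : R[i]) y (F P Q : R[i]) : Prop :=
  (c12 y)%:C%C * Q + (c11 y)%:C%C * P + (c20 y)%:C%C * ((lam + 2) * F)
  + (c21 y)%:C%C * ((lam + 2) * P) - 2 * ((lam + 2) * F) + (V y)%:C%C * F
  = lam * ((lam + 2) * F).

(** The first row ties the second component of the approximants to the first one in C^1; the second
    row then gives their second derivatives a uniform limit wherever [c12] does not vanish. At the
    light cone only C^1 regularity survives, hence the separate continuity of P and the one-sided
    limits up to y = r. *)
Lemma graph_classical r (lam : R[i]) (f : pairfun R) : 0 < r -> graph_L r f (cscale lam f) ->
  exists F P : R -> R[i],
  [/\ forall y, 0 < y < r -> cder F y (P y),
      forall y, 0 < y < r -> c12 y != 0 -> exists Q, cder P y Q /\ eigen_ode lam y (F y) (P y) Q,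
      forall y, 0 < y <= r -> exists l m, cleft F y l /\ cleft P y m,
      aeq r f.1 F & aeq r f.2 (fun y => (lam + 2) * F y)] /\
  forall y e, 0 < y < r -> 0 < e -> \forall z \near y, nz (P z - P y) <= e.
Proof.
move=> r0 [u [udom cu cLu]].
pose v n := (u n).1; pose w n := (u n).2.
pose v' n := cderivn_in r 1 (v n); pose v2 n := cderivn_in r 2 (v n); pose w' n := cderivn_in r 1 (w n).
have sv n : smooth_in r (v n) by have [[]] := udom n.
have sw n : smooth_in r (w n) by have [_ []] := udom n.
have dv n y : 0 < y < r -> cder (v n) y (v' n y) by exact: (smooth_in_cder 0 (sv n)).
have dv' n y : 0 < y < r -> cder (v' n) y (v2 n y) by exact: (smooth_in_cder 1 (sv n)).
have dw n y : 0 < y < r -> cder (w n) y (w' n y) by exact: (smooth_in_cder 0 (sw n)).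
have kv m n : cdif r m (v n) by exact: (cdif_smooth m 0 (sv n)).
have kv' m n : cdif r m (v' n) by exact: (cdif_smooth m 1 (sv n)).
have kv2 m n : cdif r m (v2 n) by exact: (cdif_smooth m 2 (sv n)).
have kw m n : cdif r m (w n) by exact: (cdif_smooth m 0 (sw n)).
have kw' m n : cdif r m (w' n) by exact: (cdif_smooth m 1 (sw n)).
pose A n y := w n y - 2 * v n y.
pose B n y := (c11 y)%:C%C * v' n y + (c12 y)%:C%C * v2 n y + (c20 y)%:C%C * w n y
          + (c21 y)%:C%C * w' n y - 2 * w n y + (V y)%:C%C * v n y.
have [S1 S2] := HR_cvg_small cu; have [S3 S4] := HR_cvg_small cLu.
have {}S1 : small \oo r (fun n => lift7 (v n - f.1)) by [].
have {}S2 : small \oo r (fun n => lift7 (w n - f.2)) by [].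
have {}S3 : small \oo r (fun n => lift7 (A n - (fun y => lam * f.1 y))) by [].
have {}S4 : small \oo r (fun n => lift7 (B n - (fun y => lam * f.2 y))) by [].
have [cv cv'] := small_unif_cauchy S1 dv (kv' 2%N).
have [F uF] := unif_cauchy_conv cv; have [P uP] := unif_cauchy_conv cv'.
(* First row of [Ltilde] minus lam, applied to the approximants: combining the two convergences
   eliminates f. *)
have SD : small \oo r (fun n => lift7 (fun y => A n y - lam * v n y)).
  have FFoo : Filter (\oo : set_system nat) by exact: _.
  have := small_lin FFoo 1 (- lam) S3 S1; congr (@small R nat _ r _); apply/funext => n; apply/funext => x.
  rewrite /lift7 (_ : (A n - (fun y => lam * f.1 y)) (norm7 x) = A n (norm7 x) - lam * f.1 (norm7 x))//.
  by rewrite (_ : (v n - f.1) (norm7 x) = v n (norm7 x) - f.1 (norm7 x))//; ring.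
have SB : small \oo r (fun n => lift7 (fun y => B n y - lam * w n y)).
  have FFoo : Filter (\oo : set_system nat) by exact: _.
  have := small_lin FFoo 1 (- lam) S4 S2; congr (@small R nat _ r _); apply/funext => n; apply/funext => x.
  rewrite /lift7 (_ : (B n - (fun y => lam * f.2 y)) (norm7 x) = B n (norm7 x) - lam * f.2 (norm7 x))//.
  by rewrite (_ : (w n - f.2) (norm7 x) = w n (norm7 x) - f.2 (norm7 x))//; ring.
have cZ m (c : R[i]) g : cdif r m g -> cdif r m (fun y => c * g y).
  by move=> Dg; apply: cdifM => //; exact: cdif_cst.
have dD n y : 0 < y < r -> cder (fun y => A n y - lam * v n y) y (w' n y - 2 * v' n y - lam * v' n y).
  by move=> yr; apply: cderB; [apply: cderB; [exact: dw|apply: cderZ; exact: dv]|apply: cderZ; exact: dv].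
have kD n : cdif r 2 (fun y => w' n y - 2 * v' n y - lam * v' n y).
  by apply: cdifD; [apply: cdifD => //|]; apply: cdifN; apply: cZ.
have [uD uD'] := small_uconv0 SD dD kD.
have kB n : cdif r 3 (fun y => B n y - lam * w n y).
  apply: cdifD; last by apply: cdifN; exact: cZ.
  apply: cdifD; last by apply: cdifM => //; apply: cdif_real; exact: rdif_V.
  apply: cdifD; last by apply: cdifN; exact: cZ.
  apply: cdifD; last by apply: cdifM => //; apply: cdif_real; exact: rdif_c21.
  apply: cdifD; last by apply: cdifM => //; apply: cdif_real; exact: rdif_c20.
  apply: cdifD; last by apply: cdifM => //; apply: cdif_real; exact: rdif_c12.
  by apply: cdifM => //; apply: cdif_real; exact: rdif_c11.
have [B' HB'] := choice kB.
have [uB _] := small_uconv0 SB (fun n => proj1 (HB' n)) (fun n => proj2 (HB' n)).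
have uw : uconv r w (fun y => (lam + 2) * F y).
  apply: uconv_ext (uconvD uD (uconvZ (lam + 2) uF)) => [n y _|y _]; last by rewrite add0r.
  by rewrite /A; ring.
have uw' : uconv r w' (fun y => (lam + 2) * P y).
  apply: uconv_ext (uconvD uD' (uconvZ (lam + 2) uP)) => [n y _|y _]; last by rewrite add0r.
  by ring.
have uBB : uconv r B (fun y => lam * ((lam + 2) * F y)).
  apply: uconv_ext (uconvD uB (uconvZ lam uw)) => [n y _|y _]; last by rewrite add0r.
  by ring.
have dF y : 0 < y < r -> cder F y (P y).
  move=> yr; have /andP[y0 y1] := yr.
  have h : 0 < y / 2 < r by apply/andP; split; lra_ctx.
  have sub z : y / 2 < z < r -> 0 < z < r by move=> /andP[z1 ->]; rewrite andbT; lra_ctx.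
  apply: (@cder_limit R (y / 2) r v v') => [n z /sub|z /sub zr||]; first exact: dv.
  - exact: uconv_pt uF.
  - exact: (uconv_uco h (lexx r) uP).
  - by apply/andP; split; lra_ctx.
exists F, P; split; last first.
  move=> y e yr e0; have e30 : 0 < e / 3 by rewrite divr_gt0.
  have [y0 y1] := andP yr.
  have hr : 0 < y / 2 < r by apply/andP; split; lra_ctx.
  have [N HN] := uP _ _ hr e30; have {}HN z := HN N (leqnn N) z.
  have [c1 c2] := dv' N y yr.
  have {}c1 := der_cont c1; have {}c2 := der_cont c2.
  have e60 : 0 < e / 6 by rewrite divr_gt0.
  near=> z.
  have zr : y / 2 <= z < r.
    have /andP[h1 ->] : y / 2 < z < r by near: z; apply: near_oo; apply/andP; split; lra_ctx.
    by rewrite ltW.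
  have h1 : `|Re (v' N y) - Re (v' N z)| <= e / 6 by near: z; move/cvgrPdist_le : c1; exact.
  have h2 : `|Im (v' N y) - Im (v' N z)| <= e / 6 by near: z; move/cvgrPdist_le : c2; exact.
  have -> : P z - P y = (- (v' N z - P z) + (v' N y - P y)) + - (v' N y - v' N z) by ring.
  have h3 : nz (v' N y - v' N z) <= e / 3.
    by rewrite /nz ReD ReN ImD ImN; apply: le_trans (lerD h1 h2) _; rewrite le_eqVlt; apply/orP; left; apply/eqP; field.
  apply: le_trans (nz_D _ _) _; rewrite nz_N.
  have := nz_D (- (v' N z - P z)) (v' N y - P y); rewrite nz_N.
  have := HN z zr; have : y / 2 <= y < r by apply/andP; split; lra_ctx.
  move=> /HN; lra_ctx.
split=> //.
- move=> y yr c0.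
  (* The second row solved for the second derivative; [H] will be the uniform limit of [v2 n] near
     y. *)
  pose E y := lam * ((lam + 2) * F y) - (c11 y)%:C%C * P y - (c20 y)%:C%C * ((lam + 2) * F y)
    - (c21 y)%:C%C * ((lam + 2) * P y) + 2 * ((lam + 2) * F y) - (V y)%:C%C * F y.
  pose H y := ((c12 y)^-1)%:C%C * E y.
  exists (H y); split; last first.
    have cc : (c12 y)%:C%C * H y = E y.
      by rewrite /H mulrA -rmorphM /= mulfV// mul1r.
    by rewrite /eigen_ode cc /E; ring.
  have nb (k : R -> R) : {for y, continuous k} -> \forall z \near y, `|k z| <= `|k y| + 1.
    move=> /cvgrPdist_le /(_ _ ltr01); apply: filterS => z h.
    rewrite -lerBlDl; apply: le_trans (lerB_dist _ _) _; by rewrite distrC.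
  have ct12 := rdif_cont yr (rdif_c12 r 1).
  have ci : {for y, continuous (fun z => (c12 z)^-1)} by apply: continuousV.
  have n0 : \forall z \near y, c12 z != 0.
    have a0 : 0 < `|c12 y| by rewrite normr_gt0.
    move/cvgrPdist_lt : (ct12) => /(_ _ a0); apply: filterS => z h.
    by apply/eqP => z0; move: h; rewrite z0 subr0 ltxx.
  have [d /= d0 Hd] : exists2 d, 0 < d & forall z, `|y - z| < d -> [/\ 0 < z < r, c12 z != 0,
      `|(c12 z)^-1| <= `|(c12 y)^-1| + 1, `|c11 z| <= `|c11 y| + 1 &
      [/\ `|c20 z| <= `|c20 y| + 1, `|c21 z| <= `|c21 y| + 1 & `|V z| <= `|V y| + 1]].
    have : \forall z \near y, [/\ 0 < z < r, c12 z != 0,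
      `|(c12 z)^-1| <= `|(c12 y)^-1| + 1, `|c11 z| <= `|c11 y| + 1 &
      [/\ `|c20 z| <= `|c20 y| + 1, `|c21 z| <= `|c21 y| + 1 & `|V z| <= `|V y| + 1]].
      near=> z; split; [near: z; exact: near_oo|near: z; exact: n0|near: z; exact: (nb _ ci)| |split].
      + near: z; apply: nb; exact: rdif_cont yr (rdif_c11 r 1).
      + near: z; apply: nb; exact: rdif_cont yr (rdif_c20 r 1).
      + near: z; apply: nb; exact: rdif_cont yr (rdif_c21 r 1).
      + near: z; apply: nb; exact: rdif_cont yr (rdif_V r 1).
    by move=> /nbhs_ballP[d d0 Hd]; exists d.
  pose a := Num.max (y / 2) (y - d / 2); pose b := Num.min r (y + d / 2).
  have y0 : 0 < y by case/andP: yr.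
  have a1 : y / 2 <= a by rewrite le_max lexx.
  have a2 : y - d / 2 <= a by rewrite le_max lexx orbT.
  have b1 : b <= r by rewrite ge_min lexx.
  have b2 : b <= y + d / 2 by rewrite ge_min lexx orbT.
  have ay : a < y by rewrite /a gt_max; apply/andP; split; lra_ctx.
  have yb : y < b by rewrite /b lt_min; apply/andP; split; [case/andP: yr|lra_ctx].
  have ab : 0 < a < b by apply/andP; split; lra_ctx.
  have zd z : a < z < b -> `|y - z| < d.
    by move=> /andP[z1 z2]; apply/ltr_normlP; split; lra_ctx.
  have toU g G := @uconv_uco r a b g G ab b1.
  apply: (@cder_limit R a b v' v2) => [n z /zd/Hd[zr _ _ _ _]|z /zd/Hd[zr _ _ _ _]||].
  + exact: dv'.
  + exact: uconv_pt uP.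
  + apply: (@uco_ext a b (fun n z => ((c12 z)^-1)%:C%C * (B n z + - ((c11 z)%:C%C * v' n z) + - ((c20 z)%:C%C * w n z)
      + - ((c21 z)%:C%C * w' n z) + 2%:C%C * w n z + - ((V z)%:C%C * v n z))) _
      (fun z => ((c12 z)^-1)%:C%C * (lam * ((lam + 2) * F z) + - ((c11 z)%:C%C * P z) + - ((c20 z)%:C%C * ((lam + 2) * F z))
      + - ((c21 z)%:C%C * ((lam + 2) * P z)) + 2%:C%C * ((lam + 2) * F z) + - ((V z)%:C%C * F z)))).
    * move=> n z /zd/Hd[zr z0 _ _ _]; rewrite /B.
      have i1 : ((c12 z)^-1)%:C%C * (c12 z)%:C%C = 1 by rewrite -rmorphM /= mulVf.
      rewrite -[v2 n z in RHS]mul1r -[X in _ = X * _]i1 (_ : 2%:C%C = 2); last by rewrite rmorph_nat.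
      have alg (i k1 k2 k3 k4 k5 x1 x2 x3 x4 x5 : R[i]) : i * (k1 * x1 + k2 * x2 + k3 * x3 + k4 * x4
         - 2 * x3 + k5 * x5 + - (k1 * x1) + - (k3 * x3) + - (k4 * x4) + 2 * x3 + - (k5 * x5)) = i * k2 * x2.
        by ring.
      exact: alg.
    * by move=> z _; rewrite /H /E (_ : 2%:C%C = 2)//; rewrite rmorph_nat.
    apply: (@ucoM a b _ (`|(c12 y)^-1| + 1)); first by move=> z /zd/Hd[].
    apply: ucoD; last first.
      apply: ucoN; apply: (@ucoM a b _ (`|V y| + 1)); first by move=> z /zd/Hd[_ _ _ _ []].
      exact: toU.
    apply: ucoD; last by apply: (@ucoM a b (fun=> 2) 2) => [z _|]; [rewrite normr_nat|exact: toU].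
    apply: ucoD; last first.
      apply: ucoN; apply: (@ucoM a b _ (`|c21 y| + 1)); first by move=> z /zd/Hd[_ _ _ _ []].
      exact: toU.
    apply: ucoD; last first.
      apply: ucoN; apply: (@ucoM a b _ (`|c20 y| + 1)); first by move=> z /zd/Hd[_ _ _ _ []].
      exact: toU.
    apply: ucoD; first exact: toU.
    apply: ucoN; apply: (@ucoM a b _ (`|c11 y| + 1)); first by move=> z /zd/Hd[].
    exact: toU.
  + by rewrite ay yb.
- have cl (g : R -> R[i]) k y : smooth_in r g -> 0 < y <= r -> cleft (cderivn_in r k g) y (cderivn_in r k g y).
    move=> sg yr e e0; have yr' : 0 <= y <= r by case/andP: yr => /ltW -> ->.
    have [d1 d2] := sg k y yr'; have e20 : 0 < e / 2 by rewrite divr_gt0.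
    have [e1 e10 K1] := derivable_in_left yr d1 e20; have [e2 e20' K2] := derivable_in_left yr d2 e20.
    exists (Num.min e1 e2); first by rewrite lt_min e10.
    move=> z /andP[z1 z2]; rewrite /nz ReD ReN ImD ImN [e]splitr; apply: ltrD.
      apply: K1; rewrite z2 andbT; apply: le_lt_trans z1.
      by rewrite lerD2l lerN2 ge_min lexx.
    apply: K2; rewrite z2 andbT; apply: le_lt_trans z1.
    by rewrite lerD2l lerN2 ge_min lexx orbT.
  move=> y yr.
  have [l Hl] := cleft_uconv yr uF (fun n => cl _ 0%N y (sv n) yr).
  have [m Hm] := cleft_uconv yr uP (fun n => cl _ 1%N y (sv n) yr).
  by exists l, m.
- apply: small_ae S1 _ uF _; first by case: cu => _ [[]].
  by move=> y yr; have [d1 d2] := dF y yr; split; [exact: der_cont d1|exact: der_cont d2].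
- apply: small_ae S2 _ uw _; first by case: cu => _ [_ []].
  move=> y yr; have [d1 d2] := cderZ (lam + 2) (dF y yr); split; [exact: der_cont d1|exact: der_cont d2].
Unshelve. all: by end_near. Qed.

End Classical.

(** * The Darboux-Crum transformation *)

Section CrumCoefficients.
Context {R : realType}.
Implicit Types (y : R).

(** The self-similar variable - y / h, equal to 1 at the light cone y = 1/2. The operator [mm] d/dy
    is differentiation with respect to artanh rho. *)
Definition rho y : R := y * (2 - sq y)^-1.
(** Minus one half of the logarithmic derivative of [sg] along artanh rho: the power weight [sg] ^
    (- k / 2) contributes k [zz] to derivatives. *)
Definition zz y : R := y * (sq y - 1)^-1.
Definition mm y : R := sq y * (3 - 2 * sq y) * (sq y - 1)^-1.
Definition sg y : R := 6 - 4 * sq y.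
(** The common denominator of all Crum coefficients, kept as a symbol so that derivatives stay
    polynomial in [rho] and [ee]. *)
Definition ee y : R := (3 * rho y + 5 * rho y ^+ 3)^-1.

(** Logarithmic derivative along artanh rho of rho^7 (1 - rho^2)^(3/2) / (3 + 5 rho^2)^5, which is a
    multiple of the Wronskian of the two known solutions; [L1] is its derivative. *)
Definition LL y : R := (21 - 45 * rho y ^+ 2) * ee y.
Definition L1 y : R := (1 - rho y ^+ 2) * (-63 - 450 * rho y ^+ 2 + 225 * rho y ^+ 4) * ee y ^+ 2.
(** Equal to [LL] times the logarithmic derivative of the known solution at k = 0, so that [om]
    annihilates it; [LP1] and [LP2] are the next two derivatives. *)
Definition LP y : R := (1 - rho y ^+ 2) * (189 - 990 * rho y ^+ 2 + 225 * rho y ^+ 4) * ee y ^+ 2.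
Definition LP1 y : R := 18 * (1 - rho y ^+ 2) *
  (-63 - 315 * rho y ^+ 2 + 1715 * rho y ^+ 4 - 825 * rho y ^+ 6) * ee y ^+ 3.
Definition LP2 y : R := 18 * (1 - rho y ^+ 2) *
  (567 + 3591 * rho y ^+ 2 + 1491 * 10 * rho y ^+ 4 - 7361 * 10 * rho y ^+ 6 + 2019 * 25 * rho y ^+ 8
   - 4125 * rho y ^+ 10) * ee y ^+ 4.
Definition UU y : R := (1 - rho y ^+ 2) * (180 + 72 * rho y ^+ 2 - 60 * rho y ^+ 4) * ee y ^+ 2.
Definition U1 y : R := (1 - rho y ^+ 2) *
  (-1080 - 5400 * rho y ^+ 2 + 1368 * rho y ^+ 4 + 2040 * rho y ^+ 6) * ee y ^+ 3.
(** Crum's formula read backwards: the original potential from the transformed one. Its closed form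
    in s is [U0E]. *)
Definition U0 y : R := UU y + 2 * L1 y.

Lemma sq_lt y (a : R) : 0 < a -> 2 + y ^+ 2 < a ^+ 2 -> sq y < a.
Proof.
by move=> a0 h; rewrite -(@ltr_pXn2r _ 2)// ?nnegrE ?ltW ?sq_gt0// sq_sq.
Qed.

Lemma sq_lt2 y : 0 < y < 1 -> sq y < 2.
Proof. by move=> /andP[y0 y1]; apply: sq_lt => //; nra_ctx. Qed.

Lemma sq_lt32 y : 0 < y < 1 / 2 -> sq y < 3 / 2.
Proof. by move=> /andP[y0 y1]; apply: sq_lt; [lra_ctx|nra_ctx]. Qed.

Lemma rho_gt0 y : 0 < y < 1 -> 0 < rho y.
Proof. by move=> h; rewrite mulr_gt0 ?invr_gt0 ?subr_gt0 ?sq_lt2//; case/andP: h. Qed.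

Lemma rho_neq0 y : 0 < y < 1 -> rho y != 0.
Proof. by move=> /rho_gt0/lt0r_neq0. Qed.

Lemma eeD_gt0 y : 0 < y < 1 -> 0 < 3 * rho y + 5 * rho y ^+ 3.
Proof. by move=> /rho_gt0 h; rewrite addr_gt0// mulr_gt0// exprn_gt0. Qed.

Lemma ee_gt0 y : 0 < y < 1 -> 0 < ee y.
Proof. by move=> h; rewrite invr_gt0 eeD_gt0. Qed.

Lemma ee_rho y : 0 < y < 1 -> ee y * (3 * rho y + 5 * rho y ^+ 3) = 1.
Proof. by move=> h; rewrite mulVf// lt0r_neq0// eeD_gt0. Qed.

Lemma ysq2 y : y ^+ 2 = sq y ^+ 2 - 2 :> R.
Proof. exact: ysq. Qed.

Lemma one_sub_rho y : 0 < y < 1 -> 1 - rho y ^+ 2 = sg y * (2 - sq y)^-1 ^+ 2.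
Proof.
move=> h; have s2 : 2 - sq y != 0 by rewrite subr_eq0 gt_eqF// sq_lt2.
by rewrite /rho /sg exprMn (ysq2 y); field.
Qed.

Lemma mm_sg y : mm y = sg y * (sq y / (2 * (sq y - 1))).
Proof. by rewrite /mm /sg; field; exact: sqm1_neq0. Qed.

Lemma sg_gt0 y : 0 < y < 1 / 2 -> 0 < sg y.
Proof. by move=> /sq_lt32; rewrite /sg; lra_ctx. Qed.

Lemma half1 y : 0 < y < 1 / 2 -> 0 < y < 1.
Proof. by move=> /andP[-> h] /=; lra_ctx. Qed.

Lemma sqm1_gt0 y : 0 < sq y - 1.
Proof. by rewrite subr_gt0 sq_gt1. Qed.

Lemma mm_gt0 y : 0 < y < 1 / 2 -> 0 < mm y.
Proof.
move=> h; by rewrite mm_sg mulr_gt0 ?sg_gt0// divr_gt0 ?sq_gt0// mulr_gt0// sqm1_gt0.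
Qed.

Lemma rho_lt1 y : 0 < y < 1 / 2 -> rho y < 1.
Proof.
move=> h; have := one_sub_rho (half1 h); have g := sg_gt0 h; have r0 := rho_gt0 (half1 h).
have : 0 < sg y * (2 - sq y)^-1 ^+ 2.
  by rewrite mulr_gt0// exprn_gt0// invr_gt0 subr_gt0 sq_lt2// half1.
nra_ctx.
Qed.

Lemma one_sub_z y : 0 < y -> 1 - zz y = sg y / (2 * (sq y - 1) * (sq y - 1 + y)).
Proof.
move=> y0; have s1 := sqm1_gt0 y; have s3 : sq y - 1 + y != 0 by rewrite lt0r_neq0// addr_gt0.
rewrite /zz /sg.
transitivity ((sq y ^+ 2 - 2 * sq y + 1 - y ^+ 2) / ((sq y - 1) * (sq y - 1 + y))).
  by field; rewrite s3 sqm1_neq0.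
by rewrite (ysq2 y); field; rewrite s3 sqm1_neq0.
Qed.

Lemma der_rho y : 0 < y < 1 / 2 -> is_derive y (1 : R) rho ((1 - rho y ^+ 2) / mm y).
Proof.
move=> h; have s2 : 2 - sq y != 0 by rewrite subr_eq0 gt_eqF// sq_lt2// half1.
have ds := derB (der_cst y 1 2) (der_sq y).
have := derM (der_id y) (derV (f := fun z => 2 - sq z) s2 ds).
apply: der_eq; rewrite one_sub_rho ?half1// mm_sg.
have s0 := lt0r_neq0 (sq_gt0 y); have s1 := sqm1_neq0 y; have g0 := lt0r_neq0 (sg_gt0 h).
transitivity (((2 - sq y) * sq y + y ^+ 2) / (sq y * (2 - sq y) ^+ 2)).
  by field; rewrite s0 s2.
by rewrite (ysq2 y); rewrite /sg in g0 *; field; rewrite ?s0 ?s2 ?s1 ?g0.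
Qed.

Lemma der_sg y : 0 < y < 1 / 2 -> is_derive y (1 : R) sg (- 2 * zz y * sg y / mm y).
Proof.
move=> h; have := derB (der_cst y 1 6) (derM (der_cst y 1 4) (der_sq y)).
apply: der_eq; rewrite mm_sg /zz.
have s0 := lt0r_neq0 (sq_gt0 y); have s1 := sqm1_neq0 y; have g0 := lt0r_neq0 (sg_gt0 h).
by rewrite /sg in g0 *; field; rewrite ?g0 ?s0 ?s1.
Qed.

Lemma der_ee y : 0 < y < 1 / 2 ->
  is_derive y (1 : R) ee (- ((1 - rho y ^+ 2) / mm y * (3 + 15 * rho y ^+ 2)) * ee y ^+ 2).
Proof.
move=> h; have D := eeD_gt0 (half1 h); have dr := der_rho h.
have ds := derD (derM (der_cst y 1 3) dr) (derM (der_cst y 1 5) (derX 3 dr)).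
have := derV (f := fun z => 3 * rho z + 5 * rho z ^+ 3) (lt0r_neq0 D) ds.
apply: der_eq; rewrite /ee -exprVn /=; ring.
Qed.

Lemma der_LL y : 0 < y < 1 / 2 -> is_derive y (1 : R) LL (L1 y / mm y).
Proof.
move=> h; have dr := der_rho h; have E := ee_rho (half1 h).
have := derM (derB (der_cst y 1 21) (derM (der_cst y 1 45) (derX 2 dr))) (der_ee h).
apply: der_eq; rewrite /L1 /=.
(* A factor [ee] (3 rho + 5 rho^3) = 1 is inserted to bring both terms to the same power of [ee]. *)
transitivity ((1 - rho y ^+ 2) / mm y * ee y * (- 90 * rho y * (ee y * (3 * rho y + 5 * rho y ^+ 3))
   - (21 - 45 * rho y ^+ 2) * (3 + 15 * rho y ^+ 2) * ee y)).
  by rewrite E; ring.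
by ring.
Qed.

Lemma der_LP y : 0 < y < 1 / 2 -> is_derive y (1 : R) LP (LP1 y / mm y).
Proof.
move=> h; have dr := der_rho h; have E := ee_rho (half1 h).
have := derM (derM (derB (der_cst y 1 1) (derX 2 dr))
  (derD (derB (der_cst y 1 189) (derM (der_cst y 1 990) (derX 2 dr))) (derM (der_cst y 1 225) (derX 4 dr))))
  (derX 2 (der_ee h)).
apply: der_eq; rewrite /LP1 /=.
transitivity ((1 - rho y ^+ 2) / mm y * ee y ^+ 2 * ((- 2 * rho y * (189 - 990 * rho y ^+ 2 + 225 * rho y ^+ 4)
   + (1 - rho y ^+ 2) * (- 1980 * rho y + 900 * rho y ^+ 3)) * (ee y * (3 * rho y + 5 * rho y ^+ 3))
   - 2 * (1 - rho y ^+ 2) * (189 - 990 * rho y ^+ 2 + 225 * rho y ^+ 4) * (3 + 15 * rho y ^+ 2) * ee y)).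
  by rewrite E; ring.
by ring.
Qed.

Lemma der_LP1 y : 0 < y < 1 / 2 -> is_derive y (1 : R) LP1 (LP2 y / mm y).
Proof.
move=> h; have dr := der_rho h; have E := ee_rho (half1 h).
have := derM (derM (derM (der_cst y 1 18) (derB (der_cst y 1 1) (derX 2 dr)))
  (derB (derD (derB (der_cst y 1 (-63)) (derM (der_cst y 1 315) (derX 2 dr))) (derM (der_cst y 1 1715) (derX 4 dr)))
   (derM (der_cst y 1 825) (derX 6 dr))))
  (derX 3 (der_ee h)).
apply: der_eq; rewrite /LP2 /=.
transitivity (18 * (1 - rho y ^+ 2) / mm y * ee y ^+ 3 * ((- 2 * rho y * (-63 - 315 * rho y ^+ 2 + 1715 * rho y ^+ 4 - 825 * rho y ^+ 6)
   + (1 - rho y ^+ 2) * (- 630 * rho y + 6860 * rho y ^+ 3 - 4950 * rho y ^+ 5)) * (ee y * (3 * rho y + 5 * rho y ^+ 3))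
   - 3 * (1 - rho y ^+ 2) * (-63 - 315 * rho y ^+ 2 + 1715 * rho y ^+ 4 - 825 * rho y ^+ 6) * (3 + 15 * rho y ^+ 2) * ee y)).
  by rewrite E; ring.
by ring.
Qed.

Lemma der_UU y : 0 < y < 1 / 2 -> is_derive y (1 : R) UU (U1 y / mm y).
Proof.
move=> h; have dr := der_rho h; have E := ee_rho (half1 h).
have := derM (derM (derB (der_cst y 1 1) (derX 2 dr))
  (derB (derD (der_cst y 1 180) (derM (der_cst y 1 72) (derX 2 dr))) (derM (der_cst y 1 60) (derX 4 dr))))
  (derX 2 (der_ee h)).
apply: der_eq; rewrite /U1 /=.
transitivity ((1 - rho y ^+ 2) / mm y * ee y ^+ 2 * ((- 2 * rho y * (180 + 72 * rho y ^+ 2 - 60 * rho y ^+ 4)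
   + (1 - rho y ^+ 2) * (144 * rho y - 240 * rho y ^+ 3)) * (ee y * (3 * rho y + 5 * rho y ^+ 3))
   - 2 * (1 - rho y ^+ 2) * (180 + 72 * rho y ^+ 2 - 60 * rho y ^+ 4) * (3 + 15 * rho y ^+ 2) * ee y)).
  by rewrite E; ring.
by ring.
Qed.

(** For the known solutions u (k = 0) and v (k = -3), LP = LL u'/u and LP + 9 = LL v'/v. Since LL is
    9 u v over the Wronskian, the sum of the two equations is 2 LP + 9 = LL' + LL^2. *)
Lemma L1E y : 0 < y < 1 -> L1 y = 2 * LP y - LL y ^+ 2 + 9.
Proof.
move=> h; have r0 := rho_neq0 h; have d0 := lt0r_neq0 (eeD_gt0 h).
rewrite /L1 /LP /LL /ee; field; exact: d0.
Qed.

Lemma der_L1 y : 0 < y < 1 / 2 -> is_derive y (1 : R) L1 ((2 * LP1 y - 2 * LL y * L1 y) / mm y).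
Proof.
move=> h; apply: (@der_ext _ _ (fun z => 2 * LP z - LL z ^+ 2 + 9)).
  by apply: filterS (near_oo h) => z /half1 /L1E ->.
have := derD (derB (derM (der_cst y 1 2) (der_LP h)) (derX 2 (der_LL h))) (der_cst y 1 9).
by apply: der_eq => /=; ring.
Qed.

Definition U01 y : R := U1 y + 2 * (2 * LP1 y - 2 * LL y * L1 y).

Lemma der_U0 y : 0 < y < 1 / 2 -> is_derive y (1 : R) U0 (U01 y / mm y).
Proof.
move=> h; have := derD (der_UU h) (derM (der_cst y 1 2) (der_L1 h)).
by apply: der_eq; rewrite /U01; ring.
Qed.

(** The one part of the intertwining relation om'' = (UU + k^2) om that is not formal: the
    coefficient of W free of k. *)
Lemma crum3 y : 0 < y < 1 ->
  LP2 y - L1 y * U0 y - LL y * U01 y + (LP y - L1 y) * U0 y = UU y * LP y.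
Proof.
move=> h; have d0 := lt0r_neq0 (eeD_gt0 h).
rewrite /U01 /U0 /LP2 /L1 /LP /LL /LP1 /UU /U1 /ee; field; exact: d0.
Qed.

(** At k = 0 the map from (W, Y) to om and its derivative annihilates a nonzero solution, so its
    determinant vanishes. *)
Lemma crum_det y : 0 < y < 1 -> LP y * (LP y - L1 y) + LL y * (LP1 y - LL y * U0 y) = 0.
Proof.
move=> h; have d0 := lt0r_neq0 (eeD_gt0 h).
rewrite /U0 /L1 /LP /LL /LP1 /UU /ee; field; exact: d0.
Qed.

Lemma UU_gt0 y : 0 < y < 1 / 2 -> 0 < UU y.
Proof.
move=> h; have r0 := rho_gt0 (half1 h); have r1 := rho_lt1 h; have e0 := ee_gt0 (half1 h).
have r4 : rho y ^+ 4 < 1 by rewrite exprn_ilt1// ltW.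
have r2 : rho y ^+ 2 < 1 by rewrite exprn_ilt1// ltW.
have p2 : 0 < rho y ^+ 2 by rewrite exprn_gt0.
have a0 : 0 < 1 - rho y ^+ 2 by rewrite subr_gt0.
have b0 : 0 < 180 + 72 * rho y ^+ 2 - 60 * rho y ^+ 4 by move: r4 p2; lra_ctx.
exact: mulr_gt0 (mulr_gt0 a0 b0) (exprn_gt0 2 e0).
Qed.

(** The constant 2 is what makes [KK] monotone for every Re k <= 1. Since UU decays like the square
    of e^(- artanh rho) at the cone, the inequality becomes an equality in the limit. *)
Lemma nu_gt1 y : 0 < y < 1 / 2 -> U1 y + 2 * UU y < 0.
Proof.
move=> h; have r0 := rho_gt0 (half1 h); have r1 := rho_lt1 h; have e0 := ee_gt0 (half1 h).
have E := ee_rho (half1 h).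
have -> : U1 y + 2 * UU y = (1 - rho y ^+ 2) * ee y ^+ 3 * (-1080 - 5400 * rho y ^+ 2 + 1368 * rho y ^+ 4 + 2040 * rho y ^+ 6
   + 2 * (180 + 72 * rho y ^+ 2 - 60 * rho y ^+ 4) * (3 * rho y + 5 * rho y ^+ 3)).
  have -> : 2 * UU y = 2 * UU y * (ee y * (3 * rho y + 5 * rho y ^+ 3)) by rewrite E mulr1.
  by rewrite /U1 /UU; ring.
set t := rho y in r0 r1 *.
rewrite pmulr_rlt0; last by rewrite mulr_gt0 ?exprn_gt0//; nra_ctx.
(* The degenerate limit at rho = 1 shows up as the factor t - 1; the cofactor is positive on (0,
   1). *)
have -> : -1080 - 5400 * t ^+ 2 + 1368 * t ^+ 4 + 2040 * t ^+ 6
   + 2 * (180 + 72 * t ^+ 2 - 60 * t ^+ 4) * (3 * t + 5 * t ^+ 3) =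
   (t - 1) * (1080 * (1 - t ^+ 6) + 480 * t ^+ 6 + 5400 * t ^+ 2 + 3168 * t ^+ 3 + 1800 * t ^+ 4 + 1440 * t ^+ 5).
  by ring.
have t1 : t - 1 < 0 by rewrite subr_lt0.
rewrite (nmulr_rlt0 _ t1).
have p k : 0 < t ^+ k by exact: exprn_gt0.
have : t ^+ 6 < 1 by rewrite exprn_ilt1// ltW.
have := p 2%N; have := p 3%N; have := p 4%N; have := p 5%N; have := p 6%N; lra_ctx.
Qed.

End CrumCoefficients.

(** * Algebra of the change to the variable artanh rho *)

Section StepA.
Context {R : realType}.
Local Notation C := (R[i]).

(** Coefficient of the first derivative: the factor y^3 and the power weight are chosen so that the
    first-order term of the equation disappears. *)
Lemma alg_P (y s k l : C) : y != 0 -> s != 0 -> s - 1 != 0 -> l = 1 - k ->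
  let m := s * (3 - 2 * s) / (s - 1) in
  let m1 := (- 2 * s ^+ 2 + 4 * s - 3) / (s - 1) ^+ 2 * (y / s) in
  let z := y / (s - 1) in
  let B := (3 - 2 * s) * (6 * s ^+ 2 / y - y / (s - 1)) - 2 * l * y * s in
  m * m1 * y ^+ 3 + 6 * m ^+ 2 * y ^+ 2 - (3 - 2 * s) / (s - 1) ^+ 2 * y ^+ 3 * B + m * k * z * y ^+ 3
  = - (k * z * m * y ^+ 3).
Proof.
move=> y0 s0 s1 -> /=; field.
by rewrite s1 y0 s0.
Qed.

(** Coefficient of the function itself, divided by y^3; with x = rho^2 it identifies the potential
    [u0] and the shift k^2. *)
Lemma alg_F (s k l : C) (x := (s ^+ 2 - 2) / (2 - s) ^+ 2) (d := 5 * (s ^+ 2 - 2) + 3 * (2 - s) ^+ 2) :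
  s != 0 -> s - 1 != 0 -> 2 - s != 0 -> s ^+ 2 - 2 != 0 -> d != 0 -> l = 1 - k ->
  let m := s * (3 - 2 * s) / (s - 1) in
  let ms := (- 2 * s ^+ 2 + 4 * s - 3) / (s - 1) ^+ 2 in
  let z1 := (s - 1 - (s ^+ 2 - 2) / s) / (s - 1) ^+ 2 in
  let Cc := (l + 2) * (- l - 6 * s + 5 - 1 / (s - 1)) +
     96 * (s - 1) ^+ 2 * (21 * (s - 2) ^+ 2 - 5 * (s ^+ 2 - 2)) / d ^+ 2 in
  let u0 := 6 * (1 - x) * (9 - 138 * x + 65 * x ^+ 2) / (x * (d / (2 - s) ^+ 2) ^+ 2) in
  3 * m * ms / s + 6 * m ^+ 2 / (s ^+ 2 - 2) - (3 - 2 * s) / (s - 1) ^+ 2 * Cc + m * k * (z1 + 3 / (s - 1))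
  = u0 + k ^+ 2 - k * (3 * m / (s - 1) + k * (s ^+ 2 - 2) / (s - 1) ^+ 2).
Proof.
move=> s0 s1 s2 s3 d0 -> /=; rewrite /x.
rewrite /d in d0 *; field.
by rewrite s0 s1 s2 s3 d0.
Qed.

Lemma U0E (y : R) (s := sq y) (x := (s ^+ 2 - 2) / (2 - s) ^+ 2) (d := 5 * (s ^+ 2 - 2) + 3 * (2 - s) ^+ 2) :
  0 < y < 1 -> U0 y = 6 * (1 - x) * (9 - 138 * x + 65 * x ^+ 2) / (x * (d / (2 - s) ^+ 2) ^+ 2).
Proof.
move=> h; have r0 := rho_neq0 h; have d0 := lt0r_neq0 (eeD_gt0 h).
have s2 : 2 - s != 0 by rewrite subr_eq0 gt_eqF// sq_lt2.
have xE : rho y ^+ 2 = x by rewrite /rho exprMn (ysq2 y) -/s exprVn.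
have dE : 3 + 5 * x = d / (2 - s) ^+ 2 by rewrite /x /d; field.
have eE : ee y ^+ 2 = (x * (3 + 5 * x) ^+ 2)^-1.
  by rewrite /ee exprVn -xE; congr (_^-1); ring.
rewrite /U0 /UU /L1 eE -dE.
have -> : rho y ^+ 4 = x ^+ 2 by rewrite -xE; ring.
by rewrite xE; ring.
Qed.

(** Assembles the two coefficient identities. [T] stands for m^2 / [c12], which turns the eigenvalue
    equation into a formula for m^2 Q. *)
Lemma alg_Y (y m m1 z z1 k T B Cc u0 F P Q : C) : y != 0 ->
  m ^+ 2 * Q = - (T * (B * P + Cc * F)) ->
  m * m1 * y ^+ 3 + 6 * m ^+ 2 * y ^+ 2 - T * y ^+ 3 * B + m * k * z * y ^+ 3 = - (k * z * m * y ^+ 3) ->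
  3 * m * m1 / y + 6 * m ^+ 2 / y ^+ 2 - T * Cc + m * k * (z1 + 3 * z / y)
    = u0 + k ^+ 2 - k * (3 * m * z / y + k * z ^+ 2) ->
  m * (m1 * (3 * y ^+ 2 * F + y ^+ 3 * P) + m * (6 * y * F + 3 * y ^+ 2 * P + (3 * y ^+ 2 * P + y ^+ 3 * Q))
     + k * (z1 * (y ^+ 3 * F) + z * (3 * y ^+ 2 * F + y ^+ 3 * P)))
  = (u0 + k ^+ 2) * (y ^+ 3 * F) - k * z * (m * (3 * y ^+ 2 * F + y ^+ 3 * P) + k * z * (y ^+ 3 * F)).
Proof.
move=> y0 hQ hP hF.
have e1 : m ^+ 2 * Q + T * (B * P + Cc * F) = 0 by rewrite hQ addNr.
have e2 : m * m1 * y ^+ 3 + 6 * m ^+ 2 * y ^+ 2 - T * y ^+ 3 * B + m * k * z * y ^+ 3 + k * z * m * y ^+ 3 = 0.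
  by rewrite hP addNr.
have e3 : 3 * m * m1 / y + 6 * m ^+ 2 / y ^+ 2 - T * Cc + m * k * (z1 + 3 * z / y)
    - (u0 + k ^+ 2 - k * (3 * m * z / y + k * z ^+ 2)) = 0 by rewrite hF subrr.
apply/eqP; rewrite -subr_eq0; apply/eqP.
transitivity (y ^+ 3 * (m ^+ 2 * Q + T * (B * P + Cc * F)) + P * (m * m1 * y ^+ 3 + 6 * m ^+ 2 * y ^+ 2 - T * y ^+ 3 * B + m * k * z * y ^+ 3 + k * z * m * y ^+ 3)
  + y ^+ 3 * F * (3 * m * m1 / y + 6 * m ^+ 2 / y ^+ 2 - T * Cc + m * k * (z1 + 3 * z / y)
    - (u0 + k ^+ 2 - k * (3 * m * z / y + k * z ^+ 2)))).
  by field.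
by rewrite e1 e2 e3 !mulr0 !addr0.
Qed.

Lemma der_mm (y : R) : is_derive y (1 : R) mm ((- 2 * sq y ^+ 2 + 4 * sq y - 3) / (sq y - 1) ^+ 2 * (y / sq y)).
Proof.
have s1 := sqm1_neq0 y; have s0 := lt0r_neq0 (sq_gt0 y); have ds := der_sq y.
have dV := derV (f := fun z => sq z - 1) s1 (derB ds (der_cst y 1 1)).
have := derM (derM ds (derB (der_cst y 1 3) (derM (der_cst y 1 2) ds))) dV.
by apply: der_eq; field; rewrite s1 s0.
Qed.

Lemma der_zz (y : R) : is_derive y (1 : R) zz ((sq y - 1 - y ^+ 2 / sq y) / (sq y - 1) ^+ 2).
Proof.
have s1 := sqm1_neq0 y; have s0 := lt0r_neq0 (sq_gt0 y).
have dV := derV (f := fun z => sq z - 1) s1 (derB (der_sq y) (der_cst y 1 1)).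
have := derM (der_id y) dV.
by apply: der_eq; field; rewrite s1 s0.
Qed.

End StepA.

(** * The eigenvalue equation as a first-order system for W and Y *)

Section System.
Context {R : realType}.
Local Notation C := (R[i]).
Local Notation "f ^c" := (fun y : R => (f y)%:C%C) (at level 1).
Variables (lam : C) (F P : R -> C).
Let k : C := 1 - lam.
Hypothesis dF : forall y, 0 < y < 1 / 2 -> cder F y (P y).
Hypothesis dP : forall y, 0 < y < 1 / 2 -> exists Q, cder P y Q /\ eigen_ode lam y (F y) (P y) Q.

Definition Wf (y : R) : C := (y ^+ 3)%:C%C * F y.
Definition Xf (y : R) : C := (mm y)%:C%C * ((3 * y ^+ 2)%:C%C * F y + (y ^+ 3)%:C%C * P y).
(** The derivative along artanh rho of [sg] ^ (- k / 2) W, divided by the same weight: the complex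
    power never has to be written. *)
Definition Yf (y : R) : C := Xf y + k * ((zz y)%:C%C * Wf y).

Lemma cder_W y : 0 < y < 1 / 2 -> cder Wf y (((mm y)^-1)%:C%C * (Yf y - k * (zz y)%:C%C * Wf y)).
Proof.
move=> h; have m0 := lt0r_neq0 (mm_gt0 h).
have := cderM (cder_real (derX 3 (der_id y))) (dF h).
apply: cder_eq; rewrite /Yf /Xf /=.
have -> : 3 * y ^+ 2 * 1 = 3 * y ^+ 2 :> R by rewrite mulr1.
set D := _ + _.
have -> : ((mm y)^-1)%:C%C * ((mm y)%:C%C * D + k * ((zz y)%:C%C * Wf y) - k * (zz y)%:C%C * Wf y)
  = ((mm y)^-1)%:C%C * (mm y)%:C%C * D by ring.
by rewrite -rmorphM /= mulVf// mul1r.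
Qed.

Lemma cder_Y y : 0 < y < 1 / 2 ->
  cder Yf y (((mm y)^-1)%:C%C * (((U0 y)%:C%C + k ^+ 2) * Wf y - k * (zz y)%:C%C * Yf y)).
Proof.
move=> h; have m0 := lt0r_neq0 (mm_gt0 h); have h1 := half1 h.
have y0 : 0 < y by case/andP: h.
have yn := lt0r_neq0 y0.
have [Q [dQ ode]] := dP h.
have d2 : cder (fun y => (3 * y ^+ 2)%:C%C) y (6 * y)%:C%C.
  apply: cder_real; have := derM (der_cst y 1 3) (derX 2 (der_id y)); apply: der_eq => /=; ring.
have d3 : cder (fun y => (y ^+ 3)%:C%C) y (3 * y ^+ 2)%:C%C.
  by apply: cder_real; have := derX 3 (der_id y); apply: der_eq => /=; ring.
have dm := cder_real (der_mm y); have dz := cder_real (der_zz y).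
have := cderD (cderM dm (cderD (cderM d2 (dF h)) (cderM d3 dQ)))
  (cderZ k (cderM dz (cderM d3 (dF h)))).
apply: cder_eq.
have s1 := sqm1_neq0 y; have s0 := lt0r_neq0 (sq_gt0 y).
have s2 : 2 - sq y != 0 by rewrite subr_eq0 gt_eqF// sq_lt2.
have s3 : sq y ^+ 2 - 2 != 0 by rewrite -(ysq y) expf_neq0.
have s4 := lt0r_neq0 (dn_gt0 y).
have dE : dn y = 5 * (sq y ^+ 2 - 2) + 3 * (2 - sq y) ^+ 2 by rewrite /dn; ring.
have toC (x : R) : x != 0 -> x%:C%C != 0 :> C by rewrite fmorph_eq0.
(* The computation moves to complex variables s and y, where [field] can treat real coefficients,
   lam and k alike. *)
pose ss : C := (sq y)%:C%C; pose yy : C := y%:C%C.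
have E2 : yy ^+ 2 = ss ^+ 2 - 2.
  by rewrite /yy /ss -!rmorphXn /= (ysq y) rmorphB /= rmorph_nat.
(* This is [mm] ^ 2 / [c12] after cancellation. *)
pose T : C := (3 - 2 * ss) / (ss - 1) ^+ 2.
pose B : C := (3 - 2 * ss) * (6 * ss ^+ 2 / yy - yy / (ss - 1)) - 2 * lam * yy * ss.
pose d : C := 5 * (ss ^+ 2 - 2) + 3 * (2 - ss) ^+ 2.
pose Cc : C := (lam + 2) * (- lam - 6 * ss + 5 - 1 / (ss - 1)) +
     96 * (ss - 1) ^+ 2 * (21 * (ss - 2) ^+ 2 - 5 * (ss ^+ 2 - 2)) / d ^+ 2.
have C1 : ss - 1 != 0 by have := toC _ s1; rewrite rmorphB /= rmorph1.
have C0 : ss != 0 by exact: toC s0.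
have C2 : 2 - ss != 0 by have := toC _ s2; rewrite rmorphB /= rmorph_nat.
have C3 : ss ^+ 2 - 2 != 0 by rewrite -E2 expf_neq0// toC.
have Cd : d = (dn y)%:C%C by rewrite dE /d /ss; ring.
have C4 : d != 0 by rewrite Cd; exact: toC s4.
have Cy : yy != 0 by exact: toC yn.
have lk : lam = 1 - k by rewrite /k opprB addrCA subrr addr0.
pose m : C := ss * (3 - 2 * ss) / (ss - 1).
pose ms : C := (- 2 * ss ^+ 2 + 4 * ss - 3) / (ss - 1) ^+ 2.
pose x : C := (ss ^+ 2 - 2) / (2 - ss) ^+ 2.
pose u0 : C := 6 * (1 - x) * (9 - 138 * x + 65 * x ^+ 2) / (x * (d / (2 - ss) ^+ 2) ^+ 2).
have HP : m * (ms * (yy / ss)) * yy ^+ 3 + 6 * m ^+ 2 * yy ^+ 2 - T * yy ^+ 3 * B + m * k * (yy / (ss - 1)) * yy ^+ 3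
  = - (k * (yy / (ss - 1)) * m * yy ^+ 3) := alg_P Cy C0 C1 lk.
have HF : 3 * m * ms / ss + 6 * m ^+ 2 / (ss ^+ 2 - 2) - T * Cc
    + m * k * ((ss - 1 - (ss ^+ 2 - 2) / ss) / (ss - 1) ^+ 2 + 3 / (ss - 1))
  = u0 + k ^+ 2 - k * (3 * m / (ss - 1) + k * (ss ^+ 2 - 2) / (ss - 1) ^+ 2) := alg_F C0 C1 C2 C3 C4 lk.
have mC : (mm y)%:C%C = m by rewrite /mm /m /ss; field; do ?[apply/andP; split]; first [exact: C0|exact: C1|exact: C2|exact: C3|exact: C4|exact: Cy].
have m1C : ((- 2 * sq y ^+ 2 + 4 * sq y - 3) / (sq y - 1) ^+ 2 * (y / sq y))%:C%C = ms * (yy / ss) :> C.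
  by rewrite /ms /yy /ss; field; do ?[apply/andP; split]; first [exact: C0|exact: C1|exact: C2|exact: C3|exact: C4|exact: Cy].
have zC : (zz y)%:C%C = yy / (ss - 1) :> C by rewrite /zz /yy /ss; field; do ?[apply/andP; split]; first [exact: C0|exact: C1|exact: C2|exact: C3|exact: C4|exact: Cy].
have z1C : ((sq y - 1 - y ^+ 2 / sq y) / (sq y - 1) ^+ 2)%:C%C = (ss - 1 - yy ^+ 2 / ss) / (ss - 1) ^+ 2 :> C.
  by rewrite /yy /ss; field; do ?[apply/andP; split]; first [exact: C0|exact: C1|exact: C2|exact: C3|exact: C4|exact: Cy].
have u0C : (U0 y)%:C%C = u0.
  rewrite U0E// /u0 /x /d /ss; field; do ?[apply/andP; split]; first [exact: C0|exact: C1|exact: C2|exact: C3|exact: C4|exact: Cy].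
have h12 : (c12 y)%:C%C = (3 - 2 * ss) * ss ^+ 2 :> C by rewrite c12E /ss; ring.
have h11 : (c11 y)%:C%C = (3 - 2 * ss) * (6 * ss ^+ 2 / yy - yy / (ss - 1)) + 4 * yy * ss :> C.
  by rewrite c11E// /ss /yy; field; do ?[apply/andP; split]; first [exact: C0|exact: C1|exact: C2|exact: C3|exact: C4|exact: Cy].
have h20 : (c20 y)%:C%C = 7 - 6 * ss - 1 / (ss - 1) :> C by rewrite c20E// /ss; field; do ?[apply/andP; split]; first [exact: C0|exact: C1|exact: C2|exact: C3|exact: C4|exact: Cy].
have h21 : (c21 y)%:C%C = - 2 * yy * ss :> C by rewrite c21E /ss /yy; ring.
have hV : (V y)%:C%C = 96 * (ss - 1) ^+ 2 * (21 * (ss - 2) ^+ 2 - 5 * (ss ^+ 2 - 2)) / d ^+ 2 :> C.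
  by rewrite VE Cd /ss; field; exact: (toC _ s4).
have hQ : m ^+ 2 * Q = - (T * (B * P y + Cc * F y)).
  have o : (3 - 2 * ss) * ss ^+ 2 * Q = - (B * P y + Cc * F y).
    move: ode; rewrite /eigen_ode h12 h11 h20 h21 hV => ode.
    transitivity (((3 - 2 * ss) * ss ^+ 2 * Q + ((3 - 2 * ss) * (6 * ss ^+ 2 / yy - yy / (ss - 1)) + 4 * yy * ss) * P y +
     (7 - 6 * ss - 1 / (ss - 1)) * ((lam + 2) * F y) +
     - 2 * yy * ss * ((lam + 2) * P y) - 2 * ((lam + 2) * F y) +
     96 * (ss - 1) ^+ 2 * (21 * (ss - 2) ^+ 2 - 5 * (ss ^+ 2 - 2)) / d ^+ 2 * F y) - lam * ((lam + 2) * F y) - (B * P y + Cc * F y)).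
      by rewrite /B /Cc; ring.
    by rewrite ode subrr add0r.
  transitivity (T * ((3 - 2 * ss) * ss ^+ 2 * Q)); last by rewrite o mulrN.
  by rewrite /m /T; field; do ?[apply/andP; split]; first [exact: C0|exact: C1|exact: C2|exact: C3|exact: C4|exact: Cy].
have hF : 3 * m * (ms * (yy / ss)) / yy + 6 * m ^+ 2 / yy ^+ 2 - T * Cc
    + m * k * ((ss - 1 - yy ^+ 2 / ss) / (ss - 1) ^+ 2 + 3 * (yy / (ss - 1)) / yy)
    = u0 + k ^+ 2 - k * (3 * m * (yy / (ss - 1)) / yy + k * (yy / (ss - 1)) ^+ 2).
  rewrite [(yy / _) ^+ 2]expr_div_n !E2; apply: etrans (etrans HF _).
    congr (_ + _ - _ + _ * (_ + _)); field; do ?[apply/andP; split]; first [exact: C0|exact: C1|exact: C2|exact: C3|exact: C4|exact: Cy].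
  congr (_ + _ - _ * (_ + _)); field; do ?[apply/andP; split]; first [exact: C0|exact: C1|exact: C2|exact: C3|exact: C4|exact: Cy].
have A := alg_Y Cy hQ HP hF.
have mn : (mm y)%:C%C != 0 :> C by exact: toC m0.
apply: (mulfI mn); rewrite [RHS]mulrA -rmorphM mulfV// rmorph1 mul1r.
rewrite /Yf /Xf /Wf m1C z1C zC u0C mC.
have -> : (3 * y ^+ 2)%:C%C = 3 * yy ^+ 2 :> C by rewrite /yy; ring.
have -> : (6 * y)%:C%C = 6 * yy :> C by rewrite /yy; ring.
have -> : (y ^+ 3)%:C%C = yy ^+ 3 :> C by rewrite /yy; ring.
rewrite A; ring.
Qed.

End System.

(** * The transformed system and its two monotone quantities *)

Section CrumSystem.
Context {R : realType}.
Local Notation C := (R[i]).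
Local Notation Re := (@complex.Re R).
Local Notation Im := (@complex.Im R).
Variables (k : C) (W Y : R -> C).
Hypothesis dW : forall y, 0 < y < 1 / 2 -> cder W y (((mm y)^-1)%:C%C * (Y y - k * (zz y)%:C%C * W y)).
Hypothesis dY : forall y, 0 < y < 1 / 2 ->
  cder Y y (((mm y)^-1)%:C%C * (((U0 y)%:C%C + k ^+ 2) * W y - k * (zz y)%:C%C * Y y)).

(** Crum's quotient of the Wronskian of three solutions by that of the two known ones, with the
    second derivative of the solution replaced by (U0 + k^2) W. *)
Definition om (y : R) : C := (k ^+ 2 + (LP y)%:C%C) * W y - (LL y)%:C%C * Y y.
(** The weighted derivative of [om] minus k [om]; this combination has a zero at the light cone,
    where [om] itself only has a limit. *)
Definition qq (y : R) : C :=
  ((LP1 y)%:C%C - (LL y)%:C%C * ((U0 y)%:C%C + k ^+ 2) - k * (k ^+ 2 + (LP y)%:C%C)) * W y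
  + (k ^+ 2 + (LP y)%:C%C - (L1 y)%:C%C + k * (LL y)%:C%C) * Y y.

Let cdiv (g : R -> R) (y d m : R) : is_derive y (1 : R) g (d / m) ->
  cder (fun z => (g z)%:C%C) y ((m^-1)%:C%C * d%:C%C).
Proof. by move=> H; apply: cder_eq (cder_real H); rewrite -rmorphM mulrC. Qed.

Lemma cder_om (y : R) :  0 < y < 1 / 2 ->
  cder om y (((mm y)^-1)%:C%C * (qq y + k * (1 - (zz y)%:C%C) * om y)).
Proof.
move=> h; have := cderB (cderM (cderD (cder_cst (k ^+ 2) y) (cdiv (der_LP h))) (dW h))
  (cderM (cdiv (der_LL h)) (dY h)).
by apply: cder_eq; rewrite /om /qq; ring.
Qed.

Lemma cder_qq (y : R) :  0 < y < 1 / 2 ->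
  cder qq y (((mm y)^-1)%:C%C * ((UU y)%:C%C * om y - k * (1 + (zz y)%:C%C) * qq y)).
Proof.
move=> h; have c3 := crum3 (half1 h).
have {}c3 : (LP2 y)%:C%C - (L1 y)%:C%C * (U0 y)%:C%C - (LL y)%:C%C * (U01 y)%:C%C
    + ((LP y)%:C%C - (L1 y)%:C%C) * (U0 y)%:C%C - (UU y)%:C%C * (LP y)%:C%C = 0 :> C.
  by rewrite -[RHS](rmorph0 (real_complex R)) -(subrr (UU y * LP y)) -{1}c3; ring.
have u0 : (UU y)%:C%C = (U0 y)%:C%C - 2 * (L1 y)%:C%C :> C by rewrite /U0; ring.
have dL1 := cdiv (der_L1 h); have dL := cdiv (der_LL h).
have dLP := cdiv (der_LP h); have dLP1 := cdiv (der_LP1 h).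
have dU := cdiv (der_U0 h).
have d1 := cderB (cderB dLP1 (cderM dL (cderD dU (cder_cst (k ^+ 2) y))))
  (cderZ k (cderD (cder_cst (k ^+ 2) y) dLP)).
have d2 := cderD (cderB (cderD (cder_cst (k ^+ 2) y) dLP) dL1) (cderZ k dL).
have := cderD (cderM d1 (dW h)) (cderM d2 (dY h)).
apply: cder_eq.
set mi := ((mm y)^-1)%:C%C.
apply/eqP; rewrite -subr_eq0; apply/eqP.
transitivity (mi * W y * ((LP2 y)%:C%C - (L1 y)%:C%C * (U0 y)%:C%C - (LL y)%:C%C * (U01 y)%:C%C
    + ((LP y)%:C%C - (L1 y)%:C%C) * (U0 y)%:C%C - (UU y)%:C%C * (LP y)%:C%C)).
  by rewrite u0 /om /qq; ring.
by rewrite c3 mulr0.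
Qed.

Let w1 y := Re (om y).
Let w2 y := Im (om y).
Let q1 y := Re (qq y).
Let q2 y := Im (qq y).
Let k1 := Re k.
Let k2 := Im k.

Let alg_re (r z : R) (q c w : C) : Re (r%:C%C * (q + c * (1 - z%:C%C) * w))
  = r * (Re q + (1 - z) * (Re c * Re w - Im c * Im w)).
Proof. by case: q c w => [x1 x2] [x3 x4] [x5 x6] /=; ring. Qed.

Let alg_im (r z : R) (q c w : C) : Im (r%:C%C * (q + c * (1 - z%:C%C) * w))
  = r * (Im q + (1 - z) * (Re c * Im w + Im c * Re w)).
Proof. by case: q c w => [x1 x2] [x3 x4] [x5 x6] /=; ring. Qed.

Let dw1 (y : R) :  0 < y < 1 / 2 -> is_derive y (1 : R) w1 ((mm y)^-1 * (q1 y + (1 - zz y) * (k1 * w1 y - k2 * w2 y))).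
Proof. by move=> /cder_om[d _]; apply: der_eq d; rewrite alg_re. Qed.

Let dw2 (y : R) :  0 < y < 1 / 2 -> is_derive y (1 : R) w2 ((mm y)^-1 * (q2 y + (1 - zz y) * (k1 * w2 y + k2 * w1 y))).
Proof. by move=> /cder_om[_ d]; apply: der_eq d; rewrite alg_im. Qed.

Let dq1 (y : R) :  0 < y < 1 / 2 -> is_derive y (1 : R) q1
  ((mm y)^-1 * (UU y * w1 y - (1 + zz y) * (k1 * q1 y - k2 * q2 y))).
Proof.
move=> /cder_qq[d _]; apply: der_eq d; rewrite !Re_mul !ReD !ReN !Re_mul /=.
by rewrite /q1 /q2 /w1 /k1 /k2 !ReD !ImD !Im_mul /=; ring.
Qed.

Let dq2 (y : R) :  0 < y < 1 / 2 -> is_derive y (1 : R) q2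
  ((mm y)^-1 * (UU y * w2 y - (1 + zz y) * (k1 * q2 y + k2 * q1 y))).
Proof.
move=> /cder_qq[_ d]; apply: der_eq d; rewrite !Im_mul !ImD !ImN !Im_mul /=.
by rewrite /q1 /q2 /w2 /k1 /k2 !ReD !ImD !Re_mul /=; ring.
Qed.

(** The squared modulus of [sg] ^ (- k / 2): quadratic expressions receive back the power weight
    left out of W and Y. *)
Definition weight (y : R) : R := sg y `^ (- k1).

Lemma weight_gt0 (y : R) :  0 < y < 1 / 2 -> 0 < weight y.
Proof. by move=> h; rewrite powR_gt0// sg_gt0. Qed.

Lemma der_weight (y : R) :  0 < y < 1 / 2 -> is_derive y (1 : R) weight ((mm y)^-1 * (2 * k1 * zz y * weight y)).
Proof.
move=> h; have g0 := sg_gt0 h.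
have := @der_comp _ _ y 1 (fun x => x `^ (- k1)) sg _ _ (is_derive1_powR (- k1) g0) (der_sg h).
apply: der_eq; rewrite powRB ?lt0r_neq0 ?implybT// powRr1 ?ltW// -/(weight y).
by field; rewrite !lt0r_neq0// mm_gt0.
Qed.

Definition EE (y : R) : R := weight y * (Re (qq y) * Re (om y) + Im (qq y) * Im (om y)).

(** In weighted form om' = qq + k om and qq' = UU om - k qq; for real k the two terms with k cancel
    in the derivative of Re (qq conj om), leaving a sum of squares. *)
Lemma der_EE (y : R) : k2 = 0 ->  0 < y < 1 / 2 -> is_derive y (1 : R) EE
  (weight y / mm y * (Re (qq y) ^+ 2 + Im (qq y) ^+ 2 + UU y * (Re (om y) ^+ 2 + Im (om y) ^+ 2))).
Proof.
move=> k20 h; have := derM (der_weight h) (derD (derM (dq1 h) (dw1 h)) (derM (dq2 h) (dw2 h))).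
apply: der_eq; rewrite k20 -/(w1 y) -/(w2 y) -/(q1 y) -/(q2 y); ring.
Qed.

Definition KK (y : R) : R := weight y *
  (- k2 * (Im (om y) * Re (qq y) - Re (om y) * Im (qq y)) + k2 ^+ 2 * ((Re (qq y) ^+ 2 + Im (qq y) ^+ 2) / UU y)).

(** The terms with Re (om conj qq) produced by the two summands of [KK] are opposite, so only |qq|^2
    remains, with a coefficient that is nonnegative as long as Re k <= 1. *)
Lemma der_KK (y : R) :  0 < y < 1 / 2 -> is_derive y (1 : R) KK
  (weight y / mm y * (k2 ^+ 2 * ((- U1 y - 2 * k1 * UU y) / UU y ^+ 2) * (Re (qq y) ^+ 2 + Im (qq y) ^+ 2))).
Proof.
move=> h; have u0 := lt0r_neq0 (UU_gt0 h); have m0 := lt0r_neq0 (mm_gt0 h).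
have dU := derV u0 (der_UU h).
have := derM (der_weight h) (derD (derM (der_cst y 1 (- k2)) (derB (derM (dw2 h) (dq1 h)) (derM (dw1 h) (dq2 h))))
  (derM (der_cst y 1 (k2 ^+ 2)) (derM (derD (derX 2 (dq1 h)) (derX 2 (dq2 h))) dU))).
apply: der_eq; rewrite -/(w1 y) -/(w2 y) -/(q1 y) -/(q2 y) /=.
by field; rewrite u0 m0.
Qed.

(** The determinant of (W, Y) -> (om, qq + k om) is k^2 (k^2 - 9), with one factor for each removed
    solution. *)
Lemma crum_invert (y : R) :  0 < y < 1 / 2 -> om y = 0 -> qq y = 0 -> k ^+ 2 * (k ^+ 2 - 9) * W y = 0 /\
  k ^+ 2 * (k ^+ 2 - 9) * Y y = 0.
Proof.
move=> h o0 q0.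
have l1 := L1E (half1 h); have cd := crum_det (half1 h).
have {}l1 : (L1 y)%:C%C = 2 * (LP y)%:C%C - (LL y)%:C%C ^+ 2 + 9 :> C by rewrite l1; ring.
have {}cd : (LP y)%:C%C * ((LP y)%:C%C - (L1 y)%:C%C) + (LL y)%:C%C * ((LP1 y)%:C%C - (LL y)%:C%C * (U0 y)%:C%C) = 0 :> C.
  by rewrite -[RHS](rmorph0 (real_complex R)) -cd; ring.
have e1 : qq y + k * om y = 0 by rewrite o0 q0 mulr0 addr0.
move: o0 e1; rewrite /om /qq.
set lp := (LP y)%:C%C in l1 cd *; set l := (LL y)%:C%C in l1 cd *; set lo := (L1 y)%:C%C in l1 cd *.
set lp1 := (LP1 y)%:C%C in cd *; set u := (U0 y)%:C%C in cd *.
set A := _ - l * Y y; set B := _ + k * A => a0 b0.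
split.
  (* Cramer's rule: a row of the adjugate is applied, and the part of the determinant free of k is
     subtracted because [crum_det] makes it vanish. *)
  transitivity ((k ^+ 2 + lp - lo) * A + l * B - (lp * (lp - lo) + l * (lp1 - l * u)) * W y).
    by rewrite /B /A l1; ring.
  by rewrite a0 b0 cd; ring.
transitivity ((k ^+ 2 + lp) * B - (lp1 - l * (u + k ^+ 2)) * A - (lp * (lp - lo) + l * (lp1 - l * u)) * Y y).
  by rewrite /B /A l1; ring.
by rewrite a0 b0 cd; ring.
Qed.

End CrumSystem.

(** * The light cone y = 1/2 *)

Section Limits.
Context {R : realType}.
Local Notation C := (R[i]).
Local Notation Re := (@complex.Re R).
Local Notation Im := (@complex.Im R).

Definition clim (F : set_system R) (f : R -> C) (l : C) : Prop :=
  (Re (f y) @[y --> F] --> Re l) /\ (Im (f y) @[y --> F] --> Im l).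

Section Filt.
Context {F : set_system R} {FF : Filter F}.
Implicit Types (f g : R -> C).

Lemma clim_cst c : clim F (fun=> c) c.
Proof. by split; exact: cvg_cst. Qed.

Lemma clim_real (f : R -> R) (l : R) : f y @[y --> F] --> l -> clim F (fun y => (f y)%:C%C) l%:C%C.
Proof. by move=> H; split=> //; exact: cvg_cst. Qed.

Lemma clim_ext f g l : (\forall y \near F, f y = g y) -> clim F f l -> clim F g l.
Proof.
move=> H [h1 h2]; split.
  by apply: cvg_trans h1; apply: near_eq_cvg; apply: filterS H => y ->.
by apply: cvg_trans h2; apply: near_eq_cvg; apply: filterS H => y ->.
Qed.

Lemma climD f g l m : clim F f l -> clim F g m -> clim F (fun y => f y + g y) (l + m).
Proof.
move=> [f1 f2] [g1 g2]; split.
  by rewrite ReD; under eq_fun do rewrite ReD; exact: cvgD.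
by rewrite ImD; under eq_fun do rewrite ImD; exact: cvgD.
Qed.

Lemma climM f g l m : clim F f l -> clim F g m -> clim F (fun y => f y * g y) (l * m).
Proof.
move=> [f1 f2] [g1 g2]; split.
  by rewrite Re_mul; under eq_fun do rewrite Re_mul; apply: cvgB; exact: cvgM.
by rewrite Im_mul; under eq_fun do rewrite Im_mul; apply: cvgD; exact: cvgM.
Qed.

Lemma climN f l : clim F f l -> clim F (fun y => - f y) (- l).
Proof.
move=> [f1 f2]; split.
  by rewrite ReN; under eq_fun do rewrite ReN; exact: cvgN.
by rewrite ImN; under eq_fun do rewrite ImN; exact: cvgN.
Qed.

Lemma climB f g l m : clim F f l -> clim F g m -> clim F (fun y => f y - g y) (l - m).
Proof. by move=> hf hg; apply: climD hf (climN hg). Qed.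

End Filt.

Lemma cleft_clim f y l : cleft f y l -> clim y^'- f l.
Proof.
move=> H; split; apply/cvgrPdist_lt => e e0; have [d d0 Hd] := H e e0.
  near=> z; have zd : y - d < z < y.
    by apply/andP; split; near: z; [apply: nbhs_left_gt; rewrite ltrBlDr ltrDl|exact: nbhs_left_lt].
  apply: le_lt_trans (Hd z zd); rewrite /nz ReD ReN distrC lerDl; exact: normr_ge0.
near=> z; have zd : y - d < z < y.
  by apply/andP; split; near: z; [apply: nbhs_left_gt; rewrite ltrBlDr ltrDl|exact: nbhs_left_lt].
apply: le_lt_trans (Hd z zd); rewrite /nz ImD ImN distrC lerDr; exact: normr_ge0.
Unshelve. all: by end_near. Qed.

Lemma mvt_diff a b (f f' : R -> R) : (forall x : R, a < x < b -> is_derive x (1 : R) f (f' x)) ->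
  forall x y, a < x -> x < y -> y < b -> exists2 c, x < c < y & f y - f x = f' c * (y - x).
Proof.
move=> df x y ax xy yb.
have dd (z : R) : x <= z <= y -> is_derive z (1 : R) f (f' z).
  by move=> /andP[h1 h2]; apply: df; apply/andP; split; [exact: lt_le_trans h1|exact: le_lt_trans yb].
have [||c cxy ->] := @MVT R f f' x y xy.
- by move=> z; rewrite in_itv /= => /andP[h1 h2]; apply: dd; rewrite !ltW.
- apply: continuous_in_subspaceT => z; rewrite inE /= in_itv /= => h; exact: der_cont (dd z h).
by exists c => //; rewrite in_itv /= in cxy.
Qed.

(** A nondecreasing function that is asymptotically nonnegative at the left end and nonpositive at
    the right end is identically 0. *)
Lemma mono_zero a b (f f' : R -> R) : (forall x : R, a < x < b -> is_derive x (1 : R) f (f' x)) ->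
  (forall x, a < x < b -> 0 <= f' x) ->
  (forall e, 0 < e -> \forall z \near a^'+, - e <= f z) ->
  (forall e, 0 < e -> \forall z \near b^'-, f z <= e) ->
  forall x, a < x < b -> f' x = 0.
Proof.
move=> df f0 fa fb x xab; have [ax xb] := andP xab.
have mono u v : a < u -> u <= v -> v < b -> f u <= f v.
  move=> au; rewrite le_eqVlt => /orP[/eqP -> //|uv] vb.
  have [c /andP[c1 c2] e] := mvt_diff df au uv vb.
  rewrite -subr_ge0 e mulr_ge0 ?subr_ge0 ?(ltW uv)// f0// (lt_trans au c1)/=.
  exact: lt_trans c2 vb.
have ge0 u : a < u < b -> 0 <= f u.
  move=> /andP[au ub]; rewrite leNgt; apply/negP => fu.
  have e0 : 0 < - f u / 2 by lra_ctx.
  near a^'+ => z.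
  have h1 : - (- f u / 2) <= f z by near: z; exact: fa.
  have h2 : a < z by near: z; exact: nbhs_right_gt.
  have h3 : z <= u by near: z; exact: nbhs_right_le.
  have := mono z u h2 h3 ub.
  lra_ctx.
have le0 u : a < u < b -> f u <= 0.
  move=> /andP[au ub]; rewrite leNgt; apply/negP => fu.
  have e0 : 0 < f u / 2 by lra_ctx.
  near b^'- => z.
  have h1 : f z <= f u / 2 by near: z; exact: fb.
  have h2 : u <= z by near: z; exact: nbhs_left_ge.
  have h3 : z < b by near: z; exact: nbhs_left_lt.
  have := mono u z au h2 h3.
  lra_ctx.
have [_ <-] := df x xab.
have : is_derive x (1 : R) f 0.
  apply: (@der_ext _ _ (fun=> 0)).
  by apply: filterS (near_oo xab) => z zab; apply/esym/le_anti; rewrite ge0 ?le0.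
by move=> [].
Unshelve. all: by end_near. Qed.

(* If [(b - y) g' y] had a nonzero limit, then [g] would grow logarithmically. *)
Lemma log_slope_zero a b (g g' : R -> R) (l m : R) : a < b ->
  (forall x : R, a < x < b -> is_derive x (1 : R) g (g' x)) ->
  g y @[y --> b^'-] --> l -> (b - y) * g' y @[y --> b^'-] --> m -> m = 0.
Proof.
move=> ab dg gl hm; apply/eqP; rewrite -normr_eq0 eq_le normr_ge0 andbT leNgt; apply/negP => m0.
have e0 : 0 < `|m| / 8 by lra_ctx.
have n1 : \forall z \near b^'-, `|l - g z| < `|m| / 8 by move/cvgrPdist_lt : gl; exact.
have n2 : \forall z \near b^'-, `|m - (b - z) * g' z| < `|m| / 8 by move/cvgrPdist_lt : hm; exact.
have [d /= d0 Hd] : exists2 d, 0 < d & forall z, b - d < z < b ->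
    `|l - g z| < `|m| / 8 /\ `|m - (b - z) * g' z| < `|m| / 8.
  have [d1 /= d10 H1] := n1; have [d2 /= d20 H2] := n2.
  exists (Num.min d1 d2); first by rewrite lt_min d10.
  move=> z /andP[z1 z2]; have hz : `|b - z| < Num.min d1 d2 by rewrite gtr0_norm ?subr_gt0//; lra_ctx.
  by rewrite lt_min in hz; have [h1 h2] := andP hz; split; [exact: H1|exact: H2].
pose x := Num.max ((a + b) / 2) (b - d / 2); pose y := (x + b) / 2.
have x1 : (a + b) / 2 <= x by rewrite le_max lexx.
have x2 : b - d / 2 <= x by rewrite le_max lexx orbT.
have xb : x < b by rewrite gt_max; apply/andP; split; lra_ctx.
have ax : a < x by lra_ctx.
have xy : x < y by rewrite /y; lra_ctx.
have yb : y < b by rewrite /y; lra_ctx.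
have [c /andP[c1 c2] E] := mvt_diff dg ax xy yb.
have /Hd[h1 _] : b - d < x < b by apply/andP; split; lra_ctx.
have /Hd[h2 _] : b - d < y < b by apply/andP; split; lra_ctx.
have /Hd[_ h3] : b - d < c < b by apply/andP; split; lra_ctx.
have n3 : `|g y - g x| < `|m| / 4.
  have -> : g y - g x = (l - g x) - (l - g y) by ring.
  by apply: le_lt_trans (ler_normB _ _) _; lra_ctx.
have n4 : `|m| * (7 / 8) <= `|(b - c) * g' c|.
  have := ler_normD (m - (b - c) * g' c) ((b - c) * g' c); rewrite subrK; lra_ctx.
move: n3; rewrite E !normrM (@gtr0_norm _ (y - x)) ?subr_gt0// => n3.
move: n4; rewrite normrM (@gtr0_norm _ (b - c)) ?subr_gt0; last by lra_ctx.
move: n3; rewrite (_ : y - x = (b - x) / 2); last by rewrite /y; field.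
have := normr_ge0 (g' c); have : b - c <= b - x by lra_ctx.
set A := `|g' c|; set M := `|m| => i1 i2 i3 i4.
have : (b - c) * A <= (b - x) * A by exact: ler_wpM2r.
move: (m0); rewrite -/M; lra_ctx.
Qed.

End Limits.

(** * Limits at the light cone and the relation between them *)

Section LightCone.
Context {R : realType}.
Local Notation C := (R[i]).
Local Notation Re := (@complex.Re R).
Local Notation Im := (@complex.Im R).
Local Notation hf := (1 / 2 : R).

Lemma sq_half : sq hf = 3 / 2.
Proof.
apply/eqP; rewrite -(@eqrXn2 _ 2)// ?ltW ?sq_gt0//.
by rewrite sq_sq; apply/eqP; field.
Qed.

Lemma rho_half : rho hf = 1.
Proof. by rewrite /rho sq_half; field. Qed.

Lemma der_rho_half : exists d, is_derive hf (1 : R) rho d.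
Proof.
have s2 : 2 - sq hf != 0 by rewrite sq_half; apply/eqP; lra_ctx.
have ds := derB (der_cst hf 1 2) (der_sq hf).
by eexists; exact: (derM (der_id hf) (derV (f := fun z => 2 - sq z) s2 ds)).
Qed.

Lemma der_ee_half : exists d, is_derive hf (1 : R) ee d.
Proof.
have [d dr] := der_rho_half.
have D : 3 * rho hf + 5 * rho hf ^+ 3 != 0 by rewrite rho_half; apply/eqP; lra_ctx.
eexists; exact: (derV (f := fun z => 3 * rho z + 5 * rho z ^+ 3) D
  (derD (derM (der_cst hf 1 3) dr) (derM (der_cst hf 1 5) (derX 3 dr)))).
Qed.

Lemma cvg_left (f : R -> R) : {for hf, continuous f} -> f y @[y --> hf^'-] --> f hf.
Proof. by move=> H; apply: cvg_at_left_filter. Qed.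

Lemma near_left : \forall y \near hf^'-, 0 < y < hf.
Proof.
near=> y; apply/andP; split; near: y; [apply: nbhs_left_gt; lra_ctx|exact: nbhs_left_lt].
Unshelve. all: by end_near. Qed.

(** The zero of 1 - rho^2 is that of [sg]: their quotient (2 - s)^(-2) tends to 4 at s = 3/2. *)
Lemma quot_lim (f p : R -> R) (n : nat) : (exists d, is_derive hf (1 : R) p d) ->
  (forall y, f y = (1 - rho y ^+ 2) * p y * ee y ^+ n) ->
  (sg y)^-1 * f y @[y --> hf^'-] --> 4 * (p hf * ee hf ^+ n).
Proof.
move=> [d dp] fE; have [d' de] := der_ee_half.
have s2 : 2 - sq hf != 0 by rewrite sq_half; apply/eqP; lra_ctx.
have ds := derV (f := fun z => 2 - sq z) s2 (derB (der_cst hf 1 2) (der_sq hf)).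
have := cvg_left (der_cont (derM (derX 2 ds) (derM dp (derX n de)))).
have -> : (2 - sq hf)^-1 ^+ 2 = 4 :> R by rewrite sq_half; field.
apply: cvg_trans; apply: near_eq_cvg; apply: filterS near_left => y h.
by have g0 := lt0r_neq0 (sg_gt0 h); rewrite fE one_sub_rho ?half1// -!mulrA (mulKf g0).
Qed.

Lemma sg_left : sg y @[y --> hf^'-] --> 0.
Proof.
have := cvg_left (der_cont (derB (der_cst hf 1 6) (derM (der_cst hf 1 4) (der_sq hf)))).
by rewrite sq_half (_ : 6 - 4 * (3 / 2) = 0)//; field.
Qed.

Lemma sg_quot_left (f : R -> R) (l : R) : (sg y)^-1 * f y @[y --> hf^'-] --> l -> f y @[y --> hf^'-] --> 0.
Proof.
move=> H; have h : sg y * ((sg y)^-1 * f y) @[y --> hf^'-] --> (0 : R).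
  by rewrite -(mul0r l); exact: cvgM sg_left H.
apply: cvg_trans h; apply: near_eq_cvg.
by apply: filterS near_left => y h; rewrite mulrA mulfV ?mul1r// lt0r_neq0// sg_gt0.
Qed.

Let poly_der (a b c d : R) : exists d', is_derive hf (1 : R)
  (fun y => a + b * rho y ^+ 2 + c * rho y ^+ 4 + d * rho y ^+ 6) d'.
Proof.
have [d0 dr] := der_rho_half; eexists.
exact: (derD (derD (derD (der_cst hf 1 a) (derM (der_cst hf 1 b) (derX 2 dr)))
  (derM (der_cst hf 1 c) (derX 4 dr))) (derM (der_cst hf 1 d) (derX 6 dr))).
Qed.

Lemma UU_quot : (sg y)^-1 * UU y @[y --> hf^'-] --> (12 : R).
Proof.
have := @quot_lim UU _ 2 (poly_der 180 72 (-60) 0) _.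
rewrite /ee rho_half; have -> : 4 * ((180 + 72 * 1 ^+ 2 + -60 * 1 ^+ 4 + 0 * 1 ^+ 6) * (3 * 1 + 5 * 1 ^+ 3)^-1 ^+ 2) = 12 :> R by field.
by apply => y; rewrite /UU /ee; ring.
Qed.

Lemma LP_quot : exists l : R, (sg y)^-1 * LP y @[y --> hf^'-] --> l.
Proof. by eexists; apply: (@quot_lim LP _ 2 (poly_der 189 (-990) 225 0)) => y; rewrite /LP; ring. Qed.

Lemma L1_quot : exists l : R, (sg y)^-1 * L1 y @[y --> hf^'-] --> l.
Proof. by eexists; apply: (@quot_lim L1 _ 2 (poly_der (-63) (-450) 225 0)) => y; rewrite /L1; ring. Qed.

Lemma LP1_quot : exists l : R, (sg y)^-1 * LP1 y @[y --> hf^'-] --> l.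
Proof.
eexists; apply: (@quot_lim LP1 _ 3 (poly_der (18 * -63) (18 * -315) (18 * 1715) (18 * -825))) => y.
by rewrite /LP1; ring.
Qed.

Lemma LL_left : exists l : R, LL y @[y --> hf^'-] --> l.
Proof.
have [d de] := der_ee_half; have [d' dp] := poly_der 21 (-45) 0 0.
eexists; apply: cvg_trans (cvg_left (der_cont (derM dp de))); apply: near_eq_cvg.
by apply: filterE => y; rewrite /LL; ring.
Qed.

Lemma zz_left : zz y @[y --> hf^'-] --> (1 : R).
Proof.
have := cvg_left (der_cont (der_zz hf)).
by rewrite /zz sq_half (_ : hf * (3 / 2 - 1)^-1 = 1)//; field.
Qed.

(** What is left of [mm] once its zero [sg] at the cone is factored out. *)
Definition cm (y : R) : R := sq y / (2 * (sq y - 1)).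

Lemma cm_left : cm y @[y --> hf^'-] --> (3 / 2 : R).
Proof.
have s1 : 2 * (sq hf - 1) != 0 by rewrite mulf_neq0// sqm1_neq0.
have := cvg_left (der_cont (derM (der_sq hf) (derV (f := fun y => 2 * (sq y - 1)) s1
  (derM (der_cst hf 1 2) (derB (der_sq hf) (der_cst hf 1 1)))))).
by rewrite sq_half (_ : 3 / 2 * (2 * (3 / 2 - 1))^-1 = 3 / 2)//; field.
Qed.

Lemma z1_quot : exists l : R, (sg y)^-1 * (1 - zz y) @[y --> hf^'-] --> l.
Proof.
have s1 : 2 * (sq hf - 1) * (sq hf - 1 + hf) != 0 by rewrite sq_half; apply/eqP; lra_ctx.
have d1 := derB (der_sq hf) (der_cst hf 1 1).
eexists; apply: cvg_trans (cvg_left (der_cont (derV (f := fun y => 2 * (sq y - 1) * (sq y - 1 + y)) s1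
  (derM (derM (der_cst hf 1 2) d1) (derD d1 (der_id hf)))))).
apply: near_eq_cvg; apply: filterS near_left => y h; have y0 : 0 < y by case/andP: h.
rewrite one_sub_z// mulrA mulVf ?mul1r// lt0r_neq0// sg_gt0 //.
Qed.

Let FL : Filter hf^'-. Proof. exact: _. Qed.
Local Notation lM := (@climM R hf^'- FL _ _ _ _).
Local Notation lD := (@climD R hf^'- FL _ _ _ _).
Local Notation lB := (@climB R hf^'- FL _ _ _ _).
Local Notation lR := (@clim_real R hf^'- FL _ _).
Local Notation lC := (@clim_cst R hf^'- FL).

(** Divides [qq] by [sg]. The only terms without an evident factor [sg] combine into (LL k^2 + k^3)
    (1 - zz), and 1 - zz vanishes to first order at the cone. *)
Let alg_theta (lp1 ll uu l1 lp z g c : R) (k D w : C) : g%:C%C != 0 :> C ->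
  (g^-1)%:C%C * ((lp1%:C%C - ll%:C%C * ((uu + 2 * l1)%:C%C + k ^+ 2) - k * (k ^+ 2 + lp%:C%C)) * w
    + (k ^+ 2 + lp%:C%C - l1%:C%C + k * ll%:C%C) * ((g * c)%:C%C * D + k * (z%:C%C * w))) =
  ((g^-1 * lp1)%:C%C - ll%:C%C * ((g^-1 * uu)%:C%C + 2 * (g^-1 * l1)%:C%C)
   - k * (g^-1 * lp)%:C%C + k * z%:C%C * ((g^-1 * lp)%:C%C - (g^-1 * l1)%:C%C)
   - (ll%:C%C * k ^+ 2 + k ^+ 3) * (g^-1 * (1 - z))%:C%C) * w
  + (k ^+ 2 + lp%:C%C - l1%:C%C + k * ll%:C%C) * (c%:C%C * D).
Proof.
have eV (x : R) : (g^-1 * x)%:C%C = g%:C%C^-1 * x%:C%C :> C by rewrite rmorphM fmorphV.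
have e1 : (uu + 2 * l1)%:C%C = uu%:C%C + 2 * l1%:C%C :> C by rewrite rmorphD rmorphM rmorph_nat.
have e2 : (1 - z)%:C%C = 1 - z%:C%C :> C by rewrite rmorphB rmorph1.
have e3 : (g * c)%:C%C = g%:C%C * c%:C%C :> C by rewrite rmorphM.
have e4 : (g^-1)%:C%C = g%:C%C^-1 :> C by rewrite fmorphV.
rewrite !eV e1 e2 e3 e4.
move: lp1%:C%C ll%:C%C uu%:C%C l1%:C%C lp%:C%C z%:C%C g%:C%C c%:C%C => {lp1 ll uu l1 lp z g c eV e1 e2 e3 e4}.
by move=> lp1 ll uu l1 lp z g c g0; field.
Qed.

Variables (lam : C) (F P : R -> C) (l m : C).
Hypothesis dF : forall y, 0 < y < 1 / 2 -> cder F y (P y).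
Hypothesis dP : forall y, 0 < y < 1 / 2 -> exists Q, cder P y Q /\ eigen_ode lam y (F y) (P y) Q.
Hypothesis cF : clim hf^'- F l.
Hypothesis cP : clim hf^'- P m.
Let k : C := 1 - lam.
Let W := Wf F.
Let Y := Yf lam F P.

Definition theta (y : R) : C := ((sg y)^-1)%:C%C * qq k W Y y.

Let Dd (y : R) : C := (3 * y ^+ 2)%:C%C * F y + (y ^+ 3)%:C%C * P y.

Let cD : exists l', clim hf^'- Dd l'.
Proof.
have c3 := lR (cvg_left (der_cont (derX 3 (der_id hf)))).
have c2 := lR (cvg_left (der_cont (derM (der_cst hf 1 3) (derX 2 (der_id hf))))).
by eexists; exact: lD (lM c2 cF) (lM c3 cP).
Qed.

Let cW : exists l', clim hf^'- W l'.
Proof.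
have c3 := lR (cvg_left (der_cont (derX 3 (der_id hf)))).
by eexists; exact: lM c3 cF.
Qed.

Let thetaE (y : R) : 0 < y < hf -> theta y =
  (((sg y)^-1 * LP1 y)%:C%C - (LL y)%:C%C * (((sg y)^-1 * UU y)%:C%C + 2 * ((sg y)^-1 * L1 y)%:C%C)
   - k * ((sg y)^-1 * LP y)%:C%C + k * (zz y)%:C%C * (((sg y)^-1 * LP y)%:C%C - ((sg y)^-1 * L1 y)%:C%C)
   - ((LL y)%:C%C * k ^+ 2 + k ^+ 3) * ((sg y)^-1 * (1 - zz y))%:C%C) * W y
  + (k ^+ 2 + (LP y)%:C%C - (L1 y)%:C%C + k * (LL y)%:C%C) * ((cm y)%:C%C * Dd y).
Proof.
move=> h; have g0 : (sg y)%:C%C != 0 :> C by rewrite fmorph_eq0 lt0r_neq0// sg_gt0.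
rewrite /theta /qq /Y /Yf /Xf -/(Dd y) -/(W y) (mm_sg y) -/(cm y) /U0 -/k.
exact: alg_theta.
Qed.

(** [theta] satisfies theta' = T / sg with T tending to (2/3) (12 v + 2 lam t). As [sg] has a simple
    zero and [theta] converges, a nonzero limit of T would produce a logarithm, which
    [log_slope_zero] excludes. *)
Lemma light_cone : exists v t : C, [/\ clim hf^'- (om k W Y) v, clim hf^'- theta t &
  12 * v + 2 * lam * t = 0].
Proof.
have [d cd] := cD; have [w cw] := cW.
have [l1 h1] := LP1_quot; have [l2 h2] := LP_quot; have [l3 h3] := L1_quot.
have [l4 h4] := LL_left; have [l5 h5] := z1_quot.
have hU := UU_quot; have hz := zz_left; have hc := cm_left.
have g2 := lR (sg_quot_left h2); have g3 := lR (sg_quot_left h3).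
have ck := lC k.
have ck2 := lC (k ^+ 2); have ck3 := lC (k ^+ 3).
have c2 := lC (2 : C).
have [t ct] : exists t, clim hf^'- theta t.
  eexists; apply: clim_ext; first by apply: filterS near_left => y h; exact/esym/thetaE.
  apply: lD.
    apply: lM cw; apply: lB; last first.
      apply: lM (lR h5); apply: lD ck3; exact: lM (lR h4) ck2.
    apply: lD; last first.
      by apply: lM; [exact: lM ck (lR hz)|exact: lB (lR h2) (lR h3)].
    apply: lB; last exact: lM ck (lR h2).
    apply: lB; first exact: lR h1.
    apply: lM (lR h4) _; apply: lD (lR hU) _; exact: lM c2 (lR h3).
  apply: lM; last exact: lM (lR hc) cd.
  apply: lD; last exact: lM ck (lR h4).
  by apply: lB; [exact: lD ck2 g2|exact: g3].
have cY : exists l', clim hf^'- Y l'.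
  eexists; apply: lD; last by apply: lM ck _; exact: lM (lR hz) cw.
  apply: (@clim_ext _ _ _ (fun y => (sg y * cm y)%:C%C * Dd y)).
    by apply: filterE => y; rewrite /Xf (mm_sg y).
  exact: lM (lR (cvgM sg_left hc)) cd.
have {cY} [y0 cy] := cY.
have [v0 cvo] : exists v, clim hf^'- (om k W Y) v.
  eexists; apply: lB; last exact: lM (lR h4) cy.
  by apply: lM cw; exact: lD ck2 g2.
exists v0, t; split=> //.
pose T y := (cm y)^-1%:C%C * (((sg y)^-1 * UU y)%:C%C * om k W Y y + (2 * (zz y)%:C%C - k * (1 + (zz y)%:C%C)) * theta y).
have dT y : 0 < y < hf -> cder theta y (((sg y)^-1)%:C%C * T y).
  move=> h; have g0 := lt0r_neq0 (sg_gt0 h).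
  have dq := cder_qq (cder_W lam dF) (cder_Y dF dP) h.
  have := cderM (cder_real (derV (f := sg) g0 (der_sg h))) dq.
  apply: cder_eq.
  have cm0 : cm y != 0 by rewrite /cm mulf_neq0 ?lt0r_neq0 ?sq_gt0// invr_gt0 mulr_gt0// sqm1_gt0.
  rewrite /T /theta -/k -/W -/Y (mm_sg y) -/(cm y).
  have G0 : (sg y)%:C%C != 0 :> C by rewrite fmorph_eq0.
  have C0 : (cm y)%:C%C != 0 :> C by rewrite fmorph_eq0.
  move: (qq k W Y y) (om k W Y y) => q o'.
  by field; do ?[apply/andP; split].
have cT : clim hf^'- T ((3 / 2)^-1%:C%C * ((12 : R)%:C%C * v0 + (2 * (1 : R)%:C%C - k * (1 + (1 : R)%:C%C)) * t)).
  apply: lM; first by apply: lR; apply: cvgV => //; apply/eqP; lra.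
  apply: lD; first exact: lM (lR hU) cvo.
  apply: lM ct; apply: lB; first exact: lM c2 (lR hz).
  by apply: lM ck _; apply: lD; [exact: lC _|exact: lR].
(* The quotient (1/2 - y) / sg in a form regular at y = 1/2, from 36 - 16 s^2 = 16 (1/2 - y) (1/2 +
   y); its limit there is 3/4. *)
pose fr (y : R) : R := (6 + 4 * sq y) * (16 * (1 / 2 + y))^-1.
have n0 : 16 * (1 / 2 + hf) != 0 by apply/eqP; lra.
have dv := derM (der_cst hf 1 (16 : R)) (derD (der_cst hf 1 (1 / 2 : R)) (der_id hf)).
have dn := derD (der_cst hf 1 (6 : R)) (derM (der_cst hf 1 (4 : R)) (der_sq hf)).
have cfr := cvg_left (der_cont (derM dn (derV (f := fun y : R => 16 * (1 / 2 + y)) n0 dv))).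
have := lM (lR cfr) cT.
set val := (X in clim _ _ X) => cv.
have E : 2 * val = 12 * v0 + 2 * lam * t.
  by rewrite /val sq_half /k; field.
have frE y : 0 < y < hf -> fr y = (hf - y) * (sg y)^-1.
  move=> h; have g0 := lt0r_neq0 (sg_gt0 h); have /andP[yp _] := h.
  apply: (mulIf g0); rewrite -[RHS]mulrA mulVf// mulr1 /fr /sg.
  transitivity ((36 - 16 * sq y ^+ 2) / (16 * (1 / 2 + y))).
    by field; rewrite lt0r_neq0//; lra.
  rewrite -(addrNK 2 (sq y ^+ 2)) -(ysq y); field; rewrite lt0r_neq0//; lra.
have cv' : clim hf^'- (fun y => (hf - y)%:C%C * (((sg y)^-1)%:C%C * T y)) val.
  apply: clim_ext cv; apply: filterS near_left => y h.
  by rewrite mulrA -rmorphM /= -frE.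
have hf0 : 0 < hf by lra.
rewrite -E; suff -> : val = 0 by rewrite mulr0.
apply/complexP; have [t1 t2] := ct; have [v1 v2] := cv'; split.
  apply: (log_slope_zero (g := fun y => Re (theta y)) (g' := fun y => Re (((sg y)^-1)%:C%C * T y)) hf0 _ t1).
    by move=> y /dT[].
  apply: cvg_trans v1; apply: near_eq_cvg; apply: filterE => y.
  by move: (_ * T y) => q; rewrite Re_mul /= mul0r subr0.
apply: (log_slope_zero (g := fun y => Im (theta y)) (g' := fun y => Im (((sg y)^-1)%:C%C * T y)) hf0 _ t2).
  by move=> y /dT[].
apply: cvg_trans v2; apply: near_eq_cvg; apply: filterE => y.
by move: (_ * T y) => q; rewrite Im_mul /= mul0r addr0.
Qed.

End LightCone.

(** * The origin *)

Section Cone.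
Context {R : realType}.

Lemma dot_bound (K a1 a2 g1 g2 s : R) : 0 < K -> a1 ^+ 2 + a2 ^+ 2 <= s ->
  g1 ^+ 2 + g2 ^+ 2 <= K ^+ 2 * s -> `|2 * (a1 * g1 + a2 * g2)| <= 2 * K * s.
Proof.
move=> K0 ha hg.
have H (e : R) : e ^+ 2 = 1 -> e * (2 * (a1 * g1 + a2 * g2)) <= 2 * K * s.
  move=> e1; rewrite -(ler_pM2l K0).
  have : 0 <= (K * a1 - e * g1) ^+ 2 + (K * a2 - e * g2) ^+ 2 by rewrite addr_ge0 ?sqr_ge0.
  have : K ^+ 2 * (a1 ^+ 2 + a2 ^+ 2) <= K ^+ 2 * s by rewrite ler_pM2l// exprn_gt0.
  have -> : (K * a1 - e * g1) ^+ 2 + (K * a2 - e * g2) ^+ 2 =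
    K ^+ 2 * (a1 ^+ 2 + a2 ^+ 2) + e ^+ 2 * (g1 ^+ 2 + g2 ^+ 2) - K * (e * (2 * (a1 * g1 + a2 * g2))) by ring.
  rewrite e1 mul1r (_ : K * (2 * K * s) = 2 * (K ^+ 2 * s)); last by ring.
  set A := K ^+ 2 * s in hg *; move: hg; lra_ctx.
rewrite ler_norml; apply/andP; split; last by rewrite -[leLHS]mul1r; apply: H; rewrite expr1n.
by rewrite lerNl -mulN1r; apply: H; rewrite sqrrN expr1n.
Qed.

Let cone_arith (p q b v w : R) : b <= 100 * p -> 0 <= p -> 0 <= q -> 0 < v -> w < 1 ->
  (1 + v) * p <= (1 + w) * q -> p + b <= 101 * (4 * q).
Proof.
move=> pb p0 q0 v0 w1.
rewrite (_ : (1 + v) * p = p + v * p); last by ring.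
rewrite (_ : (1 + w) * q = q + w * q); last by ring.
have := ler_wpM2r q0 (ltW w1); have := mulr_ge0 (ltW v0) p0; lra_ctx.
Qed.

Variables (c K : R) (a1 a2 b1 b2 g1 g2 h1 h2 : R -> R).
Hypothesis c0 : 0 < c.
Hypothesis K0 : 0 < K.
Hypothesis da1 : forall y : R, 0 < y < c -> is_derive y (1 : R) a1 (g1 y).
Hypothesis da2 : forall y : R, 0 < y < c -> is_derive y (1 : R) a2 (g2 y).
Hypothesis db1 : forall y : R, 0 < y < c -> is_derive y (1 : R) b1 (- 5 * b1 y / y + h1 y).
Hypothesis db2 : forall y : R, 0 < y < c -> is_derive y (1 : R) b2 (- 5 * b2 y / y + h2 y).
Let S (y : R) := a1 y ^+ 2 + a2 y ^+ 2 + (b1 y ^+ 2 + b2 y ^+ 2).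
Hypothesis gS : forall y, 0 < y < c -> g1 y ^+ 2 + g2 y ^+ 2 <= K ^+ 2 * S y.
Hypothesis hS : forall y, 0 < y < c -> h1 y ^+ 2 + h2 y ^+ 2 <= K ^+ 2 * S y.

Let A (y : R) := a1 y ^+ 2 + a2 y ^+ 2.
Let B (y : R) := b1 y ^+ 2 + b2 y ^+ 2.

Lemma mono_itv u v (f f' : R -> R) : (forall x : R, u < x < v -> is_derive x (1 : R) f (f' x)) ->
  (forall x, u < x < v -> 0 <= f' x) -> forall x y, u < x -> x <= y -> y < v -> f x <= f y.
Proof.
move=> df f0 x y ux; rewrite le_eqVlt => /orP[/eqP -> //|xy] yv.
have [z /andP[z1 z2] e] := mvt_diff df ux xy yv.
rewrite -subr_ge0 e mulr_ge0 ?subr_ge0 ?(ltW xy)// f0// (lt_trans ux z1)/=.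
exact: lt_trans z2 yv.
Qed.

(* [y B' = - 10 B + O(y)] pushes the solution into the cone [B <= 100 A], unless it is as singular as [y ^- 9]. *)
Lemma cone : (exists d M : R, [/\ 0 < d, d <= c & forall y, 0 < y < d -> S y <= M]) \/
  (exists d m : R, [/\ 0 < d, d <= c, 0 < m & forall y, 0 < y < d -> m <= y ^+ 9 * (B y - 100 * A y)]).
Proof.
(* The constant 101 is 1 + 100 twice: the error weights in B - 100 A, and S <= 101 A inside the
   cone. *)
have [L [L0 KE]] : exists L, 0 < L /\ 2 * K = L / 101.
  by exists (101 * (2 * K)); split; [rewrite !mulr_gt0|field].
pose d := Num.min c (2 * L)^-1.
have d0 : 0 < d by rewrite lt_min c0 invr_gt0 mulr_gt0.
have dc : d <= c by rewrite ge_min lexx.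
have dK y : y < d -> 2 * L * y < 1.
  by rewrite lt_min => /andP[_ h]; rewrite mulrC -ltr_pdivlMr ?mulr_gt0// mul1r.
have yc y : 0 < y < d -> 0 < y < c by move=> /andP[-> h]; rewrite (lt_le_trans h dc).
have SA y : S y = A y + B y by [].
have A0 y : 0 <= A y by rewrite addr_ge0 ?sqr_ge0.
have B0 y : 0 <= B y by rewrite addr_ge0 ?sqr_ge0.
have bd_a y : 0 < y < d -> `|2 * (a1 y * g1 y + a2 y * g2 y)| <= 2 * K * S y.
  move=> /yc h; apply: dot_bound => //; last exact: gS.
  by have := B0 y; rewrite SA /A; lra.
have bd_b y : 0 < y < d -> `|2 * (b1 y * h1 y + b2 y * h2 y)| <= 2 * K * S y.
  move=> /yc h; apply: dot_bound => //; last exact: hS.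
  by have := A0 y; rewrite SA /B; lra.
have dA (y : R) : 0 < y < d -> is_derive y (1 : R) A (2 * (a1 y * g1 y + a2 y * g2 y)).
  move=> /yc h; have := derD (derX 2 (da1 h)) (derX 2 (da2 h)).
  by apply: der_eq => /=; ring.
have dB (y : R) : 0 < y < d -> is_derive y (1 : R) B (- 10 * B y / y + 2 * (b1 y * h1 y + b2 y * h2 y)).
  move=> /yc h; have := derD (derX 2 (db1 h)) (derX 2 (db2 h)).
  by apply: der_eq => /=; rewrite /B; ring.
(* The exponent 9 instead of 10 leaves a margin - B - 900 A that absorbs the error terms for small
   y. *)
pose T y := - (y ^+ 9 * (B y - 100 * A y)).
pose T' y := - (y ^+ 8 * (9 * (B y - 100 * A y) + (- 10 * B y + y * (2 * (b1 y * h1 y + b2 y * h2 y))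
  - 100 * (y * (2 * (a1 y * g1 y + a2 y * g2 y)))))).
have dT (y : R) : 0 < y < d -> is_derive y (1 : R) T (T' y).
  move=> h; have y0 : y != 0 by rewrite gt_eqF//; case/andP: h.
  have := derN (derM (derX 9 (der_id y)) (derB (dB y h) (derM (der_cst y 1 100) (dA y h)))).
  apply: der_eq; rewrite /T' /=.
  move: (B y) (A y) (2 * (b1 y * h1 y + b2 y * h2 y)) (2 * (a1 y * g1 y + a2 y * g2 y)) => p q u v.
  by field.
have T0 y : 0 < y < d -> 0 <= T' y.
  move=> h; have := bd_a y h; have := bd_b y h; have /andP[y0 /dK yK] := h.
  rewrite /T'; set u := 2 * (b1 y * h1 y + _); set v := 2 * (a1 y * g1 y + _) => hu hv.
  rewrite oppr_ge0 pmulr_rle0 ?exprn_gt0//.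
  have s0 : 0 <= S y by rewrite SA addr_ge0.
  have yu : y * u <= y * (2 * K * S y) by rewrite ler_pM2l//; apply: le_trans (ler_norm _) hu.
  have yv : - (y * v) <= y * (2 * K * S y) by rewrite -mulrN ler_pM2l//; apply: le_trans _ hv; rewrite -normrN ler_norm.
  have : L * y * S y <= S y / 2.
    by rewrite -[leRHS]mulrC ler_wpM2r//; move: yK; lra.
  move: yu yv; rewrite (_ : y * (2 * K * S y) = (L * y * S y) / 101); last by rewrite KE; field.
  move: (L * y * S y) (y * u) (y * v) => p q w; have := A0 y; have := B0 y; rewrite SA.
  lra.
have [neg|pos] := pselect (forall y, 0 < y < d -> B y <= 100 * A y); last first.
  right; have [y0 [hy0 By]] : exists y0, 0 < y0 < d /\ 100 * A y0 < B y0.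
    apply: contrapT => h; apply: pos => y hy; rewrite leNgt; apply/negP => By.
    by apply: h; exists y.
  have [y1 y2] := andP hy0.
  exists y0, (y0 ^+ 9 * (B y0 - 100 * A y0)); split => //.
  - by apply/ltW; exact: lt_le_trans y2 dc.
  - by rewrite mulr_gt0 ?exprn_gt0// subr_gt0.
  move=> y /andP[y3 y4]; rewrite -lerN2.
  exact: (mono_itv dT T0 y3 (ltW y4) y2).
left; exists (d / 2), (101 * (4 * A (d / 2))).
split; [by rewrite divr_gt0|by lra|] => y /andP[y0 yd].
have hd : d / 2 < d by lra.
(* The factor 1 + 2 L y compensates the possible decrease of A inside the cone, so that A near 0 is
   bounded by its value at d/2. *)
pose G y := (1 + 2 * L * y) * A y.
pose G' y := 2 * L * A y + (1 + 2 * L * y) * (2 * (a1 y * g1 y + a2 y * g2 y)).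
have dG (x : R) : 0 < x < d -> is_derive x (1 : R) G (G' x).
  move=> hx; have := derM (derD (der_cst x 1 1) (derM (der_cst x 1 (2 * L)) (der_id x))) (dA x hx).
  by apply: der_eq; rewrite /G'; ring.
have G0 x : 0 < x < d -> 0 <= G' x.
  move=> hx; have := bd_a x hx; have := neg x hx; rewrite SA /G'; set u := 2 * (a1 x * g1 x + _).
  have [x0 xd] := andP hx; have xK := dK x xd => hB; rewrite ler_norml => /andP[hu _].
  have K1 : 2 * K * (A x + B x) <= L * A x.
    rewrite KE -mulrA ler_pM2l// mulrC ler_pdivrMr//; move: hB; lra.
  have h3 : - (L * A x) <= u by lra.
  have xk0 : 0 < 2 * L * x by rewrite !mulr_gt0.
  have xk1 : 0 < 1 + 2 * L * x by lra.
  have h4 : (1 + 2 * L * x) * - (L * A x) <= (1 + 2 * L * x) * u by rewrite ler_pM2l.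
  have h5 : 2 * L * x * (L * A x) <= L * A x.
    by rewrite -[leRHS]mul1r ler_wpM2r ?(ltW xK)// !mulr_ge0// ltW.
  move: h4; rewrite mulrDl mul1r mulrN; move: h5; lra.
have AG : G y <= G (d / 2) := mono_itv dG G0 y0 (ltW yd) hd.
have hd0 : 0 < d / 2 by rewrite divr_gt0.
have nB := neg y; rewrite SA; apply: (@cone_arith _ _ _ (2 * L * y) (2 * L * (d / 2))) => //.
- by apply: nB; rewrite y0 (lt_trans yd hd).
- by rewrite !mulr_gt0.
- exact: dK.
Qed.

End Cone.

(** * The alternative between bounded and y^-5 behaviour at the origin *)

Section Origin.
Context {R : realType}.
Local Notation C := (R[i]).
Local Notation Re := (@complex.Re R).
Local Notation Im := (@complex.Im R).

Lemma sqmod_le_nz (z : C) : sqmod z <= nz z ^+ 2.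
Proof.
rewrite /sqmod /nz -(real_normK (num_real (Re z))) -(real_normK (num_real (Im z))).
have := normr_ge0 (Re z); have := normr_ge0 (Im z); nra_ctx.
Qed.

Lemma nz_sq_le (z : C) : nz z ^+ 2 <= 2 * sqmod z.
Proof.
rewrite /sqmod /nz -(real_normK (num_real (Re z))) -(real_normK (num_real (Im z))).
have := sqr_ge0 (`|Re z| - `|Im z|); nra_ctx.
Qed.

Let comb_le (p q p' q' b f : R) : 0 <= b -> 0 <= f -> 0 <= p' -> 0 <= q' -> p <= p' -> q <= q' ->
  p * b + q * f <= (p' + q') * (b + f).
Proof.
move=> b0 f0 p0 q0 pp qq; have h1 := ler_wpM2r b0 pp; have h2 := ler_wpM2r f0 qq.
have := mulr_ge0 q0 b0; have := mulr_ge0 p0 f0; nra_ctx.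
Qed.

Let quad_le (k x z sx sz : R) : 0 <= sx -> x ^+ 2 <= 2 * sx -> z ^+ 2 <= 2 * sz ->
  (k * (2 * z + x)) ^+ 2 <= (4 * k) ^+ 2 * (sx + sz).
Proof.
move=> s0 hx hz; rewrite (_ : (4 * k) ^+ 2 * (sx + sz) = k ^+ 2 * (16 * (sx + sz))); last by ring.
rewrite exprMn; apply: ler_wpM2l; first exact: sqr_ge0.
have := sqr_ge0 (2 * z - x); lra_ctx.
Qed.

Lemma sq_near0 (y : R) : 0 < y < 1 / 4 -> 7 / 5 < sq y < 29 / 20.
Proof.
move=> /andP[y0 y1]; rewrite sq_lt /=; last 2 first.
- lra_ctx.
- nra_ctx.
rewrite andbT ltNge; apply/negP => h.
have := sq_sq y; have := sq_gt0 y; nra_ctx.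
Qed.

Lemma coef_near0 (y : R) : 0 < y < 1 / 4 ->
  [/\ 1 / 10 <= c12 y, `|c20 y| <= 10, `|V y| <= 24 * 21 &
    `|- (3 - 2 * sq y) / (sq y - 1) + 4 * sq y| <= 10].
Proof.
move=> h; have /andP[s1 s2] := sq_near0 h; have /andP[y0 y1] := h.
have i1 : 0 < (sq y - 1)^-1 by rewrite invr_gt0; lra_ctx.
have i2 : (sq y - 1)^-1 <= 5 / 2.
  rewrite -[leRHS]invrK lef_pV2 ?posrE ?invr_gt0//; lra_ctx.
split.
- by rewrite c12E; nra_ctx.
- rewrite c20E ?gt_eqF// div1r ler_norml; apply/andP; split; lra_ctx.
- rewrite VE.
  have d1 : 9 / 10 <= dn y.
    have : 0 <= (2 - sq y - 11 / 20) * (2 - sq y + 11 / 20) by rewrite mulr_ge0//; lra_ctx.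
    rewrite /dn; have := sqr_ge0 y; rewrite (ysq y); lra_ctx.
  have d0 : 0 < dn y ^+ 2 by rewrite exprn_gt0//; lra_ctx.
  rewrite normrM (@gtr0_norm _ (_^-1)) ?invr_gt0// ler_pdivrMr//.
  have d2 : 4 / 5 <= dn y ^+ 2 by nra_ctx.
  have u1 : (sq y - 1) ^+ 2 <= 1 / 4 by nra_ctx.
  have u2 : 0 <= (sq y - 1) ^+ 2 by exact: sqr_ge0.
  have v1 : `|21 * (sq y - 2) ^+ 2 - 5 * (sq y ^+ 2 - 2)| <= 8.
    rewrite -(ysq y) ler_norml; apply/andP; split; nra_ctx.
  rewrite normrM (@ger0_norm _ (96 * _)); last by rewrite mulr_ge0.
    apply: (@le_trans _ _ (24 * 21 * (4 / 5))); last by rewrite ler_pM2l// mulr_gt0.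
  apply: (@le_trans _ _ (24 * 8)); last by lra_ctx.
  by apply: ler_pM => //; [rewrite mulr_ge0|lra_ctx].
- set i := (sq y - 1)^-1 in i1 i2 *.
  have a1 : 0 <= (3 - 2 * sq y) * i <= 1.
    by apply/andP; split; [rewrite mulr_ge0 ?ltW//; lra_ctx|nra_ctx].
  by move/andP: a1 => [a1 a2]; rewrite mulNr ler_norml; apply/andP; split; lra_ctx.
Qed.

(** After multiplication by y^2 and division by [c12], the singular part of the equation is the
    radial Laplacian of R^7; everything else is O(y^2). *)
Lemma ode_near0 (lam : C) : exists2 K, 0 < K & forall (y : R) (F P Q : C), 0 < y < 1 / 4 -> eigen_ode lam y F P Q ->
  nz ((y ^+ 2)%:C%C * Q + 6 * (y%:C%C * P)) <= K * y ^+ 2 * (nz (y%:C%C * P) + nz F).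
Proof.
pose n2 := nz (lam + 2); pose E0 := n2 * (12 + nz lam) + 24 * 21.
have n20 : 0 <= n2 by exact: nz_ge0.
have nl := nz_ge0 lam.
have E00 : 0 <= E0 by rewrite addr_ge0 ?mulr_ge0 ?addr_ge0.
exists (10 * (10 + 3 * n2 + E0)); first by rewrite mulr_gt0//; move: E00 n20; move: (E0) (n2) => p q; lra_ctx.
move=> y F P Q h ode; have [k12 k20 kV k11] := coef_near0 h.
have /andP[s1 s2] := sq_near0 h; have /andP[y0 y1] := h.
have yn : y != 0 by rewrite gt_eqF.
pose a1 : R := - (3 - 2 * sq y) / (sq y - 1) + 4 * sq y.
pose b : C := y%:C%C * P.
pose E : C := (lam + 2) * ((c20 y)%:C%C - 2 - lam) + (V y)%:C%C.
have key : (c12 y)%:C%C * ((y ^+ 2)%:C%C * Q + 6 * b) =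
  (- y ^+ 2)%:C%C * ((a1%:C%C + (lam + 2) * (- 2 * sq y)%:C%C) * b + E * F).
  have e11 : y * c11 y = 6 * c12 y + y ^+ 2 * a1.
    rewrite c11E// c12E /a1; field; by rewrite yn sqm1_neq0.
  have e11c : y%:C%C * (c11 y)%:C%C = 6 * (c12 y)%:C%C + y%:C%C ^+ 2 * a1%:C%C :> C.
    by rewrite -rmorphM e11 rmorphD !rmorphM rmorph_nat.
  have e21 : (c21 y)%:C%C = y%:C%C * (- 2 * sq y)%:C%C :> C by rewrite -rmorphM c21E; congr (_%:C%C); ring.
  move: ode; rewrite /eigen_ode e21 /b /E !rmorphN !rmorphXn /=.
  move: e11c; set cc := (c11 y)%:C%C; set yy := y%:C%C; set c := (c12 y)%:C%C; set s := (_ * sq y)%:C%C.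
  set c0 := (c20 y)%:C%C; set v := (V y)%:C%C; set a := a1%:C%C => e11c ode.
  have z : c * Q + cc * P + c0 * ((lam + 2) * F) + yy * s * ((lam + 2) * P) - 2 * ((lam + 2) * F) + v * F - lam * ((lam + 2) * F) = 0.
    by rewrite ode subrr.
  apply/eqP; rewrite -subr_eq0; apply/eqP.
  transitivity (yy ^+ 2 * (c * Q + cc * P + c0 * ((lam + 2) * F) + yy * s * ((lam + 2) * P) - 2 * ((lam + 2) * F) + v * F - lam * ((lam + 2) * F))
     + yy * P * (6 * c + yy ^+ 2 * a - yy * cc)).
    by ring.
  by rewrite z e11c subrr !mulr0 addr0.
rewrite -/b; set e := _ + 6 * b in key *.
have c0 : 0 < c12 y by lra_ctx.
have : c12 y * nz e <= y ^+ 2 * ((10 + 3 * n2 + E0) * (nz b + nz F)).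
  have -> : c12 y * nz e = nz ((c12 y)%:C%C * e) by rewrite nz_real gtr0_norm.
  rewrite key nz_real normrN ger0_norm ?sqr_ge0// ler_wpM2l ?sqr_ge0//.
  apply: le_trans (nz_D _ _) _; apply: le_trans (lerD (nz_M _ _) (nz_M _ _)) _.
  have u1 : nz (a1%:C%C + (lam + 2) * (- 2 * sq y)%:C%C) <= 10 + 3 * n2.
    apply: le_trans (nz_D _ _) _; apply: lerD; first by rewrite /nz /= normr0 addr0.
    rewrite mulrC nz_real; apply: ler_wpM2r => //; rewrite ler_norml; apply/andP; split; lra_ctx.
  have u2 : nz E <= E0.
    apply: le_trans (nz_D _ _) _; apply: lerD; last by rewrite /nz /= normr0 addr0.
    apply: le_trans (nz_M _ _) _; apply: ler_wpM2l => //.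
    have -> : (c20 y)%:C%C - 2 - lam = (c20 y - 2)%:C%C - lam by ring.
    apply: le_trans (nz_D _ _) _; rewrite nz_N lerD2r /nz /= normr0 addr0.
    by apply: le_trans (ler_normB _ _) _; rewrite normr_nat; lra_ctx.
  have b0 := nz_ge0 b; have F0 := nz_ge0 F.
  by apply: comb_le => //; rewrite addr_ge0// mulr_ge0.
have e0 := nz_ge0 e.
have : 1 / 10 * nz e <= c12 y * nz e by exact: ler_wpM2r.
move: (nz e) (nz b + nz F) (y ^+ 2) (10 + 3 * n2 + E0) => p q u v h1 h2.
have -> : 10 * v * u * q = 10 * (u * (v * q)) by ring.
lra_ctx.
Qed.

Variables (lam : C) (F P : R -> C).
Hypothesis dF : forall y, 0 < y < 1 / 2 -> cder F y (P y).
Hypothesis dP : forall y, 0 < y < 1 / 2 -> exists Q, cder P y Q /\ eigen_ode lam y (F y) (P y) Q.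

Lemma origin_dichotomy :
  (exists d M : R, [/\ 0 < d, d <= 1 / 4 & forall y, 0 < y < d -> nz (F y) <= M /\ nz (y%:C%C * P y) <= M]) \/
  (exists d m : R, [/\ 0 < d, d <= 1 / 4, 0 < m & forall y, 0 < y < d -> m <= y ^+ 9 * sqmod (F y)]).
Proof.
have [K K0 HK] := ode_near0 lam.
have to2 (y : R) : 0 < y < 1 / 4 -> 0 < y < 1 / 2 by move=> /andP[-> h] /=; lra.
have /choice[Q HQ] : forall y : R, exists q, 0 < y < 1 / 2 -> cder P y q /\ eigen_ode lam y (F y) (P y) q.
  move=> y; have [/dP[q hq]|n] := pselect (0 < y < 1 / 2); first by exists q.
  by exists 0.
(* These combinations separate the two behaviours: a constant has b = 0, while y^-5 has a = 0. *)
pose b y : C := y%:C%C * P y; pose a y : C := F y + (5^-1)%:C%C * b y.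
pose e y : C := (y ^+ 2)%:C%C * Q y + 6 * b y.
pose h y : C := (y^-1)%:C%C * e y; pose g y : C := (5^-1)%:C%C * h y.
have db y : 0 < y < 1 / 4 -> cder b y ((- 5 / y)%:C%C * b y + h y).
  move=> hy; have yn : y%:C%C != 0 :> C by rewrite fmorph_eq0 gt_eqF//; case/andP: hy.
  have [dQ _] := HQ y (to2 y hy); have := cderM (cder_real (der_id y)) dQ.
  apply: cder_eq; rewrite /h /e /b.
  by field.
have da y : 0 < y < 1 / 4 -> cder a y (g y).
  move=> hy; have yn : y%:C%C != 0 :> C by rewrite fmorph_eq0 gt_eqF//; case/andP: hy.
  have := cderD (dF (to2 y hy)) (cderZ (5^-1)%:C%C (db y hy)).
  apply: cder_eq; rewrite /g /h /e /b.
  by field.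
pose S (y : R) : R := Re (a y) ^+ 2 + Im (a y) ^+ 2 + (Re (b y) ^+ 2 + Im (b y) ^+ 2).
have FE y : F y = a y - (5^-1)%:C%C * b y by rewrite /a addrK.
have i5 : `|5^-1| = 5^-1 :> R by rewrite ger0_norm// invr_ge0.
have nF y : nz (F y) <= nz (a y) + nz (b y).
  rewrite FE; apply: le_trans (nz_D _ _) _; rewrite nz_N nz_real lerD2l i5.
  by have := nz_ge0 (b y); lra.
have hb y : 0 < y < 1 / 4 -> sqmod (h y) <= (4 * K) ^+ 2 * S y.
  move=> hy; have /andP[y0 y1] := hy; have yn : y != 0 by rewrite gt_eqF.
  have H := HK _ _ _ _ hy (proj2 (HQ y (to2 y hy))).
  have H2 : nz (h y) <= K * (2 * nz (b y) + nz (a y)).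
    rewrite nz_real gtr0_norm ?invr_gt0// ler_pdivrMl//.
    have K1 : 0 <= nz (b y) + nz (F y) by rewrite addr_ge0// nz_ge0.
    apply: le_trans H _.
    have -> : K * y ^+ 2 * (nz (b y) + nz (F y)) = y * (K * (y * (nz (b y) + nz (F y)))) by ring.
    rewrite ler_pM2l// ler_pM2l//; apply: (@le_trans _ _ (1 * (nz (b y) + nz (F y)))).
      by apply: ler_wpM2r => //; lra.
    by have := nF y; lra.
  apply: le_trans (sqmod_le_nz _) _.
  have B0 := nz_ge0 (b y); have A0 := nz_ge0 (a y); have h0 := nz_ge0 (h y).
  have k0 : 0 <= K * (2 * nz (b y) + nz (a y)) by apply: le_trans h0 H2.
  apply: (@le_trans _ _ ((K * (2 * nz (b y) + nz (a y))) ^+ 2)); first by rewrite lerXn2r// nnegrE.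
  exact: quad_le (sqmod_ge0 _) (nz_sq_le (a y)) (nz_sq_le (b y)).
have gb y : 0 < y < 1 / 4 -> sqmod (g y) <= (4 * K) ^+ 2 * S y.
  move=> hy; apply: le_trans _ (hb y hy); rewrite /g; move: (h y) => [p q].
  rewrite /sqmod /= !mul0r subr0 addr0 !exprMn -mulrDr ler_piMl ?addr_ge0 ?sqr_ge0//.
  by rewrite expr2 -invfM invf_le1; lra.
have c4 : 0 < 1 / 4 :> R by lra.
have K4 : 0 < 4 * K by rewrite mulr_gt0.
have dd1 (y : R) (hy : 0 < y < 1 / 4) : is_derive y (1 : R) (fun z => Re (b z)) (- 5 * Re (b y) / y + Re (h y)).
  have [d _] := db y hy; apply: der_eq d; rewrite ReD Re_mul /= mul0r subr0; ring.
have dd2 (y : R) (hy : 0 < y < 1 / 4) : is_derive y (1 : R) (fun z => Im (b z)) (- 5 * Im (b y) / y + Im (h y)).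
  have [_ d] := db y hy; apply: der_eq d; rewrite ImD Im_mul /= mul0r addr0; ring.
have [[d [M [d0 d1 HM]]]|[d [m [d0 d1 m0 Hm]]]] := cone c4 K4 (fun y hy => proj1 (da y hy)) (fun y hy => proj2 (da y hy)) dd1 dd2 gb hb.
  left; exists d, (2 * (M + 1)); split=> // y hy; have HS := HM y hy.
  have A2 := nz_sq_le (a y); have B2 := nz_sq_le (b y).
  have A0 := nz_ge0 (a y); have B0 := nz_ge0 (b y).
  have sa : 0 <= sqmod (a y) by exact: sqmod_ge0. have sb : 0 <= sqmod (b y) by exact: sqmod_ge0.
  have {}HS : sqmod (a y) + sqmod (b y) <= M by [].
  have nA : nz (a y) <= M + 1 by nra.
  have nB : nz (b y) <= M + 1 by nra.
  by split; [have := nF y; lra|rewrite -/(b y); lra].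
right; exists d, (m / 100); split=> //; first by rewrite divr_gt0.
move=> y hy; have Hy := Hm y hy; have y0 : 0 < y by case/andP: hy.
(* The reason for 100: outside the cone |b| / 5 exceeds 2 |a|, so F = a - b/5 cannot be small by
   cancellation. *)
have : (sqmod (b y) - 100 * sqmod (a y)) / 100 <= sqmod (F y).
  rewrite FE; move: (a y) (b y) => [p q] [u v]; rewrite /sqmod /=.
  have := sqr_ge0 (10 * p - u); have := sqr_ge0 (10 * q - v); have := sqr_ge0 u; have := sqr_ge0 v; lra.
rewrite -(ler_pM2l (exprn_gt0 9 y0)); apply: le_trans; rewrite mulrA; apply: ler_wpM2r => //.
Qed.

End Origin.

(** * Square integrability and orders of magnitude near the origin *)

Section NearOrigin.
Context {R : realType}.
Local Notation C := (R[i]).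
Local Notation Re := (@complex.Re R).
Local Notation Im := (@complex.Im R).
Implicit Types (d y : R).

(** On the ball of radius t the integral of |F|^2 would be at least m t^-9 times the volume, that is
    a multiple of t^-2, which is unbounded as t tends to 0. *)
Lemma L2_not_singular r (F f : R -> C) d m : 0 < d <= r -> 0 < m -> L2 r (lift7 f) -> aeq r f F ->
  ~ (forall y, 0 < y < d -> m <= y ^+ 9 * sqmod (F y)).
Proof.
move=> /andP[d0 dr] m0 Lf fF H; have [_ _ fin] := Lf.
have ms := measurable_sqmod Lf.
set I := (\int[mu7]_(x in ball7 r) _)%E in fin.
have I0 : (0 <= I)%E by apply: integral_ge0 => x _; rewrite lee_fin sqmod_ge0.
have fI : I = (fine I)%:E by rewrite fineK// ge0_fin_numE.
pose J := fine I; have J0 : 0 <= J by rewrite /J fine_ge0.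
have K t : 0 < t < d -> m * vol1 <= J * t ^+ 2.
  move=> /andP[t0 td]; have tn : t != 0 by rewrite gt_eqF.
  have tr : ball7 t `<=` ball7 r by apply: ball7S; rewrite ltW// (lt_le_trans td).
  have mt := @measurable_ball7 R t; have mr := @measurable_ball7 R r.
  have h1 : (\int[mu7]_(x in ball7 t) (sqmod (lift7 f x))%:E <= I)%E.
    apply: ge0_subset_integral => //; first exact/measurable_EFinP.
    by move=> x _; rewrite lee_fin sqmod_ge0.
  have h2 : (\int[mu7]_(x in ball7 t) (m * t ^- 9)%:E <= \int[mu7]_(x in ball7 t) (sqmod (lift7 f x))%:E)%E.
    apply: ae_ge0_le_integral => //.
    - by move=> x _; rewrite lee_fin mulr_ge0 ?(ltW m0)// invr_ge0 exprn_ge0// ltW.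
    - by move=> x _; rewrite lee_fin sqmod_ge0.
    - by apply/measurable_EFinP; apply: measurable_funS ms.
    have Q := @ae_off0 R (fun x => x != 0) (fun x h => h).
    apply: ae_imp (ae_and Q fF) => x [x0 e] xt; rewrite e; last exact: tr.
    have n0 : 0 < norm7 x by rewrite lt_neqAle eq_sym norm7_eq0 x0 norm7_ge0.
    have nt : norm7 x < t := xt.
    rewrite lee_fin /lift7 ler_pdivrMr ?exprn_gt0// mulrC.
    apply: le_trans (H (norm7 x) _) _; first by rewrite n0 (lt_trans nt td).
    by apply: ler_wpM2r; [exact: sqmod_ge0|rewrite lerXn2r// ?nnegrE ltW].
  have := le_trans h2 h1; rewrite integral_cst// fI -/J mu7_ball// -EFinM lee_fin.
  rewrite -(ler_pM2r (exprn_gt0 2 t0) (m / t ^+ 9 * _)); congr (_ <= _).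
  by field.
have mv : 0 < m * vol1 by rewrite mulr_gt0// vol1_gt0.
pose t := Num.min (d / 2) (Num.min 1 (m * vol1 / (2 * (J + 1)))).
have J1 : 0 < 2 * (J + 1) by rewrite mulr_gt0// ltr_wpDl.
have t0 : 0 < t by rewrite !lt_min !divr_gt0// ltr01.
have t1 : t <= d / 2 by rewrite ge_min lexx.
have t2 : t <= 1 by rewrite !ge_min lexx orbT.
have t3 : t * (2 * (J + 1)) <= m * vol1 by rewrite -ler_pdivlMr// !ge_min lexx !orbT.
have : 0 < t < d by apply/andP; split; lra_ctx.
move=> /K; have : J * t ^+ 2 <= J * t by rewrite ler_wpM2l// expr2 -[leRHS]mulr1 ler_wpM2l// ltW.
move: t3 t0 mv; rewrite !mulrDr mulr1; move: (m * vol1) => p; lra_ctx.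
Qed.

Definition bnd d (g : R -> C) : Prop := exists2 M, 0 <= M & forall y, 0 < y < d -> nz (g y) <= M.

Lemma bnd_cst d (c : C) : bnd d (fun=> c).
Proof. by exists (nz c) => //; exact: nz_ge0. Qed.

Lemma bndD d g h : bnd d g -> bnd d h -> bnd d (fun y => g y + h y).
Proof.
move=> [M M0 HM] [N N0 HN]; exists (M + N) => [|y hy]; first exact: addr_ge0.
by apply: le_trans (nz_D _ _) _; rewrite lerD ?HM ?HN.
Qed.

Lemma bndM d g h : bnd d g -> bnd d h -> bnd d (fun y => g y * h y).
Proof.
move=> [M M0 HM] [N N0 HN]; exists (M * N) => [|y hy]; first exact: mulr_ge0.
by apply: le_trans (nz_M _ _) _; rewrite ler_pM ?nz_ge0 ?HM ?HN.
Qed.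

Lemma bndB d g h : bnd d g -> bnd d h -> bnd d (fun y => g y - h y).
Proof.
move=> [M M0 HM] [N N0 HN]; exists (M + N) => [|y hy]; first exact: addr_ge0.
by apply: le_trans (nz_D _ _) _; rewrite nz_N lerD ?HM ?HN.
Qed.

Lemma bndR d (g : R -> R) (M : R) : (forall y, 0 < y < d -> `|g y| <= M) -> bnd d (fun y => (g y)%:C%C).
Proof.
move=> H; exists `|M| => // y hy; rewrite /nz /= normr0 addr0.
by apply: le_trans (H y hy) _; exact: ler_norm.
Qed.

Lemma bnd_min d g h : bnd d g -> bnd d h -> exists M, [/\ 0 <= M, forall y, 0 < y < d -> nz (g y) <= M
  & forall y, 0 < y < d -> nz (h y) <= M].
Proof.
move=> [M M0 HM] [N N0 HN]; exists (M + N); split=> [|y hy|y hy]; first exact: addr_ge0.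
  by apply: le_trans (HM y hy) _; rewrite lerDl.
by apply: le_trans (HN y hy) _; rewrite lerDr.
Qed.

Lemma rho_near0 y : 0 < y < 1 / 4 -> y <= rho y <= 1 / 2 /\ 1 / 8 <= y * ee y <= 1.
Proof.
move=> h; have /andP[s1 s2] := sq_near0 h; have /andP[y0 y1] := h.
have h1 : 0 < y < 1 by rewrite y0 /=; lra_ctx.
have i1 : 1 <= (2 - sq y)^-1 by rewrite invf_ge1; lra_ctx.
have i2 : (2 - sq y)^-1 <= 20 / 11 by rewrite -[leRHS]invrK lef_pV2 ?posrE ?invr_gt0//; lra_ctx.
have r1 : y <= rho y by rewrite /rho ler_pMr.
have r2 : rho y <= y * (20 / 11) by rewrite /rho ler_pM2l.
have e0 := ee_gt0 h1; have E := ee_rho h1; set r := rho y in r1 r2 E *.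
have r3 : r ^+ 3 <= r * (1 / 4) by rewrite exprS ler_pM2l; [nra_ctx|lra_ctx].
split; first by apply/andP; split; lra_ctx.
have r30 : 0 <= r ^+ 3 by rewrite exprn_ge0//; lra_ctx.
apply/andP; split.
  have : ee y * (3 * r + 5 * r ^+ 3) <= ee y * (8 * y) by rewrite ler_pM2l//; lra_ctx.
  rewrite E; lra_ctx.
have : ee y * (3 * y) <= ee y * (3 * r + 5 * r ^+ 3) by rewrite ler_pM2l//; lra_ctx.
rewrite E; have : 0 < y * ee y by rewrite mulr_gt0.
lra_ctx.
Qed.

Let poly_near0 (a b c e : R) (n : nat) (f : R -> R) :
  (forall y, f y = (1 - rho y ^+ 2) * (a + b * rho y ^+ 2 + c * rho y ^+ 4 + e * rho y ^+ 6) * ee y ^+ n) ->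
  bnd (1 / 4) (fun y => (y ^+ n * f y)%:C%C).
Proof.
move=> fE; apply: (bndR (M := `|a| + `|b| + `|c| + `|e|)) => y h.
have [/andP[r1 r2] /andP[e1 e2]] := rho_near0 h; have y0 : 0 < y by case/andP: h.
have r0 : 0 <= rho y by lra_ctx.
have rn k : 0 <= rho y ^+ k <= 1 by rewrite exprn_ge0// exprn_ile1//; lra_ctx.
rewrite fE (_ : y ^+ n * _ = (1 - rho y ^+ 2) * (a + b * rho y ^+ 2 + c * rho y ^+ 4 + e * rho y ^+ 6) * (y * ee y) ^+ n); last first.
  by rewrite [(y * _) ^+ n]exprMn; exact: mulrCA.
have b2 : `|1 - rho y ^+ 2| <= 1 by have /andP[u v] := rn 2%N; rewrite ler_norml; apply/andP; split; lra_ctx.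
have b3 : `|(y * ee y) ^+ n| <= 1.
  have u : 0 <= y * ee y by lra_ctx.
  by rewrite ger0_norm ?exprn_ge0// exprn_ile1.
have t x k : `|x * rho y ^+ k| <= `|x|.
  by have /andP[u v] := rn k; rewrite normrM ler_piMr// ger0_norm.
have b4 : `|a + b * rho y ^+ 2 + c * rho y ^+ 4 + e * rho y ^+ 6| <= `|a| + `|b| + `|c| + `|e|.
  by do 3 (apply: le_trans (ler_normD _ _) _; apply: lerD; last exact: t).
rewrite !normrM; apply: (@le_trans _ _ (1 * (`|a| + `|b| + `|c| + `|e|) * 1)); last by rewrite mul1r mulr1.
by do 2 apply: ler_pM => //.
Qed.

Lemma bnd_LL : bnd (1 / 4) (fun y => (y * LL y)%:C%C).
Proof.
apply: (bndR (M := 66)) => y h.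
have [/andP[r1 r2] /andP[e1 e2]] := rho_near0 h; have y0 : 0 < y by case/andP: h.
have r20 := sqr_ge0 (rho y); have r21 : rho y ^+ 2 <= 1 by nra_ctx.
rewrite /LL mulrCA normrM -[leRHS]mulr1; apply: ler_pM => //; last first.
  by rewrite ger0_norm//; lra_ctx.
by rewrite ler_norml; apply/andP; split; lra_ctx.
Qed.

Lemma bnd_LP : bnd (1 / 4) (fun y => (y ^+ 2 * LP y)%:C%C).
Proof. by apply: (@poly_near0 189 (-990) 225 0) => y; rewrite /LP; ring. Qed.

Lemma bnd_L1 : bnd (1 / 4) (fun y => (y ^+ 2 * L1 y)%:C%C).
Proof. by apply: (@poly_near0 (-63) (-450) 225 0) => y; rewrite /L1; ring. Qed.

Lemma bnd_LP1 : bnd (1 / 4) (fun y => (y ^+ 3 * LP1 y)%:C%C).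
Proof.
by apply: (@poly_near0 (18 * -63) (18 * -315) (18 * 1715) (18 * -825)) => y; rewrite /LP1; ring.
Qed.

Lemma bnd_UU : bnd (1 / 4) (fun y => (y ^+ 2 * UU y)%:C%C).
Proof. by apply: (@poly_near0 180 72 (-60) 0) => y; rewrite /UU; ring. Qed.

Lemma UU_near0 y : 0 < y < 1 / 4 -> 1 <= y ^+ 2 * UU y.
Proof.
move=> h; have [/andP[r1 r2] /andP[e1 e2]] := rho_near0 h; have y0 : 0 < y by case/andP: h.
rewrite /UU (_ : y ^+ 2 * _ = (1 - rho y ^+ 2) * (180 + 72 * rho y ^+ 2 - 60 * rho y ^+ 4) * (y * ee y) ^+ 2); last by ring.
set r := rho y in r1 r2 *; have p2 : 0 <= r ^+ 2 by exact: sqr_ge0.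
have q2 : r ^+ 2 <= 1 / 4 by nra_ctx.
have q4 : r ^+ 4 <= 1 by rewrite exprn_ile1//; lra_ctx.
have e3 : 1 / 64 <= (y * ee y) ^+ 2 by nra_ctx.
have a1 : 3 / 4 * 120 <= (1 - r ^+ 2) * (180 + 72 * r ^+ 2 - 60 * r ^+ 4) by apply: ler_pM => //; lra_ctx.
apply: (@le_trans _ _ (3 / 4 * 120 * (1 / 64))); first by lra_ctx.
by apply: ler_pM => //; lra_ctx.
Qed.

Lemma bnd_mm_zz : bnd (1 / 4) (fun y => (mm y)%:C%C) /\ bnd (1 / 4) (fun y => (zz y)%:C%C).
Proof.
split; apply: (bndR (M := 1)) => y h; have /andP[s1 s2] := sq_near0 h; have /andP[y0 y1] := h.
  have i1 : 0 < (sq y - 1)^-1 by rewrite invr_gt0; lra_ctx.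
  have i2 : (sq y - 1)^-1 <= 5 / 2 by rewrite -[leRHS]invrK lef_pV2 ?posrE ?invr_gt0//; lra_ctx.
  have yh : 0 < y < 1 / 2 by rewrite y0/=; lra_ctx.
  rewrite gtr0_norm ?mm_gt0//.
  rewrite /mm; apply: (@le_trans _ _ (2 / 5 * (5 / 2))); last by lra_ctx.
  apply: ler_pM => //; [by rewrite mulr_ge0//; lra_ctx|exact: ltW|nra_ctx].
have i1 : 0 < (sq y - 1)^-1 by rewrite invr_gt0; lra_ctx.
have i2 : (sq y - 1)^-1 <= 5 / 2 by rewrite -[leRHS]invrK lef_pV2 ?posrE ?invr_gt0//; lra_ctx.
by rewrite /zz gtr0_norm ?mulr_gt0//; nra_ctx.
Qed.

Lemma weight_near0 (k : C) : exists2 M, 0 <= M & forall y, 0 < y < 1 / 4 -> 0 <= weight k y <= M.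
Proof.
have [|M M0 HM] := @bounded_itv R 0 (1 / 4) (weight k).
  move=> y /andP[y0 y1]; have g0 : 0 < sg y.
    have : sq y < 3 / 2 by apply: sq_lt; [lra_ctx|nra_ctx].
    by rewrite /sg; lra_ctx.
  have dg := derB (der_cst y 1 6) (derM (der_cst y 1 4) (der_sq y)).
  exact: der_cont (@der_comp _ _ y 1 (fun x => x `^ (- Re k)) sg _ _ (is_derive1_powR _ g0) dg).
exists M => // y /andP[y0 y1]; rewrite powR_ge0/=.
by apply: le_trans (ler_norm _) (HM y _); rewrite !ltW.
Qed.

End NearOrigin.

(** * Vanishing inside the light cone *)

Section LeftVanishing.
Context {R : realType}.
Local Notation C := (R[i]).
Local Notation Re := (@complex.Re R).
Local Notation Im := (@complex.Im R).
Local Notation hf := (1 / 2 : R).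
Implicit Types (y : R).
Variables (lam : C) (F P : R -> C) (l m : C) (d M0 : R).
Hypothesis dF : forall y, 0 < y < 1 / 2 -> cder F y (P y).
Hypothesis dP : forall y, 0 < y < 1 / 2 -> exists Q, cder P y Q /\ eigen_ode lam y (F y) (P y) Q.
Hypothesis cF : clim hf^'- F l.
Hypothesis cP : clim hf^'- P m.
Hypothesis d0 : 0 < d.
Hypothesis d4 : d <= 1 / 4.
Hypothesis M00 : forall y, 0 < y < d -> nz (F y) <= M0 /\ nz (y%:C%C * P y) <= M0.
Hypothesis lam0 : 0 <= Re lam.
Let k : C := 1 - lam.
Let W := Wf F.
Let Y := Yf lam F P.

Let bs g : bnd (1 / 4) g -> bnd d g.
Proof.
move=> [N N0 HN]; exists N => // y /andP[y0 yd]; apply: HN.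
by rewrite y0 (lt_le_trans yd).
Qed.

Let bF : bnd d F.
Proof. by exists `|M0| => // y /M00[h _]; apply: le_trans h (ler_norm _). Qed.

Let bP : bnd d (fun y => y%:C%C * P y).
Proof. by exists `|M0| => // y /M00[_ h]; apply: le_trans h (ler_norm _). Qed.

Let by1 : bnd d (fun y => y%:C%C).
Proof.
apply: (bndR (M := 1)) => y /andP[y0 yd]; rewrite gtr0_norm//.
have := d4; lra.
Qed.

Let Yt (y : R) : C := (mm y)%:C%C * (3 * F y + y%:C%C * P y) + k * ((zz y)%:C%C * (y%:C%C * F y)).

Let bYt : bnd d Yt.
Proof.
have [b1 b2] := bnd_mm_zz (R := R).
apply: bndD.
  by apply: bndM; [exact: bs|apply: bndD => //; apply: bndM => //; exact: bnd_cst].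
by apply: bndM; [exact: bnd_cst|apply: bndM; [exact: bs|exact: bndM]].
Qed.

(** Counting powers: W = O(y^3) and Y = O(y^2), while LL, LP and LP1 grow at most like y^-1, y^-2
    and y^-3. *)
Let near_zero : exists2 N, 0 <= N & forall y, 0 < y < d ->
  nz (om k W Y y) <= N * y /\ nz (qq k W Y y) <= N.
Proof.
have cst c := @bnd_cst R d c.
have bL := bs (bnd_LL (R := R)); have bLP := bs (bnd_LP (R := R)); have bL1 := bs (bnd_L1 (R := R)).
have bLP1 := bs (bnd_LP1 (R := R)); have bU := bs (bnd_UU (R := R)).
have YE y : Y y = y%:C%C ^+ 2 * Yt y.
  have c1 : (3 * y ^+ 2)%:C%C = 3 * y%:C%C ^+ 2 :> C by ring.
  have c2 : (y ^+ 3)%:C%C = y%:C%C ^+ 3 :> C by ring.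
  rewrite /Y /Yf /Xf /Wf /Yt -/k c1 c2.
  by move: (mm y)%:C%C (zz y)%:C%C (F y) (P y) => a b p q; ring.
have WE y : W y = y%:C%C ^+ 3 * F y by rewrite /W /Wf rmorphXn.
have gE (n : nat) (f : R -> R) y : (y ^+ n * f y)%:C%C = y%:C%C ^+ n * (f y)%:C%C :> C.
  by rewrite rmorphM rmorphXn.
pose o1 (y : R) : C := (y%:C%C ^+ 2 * k ^+ 2 + (y ^+ 2 * LP y)%:C%C) * F y - (y * LL y)%:C%C * Yt y.
pose q1 (y : R) : C := ((y ^+ 3 * LP1 y)%:C%C - (y * LL y)%:C%C * ((y ^+ 2 * UU y)%:C%C + 2 * (y ^+ 2 * L1 y)%:C%C + y%:C%C ^+ 2 * k ^+ 2)
   - k * y%:C%C * (y%:C%C ^+ 2 * k ^+ 2 + (y ^+ 2 * LP y)%:C%C)) * F y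
   + (y%:C%C ^+ 2 * k ^+ 2 + (y ^+ 2 * LP y)%:C%C - (y ^+ 2 * L1 y)%:C%C + k * y%:C%C * (y * LL y)%:C%C) * Yt y.
have by2 : bnd d (fun y => y%:C%C ^+ 2) by exact: bndM.
have bk2 : bnd d (fun y => y%:C%C ^+ 2 * k ^+ 2) by exact: bndM.
have bky : bnd d (fun y => k * y%:C%C) by exact: bndM.
have bA : bnd d (fun y => y%:C%C ^+ 2 * k ^+ 2 + (y ^+ 2 * LP y)%:C%C) by exact: bndD.
have bo : bnd d o1 by apply: bndB; exact: bndM.
have bq : bnd d q1.
  apply: bndD; apply: bndM => //.
    apply: bndB; last exact: bndM.
    apply: bndB => //; apply: bndM => //; apply: bndD => //; apply: bndD => //; exact: bndM.
  apply: bndD; last exact: bndM.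
  exact: bndB.
have [N [N0 H1 H2]] := bnd_min bo bq.
exists N => // y hy; have /andP[y0 _] := hy.
have e1 : om k W Y y = y%:C%C * o1 y.
  rewrite /om /o1 YE WE gE (rmorphM (real_complex R) y) /=.
  by move: (LP y)%:C%C (LL y)%:C%C (Yt y) (F y) => a b p q; ring.
have e2 : qq k W Y y = q1 y.
  have uE : (U0 y)%:C%C = (UU y)%:C%C + 2 * (L1 y)%:C%C :> C by rewrite /U0; ring.
  rewrite /qq /q1 YE WE uE !gE (rmorphM (real_complex R) y) /=.
  move: (LP y)%:C%C (LL y)%:C%C (UU y)%:C%C (L1 y)%:C%C (LP1 y)%:C%C (Yt y) (F y) => a b c e f p q; ring.
split; last by rewrite e2 H2.
by rewrite e1 nz_real gtr0_norm// mulrC ler_wpM2r ?H1// ltW.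
Qed.

Let small_near0 (f : R -> R) (N : R) : (forall y, 0 < y < d -> `|f y| <= N * y) ->
  forall e, 0 < e -> \forall z \near 0^'+, - e <= f z.
Proof.
move=> H e e0; have N1 : 0 < `|N| + 1 by rewrite ltr_wpDl.
near=> z.
have z0 : 0 < z by near: z; exact: nbhs_right_gt.
have z1 : z < d by near: z; exact: nbhs_right_lt.
have z2 : z < e / (`|N| + 1) by near: z; apply: nbhs_right_lt; rewrite divr_gt0.
have := H z; rewrite z0 z1 => /(_ isT); rewrite ler_norml => /andP[h _].
apply: le_trans h; rewrite lerN2.
rewrite ltr_pdivlMr// in z2; apply: le_trans (ltW z2).
by rewrite [N * z]mulrC ler_wpM2l ?(ltW z0)//; have := ler_norm N; lra.
Unshelve. all: by end_near. Qed.

Lemma dot_nz (z w : C) : `|Re z * Re w + Im z * Im w| <= nz z * nz w /\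
  `|Im w * Re z - Re w * Im z| <= nz z * nz w.
Proof.
rewrite /nz; split.
  apply: le_trans (ler_normD _ _) _; rewrite !normrM.
  have := normr_ge0 (Re z); have := normr_ge0 (Im z); have := normr_ge0 (Re w); have := normr_ge0 (Im w); nra.
apply: le_trans (ler_normB _ _) _; rewrite !normrM.
have := normr_ge0 (Re z); have := normr_ge0 (Im z); have := normr_ge0 (Re w); have := normr_ge0 (Im w); nra.
Qed.

Let EK_near0 e : 0 < e -> (\forall z \near 0^'+, - e <= EE k W Y z) /\ (\forall z \near 0^'+, - e <= KK k W Y z).
Proof.
move=> e0; have [N N0 HN] := near_zero; have [B B0 HB] := weight_near0 k.
have y4 y : 0 < y < d -> 0 < y < 1 / 4 by move=> /andP[-> h]; rewrite (lt_le_trans h).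
have b1 y : 0 < y < d -> nz (qq k W Y y) * nz (om k W Y y) <= N ^+ 2 * y.
  move=> hy; have [h1 h2] := HN y hy; rewrite expr2 -mulrA; apply: ler_pM => //; exact: nz_ge0.
have wB y x : 0 < y < d -> `|weight k y * x| <= B * `|x|.
  move=> /y4/HB/andP[w0 w1]; rewrite normrM ger0_norm//; exact: ler_wpM2r.
split.
  apply: (@small_near0 _ (B * N ^+ 2)) => // y hy; apply: le_trans (wB y _ hy) _.
  rewrite -mulrA; apply: ler_wpM2l => //; apply: le_trans (proj1 (dot_nz _ _)) _; exact: b1.
apply: (@small_near0 _ (B * (`|Im k| * N ^+ 2 + Im k ^+ 2 * N ^+ 2))) => // y hy; apply: le_trans (wB y _ hy) _.
rewrite -[leRHS]mulrA; apply: ler_wpM2l => //; apply: le_trans (ler_normD _ _) _; rewrite [leRHS]mulrDl; apply: lerD.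
  rewrite normrM normrN -[leRHS]mulrA; apply: ler_wpM2l => //; apply: le_trans (proj2 (dot_nz _ _)) _; exact: b1.
have /andP[y0 yd] := hy; have u1 := UU_near0 (y4 y hy).
have y1 : y <= 1 by have := d4; lra.
have u0 : 0 < UU y by rewrite -(pmulr_rgt0 _ (exprn_gt0 2 y0)); lra.
rewrite normrM [X in X * _]ger0_norm ?sqr_ge0// -[leRHS]mulrA; apply: ler_wpM2l; first exact: sqr_ge0.
rewrite ger0_norm; last by rewrite divr_ge0 ?(ltW u0)// addr_ge0 ?sqr_ge0.
have [_ h2] := HN y hy.
have h3 : Re (qq k W Y y) ^+ 2 + Im (qq k W Y y) ^+ 2 <= N ^+ 2.
  apply: le_trans (sqmod_le_nz (qq k W Y y)) _; rewrite lerXn2r// nnegrE//; exact: nz_ge0.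
rewrite ler_pdivrMr// -mulrA; apply: le_trans h3 _; rewrite ler_peMr ?sqr_ge0//.
apply: le_trans u1 _; rewrite ler_wpM2r ?(ltW u0)// expr2 ler_piMl//; exact: ltW.
Qed.

(** If Re lam > 0 the power of [sg] tends to 0 and wins over the convergent factor; if Re lam = 0
    the power is 1 and the sign of the limit decides. *)
Let half_end (B : R -> R) (B0 : R) : B y @[y --> hf^'-] --> B0 -> (Re lam = 0 -> B0 <= 0) ->
  forall e, 0 < e -> \forall z \near hf^'-, sg z `^ (Re lam) * B z <= e.
Proof.
move=> cB hB e e0; have [a0|a0] := eqVneq (Re lam) 0.
  have B0e : B0 < e by apply: le_lt_trans (hB a0) e0.
  by near=> z; rewrite a0 powRr0 mul1r ltW//; near: z; exact: (cvgr_lt B0 cB _ B0e).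
have ap : 0 < Re lam by rewrite lt_neqAle eq_sym a0.
have M1 : 0 < `|B0| + 1 by rewrite ltr_wpDl.
have eM : 0 < e / (`|B0| + 1) by rewrite divr_gt0.
have q0 : 0 < (e / (`|B0| + 1)) `^ (Re lam)^-1 by rewrite powR_gt0.
have cs := sg_left (R := R).
near=> z.
have zh : 0 < z < hf by near: z; exact: near_left.
have g0 := sg_gt0 zh.
have h1 : sg z < (e / (`|B0| + 1)) `^ (Re lam)^-1 by near: z; exact: (cvgr_lt 0 cs _ q0).
have h2 : `|B z| <= `|B0| + 1.
  have : `|B0 - B z| < 1 by near: z; move/cvgrPdist_lt : cB; apply.
  have := ler_normB (B0) (B0 - B z); rewrite opprB addrC subrK; lra.
have h3 : sg z `^ (Re lam) <= e / (`|B0| + 1).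
  have -> : e / (`|B0| + 1) = ((e / (`|B0| + 1)) `^ (Re lam)^-1) `^ (Re lam).
    by rewrite -powRrM mulVf// powRr1// ltW.
  by apply: ge0_ler_powR; rewrite ?nnegrE ?powR_ge0 ?(ltW ap) ?(ltW g0) ?(ltW h1).
apply: le_trans (ler_norm _) _; rewrite normrM ger0_norm ?powR_ge0//.
apply: (@le_trans _ _ (e / (`|B0| + 1) * (`|B0| + 1))); last by rewrite divfK// gt_eqF.
by apply: ler_pM => //; exact: powR_ge0.
Unshelve. all: by end_near. Qed.

(** Since [qq = sg * theta], both monotone quantities equal [sg] ^ (Re lam) times an expression with
    a limit at the cone. When Re lam = 0, the relation of [light_cone] makes that limit nonpositive:
    0 for real lam, and a negative multiple of (Im lam)^2 |t|^2 otherwise. *)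
Lemma crum_zero y : 0 < y < 1 / 2 -> om k W Y y = 0 /\ qq k W Y y = 0.
Proof.
have [v [t [cv ct rel]]] := light_cone dF dP cF cP.
have dW := cder_W lam dF; have dY := cder_Y dF dP.
have k1E : 1 - Re k = Re lam by rewrite /k ReD ReN /=; ring.
have k2E : Im k = - Im lam by rewrite /k ImD ImN /=; ring.
have wsg z : 0 < z < hf -> weight k z * sg z = sg z `^ (Re lam).
  move=> h; have g0 := sg_gt0 h; rewrite /weight -[X in _ * X](powRr1 (ltW g0)) -powRD.
    by rewrite -k1E addrC.
  by apply/implyP => _; rewrite gt_eqF.
have qE z : 0 < z < hf -> qq k W Y z = (sg z)%:C%C * theta lam F P z.
  by move=> h; rewrite /theta mulrA -rmorphM /= mulfV ?mul1r// gt_eqF// sg_gt0.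
have [v1 v2] := cv; have [t1 t2] := ct.
have r1 : 12 * Re v + 2 * (Re lam * Re t - Im lam * Im t) = 0.
  by have := congr1 (fun z => Re z) rel; case: (v) (t) (lam) => [? ?] [? ?] [? ?] /=; lra.
have r2 : 12 * Im v + 2 * (Re lam * Im t + Im lam * Re t) = 0.
  by have := congr1 (fun z => Im z) rel; case: (v) (t) (lam) => [? ?] [? ?] [? ?] /=; lra.
have [k20|k20] := eqVneq (Im k) 0.
  have l0 : Im lam = 0 by rewrite -[LHS]opprK -k2E k20 oppr0.
  pose B1 z := Re (theta lam F P z) * Re (om k W Y z) + Im (theta lam F P z) * Im (om k W Y z).
  have cB : B1 z @[z --> hf^'-] --> Re t * Re v + Im t * Im v.
    exact: cvgD (cvgM t1 v1) (cvgM t2 v2).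
  have hB : Re lam = 0 -> Re t * Re v + Im t * Im v <= 0.
    move=> a0; move: r1 r2; rewrite a0 l0 => r1 r2.
    have -> : Re v = 0 by lra. have -> : Im v = 0 by lra.
    by rewrite !mulr0 addr0.
  have near_hf e : 0 < e -> \forall z \near hf^'-, EE k W Y z <= e.
    move=> e0; near=> z; have zh : 0 < z < hf by near: z; exact: near_left.
    have : sg z `^ Re lam * B1 z <= e.
      by near: z; exact: (half_end cB hB e0).
    congr (_ <= _); rewrite /EE qE// -wsg// /B1.
    by move: (theta lam F P z) (om k W Y z) => [? ?] [? ?] /=; ring.
  have pos z : 0 < z < 1 / 2 -> 0 < weight k z / mm z.
    by move=> h; exact: divr_gt0 (weight_gt0 k h) (mm_gt0 h).
  move=> yh; have Z := mono_zero (fun (y : R) h => @der_EE R k W Y dW dY y k20 h) _ (fun e e0 => (EK_near0 e0).1) near_hf yh.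
  have {}Z : weight k y / mm y * (Re (qq k W Y y) ^+ 2 + Im (qq k W Y y) ^+ 2 + UU y * (Re (om k W Y y) ^+ 2 + Im (om k W Y y) ^+ 2)) = 0.
    apply: Z => z zh; apply: mulr_ge0; first exact: ltW (pos z zh).
    by rewrite addr_ge0 ?addr_ge0 ?sqr_ge0// mulr_ge0 ?addr_ge0 ?sqr_ge0// ltW// UU_gt0.
  move/eqP : Z; rewrite mulf_eq0 gt_eqF ?pos//= paddr_eq0 ?addr_ge0 ?sqr_ge0//; last first.
    by rewrite mulr_ge0 ?addr_ge0 ?sqr_ge0// ltW// UU_gt0.
  rewrite mulf_eq0 (gt_eqF (UU_gt0 yh)) /= !paddr_eq0 ?sqr_ge0// !sqrf_eq0.
  move=> /andP[/andP[/eqP a1 /eqP a2] /andP[/eqP a3 /eqP a4]].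
  by split; apply/complexP.
have cU := UU_quot (R := R).
pose B z := - Im k * (Im (om k W Y z) * Re (theta lam F P z) - Re (om k W Y z) * Im (theta lam F P z))
   + Im k ^+ 2 * ((Re (theta lam F P z) ^+ 2 + Im (theta lam F P z) ^+ 2) / ((sg z)^-1 * UU z)).
have cB : B z @[z --> hf^'-] --> - Im k * (Im v * Re t - Re v * Im t) + Im k ^+ 2 * ((Re t ^+ 2 + Im t ^+ 2) / 12).
  apply: cvgD; first by apply: cvgM; [exact: cvg_cst|apply: cvgB; exact: cvgM].
  apply: cvgM; first exact: cvg_cst.
  by apply: cvgM; [apply: cvgD; exact: cvgM|apply: cvgV => //; rewrite pnatr_eq0].
have hB : Re lam = 0 -> - Im k * (Im v * Re t - Re v * Im t) + Im k ^+ 2 * ((Re t ^+ 2 + Im t ^+ 2) / 12) <= 0.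
  move=> a0; move: r1 r2; rewrite a0 k2E => r1 r2.
  have -> : Re v = Im lam * Im t / 6 by lra.
  have -> : Im v = - (Im lam * Re t / 6) by lra.
  have -> : - - Im lam * (- (Im lam * Re t / 6) * Re t - Im lam * Im t / 6 * Im t) +
     (- Im lam) ^+ 2 * ((Re t ^+ 2 + Im t ^+ 2) / 12) = - (Im lam ^+ 2 * (Re t ^+ 2 + Im t ^+ 2) / 12) by field.
  by rewrite oppr_le0 divr_ge0// mulr_ge0 ?sqr_ge0// addr_ge0 ?sqr_ge0.
have near_hf e : 0 < e -> \forall z \near hf^'-, KK k W Y z <= e.
  move=> e0; near=> z; have zh : 0 < z < hf by near: z; exact: near_left.
  have : sg z `^ Re lam * B z <= e by near: z; exact: (half_end cB hB e0).
  congr (_ <= _); rewrite /KK qE// -wsg// /B.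
  have u0 := lt0r_neq0 (UU_gt0 zh); have g0 := lt0r_neq0 (sg_gt0 zh).
  move: (theta lam F P z) (om k W Y z) => [? ?] [? ?] /=; field.
  by rewrite u0 g0.
have pos z : 0 < z < 1 / 2 -> 0 < weight k z / mm z * (Im k ^+ 2 * ((- U1 z - 2 * Re k * UU z) / UU z ^+ 2)).
  move=> h; have u0 := UU_gt0 h; rewrite mulr_gt0 ?(divr_gt0 (weight_gt0 k h) (mm_gt0 h))//.
  rewrite mulr_gt0 ?exprn_even_gt0//= divr_gt0 ?exprn_gt0//.
  have := nu_gt1 h; have : Re k * UU z <= UU z by rewrite ler_piMl ?(ltW u0)// -subr_ge0 k1E.
  lra.
have q0 z : 0 < z < hf -> qq k W Y z = 0.
  move=> zh; have Z := mono_zero (fun (y : R) h => @der_KK R k W Y dW dY y h) _ (fun e e0 => (EK_near0 e0).2) near_hf zh.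
  have {}Z : weight k z / mm z * (Im k ^+ 2 * ((- U1 z - 2 * Re k * UU z) / UU z ^+ 2) * (Re (qq k W Y z) ^+ 2 + Im (qq k W Y z) ^+ 2)) = 0.
    apply: Z => x xh; rewrite mulrA; apply: mulr_ge0; first exact: ltW (pos x xh).
    by rewrite addr_ge0 ?sqr_ge0.
  move/eqP : Z; rewrite mulrA mulf_eq0 gt_eqF ?pos//= paddr_eq0 ?sqr_ge0// !sqrf_eq0 => /andP[/eqP a1 /eqP a2].
  exact/complexP.
(* [KK] controls [qq] only; once [qq] vanishes identically, its own equation reduces to UU om =
   0. *)
move=> yh; split; last exact: q0.
have Dq := cder_qq dW dY yh.
have D0 : cder (qq k W Y) y 0.
  by apply: cder_ext (cder_cst 0 y); apply: filterS (near_oo yh) => z zh; rewrite q0.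
have := cder_uniq Dq D0; rewrite q0// mulr0 subr0 => /eqP.
rewrite !mulf_eq0 !fmorph_eq0 invr_eq0 (gt_eqF (mm_gt0 yh)) (gt_eqF (UU_gt0 yh)) /=.
by move/eqP.
Unshelve. all: by end_near. Qed.

End LeftVanishing.

(** * Gronwall inequalities in both directions *)

Section Gronwall.
Context {R : realType}.
Implicit Types (x y C : R).

Lemma gronwall_fwd a b C (N N' : R -> R) : (forall x : R, a < x < b -> is_derive x (1 : R) N (N' x)) ->
  (forall x, a < x < b -> N' x <= C * N x) ->
  forall x y, a < x -> x <= y -> y < b -> N y * expR (- C * y) <= N x * expR (- C * x).
Proof.
move=> dN bN x y ax xy yb; rewrite -lerN2.
pose f z := - (N z * expR (- C * z)); pose f' z := (C * N z - N' z) * expR (- C * z).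
apply: (@mono_itv R a b f f') => // z zab.
  have := derN (derM (dN z zab) (@der_comp _ _ z 1 expR (fun t => - C * t) _ _ (is_derive_expR _) (derM (der_cst z 1 (- C)) (der_id z)))).
  by apply: der_eq; rewrite /f'; ring.
by rewrite mulr_ge0 ?expR_ge0// subr_ge0 bN.
Qed.

Lemma gronwall_bwd a b C (N N' : R -> R) : (forall x : R, a < x < b -> is_derive x (1 : R) N (N' x)) ->
  (forall x, a < x < b -> - (C * N x) <= N' x) ->
  forall x y, a < x -> x <= y -> y < b -> N x * expR (C * x) <= N y * expR (C * y).
Proof.
move=> dN bN x y ax xy yb.
pose f z := N z * expR (C * z); pose f' z := (C * N z + N' z) * expR (C * z).
apply: (@mono_itv R a b f f') => // z zab.
  have := derM (dN z zab) (@der_comp _ _ z 1 expR (fun t => C * t) _ _ (is_derive_expR _) (derM (der_cst z 1 C) (der_id z))).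
  by apply: der_eq; rewrite /f'; ring.
by rewrite mulr_ge0 ?expR_ge0//; have := bN z zab; lra_ctx.
Qed.

End Gronwall.

(** * Inverting the transformation inside the light cone *)

Section LeftSolution.
Context {R : realType}.
Local Notation C := (R[i]).
Local Notation Re := (@complex.Re R).
Local Notation Im := (@complex.Im R).
Local Notation hf := (1 / 2 : R).
Implicit Types (y : R).

(** Gronwall for |W|^2 + |Y|^2, forwards and backwards from z. *)
Lemma linear_uniq a b M (W Y W' Y' : R -> C) z :
  (forall x, a < x < b -> cder W x (W' x)) -> (forall x, a < x < b -> cder Y x (Y' x)) ->
  (forall x, a < x < b -> nz (W' x) <= M * (nz (W x) + nz (Y x)) /\ nz (Y' x) <= M * (nz (W x) + nz (Y x))) ->
  a < z < b -> W z = 0 -> Y z = 0 -> forall x, a < x < b -> W x = 0.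
Proof.
move=> dW dY bd zab Wz Yz x xab.
pose N y := sqmod (W y) + sqmod (Y y).
pose N' y := 2 * (Re (W y) * Re (W' y) + Im (W y) * Im (W' y)) + 2 * (Re (Y y) * Re (Y' y) + Im (Y y) * Im (Y' y)).
have dN (y : R) : a < y < b -> is_derive y (1 : R) N (N' y).
  move=> h; have [w1 w2] := dW y h; have [y1 y2] := dY y h.
  have := derD (derD (derX 2 w1) (derX 2 w2)) (derD (derX 2 y1) (derX 2 y2)).
  by apply: der_eq; rewrite /N' /=; ring.
have N0 y : 0 <= N y by rewrite addr_ge0 ?sqmod_ge0.
have bN y : a < y < b -> `|N' y| <= 8 * `|M| * N y.
  move=> h; have [b1 b2] := bd y h.
  have w0 := nz_ge0 (W y); have y0 := nz_ge0 (Y y).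
  have [d1 _] := dot_nz (W y) (W' y); have [d2 _] := dot_nz (Y y) (Y' y).
  have M1 u : u <= M * (nz (W y) + nz (Y y)) -> u <= `|M| * (nz (W y) + nz (Y y)).
    by move=> hu; apply: le_trans hu _; rewrite ler_wpM2r ?addr_ge0// ler_norm.
  have c1 : nz (W y) * nz (W' y) <= nz (W y) * (`|M| * (nz (W y) + nz (Y y))) by rewrite ler_wpM2l// M1.
  have c2 : nz (Y y) * nz (Y' y) <= nz (Y y) * (`|M| * (nz (W y) + nz (Y y))) by rewrite ler_wpM2l// M1.
  rewrite /N'; apply: le_trans (ler_normD _ _) _; rewrite !normrM !normr_nat.
  have q1 := nz_sq_le (W y); have q2 := nz_sq_le (Y y).
  have m0 := normr_ge0 M.
  apply: (@le_trans _ _ (`|M| * (2 * (nz (W y) + nz (Y y)) ^+ 2))).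
    move: d1 d2 c1 c2; move: (`|_ + _|) (`|_ + _|) (nz (W y) * nz (W' y)) (nz (Y y) * nz (Y' y)) => p q u v.
    nra_ctx.
  rewrite (_ : 8 * `|M| * N y = `|M| * (8 * N y)); last by ring.
  by apply: ler_wpM2l => //; rewrite /N; have := sqr_ge0 (nz (W y) - nz (Y y)); lra_ctx.
have Nz : N z = 0 by rewrite /N Wz Yz /sqmod /= !expr0n !addr0.
have Nx : N x <= 0.
  have [xz|zx] := leP x z.
    have [ax _] := andP xab; have [_ zb] := andP zab.
    have : N x * expR (8 * `|M| * x) <= N z * expR (8 * `|M| * z).
      apply: (@gronwall_bwd R a b (8 * `|M|) N N' dN _ x z ax xz zb) => y h.
      by have := bN y h; rewrite ler_norml => /andP[h1 _].
    by rewrite Nz mul0r pmulr_lle0// expR_gt0.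
  have [_ xb] := andP xab; have [az _] := andP zab.
  have : N x * expR (- (8 * `|M|) * x) <= N z * expR (- (8 * `|M|) * z).
    apply: (@gronwall_fwd R a b (8 * `|M|) N N' dN _ z x az (ltW zx) xb) => y h.
    exact: le_trans (ler_norm _) (bN y h).
  by rewrite Nz mul0r pmulr_lle0// expR_gt0.
have {Nx}Nx : N x = 0 by apply/le_anti; rewrite Nx N0.
apply: nz_eq0; apply/eqP; rewrite -sqrf_eq0 eq_le sqr_ge0 andbT.
apply: le_trans (nz_sq_le _) _; have := sqmod_ge0 (Y x); have : sqmod (W x) + sqmod (Y x) = 0 by [].
lra_ctx.
Qed.

Let coef_arith1 (q u n w v : R) : 0 <= q -> 0 <= u -> 0 <= n -> 0 <= w -> 0 <= v ->
  v + q * w <= (1 + q + u + n) * (w + v).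
Proof. nra_ctx. Qed.

Let coef_arith2 (q u n w v : R) : 0 <= q -> 0 <= u -> 0 <= n -> 0 <= w -> 0 <= v ->
  (u + n) * w + q * v <= (1 + q + u + n) * (w + v).
Proof. nra_ctx. Qed.

Variables (lam : C) (F P : R -> C) (l m : C) (d M0 : R).
Hypothesis dF : forall y, 0 < y < 1 / 2 -> cder F y (P y).
Hypothesis dP : forall y, 0 < y < 1 / 2 -> exists Q, cder P y Q /\ eigen_ode lam y (F y) (P y) Q.
Hypothesis cF : clim hf^'- F l.
Hypothesis cP : clim hf^'- P m.
Hypothesis d0 : 0 < d.
Hypothesis d4 : d <= 1 / 4.
Hypothesis M00 : forall y, 0 < y < d -> nz (F y) <= M0 /\ nz (y%:C%C * P y) <= M0.
Hypothesis lam0 : 0 <= Re lam.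
Let k : C := 1 - lam.
Let W := Wf F.
Let Y := Yf lam F P.

Let W0 y : 0 < y -> W y = 0 -> F y = 0.
Proof.
move=> y0 /eqP; rewrite mulf_eq0 fmorph_eq0 expf_eq0 /= gt_eqF//=; by move/eqP.
Qed.

Lemma left_zero y : lam != 1 -> lam != 4 -> 0 < y < 1 / 2 -> F y = 0.
Proof.
move=> l1 l4 h; have [v0 q0] := crum_zero dF dP cF cP d0 d4 M00 lam0 h.
have [+ _] := crum_invert h v0 q0.
(* The root lam = -2 lies outside the half-plane Re lam >= 0, so the only values where inversion
   fails are 1 and 4. *)
have -> : (1 - lam) ^+ 2 - 9 = (lam + 2) * (lam - 4) by ring.
have n1 : (1 - lam) ^+ 2 != 0 by rewrite expf_neq0// subr_eq0 eq_sym.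
have n2 : lam + 2 != 0.
  apply/eqP => /(congr1 (fun z => Re z)); rewrite ReD /=.
  by have := lam0; lra.
have n3 : lam - 4 != 0 by rewrite subr_eq0.
move/eqP; rewrite mulf_eq0 (negbTE (mulf_neq0 n1 (mulf_neq0 n2 n3))) /= => /eqP.
by apply: W0; case/andP: h.
Qed.

(** The identity om = 0 is a relation between W and Y. At z the coefficient [LL] is nonzero, because
    rho <= 1/2 while its zero is at rho^2 = 7/15; so a zero of W is a zero of Y too, and linear
    uniqueness applies even when the transformation is not invertible. *)
Lemma left_zero_pt z y : 0 < z < 1 / 4 -> F z = 0 -> 0 < y < 1 / 2 -> F y = 0.
Proof.
move=> hz Fz hy; have [z0 z4] := andP hz; have [y0 y1] := andP hy.
have zh : 0 < z < 1 / 2 by rewrite z0 /=; lra.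
have [v0 _] := crum_zero dF dP cF cP d0 d4 M00 lam0 zh.
have Wz : W z = 0 by rewrite /W /Wf Fz mulr0.
have Yz : Y z = 0.
  move: v0; rewrite /om -/W -/Y Wz mulr0 sub0r => /eqP; rewrite oppr_eq0 mulf_eq0 fmorph_eq0 => /orP[|/eqP//].
  have [/andP[r1 r2] _] := rho_near0 hz; have e0 := ee_gt0 (half1 zh).
  rewrite /LL mulf_eq0 (gt_eqF e0) orbF subr_eq0 => /eqP; have : rho z ^+ 2 <= 1 / 4 by nra.
  by move=> u1 u2; exfalso; lra.
have dW := cder_W lam dF; have dY := cder_Y dF dP.
pose a := Num.min y z / 2; pose b := (Num.max y z + 1 / 2) / 2.
have a0 : 0 < a by rewrite divr_gt0// lt_min y0.
have am : Num.min y z <= y /\ Num.min y z <= z by rewrite !ge_min !lexx orbT.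
have bm : y <= Num.max y z /\ z <= Num.max y z by rewrite !le_max !lexx orbT.
have bM : Num.max y z < 1 / 2 by rewrite gt_max y1; lra.
have ay : a < y by rewrite /a; lra.
have az : a < z by rewrite /a; lra.
have yb : y < b by rewrite /b; lra.
have zb : z < b by rewrite /b; lra.
have bh : b < 1 / 2 by rewrite /b; lra.
have ab y' : a <= y' <= b -> 0 < y' < 1 / 2 by move=> /andP[u v]; apply/andP; split; lra.
have [Mm Mm0 Hm] : exists2 M, 0 <= M & forall x, a <= x <= b -> `|(mm x)^-1| <= M.
  by apply: bounded_itv => x /ab h; exact: der_cont (derV (lt0r_neq0 (mm_gt0 h)) (der_mm x)).
have [Mz Mz0 Hz] : exists2 M, 0 <= M & forall x, a <= x <= b -> `|zz x| <= M.
  by apply: bounded_itv => x /ab h; exact: der_cont (der_zz x).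
have [Mu Mu0 Hu] : exists2 M, 0 <= M & forall x, a <= x <= b -> `|U0 x| <= M.
  by apply: bounded_itv => x /ab h; exact: der_cont (der_U0 h).
pose n := nz k; have n0 : 0 <= n by exact: nz_ge0.
pose n2 := nz (k ^+ 2); have n20 : 0 <= n2 by exact: nz_ge0.
apply: W0 => //.
apply: (@linear_uniq a b (Mm * (1 + n * Mz + Mu + n2)) W Y _ _ z) => //.
- by move=> x /andP[u v]; apply: dW; apply: ab; rewrite !ltW.
- by move=> x /andP[u v]; apply: dY; apply: ab; rewrite !ltW.
- move=> x /andP[u v]; have xab : a <= x <= b by rewrite !ltW.
  have w0 := nz_ge0 (W x); have x0 := nz_ge0 (Y x).
  have kz : nz (k * (zz x)%:C%C) <= n * Mz by rewrite mulrC nz_real mulrC ler_wpM2l// Hz.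
  have uk : nz ((U0 x)%:C%C + k ^+ 2) <= Mu + n2.
    by apply: le_trans (nz_D _ _) _; rewrite lerD2r /nz /= normr0 addr0 Hu.
  have nM : 0 <= n * Mz by rewrite mulr_ge0.
  have step c z1 z2 : c <= (1 + n * Mz + Mu + n2) * (nz (W x) + nz (Y x)) ->
      nz (z1 - z2) <= c -> nz (((mm x)^-1)%:C%C * (z1 - z2)) <= Mm * (1 + n * Mz + Mu + n2) * (nz (W x) + nz (Y x)).
    move=> h1 h2; rewrite nz_real -mulrA; apply: ler_pM => //; [exact: nz_ge0|exact: Hm|exact: le_trans h1].
  have kz' q : nz (k * (zz x)%:C%C * q) <= n * Mz * nz q.
    by apply: le_trans (nz_M _ _) _; rewrite ler_wpM2r ?nz_ge0.
  split.
    apply: (step (nz (Y x) + n * Mz * nz (W x))); first exact: coef_arith1.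
    by apply: le_trans (nz_D _ _) _; rewrite nz_N lerD2l.
  apply: (step ((Mu + n2) * nz (W x) + n * Mz * nz (Y x))); first exact: coef_arith2.
  apply: le_trans (nz_D _ _) _; rewrite nz_N; apply: lerD => //.
  by apply: le_trans (nz_M _ _) _; rewrite ler_wpM2r.
- by rewrite az zb.
- by rewrite ay yb.
Qed.

End LeftSolution.

(** * Vanishing outside the light cone *)

Section RightVanishing.
Context {R : realType}.
Local Notation C := (R[i]).
Local Notation Re := (@complex.Re R).
Local Notation Im := (@complex.Im R).
Local Notation hf := (1 / 2 : R).
Implicit Types (y : R).

Lemma sq_right y : 1 / 2 < y -> 3 / 2 < sq y.
Proof.
move=> h; rewrite ltNge; apply/negP => s; have := sq_sq y; have := sq_gt0 y; nra_ctx.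
Qed.

Definition kap y : R := 4 * (y + 1 / 2) * sq y ^+ 2 / (3 + 2 * sq y).

Lemma kap_ge1 y : 1 / 2 < y -> 1 <= kap y.
Proof.
move=> h; have s := sq_right h; rewrite /kap ler_pdivlMr; last by lra_ctx.
nra_ctx.
Qed.

Lemma c12_kap y : 1 / 2 < y -> c12 y = - ((y - 1 / 2) * kap y).
Proof.
move=> h; have s := sq_right h; rewrite c12E /kap.
have s3 : 3 + 2 * sq y != 0 by rewrite gt_eqF//; lra_ctx.
apply: (mulIf s3); rewrite mulNr -!mulrA mulVf// mulr1.
transitivity (sq y ^+ 2 * (9 - 4 * sq y ^+ 2)); first by ring.
rewrite (_ : 9 - 4 * sq y ^+ 2 = 1 - 4 * (sq y ^+ 2 - 2)); last by ring.
by rewrite -(ysq y); field.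
Qed.

(** The part of [c11] divisible by [c12]; the remainder is 4 y s. *)
Definition gk y : R := 6 / y - y / ((sq y - 1) * sq y ^+ 2).

(** The remainder 4 y s of [c11] cancels against 2 [c21], so at the cone the coefficient of P is a
    multiple of lam alone: a damping term when Re lam >= 0. *)
Lemma right_ode lam y (F P Q : C) : 1 / 2 < y -> eigen_ode lam y F P Q ->
  ((y - 1 / 2) * kap y)%:C%C * Q = - ((y - 1 / 2) * kap y * gk y)%:C%C * P - (2 * y * sq y)%:C%C * (lam * P)
    + ((lam + 2) * ((c20 y)%:C%C - 2 - lam) + (V y)%:C%C) * F.
Proof.
move=> h; have y0 : y != 0 by rewrite gt_eqF//; lra_ctx.
have e11 : c11 y = c12 y * gk y + 4 * y * sq y.
  rewrite c11E// c12E /gk; field.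
  by rewrite y0 sqm1_neq0 lt0r_neq0// sq_gt0.
have e12 := c12_kap h.
have -> : (y - 1 / 2) * kap y = - c12 y by rewrite e12 opprK.
rewrite /eigen_ode e11 c21E.
have -> : (c12 y * gk y + 4 * y * sq y)%:C%C = (c12 y)%:C%C * (gk y)%:C%C + 2 * (2 * y * sq y)%:C%C :> C.
  by rewrite rmorphD !rmorphM /= !rmorph_nat; ring.
have -> : (- 2 * y * sq y)%:C%C = - (2 * y * sq y)%:C%C :> C by rewrite -rmorphN; congr (_%:C%C); ring.
have -> : (- c12 y * gk y)%:C%C = - ((c12 y)%:C%C * (gk y)%:C%C) :> C by rewrite mulNr rmorphN rmorphM.
have -> : (- c12 y)%:C%C = - (c12 y)%:C%C :> C by rewrite rmorphN.
move: (c12 y)%:C%C (gk y)%:C%C (2 * y * sq y)%:C%C (c20 y)%:C%C (V y)%:C%C => c g t c0 v ode.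
apply/eqP; rewrite -subr_eq0; apply/eqP.
transitivity (lam * ((lam + 2) * F) - (c * Q + (c * g + 2 * t) * P + c0 * ((lam + 2) * F) + - t * ((lam + 2) * P) - 2 * ((lam + 2) * F) + v * F)).
  by ring.
by rewrite ode subrr.
Qed.

Let dot_real (tk gt ys : R) (lam E F P Q : C) :
  tk%:C%C * Q = - gt%:C%C * P - ys%:C%C * (lam * P) + E * F ->
  tk * (Re P * Re Q + Im P * Im Q) = - gt * sqmod P - ys * Re lam * sqmod P + (Re P * Re (E * F) + Im P * Im (E * F)).
Proof.
move=> H; have e1 := congr1 (fun z => Re z) H; have e2 := congr1 (fun z => Im z) H.
move: e1 e2; rewrite /sqmod; move: (E * F) => w; case: Q P lam w {H} => [x1 x2] [x3 x4] [x5 x6] [x7 x8] /=.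
rewrite !mul0r !oppr0 !mul0r !subr0 !addr0 => e1 e2.
transitivity (x3 * (tk * x1) + x4 * (tk * x2)); first by ring.
by rewrite e1 e2; ring.
Qed.

(** The negative term - |F|^2 / t^2, produced by differentiating the weight 1/t, absorbs every
    occurrence of F after completing the square; the term with Re lam has the good sign. *)
Let energy_step (t k g Mg ME a ys p2 f2 p f D X w e : R) : 0 < t -> 1 <= k -> `|g| <= Mg -> 0 <= a -> 0 <= ys ->
  0 <= p -> 0 <= f -> p ^+ 2 <= 2 * p2 -> f ^+ 2 <= 2 * f2 -> 0 <= e <= ME ->
  `|w| <= p * (e * f) -> `|X| <= f * p ->
  t * k * D = - (t * k * g) * p2 - ys * a * p2 + w ->
  2 * D + (2 * X * t^-1 - f2 / t ^+ 2) <= (2 * Mg + 4 * (ME + 1) ^+ 2) * p2.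
Proof.
move=> t0 k1 gM a0 y0 p0 f0 pp ff /andP[e0 eM] hw hX HD.
have p20 : 0 <= p2 by have := sqr_ge0 p; lra_ctx.
have f20 : 0 <= f2 by have := sqr_ge0 f; lra_ctx.
have k0 : 0 < k by lra_ctx.
have tn : t != 0 by rewrite gt_eqF.
have pf0 : 0 <= p * f by exact: mulr_ge0.
have ef : p * (e * f) <= ME * (p * f) by rewrite mulrCA ler_wpM2r.
have ME0 : 0 <= ME by lra_ctx.
have Mg0 : 0 <= Mg by apply: le_trans gM.
have H1 : t * D <= t * (Mg * p2) + ME * (p * f).
  rewrite -(ler_pM2l k0) (_ : k * (t * D) = t * k * D); last by ring.
  rewrite HD mulrDr; apply: lerD.
    have -> : - (t * k * g) * p2 - ys * a * p2 = t * k * p2 * (- g) - ys * a * p2 by ring.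
    have -> : k * (t * (Mg * p2)) = t * k * p2 * Mg by ring.
    have q1 : t * k * p2 * - g <= t * k * p2 * Mg.
      apply: ler_wpM2l; first by rewrite !mulr_ge0// ltW.
      by apply: le_trans gM; rewrite -normrN ler_norm.
    have : 0 <= ys * a * p2 by rewrite !mulr_ge0.
    lra_ctx.
  apply: le_trans (ler_norm _) _; apply: le_trans hw _; apply: le_trans ef _.
  by rewrite ler_peMl// mulr_ge0.
rewrite -(ler_pM2l (exprn_gt0 2 t0)).
have -> : t ^+ 2 * (2 * D + (2 * X * t^-1 - f2 / t ^+ 2)) = 2 * t * (t * D) + 2 * t * X - f2 by field.
have h2 : 2 * t * (t * D) <= 2 * t * (t * (Mg * p2) + ME * (p * f)) by rewrite ler_pM2l// mulr_gt0.
have h3 : 2 * t * X <= 2 * t * (p * f).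
  by rewrite ler_pM2l ?mulr_gt0//; apply: le_trans (ler_norm _) _; rewrite [p * f]mulrC.
have h4 : 2 * t * ((ME + 1) * (p * f)) <= 4 * t ^+ 2 * (ME + 1) ^+ 2 * p2 + f2.
  have := sqr_ge0 (2 * t * (ME + 1) * p - f).
  have -> : (2 * t * (ME + 1) * p - f) ^+ 2 = 4 * t ^+ 2 * (ME + 1) ^+ 2 * p ^+ 2 - 2 * (2 * t * ((ME + 1) * (p * f))) + f ^+ 2 by ring.
  have : 4 * t ^+ 2 * (ME + 1) ^+ 2 * p ^+ 2 <= 4 * t ^+ 2 * (ME + 1) ^+ 2 * (2 * p2).
    by apply: ler_wpM2l => //; rewrite mulr_ge0 ?sqr_ge0// mulr_ge0 ?sqr_ge0.
  have -> : 4 * t ^+ 2 * (ME + 1) ^+ 2 * (2 * p2) = 2 * (4 * t ^+ 2 * (ME + 1) ^+ 2 * p2) by ring.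
  move: (2 * t * ((ME + 1) * (p * f))) (4 * t ^+ 2 * (ME + 1) ^+ 2 * p ^+ 2) (4 * t ^+ 2 * (ME + 1) ^+ 2 * p2) => x y z.
  lra_ctx.
have -> : t ^+ 2 * ((2 * Mg + 4 * (ME + 1) ^+ 2) * p2) = 2 * t * (t * (Mg * p2)) + 4 * t ^+ 2 * (ME + 1) ^+ 2 * p2 by ring.
move: h2 h4; rewrite !mulrDr !mulrDl !mul1r !mulrDr; move: h3; lra_ctx.
Qed.

Variables (r : R) (lam : C) (F P : R -> C).
Hypothesis dF : forall y, 0 < y < r -> cder F y (P y).
Hypothesis dP : forall y, 0 < y < r -> c12 y != 0 -> exists Q, cder P y Q /\ eigen_ode lam y (F y) (P y) Q.
Hypothesis cP : forall y e, 0 < y < r -> 0 < e -> \forall z \near y, nz (P z - P y) <= e.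
Hypothesis lam0 : 0 <= Re lam.
Hypothesis Fl : forall y, 0 < y < 1 / 2 -> F y = 0.

(** F is C^1 across the cone and vanishes to its left, so value and derivative vanish at 1/2; the
    equation, degenerate there, is not consulted. *)
Lemma half_zero : hf < r -> F hf = 0 /\ P hf = 0.
Proof.
move=> hr; have h : 0 < hf < r by apply/andP; split=> //; lra.
have Pl y : 0 < y < hf -> P y = 0.
  move=> hy; have yr : 0 < y < r by case/andP: hy => -> /= hy; apply: lt_trans hy hr.
  have D0 : cder F y 0 by apply: cder_ext (cder_cst 0 y); apply: filterS (near_oo hy) => z zh; rewrite Fl.
  exact: cder_uniq (dF yr) D0.
have [d1 d2] := dF h.
have c0 (g : R -> R) : {for hf, continuous g} -> (forall y, 0 < y < hf -> g y = 0) -> g hf = 0.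
  move=> cg g0; have c1 := cvg_left cg.
  have c2 : g y @[y --> hf^'-] --> (0 : R).
    apply: cvg_near_cst; by apply: filterS near_left => y /g0 ->.
  exact: (@cvg_unique R _ (g y @[y --> hf^'-]) _ _ _ c1 c2).
split.
  apply/complexP; split.
    by apply: (c0 (fun y => Re (F y))) (der_cont d1) _ => y /Fl ->.
  by apply: (c0 (fun y => Im (F y))) (der_cont d2) _ => y /Fl ->.
apply: nz_eq0; apply/eqP; rewrite eq_le nz_ge0 andbT leNgt; apply/negP => p0.
have p2 : 0 < nz (P hf) / 2 by rewrite divr_gt0.
have := cP h p2 => /nbhs_ballP[e /= e0 He].
pose z := hf - Num.min (e / 2) (1 / 4).
have m0 : 0 < Num.min (e / 2) (1 / 4) by rewrite lt_min !divr_gt0.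
have m1 : Num.min (e / 2) (1 / 4) <= e / 2 by rewrite ge_min lexx.
have m2 : Num.min (e / 2) (1 / 4) <= 1 / 4 by rewrite ge_min lexx orbT.
have hz : 0 < z < hf by rewrite /z; apply/andP; split; lra.
have := He z; rewrite /ball /= /z opprD opprK addrA subrr add0r gtr0_norm// => /(_ _); rewrite -/z Pl// sub0r nz_N.
by move=> /(_ ltac:(lra)); lra.
Qed.

Lemma right_zero y : 0 < y < r -> F y = 0.
Proof.
move=> yr; have [y0 yr1] := andP yr.
have [yh|] := ltP y hf; first by apply: Fl; rewrite y0.
rewrite le_eqVlt => /orP[/eqP e|hy]; first by move: yr1; rewrite -e => /half_zero[].
have hr : hf < r by exact: lt_trans hy yr1.
have [F0 P0] := half_zero hr.
pose b := (y + r) / 2.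
have yb : y < b by rewrite /b; lra.
have br : b < r by rewrite /b; lra.
have inr z : hf < z < b -> 0 < z < r by move=> /andP[u v]; apply/andP; split; lra.
have inr' z : hf <= z <= b -> 0 < z < r by move=> /andP[u v]; apply/andP; split; lra.
have [Mc Mc0 Hc] : exists2 M, 0 <= M & forall x, hf <= x <= b -> `|c20 x| <= M.
  by apply: bounded_itv => x /inr' h; exact: rdif_cont h (rdif_c20 r 1).
have [MV MV0 HV] : exists2 M, 0 <= M & forall x, hf <= x <= b -> `|V x| <= M.
  by apply: bounded_itv => x /inr' h; exact: rdif_cont h (rdif_V r 1).
have [Mg Mg0 Hg] : exists2 M, 0 <= M & forall x, hf <= x <= b -> `|gk x| <= M.
  apply: bounded_itv => x /inr'/andP[x0 _].
  have n1 : (sq x - 1) * sq x ^+ 2 != 0 by rewrite mulf_neq0 ?sqm1_neq0// expf_neq0// lt0r_neq0// sq_gt0.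
  have dd := derM (derB (der_sq x) (der_cst x 1 1)) (derX 2 (der_sq x)).
  have := der_cont (derB (derM (der_cst x 1 6) (derV (lt0r_neq0 x0) (der_id x)))
    (derM (der_id x) (derV (f := fun x => (sq x - 1) * sq x ^+ 2) n1 dd))).
  exact.
pose ME := nz (lam + 2) * (Mc + 2 + nz lam) + MV.
pose E z : C := (lam + 2) * ((c20 z)%:C%C - 2 - lam) + (V z)%:C%C.
have HE z : hf < z < b -> nz (E z) <= ME.
  move=> /andP[/ltW u /ltW v]; have zz' : hf <= z <= b by rewrite u.
  apply: le_trans (nz_D _ _) _; apply: lerD; last by rewrite /nz /= normr0 addr0 HV.
  apply: le_trans (nz_M _ _) _; apply: ler_wpM2l; first exact: nz_ge0.
  have -> : (c20 z)%:C%C - 2 - lam = (c20 z - 2)%:C%C - lam by ring.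
  apply: le_trans (nz_D _ _) _; rewrite nz_N lerD2r /nz /= normr0 addr0.
  by apply: le_trans (ler_normB _ _) _; rewrite normr_nat lerD2r Hc.
have [Q HQ] : exists Q : R -> C, forall z, hf < z < b -> cder P z (Q z) /\ eigen_ode lam z (F z) (P z) (Q z).
  have /choice[Q HQ] : forall z : R, exists q, hf < z < b -> cder P z q /\ eigen_ode lam z (F z) (P z) q.
    move=> z; have [h|n] := pselect (hf < z < b); last by exists 0.
    have [z1 _] := andP h; have k1 := kap_ge1 z1.
    have [|q hq] := dP (inr z h); last by exists q.
    by rewrite (c12_kap z1) oppr_eq0 mulf_neq0 ?gt_eqF// ?subr_gt0//; lra.
  by exists Q.
(* The singular weight compensates the factor y - 1/2 in front of the second derivative. *)
pose Phi z := sqmod (P z) + sqmod (F z) * (z - hf)^-1.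
pose D z := Re (P z) * Re (Q z) + Im (P z) * Im (Q z).
pose X z := Re (F z) * Re (P z) + Im (F z) * Im (P z).
pose Phi' z := 2 * D z + (2 * X z * (z - hf)^-1 - sqmod (F z) / (z - hf) ^+ 2).
pose Cc := 2 * Mg + 4 * (ME + 1) ^+ 2.
have Cc0 : 0 <= Cc by rewrite /Cc; have := sqr_ge0 (ME + 1); move: Mg0; lra.
have dPhi (z : R) : hf < z < b -> is_derive z (1 : R) Phi (Phi' z).
  move=> h; have [z1 _] := andP h; have zn : z - hf != 0 by rewrite gt_eqF// subr_gt0.
  have [p1 p2] := (HQ z h).1; have [f1 f2] := dF (inr z h).
  have dV := derV (f := fun z => z - hf) zn (derB (der_id z) (der_cst z 1 hf)).
  have := derD (derD (derX 2 p1) (derX 2 p2)) (derM (derD (derX 2 f1) (derX 2 f2)) dV).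
  by apply: der_eq; rewrite /Phi' /D /X /sqmod /=; move: zn; set t := z - hf => tn; field.
have Phi0 z : hf < z -> 0 <= Phi z.
  by move=> h; rewrite addr_ge0 ?mulr_ge0 ?sqmod_ge0// invr_ge0 subr_ge0 ltW.
have bPhi z : hf < z < b -> Phi' z <= Cc * Phi z.
  move=> h; have [z1 z2] := andP h; have t0 : 0 < z - hf by rewrite subr_gt0.
  have k1 := kap_ge1 z1; have O := right_ode z1 (HQ z h).2.
  apply: (@le_trans _ _ (Cc * sqmod (P z))); last first.
    by apply: ler_wpM2l => //; rewrite lerDl mulr_ge0 ?sqmod_ge0// invr_ge0 ltW.
  have hz : hf <= z <= b by rewrite !ltW.
  apply: (@energy_step (z - hf) (kap z) (gk z) Mg ME (Re lam) (2 * z * sq z) (sqmod (P z)) (sqmod (F z))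
    (nz (P z)) (nz (F z)) (D z) (X z) (Re (P z) * Re (E z * F z) + Im (P z) * Im (E z * F z)) (nz (E z))) => //.
  - exact: Hg.
  - by rewrite !mulr_ge0 ?ltW ?sq_gt0//; lra.
  - exact: nz_ge0.
  - exact: nz_ge0.
  - exact: nz_sq_le.
  - exact: nz_sq_le.
  - by rewrite nz_ge0 HE.
  - apply: le_trans (dot_nz _ _).1 _; apply: ler_wpM2l; [exact: nz_ge0|exact: nz_M].
  - exact: (dot_nz _ _).1.
  - by apply: dot_real; rewrite O -rmorphN.
have mono := gronwall_fwd dPhi bPhi.
(* The initial value at the cone is 0 despite the singular weight: at distance w each component of F
   is at most e w, so the weighted term is O(e^2 w). *)
have key e : 0 < e -> e <= 1 -> Phi y * expR (- Cc * y) <= 3 * e.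
  move=> e0 e1; have hh : 0 < hf < r by apply/andP; split=> //; lra.
  have := cP hh e0 => /nbhs_ballP[d /= d0 Hd].
  pose w := Num.min (d / 2) (Num.min (y - hf) 1).
  have w0 : 0 < w by rewrite !lt_min divr_gt0// subr_gt0 hy ltr01.
  have w1 : w <= d / 2 by rewrite ge_min lexx.
  have w2 : w <= y - hf by rewrite !ge_min lexx orbT.
  have w3 : w <= 1 by rewrite !ge_min lexx !orbT.
  pose z := hf + w.
  have zy : z <= y by rewrite /z addrC -lerBrDr.
  have hz : hf < z by rewrite /z ltrDl.
  have Pe x : hf < x -> x <= z -> nz (P x) <= e.
    move=> x1 x2; have := Hd x; rewrite P0 subr0; apply.
    by rewrite /ball /= distrC gtr0_norm ?subr_gt0//; move: x2; rewrite /z; lra.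
  have comp (f p : R -> R) : (forall x : R, 0 < x < r -> is_derive x (1 : R) f (p x)) -> f hf = 0 ->
      (forall x, hf < x -> x <= z -> `|p x| <= e) -> f z ^+ 2 <= (e * w) ^+ 2.
    move=> df f0 pe; have h0 : 0 < hf by lra.
    have [c /andP[c1 c2]] := mvt_diff df h0 hz (le_lt_trans zy yr1).
    rewrite f0 subr0 => ->; rewrite (_ : z - hf = w); last by rewrite /z addrC addKr.
    rewrite !exprMn; apply: ler_wpM2r; first exact: sqr_ge0.
    by rewrite -real_normK ?num_real// lerXn2r ?nnegrE ?(ltW e0)// pe// ltW.
  have f1 : Re (F z) ^+ 2 <= (e * w) ^+ 2.
    apply: (comp (fun x => Re (F x)) (fun x => Re (P x))).
    - by move=> x /dF[].
    - by rewrite F0.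
    - by move=> x x1 x2; apply: le_trans (Pe x x1 x2); rewrite /nz lerDl.
  have f2 : Im (F z) ^+ 2 <= (e * w) ^+ 2.
    apply: (comp (fun x => Im (F x)) (fun x => Im (P x))).
    - by move=> x /dF[].
    - by rewrite F0.
    - by move=> x x1 x2; apply: le_trans (Pe x x1 x2); rewrite /nz lerDr.
  have p1 : sqmod (P z) <= e ^+ 2.
    by apply: le_trans (sqmod_le_nz _) _; rewrite lerXn2r ?nnegrE ?nz_ge0 ?(ltW e0)// Pe.
  have ee1 : e ^+ 2 <= e by rewrite expr2 ler_piMl// ltW.
  have : sqmod (F z) * (z - hf)^-1 <= 2 * e ^+ 2.
    rewrite (_ : z - hf = w); last by rewrite /z addrC addKr.
    rewrite ler_pdivrMr//; apply: (@le_trans _ _ (2 * (e * w) ^+ 2)); first by rewrite /sqmod; lra.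
    by rewrite exprMn mulrA; apply: ler_wpM2l; [rewrite mulr_ge0 ?sqr_ge0|rewrite expr2 ler_piMl// ltW].
  move=> f3; have Pz : Phi z <= 3 * e by rewrite /Phi; lra.
  apply: le_trans (mono z y hz zy yb) _; apply: le_trans _ Pz.
  rewrite -[leRHS]mulr1; apply: ler_wpM2l; first exact: Phi0.
  by rewrite -expR0 ler_expR mulNr oppr_le0 mulr_ge0// ltW// (lt_trans _ hz).
have Ph : Phi y = 0.
  apply/le_anti; rewrite Phi0// andbT leNgt; apply/negP => ph.
  have q0 : 0 < Phi y * expR (- Cc * y) by rewrite mulr_gt0 ?expR_gt0.
  have := key (Num.min 1 (Phi y * expR (- Cc * y) / 6)).
  rewrite lt_min ltr01 divr_gt0// ge_min lexx => /(_ isT isT).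
  have : Num.min 1 (Phi y * expR (- Cc * y) / 6) <= Phi y * expR (- Cc * y) / 6 by rewrite ge_min lexx orbT.
  lra.
move/eqP : Ph; rewrite paddr_eq0 ?sqmod_ge0//; last by rewrite mulr_ge0 ?sqmod_ge0// invr_ge0 subr_ge0 ltW.
rewrite mulf_eq0 invr_eq0 subr_eq0 (gt_eqF hy) orbF => /andP[_].
rewrite /sqmod paddr_eq0 ?sqr_ge0// !sqrf_eq0 => /andP[/eqP u /eqP v].
exact/complexP.
Qed.

End RightVanishing.

(** * Conclusion *)

Section Eigenfunctions.
Context {R : realType}.
Local Notation C := (R[i]).
Local Notation Re := (@complex.Re R).
Local Notation Im := (@complex.Im R).
Local Notation hf := (1 / 2 : R).
Implicit Types (y r : R).

(** What the argument retains of membership in the kernel; unlike the graph of the closure, it is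
    easily seen to be stable under subtracting a multiple of an explicit solution. *)
Definition regular_solution r (lam : C) (F P : R -> C) : Prop :=
  [/\ forall y, 0 < y < r -> cder F y (P y),
      forall y, 0 < y < r -> c12 y != 0 -> exists Q, cder P y Q /\ eigen_ode lam y (F y) (P y) Q,
      forall y e, 0 < y < r -> 0 < e -> \forall z \near y, nz (P z - P y) <= e,
      exists l m, clim hf^'- F l /\ clim hf^'- P m &
      exists d M, [/\ 0 < d, d <= 1 / 4 & forall y, 0 < y < d -> nz (F y) <= M /\ nz (y%:C%C * P y) <= M]].

Lemma c12_left y : 0 < y < 1 / 2 -> c12 y != 0.
Proof.
move=> h; rewrite c12E mulf_neq0 ?expf_neq0 ?lt0r_neq0 ?sq_gt0//.
by rewrite subr_gt0; have := sq_lt32 h; lra_ctx.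
Qed.

Lemma left_ode r lam (F P : R -> C) : hf <= r -> regular_solution r lam F P ->
  (forall y, 0 < y < 1 / 2 -> cder F y (P y)) /\
  (forall y, 0 < y < 1 / 2 -> exists Q, cder P y Q /\ eigen_ode lam y (F y) (P y) Q).
Proof.
move=> hr [dF dP _ _ _]; have sub y : 0 < y < 1 / 2 -> 0 < y < r.
  by move=> /andP[-> h] /=; exact: lt_le_trans h hr.
by split=> y hy; [exact: dF (sub y hy)|exact: dP (sub y hy) (c12_left hy)].
Qed.

Lemma ker_regular r lam f : hf <= r -> ker_L r lam f -> exists F P,
  [/\ regular_solution r lam F P, aeq r f.1 F & aeq r f.2 (fun y => (lam + 2) * F y)].
Proof.
move=> hr Kf; have r0 : 0 < r by lra_ctx.
have [F [P [[dF dP cl e1 e2] cP]]] := graph_classical r0 Kf.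
exists F, P; split=> //; split=> //.
  have [|l [m [cF cm]]] := cl hf; first by rewrite hr andbT; lra_ctx.
  by exists l, m; split; exact: cleft_clim.
have sub y : 0 < y < 1 / 2 -> 0 < y < r by move=> /andP[-> h] /=; exact: lt_le_trans h hr.
have [] := @origin_dichotomy R lam F P (fun y hy => dF y (sub y hy)) (fun y hy => dP y (sub y hy) (c12_left hy)).
  by [].
move=> [d [m [d0 d4 m0 H]]]; exfalso.
have Lf : L2 r (lift7 f.1) by have [u [_ [_ [[+ _] _] _] _]] := Kf.
apply: (@L2_not_singular R r F f.1 d m) => //; rewrite d0 /=.
by apply: le_trans d4 _; lra_ctx.
Qed.

Lemma aeq_itv r (f F G : R -> C) : (forall y, 0 < y < r -> F y = G y) -> aeq r f F -> aeq r f G.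
Proof.
move=> FG fF; have Q := @ae_off0 R (fun x => x != 0) (fun x h => h).
by apply: ae_imp (ae_and Q fF) => x [x0 e] xr; rewrite e// /lift7 FG// norm7_itv.
Qed.

Lemma regular_zero r lam (F P : R -> C) : hf <= r -> 0 <= Re lam -> regular_solution r lam F P ->
  (forall y, 0 < y < 1 / 2 -> F y = 0) -> forall y, 0 < y < r -> F y = 0.
Proof. by move=> hr l0 [dF dP cP _ _] Fl y yr; exact: (right_zero dF dP cP l0 Fl yr). Qed.

Lemma no_other_eigenvalue r lam f : hf <= r -> 0 <= Re lam -> lam != 1 -> lam != 4 ->
  ker_L r lam f -> HR_eq r f 0.
Proof.
move=> hr l0 l1 l4 /(ker_regular hr)[F [P [reg e1 e2]]].
have [dF dP] := left_ode hr reg; have [_ _ _ [l [m [cF cm]]] [d [M [d0 d4 HM]]]] := reg.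
have Fl y (hy : 0 < y < 1 / 2) := left_zero dF dP cF cm d0 d4 HM l0 l1 l4 hy.
have F0 := regular_zero hr l0 reg Fl.
split; first exact: aeq_itv e1.
by apply: aeq_itv e2 => y /F0 ->; rewrite mulr0.
Qed.

(** Subtract the multiple of p that makes the difference vanish at z; the difference is again a
    regular solution, so [left_zero_pt] and then [regular_zero] annihilate it. *)
Lemma regular_uniq r (lam : R) (p p' p'' : R -> R) z (F P : R -> C) : hf <= r -> 0 <= lam ->
  (forall y, is_derive y (1 : R) p (p' y)) -> (forall y, is_derive y (1 : R) p' (p'' y)) ->
  (forall y, 0 < y -> c11 y * p' y + c12 y * p'' y + c20 y * ((lam + 2) * p y)
    + c21 y * ((lam + 2) * p' y) - 2 * ((lam + 2) * p y) + V y * p y = lam * ((lam + 2) * p y)) ->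
  0 < z < 1 / 4 -> p z != 0 -> regular_solution r lam%:C%C F P ->
  exists c, forall y, 0 < y < r -> F y = c * (p y)%:C%C.
Proof.
move=> hr l0 dp dp' ode hz pz reg.
have [dF dP cP [l [m [cF cm]]] [d [M [d0 d4 HM]]]] := reg.
pose c := F z * (p z)^-1%:C%C; exists c.
pose G y := F y - c * (p y)%:C%C; pose PG y := P y - c * (p' y)%:C%C.
suff G0 : forall y, 0 < y < r -> G y = 0 by move=> y /G0/eqP; rewrite subr_eq0 => /eqP.
have cp (q : R -> R) y : {for y, continuous q} -> q x @[x --> y^'-] --> q y by move=> H; apply: cvg_at_left_filter.
have Gz : G z = 0.
  by rewrite /G /c -mulrA -rmorphM /= mulVf// mulr1 subrr.
have regG : regular_solution r lam%:C%C G PG.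
  split.
  - by move=> y yr; exact: cderB (dF y yr) (cderZ c (cder_real (dp y))).
  - move=> y yr y12; have [Q [dQ eQ]] := dP y yr y12.
    exists (Q - c * (p'' y)%:C%C); split; first exact: cderB dQ (cderZ c (cder_real (dp' y))).
    have y0 : 0 < y by case/andP: yr.
    have o : (c11 y)%:C%C * (p' y)%:C%C + (c12 y)%:C%C * (p'' y)%:C%C + (c20 y)%:C%C * ((lam%:C%C + 2) * (p y)%:C%C)
      + (c21 y)%:C%C * ((lam%:C%C + 2) * (p' y)%:C%C) - 2 * ((lam%:C%C + 2) * (p y)%:C%C) + (V y)%:C%C * (p y)%:C%C
      = lam%:C%C * ((lam%:C%C + 2) * (p y)%:C%C) :> C.
      transitivity ((lam * ((lam + 2) * p y))%:C%C : C); last by ring.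
      by rewrite -(ode y y0); ring.
    move: eQ o; rewrite /eigen_ode /G /PG.
    set a1 := (c11 y)%:C%C; set a2 := (c12 y)%:C%C; set a3 := (c20 y)%:C%C.
    set a4 := (c21 y)%:C%C; set a5 := (V y)%:C%C; set L := lam%:C%C.
    set q := (p y)%:C%C; set q1 := (p' y)%:C%C; set q2 := (p'' y)%:C%C => eQ o.
    transitivity (a2 * Q + a1 * P y + a3 * ((L + 2) * F y) + a4 * ((L + 2) * P y) - 2 * ((L + 2) * F y) + a5 * F y
      - c * (a1 * q1 + a2 * q2 + a3 * ((L + 2) * q) + a4 * ((L + 2) * q1) - 2 * ((L + 2) * q) + a5 * q)).
      by ring.
    by rewrite eQ o; ring.
  - move=> y e yr e0; have e2 : 0 < e / 2 by rewrite divr_gt0.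
    have c0 : 0 < nz c + 1 by rewrite ltr_wpDl// nz_ge0.
    have ec : 0 < e / 2 / (nz c + 1) by rewrite divr_gt0.
    have cq := der_cont (dp' y).
    near=> x.
    have h1 : nz (P x - P y) <= e / 2 by near: x; exact: cP.
    have h2 : `|p' y - p' x| <= e / 2 / (nz c + 1) by near: x; move/cvgrPdist_le : cq; exact.
    have -> : PG x - PG y = (P x - P y) + c * (p' y - p' x)%:C%C by rewrite /PG rmorphB; ring.
    apply: le_trans (nz_D _ _) _; rewrite [e]splitr; apply: lerD => //.
    rewrite mulrC nz_real; apply: (@le_trans _ _ (e / 2 / (nz c + 1) * (nz c + 1))); last by rewrite divfK// gt_eqF.
    by apply: ler_pM => //; [exact: nz_ge0|rewrite lerDl].
  - exists (l - c * (p hf)%:C%C), (m - c * (p' hf)%:C%C); split.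
      by apply: climB cF _; apply: climM; [exact: clim_cst|apply: clim_real; exact: cp (der_cont (dp hf))].
    by apply: climB cm _; apply: climM; [exact: clim_cst|apply: clim_real; exact: cp (der_cont (dp' hf))].
  - have [N N0 HN] : exists2 N, 0 <= N & forall y, 0 <= y <= 1 / 4 -> `|p y| <= N.
      by apply: bounded_itv => y _; exact: der_cont (dp y).
    have [N' N0' HN'] : exists2 N, 0 <= N & forall y, 0 <= y <= 1 / 4 -> `|p' y| <= N.
      by apply: bounded_itv => y _; exact: der_cont (dp' y).
    exists d, (M + nz c * (N + N')); split=> // y hy; have [y0 y1] := andP hy.
    have [h1 h2] := HM y hy; have y14 : 0 <= y <= 1 / 4 by rewrite ltW//= (le_trans (ltW y1)).
    have n0 := nz_ge0 c; have nR (x : R) : nz (c * x%:C%C) = nz c * `|x| by rewrite mulrC nz_real mulrC.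
    split.
      apply: le_trans (nz_D _ _) _; rewrite nz_N nR; apply: lerD => //; apply: ler_wpM2l => //.
      by apply: le_trans (HN y y14) _; rewrite lerDl.
    rewrite (_ : y%:C%C * PG y = y%:C%C * P y - c * (y * p' y)%:C%C); last by rewrite /PG rmorphM; ring.
    apply: le_trans (nz_D _ _) _; rewrite nz_N nR; apply: lerD => //; apply: ler_wpM2l => //.
    rewrite normrM gtr0_norm//; apply: (@le_trans _ _ (1 * N')); last by rewrite mul1r lerDr.
    by apply: ler_pM => //; [exact: ltW|lra_ctx|exact: HN'].
have [dG dPG] := left_ode hr regG; have [_ _ _ [l' [m' [cG cmG]]] [d' [M' [d0' d4' HM']]]] := regG.
have l0' : 0 <= Re lam%:C%C by [].
apply: (regular_zero hr l0' regG) => y hy.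
exact: (left_zero_pt dG dPG cG cmG d0' d4' HM' l0' hz Gz hy).
Unshelve. all: by end_near. Qed.

Lemma ker_star r (lam : R) (t : @term R) p z f : hf <= r -> 0 <= lam ->
  (forall x y, sx x = sq y -> eval t x = p y) ->
  (forall y, 0 < y -> c11 y * tray t 1 y + c12 y * tray t 2 y + c20 y * ((lam + 2) * p y)
    + c21 y * ((lam + 2) * tray t 1 y) - 2 * ((lam + 2) * p y) + V y * p y = lam * ((lam + 2) * p y)) ->
  0 < z < 1 / 4 -> p z != 0 -> ker_L r lam%:C%C f -> cspan r (star p (lam + 2)) f.
Proof.
move=> hr l0 Ht ode hz pz Kf; have [_ t0] := tray_eval Ht.
have t0E : tray t 0 = p by apply/funext.
have [F [P [reg e1 e2]]] := ker_regular hr Kf.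
split; first by have [u [_ [_ Hf _] _]] := Kf.
have dp (y : R) : is_derive y (1 : R) p (tray t 1 y) by rewrite -t0E; exact: der_tray.
have [c Hc] := regular_uniq hr l0 dp (der_tray t 1) ode hz pz reg.
exists c; split; first exact: aeq_itv e1.
apply: aeq_itv e2 => y /Hc -> /=.
by rewrite rmorphD rmorph_nat; ring.
Qed.

Lemma ker_eigen r : 1 / 2 <= r -> ker_L r 1 = cspan r f1star :> set (pairfun R) /\ ker_L r 4 = cspan r f4star :> set (pairfun R).
Proof.
move=> hr; have r0 : 0 < r by lra_ctx.
(* Any point below 1/10 would do: there [p1] is known not to vanish, and the bound 1/4 keeps [LL]
   away from its zero. *)
have hz : 0 < (1 / 20 : R) < 1 / 4 by apply/andP; split; lra_ctx.
split; apply/seteqP; split=> f.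
- rewrite f1starE; apply: (@ker_star r 1 t1 p1 (1 / 20) f hr ler01 eval_t1 ode_t1 hz).
  by apply: p1_neq0; apply/andP; split; lra_ctx.
- by move=> [Hf [c e]]; exact: ker_f1star e.
- rewrite f4starE (_ : 4 = (4 : R)%:C%C); last by rewrite rmorph_nat.
  apply: (@ker_star r 4 t4 p4 (1 / 20) f hr _ eval_t4 ode_t4 hz) => //.
  by rewrite gt_eqF// p4_gt0.
- by move=> [Hf [c e]]; exact: ker_f4star e.
Qed.

End Eigenfunctions.

Theorem proposition3p3 (R : realType) (r : R) (hr : 1 / 2 <= r) :
  [/\ point_spectrum r `&` [set lambda : R[i] | 0 <= complex.Re lambda]
        = [set 1; 4],
      ker_L r 1 = cspan r f1star &
      ker_L r 4 = cspan r f4star].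
Proof.
have [k1 k4] := ker_eigen hr; have r0 : 0 < r by lra_ctx.
split=> //; apply/seteqP; split=> lam.
  move=> [[f [Kf nf]] /= l0]; have [->|l1] := eqVneq lam 1; first by left.
  have [->|l4] := eqVneq lam 4; first by right.
  by case: nf; exact: no_other_eigenvalue Kf.
have refl (g : pairfun R) : HR_eq r g g by split; apply: aeW.
move=> [|] /= ->; split.
- exists (cscale 1 f1star); split; last exact: f1star_nonzero.
  by apply: (@ker_f1star R r 1) => //; exact: HR_f1star.
- by rewrite ler01.
- exists (cscale 1 f4star); split; last exact: f4star_nonzero.
  by apply: (@ker_f4star R r 1) => //; exact: HR_f4star.
- by rewrite -(rmorph_nat (real_complex R)) /= ler0n.
Qed.
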